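(* Let $(\mathcal{F},\bar{J})$ be a partial Nijenhuis operator of generic type on a 3-dimensional manifold $M$. Then for each of the types A, B, C, D (where for type D the partial Nijenhuis operator is assumed real-analytic), every point $x\in M$ has a neighborhood $U$ on which there exists a Nijenhuis operator $J:TU\to TU$ of that type such that $J|_{T\mathcal{F}}=\bar{J}$.
   Context: A partial Nijenhuis operator on $M$ is a pair $(\mathcal{F},\bar{J})$, where $\mathcal{F}$ is a foliation on $M$ and $\bar{J}:T\mathcal{F}\to TM$ is a vector bundle morphism such that for all $X,Y\in\Gamma(T\mathcal{F})$: (1) $[X,Y]_{\bar{J}}:=[\bar{J}X,Y]+[X,\bar{J}Y]-\bar{J}[X,Y]\in\Gamma(T\mathcal{F})$; (2) $[\bar{J}X,\bar{J}Y]-\bar{J}[X,Y]_{\bar{J}}=0$. With $\dim M=n+1$, it is of generic type if there exist local frames $v_1,\dots,v_n\in\Gamma(T\mathcal{F})$, $w_0,\dots,w_n\in\Gamma(TM)$ with $\bar{J}v_i=w_{i-1}$ and $Iv_i=w_i$ for $i=1,\dots,n$, where $I:T\mathcal{F}\hookrightarrow TM$ is the inclusion; here $n=2$. A Nijenhuis operator is a $(1,1)$-tensor $J$ with $N_J(X,Y)=[JX,JY]-J[JX,Y]-J[X,JY]+J^2[X,Y]=0$. In dimension 3, $J$ is of type A, B, C or D if in some local coordinates $(x_1,x_2,x_3)$ its matrix in the frame $\{\partial_{x_i}\}$ is respectively (A) $\begin{pmatrix}\lambda_1(x_1)&0&0\\ 0&\lambda_2(x_2)&0\\ 0&0&\lambda_3(x_3)\end{pmatrix}$;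 (B) $\begin{pmatrix}\lambda_2(x_2)&1&0\\ 0&\lambda_2(x_2)&0\\ 0&0&\lambda_3(x_3)\end{pmatrix}$; (C) $\begin{pmatrix}\lambda_3(x_3)&e^{\lambda_3'(x_3)x_2}&0\\ 0&\lambda_3(x_3)&1\\ 0&0&\lambda_3(x_3)\end{pmatrix}$; (D) $\begin{pmatrix}a(x_1,x_2)&-b(x_1,x_2)&0\\ b(x_1,x_2)&a(x_1,x_2)&0\\ 0&0&\lambda_3(x_3)\end{pmatrix}$. Here the $\lambda_i$ are smooth functions of one variable with $\lambda_i\ne\lambda_j$ for $i\neq j$, and in (D) $a+ib$ is a holomorphic function of $z=x_1+ix_2$ with non-real values ($b\neq0$). *)

(* Defs.v *)
From HB Require Import structures.
From mathcomp Require Import all_boot all_order all_algebra.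
From mathcomp Require Import all_classical all_reals all_analysis.
From mathcomp Require Import complex.

Set Implicit Arguments.
Unset Strict Implicit.
Unset Printing Implicit Defensive.
Import Order.TTheory GRing.Theory Num.Theory.
Import numFieldNormedType.Exports.
Local Open Scope classical_set_scope.
Local Open Scope ring_scope.

(* Iterated partial derivatives d_{i1} (d_{i2} ( ... f)) for s = [:: i1; i2; ...]. *)
Definition partials (R : realType) (m : nat) (V : normedModType R)
    (s : seq 'I_m) (f : 'rV[R]_m -> V) : 'rV[R]_m -> V :=
  foldr (fun i g x => 'D_(delta_mx 0 i) g x) f s.

(* C^oo on an open set: every iterated partial derivative (f included) is
   differentiable, hence continuous, at every point. *)
Definition smooth_on (R : realType) (m : nat) (V : normedModType R)
    (D : set 'rV[R]_m) (f : 'rV[R]_m -> V) : Prop :=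
  forall (s : seq 'I_m) (x : 'rV[R]_m), D x -> differentiable (partials s f) x.

(* C^oo for a function of one real variable, at every point of D. *)
Definition smooth1_on (R : realType) (D : set R) (f : R -> R) : Prop :=
  forall (k : nat) (t : R), D t -> derivable (derive1n k f) t 1.

(* Partial sum, over multi-indices with all entries < N, of the power series
   with coefficients a evaluated at h. *)
Definition power_series (R : realType) (m : nat)
    (a : {ffun 'I_m -> nat} -> R) (h : 'rV[R]_m) : R^nat :=
  fun N => \sum_(k : {ffun 'I_m -> 'I_N})
    a [ffun i => k i : nat] * \prod_(i < m) h 0 i ^+ k i.

(* Real-analyticity: around every point, each component is the sum of an
   absolutely convergent power series.  (The partial sums of absolute values
   are the partial sums of the series |a| at |h|.) *)
Definition analytic_on (R : realType) (m n : nat)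
    (D : set 'rV[R]_m) (f : 'rV[R]_m -> 'rV[R]_n) : Prop :=
  forall (x : 'rV[R]_m) (j : 'I_n), D x ->
  exists (a : {ffun 'I_m -> nat} -> R) (r : R), 0 < r /\
    forall h : 'rV[R]_m, `|h| < r ->
      cvgn (power_series (fun k => `|a k|) (\row_i `|h 0 i|)) /\
      power_series a h @ \oo --> f (x + h) 0 j.

(* [cinv] is only meaningful on the open set [cmap @` cdom]. *)
Record chart (R : realType) (m : nat) (T : topologicalType) := Chart {
  cdom : set T;
  cmap : T -> 'rV[R]_m;
  cinv : 'rV[R]_m -> T;
  cdom_open : open cdom;
  cimg_open : open (cmap @` cdom);
  cmap_continuous : forall p, cdom p -> {for p, continuous cmap};
  cinv_continuous : forall x, (cmap @` cdom) x -> {for x, continuous cinv};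
  cmapK : forall p, cdom p -> cinv (cmap p) = p
}.

Definition transition (R : realType) (m : nat) (T : topologicalType)
    (c c' : chart R m T) : 'rV[R]_m -> 'rV[R]_m := cmap c' \o cinv c.

Definition smooth_compat (R : realType) (m : nat) (T : topologicalType)
    (c c' : chart R m T) : Prop :=
  smooth_on (cmap c @` (cdom c `&` cdom c')) (transition c c') /\
  smooth_on (cmap c' @` (cdom c `&` cdom c')) (transition c' c).

(* Since the atlas is maximal, its charts are exactly the local coordinate
   systems of the manifold. *)
Record manifold (R : realType) (m : nat) := Manifold {
  mspace :> topologicalType;
  atlas : set (chart R m mspace);
  mspace_hausdorff : hausdorff_space mspace;
  mspace_second_countable : @second_countable mspace;
  atlas_cover : forall p : mspace, exists c, atlas c /\ cdom c p;
  atlas_compat : forall c c', atlas c -> atlas c' -> smooth_compat c c';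
  atlas_maximal : forall c,
    (forall c', atlas c' -> smooth_compat c c') -> atlas c
}.
Arguments atlas {R m} _.

Definition chart_at (R : realType) (m : nat) (M : manifold R m) (p : M) :
  chart R m M := sval (cid (atlas_cover p)).

(* The tangent space at p is R^m, identified with the components of a tangent
   vector in the reference chart [chart_at p].  The components in any other
   chart are given by [components]; as [chart_at p] does not depend on p in a
   regular way, smoothness of vector fields must be read through [components]. *)
Definition tangent (R : realType) (m : nat) (M : manifold R m) (p : M) :
  lmodType R := 'rV[R]_m.

Definition components (R : realType) (m : nat) (M : manifold R m)
    (c : chart R m M) (p : M) (v : tangent p) : 'rV[R]_m :=
  'd (transition (chart_at p) c) (cmap (chart_at p) p) v.

Definition vfield (R : realType) (m : nat) (M : manifold R m) :=
  forall p : M, tangent p.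

(* The expression of the vector field X in the chart c. *)
Definition in_chart (R : realType) (m : nat) (M : manifold R m)
    (c : chart R m M) (X : vfield M) : 'rV[R]_m -> 'rV[R]_m :=
  fun x => components c (X (cinv c x)).

Definition smooth_vfield (R : realType) (m : nat) (M : manifold R m)
    (W : set M) (X : vfield M) : Prop :=
  forall c, atlas M c -> smooth_on (cmap c @` (cdom c `&` W)) (in_chart c X).

(* [X, Y] = DY(X) - DX(Y) in local coordinates.  The formula may be evaluated
   in any chart around p; in [chart_at p] the result is directly an element of
   the tangent space at p. *)
Definition lie_bracket (R : realType) (m : nat) (M : manifold R m)
    (X Y : vfield M) : vfield M :=
  fun p => let c := chart_at p in let x := cmap c p in
    'd (in_chart c Y) x (in_chart c X x) - 'd (in_chart c X) x (in_chart c Y x).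

Definition tangent_distribution (R : realType) (m : nat) (M : manifold R m) :=
  forall p : M, set (tangent p).

Definition full_tangent (R : realType) (m : nat) (M : manifold R m) :
  tangent_distribution M := fun p => setT.
Arguments full_tangent {R m} M _.

(* X is a (local) section over W of the distribution E. *)
Definition is_section (R : realType) (m : nat) (M : manifold R m)
    (W : set M) (E : tangent_distribution M) (X : vfield M) : Prop :=
  smooth_vfield W X /\ forall q, W q -> E q (X q).

(* A foliation of dimension k, given by its tangent distribution TF: around
   every point there are coordinates (x_0, ..., x_{m-1}) in which the leaves
   are the slices where x_k, ..., x_{m-1} are constant. *)
Definition foliation (R : realType) (m : nat) (M : manifold R m)
    (TF : tangent_distribution M) : Prop :=
  exists2 k : nat, (k <= m)%N &
  forall p : M, exists c, [/\ atlas M c, cdom c p &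
    forall q, cdom c q -> forall v : tangent q,
      TF q v <-> forall i : 'I_m, (k <= i)%N -> components c v 0 i = 0].

(* Fibrewise endomorphisms; a bundle morphism E -> TM is represented by a
   fibrewise map whose values outside E are irrelevant. *)
Definition fibre_map (R : realType) (m : nat) (M : manifold R m) :=
  forall p : M, tangent p -> tangent p.

Definition apply_field (R : realType) (m : nat) (M : manifold R m)
    (J : fibre_map M) (X : vfield M) : vfield M := fun p => J p (X p).

(* J is a smooth vector bundle morphism E|_U -> TM|_U. *)
Definition bundle_morphism (R : realType) (m : nat) (M : manifold R m)
    (U : set M) (E : tangent_distribution M) (J : fibre_map M) : Prop :=
  (forall p, U p -> forall (a : R) (v w : tangent p), E p v -> E p w ->
     J p (a *: v + w) = a *: J p v + J p w) /\
  (forall (W : set M) (X : vfield M), open W -> W `<=` U -> is_section W E X ->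
     smooth_vfield W (apply_field J X)).

(* [X, Y]_J = [JX, Y] + [X, JY] - J[X, Y] *)
Definition deformed_bracket (R : realType) (m : nat) (M : manifold R m)
    (J : fibre_map M) (X Y : vfield M) : vfield M :=
  fun p => lie_bracket (apply_field J X) Y p + lie_bracket X (apply_field J Y) p
           - J p (lie_bracket X Y p).

Definition partial_nijenhuis (R : realType) (m : nat) (M : manifold R m)
    (TF : tangent_distribution M) (J : fibre_map M) : Prop :=
  [/\ foliation TF,
      bundle_morphism setT TF J &
      forall (W : set M) (X Y : vfield M), open W ->
        is_section W TF X -> is_section W TF Y ->
        is_section W TF (deformed_bracket J X Y) /\
        forall p, W p ->
          lie_bracket (apply_field J X) (apply_field J Y) p
          - J p (deformed_bracket J X Y p) = 0].

Definition frame (R : realType) (m : nat) (M : manifold R m) (k : nat)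
    (W : set M) (E : tangent_distribution M) (v : 'I_k -> vfield M) : Prop :=
  (forall i, is_section W E (v i)) /\
  (forall q, W q -> forall u : tangent q, E q u ->
     exists! a : 'rV[R]_k, u = \sum_(i < k) a 0 i *: v i q).

(* Indices of v start at 0: [v i] is v_{i+1}, so that J v_{i+1} = w_i and
   v_{i+1} = w_{i+1}. *)
Definition generic_type (R : realType) (n : nat) (M : manifold R n.+1)
    (TF : tangent_distribution M) (J : fibre_map M) : Prop :=
  forall p : M, exists (W : set M) (v : 'I_n -> vfield M)
      (w : 'I_n.+1 -> vfield M),
    [/\ open W, W p, frame W TF v, frame W (full_tangent M) w &
        forall (i : 'I_n) (q : M), W q ->
          J q (v i q) = w (widen_ord (leqnSn n) i) q /\
          v i q = w (lift ord0 i) q].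

Definition analytic_atlas (R : realType) (m : nat) (M : manifold R m)
    (A : set (chart R m M)) : Prop :=
  [/\ A `<=` atlas M,
      forall p : M, exists c, A c /\ cdom c p &
      forall c c', A c -> A c' ->
        analytic_on (cmap c @` (cdom c `&` cdom c')) (transition c c')].

Definition analytic_vfield (R : realType) (m : nat) (M : manifold R m)
    (A : set (chart R m M)) (W : set M) (X : vfield M) : Prop :=
  forall c, A c -> analytic_on (cmap c @` (cdom c `&` W)) (in_chart c X).

(* M carries a real-analytic structure, compatible with its smooth structure,
   for which TF is an analytic subbundle and J an analytic morphism. *)
Definition real_analytic (R : realType) (m : nat) (M : manifold R m)
    (TF : tangent_distribution M) (J : fibre_map M) : Prop :=
  exists A : set (chart R m M), analytic_atlas A /\
  forall p : M, exists (W : set M) (k : nat) (v : 'I_k -> vfield M),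
    [/\ open W, W p, frame W TF v &
        forall i, analytic_vfield A W (v i) /\
                  analytic_vfield A W (apply_field J (v i))].

Definition nijenhuis_on (R : realType) (m : nat) (M : manifold R m)
    (U : set M) (J : fibre_map M) : Prop :=
  bundle_morphism U (full_tangent M) J /\
  forall (W : set M) (X Y : vfield M), open W -> W `<=` U ->
    smooth_vfield W X -> smooth_vfield W Y ->
    forall p, W p ->
      lie_bracket (apply_field J X) (apply_field J Y) p
      - J p (lie_bracket (apply_field J X) Y p)
      - J p (lie_bracket X (apply_field J Y) p)
      + J p (J p (lie_bracket X Y p)) = 0.

(* A is the matrix of J at p in the frame of the chart c: the j-th column of A
   holds the components of the image of d/dx_j. *)
Definition has_matrix (R : realType) (m : nat) (M : manifold R m)
    (c : chart R m M) (J : fibre_map M) (p : M) (A : 'M[R]_m) : Prop :=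
  forall v : tangent p, (components c (J p v))^T = A *m (components c v)^T.

Definition mx3 (R : realType) (rows : seq (seq R)) : 'M[R]_3 :=
  \matrix_(i < 3, j < 3) (nth [::] rows i)`_j.

(* The coordinate functions x_1, x_2, x_3 of a chart. *)
Definition coord1 (R : realType) (M : manifold R 3) (c : chart R 3 M) (p : M) : R :=
  cmap c p 0 0.
Definition coord2 (R : realType) (M : manifold R 3) (c : chart R 3 M) (p : M) : R :=
  cmap c p 0 1.
Definition coord3 (R : realType) (M : manifold R 3) (c : chart R 3 M) (p : M) : R :=
  cmap c p 0 2%:R.

Definition typeA (R : realType) (M : manifold R 3) (U : set M)
    (J : fibre_map M) : Prop :=
  exists c, [/\ atlas M c, U `<=` cdom c &
  exists l1 l2 l3 : R -> R,
    [/\ smooth1_on (coord1 c @` U) l1, smooth1_on (coord2 c @` U) l2,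
        smooth1_on (coord3 c @` U) l3 &
    forall p, U p ->
      [/\ l1 (coord1 c p) != l2 (coord2 c p), l1 (coord1 c p) != l3 (coord3 c p),
          l2 (coord2 c p) != l3 (coord3 c p) &
          has_matrix c J p (mx3
            [:: [:: l1 (coord1 c p); 0; 0];
                [:: 0; l2 (coord2 c p); 0];
                [:: 0; 0; l3 (coord3 c p)]])]]].

Definition typeB (R : realType) (M : manifold R 3) (U : set M)
    (J : fibre_map M) : Prop :=
  exists c, [/\ atlas M c, U `<=` cdom c &
  exists l2 l3 : R -> R,
    [/\ smooth1_on (coord2 c @` U) l2, smooth1_on (coord3 c @` U) l3 &
    forall p, U p ->
      l2 (coord2 c p) != l3 (coord3 c p) /\
      has_matrix c J p (mx3
        [:: [:: l2 (coord2 c p); 1; 0];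
            [:: 0; l2 (coord2 c p); 0];
            [:: 0; 0; l3 (coord3 c p)]])]].

Definition typeC (R : realType) (M : manifold R 3) (U : set M)
    (J : fibre_map M) : Prop :=
  exists c, [/\ atlas M c, U `<=` cdom c &
  exists l3 : R -> R, smooth1_on (coord3 c @` U) l3 /\
    forall p, U p ->
      has_matrix c J p (mx3
        [:: [:: l3 (coord3 c p); expR (derive1 l3 (coord3 c p) * coord2 c p); 0];
            [:: 0; l3 (coord3 c p); 1];
            [:: 0; 0; l3 (coord3 c p)]])].

(* f = a + ib is holomorphic as a function of z = x_1 + i x_2, i.e.
   differentiable over the field R[i]. *)
Definition typeD (R : realType) (M : manifold R 3) (U : set M)
    (J : fibre_map M) : Prop :=
  exists c, [/\ atlas M c, U `<=` cdom c &
  exists (f : R[i]^o -> R[i]^o) (l3 : R -> R), smooth1_on (coord3 c @` U) l3 /\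
    forall p, U p ->
      let z : R[i] := (coord1 c p +i* coord2 c p)%C in
      let a := complex.Re (f z) in let b := complex.Im (f z) in
      [/\ derivable f z 1, b != 0 &
          has_matrix c J p (mx3
            [:: [:: a; - b; 0];
                [:: b; a; 0];
                [:: 0; 0; l3 (coord3 c p)]])]].

(* Every point has a neighbourhood carrying a Nijenhuis operator of the given
   type that extends Jbar. *)
Definition locally_extends (R : realType) (M : manifold R 3)
    (TF : tangent_distribution M) (Jbar : fibre_map M)
    (type : set M -> fibre_map M -> Prop) : Prop :=
  forall x : M, exists U : set M, [/\ open U, U x &
  exists J : fibre_map M, [/\ nijenhuis_on U J, type U J &
    forall p, U p -> forall v : tangent p, TF p v -> J p v = Jbar p v]].

(* Main.v *)
From HB Require Import structures.
From mathcomp Require Import all_boot all_order all_algebra.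
From mathcomp Require Import all_classical all_reals all_analysis.
From mathcomp Require Import complex ring lra.
Require Import Defs.

(** Fix a commutative algebra S of dimension 3 and an element mu of S such that 1, mu, mu^2 is a
basis and the multiplication by mu has a matrix of the required type, with constant entries.  If
v_1, v_2 is a frame of TF and u_i = J v_i, it is enough to find a local diffeomorphism f from M
to S with df(u_i) = mu df(v_i): in the coordinates f, the multiplication by mu is a Nijenhuis
operator that extends J.

So f has to be constant along the S-valued fields X_i = u_i - mu v_i.  In a chart normalised at
the given point, replace the last coordinate of R^3 by a variable zeta in S, and extend the
components of u_i and v_i to functions of (x_1, x_2, zeta) that are differentiable over S in
zeta: componentwise or by a Taylor expansion in the nilpotent directions for the types A, B, C,
and by substitution in the power series for the type D.  The conditions on the partial Nijenhuis
operator say that [X_1, X_2] is a combination of X_1 and X_2, hence that the cross product of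
X_1 and X_2 annihilates their bracket; this scalar identity, unlike the coefficients of the
combination, extends from the real slice to all zeta.  The last component of the cross product
is a unit, so the extended fields span a distribution transverse to the fibres S, and the
Frobenius theorem provides a first integral F which is differentiable over S in zeta.  Its
restriction to the real slice is f.

For the type D, a function holomorphic in zeta that vanishes on the real axis vanishes nearby:
apply the maximum principle on a half box to its product with a large power of a function whose
modulus is larger than 1 near 0 and at most 1 on the other sides of the box. *)

Set Implicit Arguments.
Unset Strict Implicit.
Unset Printing Implicit Defensive.
Import Order.TTheory GRing.Theory Num.Theory.
Import numFieldNormedType.Exports.
Local Open Scope classical_set_scope.
Local Open Scope ring_scope.

(** * Smooth germs *)

(** The generic type normalises the frame at the point to u_1 = e_1, u_2 = v_1 = e_2, v_2 = e_3.
    There X_1 = e_1 - mu e_2 and X_2 = e_2 - mu e_3, and their cross product is (mu^2, mu, 1). Both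
    conditions on mu come from this vector: its last component makes the span transverse to S, and
    the differential of f at the point sends w to w_1 mu^2 + w_2 mu + w_3, which is injective when
    1, mu, mu^2 are independent.

    The coefficients of the bracket relations are given point by point, without any regularity; this
    is why an identity free of them is the one that is extended.

    Analyticity enters with type D because C x R contains C. Over R^3 differentiability says that
    each component depends on its own real variable, and over nilpotents that it is polynomial in
    the nilpotent directions, so every smooth function extends; over C it is genuine holomorphy. *)

Section Differentiability.
Variables (R : realType) (V W : normedModType R).

Lemma differentiable_eqo (f : V -> W) (L : {linear V -> W}) x :
  continuous L ->
  (forall e, 0 < e -> \forall h \near (0 : V), `|f (h + x) - f x - L h| <= e * `|h|) ->
  differentiable f x /\ 'd f x = L :> (V -> W).
Proof.
move=> cL H.
have E : f \o shift x = cst (f x) + L +o_ 0 id.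
  apply/eqaddoP => e e0; near=> h.
  rewrite /= [X in `|X|](_ : _ = f (h + x) - f x - L h).
    by near: h; exact: H.
  by rewrite !fctE /= opprD addrA.
have dE := diff_unique cL E.
split; last exact: dE.
apply/diff_locallyP; split; first by rewrite dE.
by rewrite dE.
Unshelve. all: by end_near. Qed.

Lemma differentiable_quad (f : V -> W) (L : {linear V -> W}) x C :
  continuous L ->
  (\forall h \near (0 : V), `|f (h + x) - f x - L h| <= C * `|h| ^+ 2) ->
  differentiable f x /\ 'd f x = L :> (V -> W).
Proof.
move=> cL H; apply: differentiable_eqo => // e e0.
have C0 : 0 < `|C| + 1 by rewrite ltr_wpDl.
near=> h.
apply: (@le_trans _ _ (C * `|h| ^+ 2)); first by near: h.
rewrite expr2 mulrA ler_wpM2r //.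
apply: (@le_trans _ _ ((`|C| + 1) * `|h|)).
  by rewrite ler_wpM2r // (le_trans (ler_norm _)) // lerDl.
rewrite mulrC -ler_pdivlMr //.
near: h.
have e0' : 0 < e / (`|C| + 1) by rewrite divr_gt0.
apply: filterS (nbhsx_ballx (0 : V) _ e0').
by move=> h; rewrite -ball_normE /= sub0r normrN => /ltW.
Unshelve. all: by end_near. Qed.

Lemma near_eq_differentiable (f g : V -> W) x :
  {near x, f =1 g} -> differentiable f x ->
  differentiable g x /\ 'd g x = 'd f x :> (V -> W).
Proof.
move=> fg df; apply: differentiable_eqo => [|e e0].
  by have /diffP[] := df.
have /diff_locally/eqaddoP/(_ e e0) H := df.
have E : \forall h \near (0 : V), f (h + x) = g (h + x).
  have fg' : \forall y \near x, f y = g y by [].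
  by rewrite (near_shift 0) subr0 in fg'.
near=> h.
have <- : f (h + x) = g (h + x) by near: h.
rewrite -(nbhs_singleton fg).
have : `|((f \o shift x) - (cst (f x) + 'd f x)) h| <= e * `|h|.
  by near: h; exact: H.
by rewrite !fctE /= opprD addrA.
Unshelve. all: by end_near. Qed.

End Differentiability.

(** * Functions with finitely many derivatives on an open set *)

Section PartialDerivatives.
Variables (R : realType).

Definition pd (m : nat) (V : normedModType R) (i : 'I_m) (f : 'rV[R]_m -> V) :
  'rV[R]_m -> V := fun x => 'D_(delta_mx 0 i) f x.

Lemma partials_rcons m (V : normedModType R) s (i : 'I_m) (f : 'rV[R]_m -> V) :
  partials (rcons s i) f = partials s (pd i f).
Proof. by rewrite /partials foldr_rcons. Qed.

Definition lincomb (m : nat) (V : normedModType R) (z : 'I_m -> V)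
  (v : 'rV[R]_m) : V := \sum_i v 0 i *: z i.

Lemma lincomb_is_linear m (V : normedModType R) (z : 'I_m -> V) : linear (@lincomb m V z).
Proof.
move=> a u v; rewrite /lincomb scaler_sumr -big_split; apply: eq_bigr => i _.
by rewrite !mxE scalerDl scalerA.
Qed.
HB.instance Definition _ m (V : normedModType R) (z : 'I_m -> V) :=
  GRing.isLinear.Build R 'rV[R]_m V _ (@lincomb m V z) (@lincomb_is_linear m V z).

Lemma lincomb_continuous m (V : normedModType R) (z : 'I_m -> V) :
  continuous (lincomb z).
Proof.
move=> x; apply: (@differentiable_continuous R _ _ x (lincomb z)).
rewrite (_ : lincomb z = \sum_i ((fun v : 'rV[R]_m => v 0 i *: z i) : _ -> V)).
  apply: differentiable_sum => i; apply: differentiableZl.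
  exact: differentiable_coord.
by apply/funext => v; rewrite /lincomb fct_sumE.
Qed.

Definition mxcoord k l i j (M : 'M[R]_(k, l)) : R := M i j.

Lemma mxcoord_is_linear k l i j : linear (@mxcoord k l i j : _ -> R^o).
Proof. by move=> a u v; rewrite /mxcoord !mxE. Qed.
HB.instance Definition _ k l i j := GRing.isLinear.Build R 'M[R]_(k, l) R^o _
  (@mxcoord k l i j) (@mxcoord_is_linear k l i j).

Definition scalel (V : normedModType R) (w : V) (r : R^o) : V := r *: w.

Lemma scalel_is_linear (V : normedModType R) (w : V) : linear (scalel w).
Proof. by move=> a u v; rewrite /scalel scalerDl scalerA. Qed.
HB.instance Definition _ (V : normedModType R) (w : V) :=
  GRing.isLinear.Build R R^o V _ (scalel w) (scalel_is_linear w).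

Lemma linear_rV m (V : normedModType R) (L : {linear 'rV[R]_m -> V}) v :
  L v = lincomb (fun i => L (delta_mx 0 i)) v.
Proof.
rewrite [in LHS](row_sum_delta v) linear_sum /lincomb.
by apply: eq_bigr => i _; rewrite linearZ.
Qed.

Lemma rV_linear_continuous m (V : normedModType R) (L : {linear 'rV[R]_m -> V}) :
  continuous L.
Proof.
have -> : (L : _ -> _) = lincomb (fun i => L (delta_mx 0 i)).
  by apply/funext => v; exact: linear_rV.
exact: lincomb_continuous.
Qed.

Lemma diff_pd m (V : normedModType R) (f : 'rV[R]_m -> V) x v :
  differentiable f x -> 'd f x v = \sum_i v 0 i *: pd i f x.
Proof.
move=> df; rewrite linear_rV; apply: eq_bigr => i _.
by rewrite /pd deriveE.
Qed.

Lemma differentiable_rVP m n (f : 'rV[R]_m -> 'rV[R]_n) x :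
  differentiable f x <-> forall j, differentiable (fun y => f y 0 j) x.
Proof.
split=> [df j|df].
  apply: (@differentiable_comp _ _ _ _ f (fun u : 'rV[R]_n => u 0 j)) => //.
  exact: differentiable_coord.
rewrite (_ : f = \sum_j ((fun y => f y 0 j *: (delta_mx 0 j : 'rV[R]_n)) : _ -> 'rV[R]_n)).
  by apply: differentiable_sum => j; apply: differentiableZl.
by apply/funext => y; rewrite fct_sumE -row_sum_delta.
Qed.

Lemma derive_coord (V : normedModType R) n (f : V -> 'rV[R]_n) x v j :
  derivable f x v -> ('D_v f x) 0 j = 'D_v (fun y => f y 0 j) x.
Proof. by move=> df; rewrite derive_mx // mxE. Qed.

Lemma derive_lin (U V W : normedModType R) (L : {linear V -> W}) (f : U -> V) x v :
  continuous L -> differentiable f x ->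
  'D_v (L \o f) x = L ('D_v f x).
Proof.
move=> cL df; rewrite !deriveE //; last first.
  by apply: differentiable_comp => //; exact: linear_differentiable.
by rewrite diff_comp //= ?diff_lin //; exact: linear_differentiable.
Qed.

Lemma derive_comp (U : normedModType R) n (W : normedModType R)
    (f : U -> 'rV[R]_n) (g : 'rV[R]_n -> W) x v :
  differentiable f x -> differentiable g (f x) ->
  'D_v (g \o f) x = \sum_j 'D_v (fun y => f y 0 j) x *: pd j g (f x).
Proof.
move=> df dg; rewrite deriveE; last exact: differentiable_comp.
rewrite diff_comp //= diff_pd //; apply: eq_bigr => j _.
by rewrite -deriveE // derive_coord //; exact: diff_derivable.
Qed.

Section Smn.
Variables (m : nat).
Implicit Types (D : set 'rV[R]_m) (V W : normedModType R).

(** The order n is the variable of induction: a partial derivative of a product or of a composite is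
    a combination of functions of order one less. The partial derivatives of order n are themselves
    required to be differentiable. *)
Definition smn V n D (f : 'rV[R]_m -> V) :=
  forall s, (size s <= n)%N -> forall x, D x -> differentiable (partials s f) x.

Lemma smnS V n D (f : 'rV[R]_m -> V) :
  smn n.+1 D f <->
  (forall x, D x -> differentiable f x) /\ forall i, smn n D (pd i f).
Proof.
split=> [H|[H0 H1]].
  split=> [x Dx|i s sn x Dx]; first exact: (H [::]).
  by rewrite -partials_rcons; apply: H; rewrite ?size_rcons.
(* The last index of [s] is the derivative that [partials] takes first. *)
move=> s; case/lastP: s => [_|s i]; first exact: H0.
by rewrite size_rcons ltnS partials_rcons => sn; exact: H1.
Qed.

Lemma smn0 V D (f : 'rV[R]_m -> V) :
  smn 0 D f <-> forall x, D x -> differentiable f x.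
Proof.
split=> [H x Dx|H [|//] _ x Dx]; first exact: (H [::]).
exact: H.
Qed.

Lemma smnW V n D (f : 'rV[R]_m -> V) : smn n.+1 D f -> smn n D f.
Proof. by move=> H s sn; apply: H; apply: ltnW. Qed.

Lemma smn_diff V n D (f : 'rV[R]_m -> V) x :
  smn n D f -> D x -> differentiable f x.
Proof. by move=> H Dx; exact: (H [::]). Qed.

Lemma smooth_onE V D (f : 'rV[R]_m -> V) :
  smooth_on D f <-> forall n, smn n D f.
Proof. by split=> [H n s _ x|H s x]; [exact: H|exact: (H (size s))]. Qed.

Variable D : set 'rV[R]_m.
Hypothesis oD : open D.

Lemma smn_eq V n (f g : 'rV[R]_m -> V) :
  (forall x, D x -> f x = g x) -> smn n D f -> smn n D g.
Proof.
have nE (h k : 'rV[R]_m -> V) x : (forall y, D y -> h y = k y) -> D x -> \near x, h x = k x.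
  by move=> hk Dx; apply: filterS (open_nbhs_nbhs (conj oD Dx)).
elim: n f g => [|n IH] f g fg.
  move=> /smn0 H; apply/smn0 => x Dx.
  by have [] := near_eq_differentiable (nE _ _ _ fg Dx) (H x Dx).
move=> /smnS[H0 H1]; apply/smnS; split=> [x Dx|i].
  by have [] := near_eq_differentiable (nE _ _ _ fg Dx) (H0 x Dx).
by apply: (IH _ _ _ (H1 i)) => x Dx; exact: near_eq_derive (nE _ _ _ fg Dx).
Qed.

Lemma smn_cst V n (a : V) : smn n D (fun=> a).
Proof.
elim: n a => [|n IH] a; first by apply/smn0 => x _; exact: differentiable_cst.
apply/smnS; split=> [x _|i]; first exact: differentiable_cst.
by apply: (smn_eq _ (IH (0 : V))) => x _; rewrite /pd derive_cst.
Qed.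

Lemma smn_lin V W n (L : {linear V -> W}) (f : 'rV[R]_m -> V) : continuous L ->
  smn n D f -> smn n D (fun x => L (f x)).
Proof.
move=> cL; have dL x : differentiable f x -> differentiable (fun x => L (f x)) x.
  by move=> df; apply: (@differentiable_comp _ _ _ _ f L) => //; exact: linear_differentiable.
elim: n f dL => [|n IH] f dL; first by move=> /smn0 H; apply/smn0 => x Dx; apply/dL/H.
move=> /smnS[H0 H1]; apply/smnS; split=> [x Dx|i]; first exact/dL/H0.
apply: (@smn_eq _ _ (fun x => L (pd i f x))) => [x Dx|]; last apply: IH => //.
  by rewrite -derive_lin //; exact: H0.
move=> x df; apply: (@differentiable_comp _ _ _ _ (pd i f) L) => //.
exact: linear_differentiable.
Qed.

Lemma smnD V n (f g : 'rV[R]_m -> V) :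
  smn n D f -> smn n D g -> smn n D (fun x => f x + g x).
Proof.
elim: n f g => [|n IH] f g.
  move=> /smn0 H /smn0 K; apply/smn0 => x Dx; apply: differentiableD; [exact: H|exact: K].
move=> /smnS[H0 H1] /smnS[K0 K1]; apply/smnS; split=> [x Dx|i].
  by apply: differentiableD; [exact: H0|exact: K0].
apply: (@smn_eq _ _ (fun x => pd i f x + pd i g x)) => [x Dx|]; last exact: IH.
by rewrite /pd deriveD //; apply: diff_derivable; [exact: H0|exact: K0].
Qed.

Lemma smn_sum V n (I : Type) (r : seq I) (P : pred I) (F : I -> 'rV[R]_m -> V) :
  (forall i, P i -> smn n D (F i)) -> smn n D (fun x => \sum_(i <- r | P i) F i x).
Proof.
move=> H; elim: r => [|i r IH].
  by apply: (@smn_eq V n (fun=> 0)); [move=> x _; rewrite big_nil|exact: smn_cst].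
case Pi : (P i).
  apply: (@smn_eq V n (fun x => F i x + \sum_(j <- r | P j) F j x)).
    by move=> x _; rewrite big_cons Pi.
  by apply: smnD => //; exact: H.
by apply: (@smn_eq V n (fun x => \sum_(j <- r | P j) F j x)) => // x _; rewrite big_cons Pi.
Qed.

Lemma smnM n (f g : 'rV[R]_m -> R) :
  smn n D f -> smn n D g -> smn n D (fun x => f x * g x).
Proof.
elim: n f g => [|n IH] f g.
  move=> /smn0 H /smn0 K; apply/smn0 => x Dx; apply: differentiableM; [exact: H|exact: K].
move=> Hf Hg; have Hf' := smnW Hf; have Hg' := smnW Hg.
move: Hf Hg => /smnS[H0 H1] /smnS[K0 K1]; apply/smnS; split=> [x Dx|i].
  by apply: differentiableM; [exact: H0|exact: K0].
apply: (@smn_eq _ _ (fun x => pd i f x * g x + f x * pd i g x)) => [x Dx|].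
  rewrite /pd deriveM //; [|exact/diff_derivable/H0|exact/diff_derivable/K0].
  by rewrite addrC; congr (_ + _); exact: mulrC.
by apply: smnD; apply: IH.
Qed.

Lemma smnV n (f : 'rV[R]_m -> R) : (forall x, D x -> f x != 0) ->
  smn n D f -> smn n D (fun x => (f x)^-1).
Proof.
move=> f0; elim: n => [|n IH].
  by move=> /smn0 H; apply/smn0 => x Dx; apply: differentiableV; [exact: H|exact: f0].
move=> Hf; have Hf' := smnW Hf; move: Hf => /smnS[H0 H1]; apply/smnS; split=> [x Dx|i].
  by apply: differentiableV; [exact: H0|exact: f0].
apply: (@smn_eq _ _ (fun x => -1 * ((f x)^-1 * (f x)^-1) * pd i f x)) => [x Dx|].
  rewrite /pd deriveV //; [|exact: f0|exact/diff_derivable/H0].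
  by rewrite scaleNr mulN1r mulNr /exprz /= exprSr expr1 -invfM.
by do ! apply: smnM => //; [exact: smn_cst|exact: IH|exact: IH].
Qed.

Lemma smn_rVP k n (f : 'rV[R]_m -> 'rV[R]_k) :
  smn n D f <-> forall j, smn n D (fun x => f x 0 j).
Proof.
split=> [H j|H].
  apply: (@smn_lin _ _ n (@mxcoord 1 k 0 j) f) => //.
  exact: coord_continuous.
apply: (@smn_eq _ _ (fun x => \sum_j f x 0 j *: (delta_mx 0 j : 'rV[R]_k))) => [x _|].
  by rewrite -row_sum_delta.
apply: smn_sum => j _.
apply: (@smn_lin _ _ n (scalel (delta_mx 0 j : 'rV[R]_k)) (fun x => f x 0 j)) => //.
exact: scalel_continuous.
Qed.

End Smn.

Lemma smn_compR m k n (D : set 'rV[R]_m) (E : set 'rV[R]_k)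
    (f : 'rV[R]_m -> 'rV[R]_k) (g : 'rV[R]_k -> R) :
  open D -> open E -> (forall x, D x -> E (f x)) ->
  smn n D f -> smn n E g -> smn n D (fun x => g (f x)).
Proof.
move=> oD oE DE; elim: n f g DE => [|n IH] f g DE.
  move=> /smn0 H /smn0 K; apply/smn0 => x Dx.
  by apply: (@differentiable_comp _ _ _ _ f g); [exact: H|exact/K/DE].
move=> Hf /smnS[K0 K1]; have Hf' := smnW Hf.
move: Hf => /smnS[H0 H1]; apply/smnS; split=> [x Dx|i].
  by apply: (@differentiable_comp _ _ _ _ f g); [exact: H0|exact/K0/DE].
apply: (@smn_eq _ _ oD _ _ (fun x => \sum_j (pd i f x) 0 j * pd j g (f x))) => [x Dx|].
  rewrite [RHS]/pd derive_comp; [|exact: H0|exact/K0/DE].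
  apply: eq_bigr => j _; congr (_ * _).
  by rewrite derive_coord //; exact/diff_derivable/H0.
apply: smn_sum => // j _; apply: smnM => //; last exact: IH.
exact: ((smn_rVP oD _ (pd i f)).1 (H1 i) j).
Qed.

Lemma smn_comp m k l n (D : set 'rV[R]_m) (E : set 'rV[R]_k)
    (f : 'rV[R]_m -> 'rV[R]_k) (g : 'rV[R]_k -> 'rV[R]_l) :
  open D -> open E -> (forall x, D x -> E (f x)) ->
  smn n D f -> smn n E g -> smn n D (fun x => g (f x)).
Proof.
move=> oD oE DE Hf Hg; apply/smn_rVP => // j.
apply: (@smn_compR _ _ _ D E f (fun x => g x 0 j)) => //.
exact: ((smn_rVP oE _ g).1 Hg j).
Qed.

End PartialDerivatives.

(** * Smoothness at a point *)

Section Germs.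
Variables (R : realType).

Lemma norm_coord m (v : 'rV[R]_m) j : `|v 0 j| <= `|v|.
Proof.
rewrite [leRHS]/Num.Def.normr /= mx_normrE.
exact: (le_bigmax _ _ ((0 : 'I_1), j)).
Qed.

Lemma norm_rV_le m (v : 'rV[R]_m) C : 0 <= C ->
  (forall j, `|v 0 j| <= C) -> `|v| <= C.
Proof.
move=> C0 H; rewrite [leLHS]/Num.Def.normr /= mx_normrE.
by apply: bigmax_le => // -[i j] _; rewrite (ord1 i) /=.
Qed.

(** The neighbourhood is hidden in the statement, so that local constructions carry no domain. *)
Definition sm (m : nat) (V : normedModType R) (f : 'rV[R]_m -> V) x :=
  exists D, [/\ open D, D x & smooth_on D f].

Section Basic.
Variable m : nat.
Implicit Types (V W : normedModType R) (x : 'rV[R]_m).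

Lemma smooth_onP V D (f : 'rV[R]_m -> V) : open D ->
  smooth_on D f <-> (forall x, D x -> sm f x).
Proof.
move=> oD; split=> [H x Dx|H s x /H[E [oE Ex HE]]]; last exact: HE.
by exists D.
Qed.

Lemma sm_near V (f : 'rV[R]_m -> V) x : sm f x -> \forall y \near x, sm f y.
Proof.
move=> [D [oD Dx H]]; apply: filterS (open_nbhs_nbhs (conj oD Dx)) => y Dy.
by exists D.
Qed.

Lemma sm_diff V (f : 'rV[R]_m -> V) x : sm f x -> differentiable f x.
Proof. by move=> [D [oD Dx H]]; exact: (H [::]). Qed.

Lemma sm_cont V (f : 'rV[R]_m -> V) x : sm f x -> {for x, continuous f}.
Proof. by move=> /sm_diff; exact: differentiable_continuous. Qed.

Lemma sm_pd V (f : 'rV[R]_m -> V) x i : sm f x -> sm (pd i f) x.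
Proof.
move=> [D [oD Dx H]]; exists D; split=> // s y Dy.
by rewrite -partials_rcons; exact: H.
Qed.

Lemma sm_lift1 V W (P : ('rV[R]_m -> V) -> ('rV[R]_m -> W)) (f : 'rV[R]_m -> V) x :
  (forall D n, open D -> smn n D f -> smn n D (P f)) -> sm f x -> sm (P f) x.
Proof.
move=> H [D [oD Dx K]]; exists D; split=> //.
by apply/smooth_onE => n; apply: H => // s _; exact: K.
Qed.

Lemma sm_lift2 V1 V2 W (h : 'rV[R]_m -> W) (f : 'rV[R]_m -> V1) (g : 'rV[R]_m -> V2) x :
  (forall D n, open D -> smn n D f -> smn n D g -> smn n D h) ->
  sm f x -> sm g x -> sm h x.
Proof.
move=> H [D [oD Dx K]] [E [oE Ex L]]; exists (D `&` E); split=> //.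
  exact: openI.
have S V (k : 'rV[R]_m -> V) (A B : set 'rV[R]_m) n : A `<=` B -> smooth_on B k -> smn n A k.
  by move=> AB Bk s _ y /AB By; exact: Bk.
apply/smooth_onE => n; apply: H; first exact: openI.
  by apply: S K => y [].
by apply: S L => y [].
Qed.

Lemma sm_eq V (f g : 'rV[R]_m -> V) x :
  (\forall y \near x, f y = g y) -> sm f x -> sm g x.
Proof.
move=> fg [D [oD Dx K]].
exists (D `&` [set y | f y = g y]^°); split.
- by apply: openI => //; exact: open_interior.
- by split.
- apply/smooth_onE => n.
  apply: (@smn_eq _ _ _ _ _ _ f).
  + by apply: openI => //; exact: open_interior.
  + by move=> y [_ /interior_subset].
  + by move=> s _ y [Dy _]; exact: K.
Qed.

Lemma sm_cst V (a : V) x : sm (fun=> a) x.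
Proof.
exists setT; split=> //; first exact: openT.
by apply/smooth_onE => n; apply: smn_cst; exact: openT.
Qed.

Lemma smD V (f g : 'rV[R]_m -> V) x : sm f x -> sm g x -> sm (fun y => f y + g y) x.
Proof. by apply: sm_lift2 => D n oD; exact: smnD. Qed.

Lemma sm_lin V W (L : {linear V -> W}) (f : 'rV[R]_m -> V) x : continuous L ->
  sm f x -> sm (fun y => L (f y)) x.
Proof.
move=> cL; apply: (@sm_lift1 _ _ (fun f y => L (f y))) => D n oD.
exact: smn_lin.
Qed.

Lemma sm_linrV k W (L : {linear 'rV[R]_k -> W}) (f : 'rV[R]_m -> 'rV[R]_k) x :
  sm f x -> sm (fun y => L (f y)) x.
Proof. by apply: sm_lin; exact: rV_linear_continuous. Qed.

Lemma sm_id x : sm (fun y : 'rV[R]_m => y) x.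
Proof.
exists setT; split=> //; first exact: openT.
apply/smooth_onE; case=> [|n]; first by apply/smn0.
apply/smnS; split=> // i.
apply: (@smn_eq _ _ _ openT _ _ (fun=> delta_mx 0 i)); last exact/smn_cst/openT.
by move=> y _; rewrite /pd derive_id.
Qed.

Lemma smZ V a (f : 'rV[R]_m -> V) x : sm f x -> sm (fun y => a *: f y) x.
Proof.
move=> sf; apply: (@sm_lin _ _ (a \*: idfun) f) => //= v.
exact: scaler_continuous.
Qed.

Lemma smN V (f : 'rV[R]_m -> V) x : sm f x -> sm (fun y => - f y) x.
Proof. by move=> /(smZ (-1)); apply: sm_eq; near=> y; rewrite scaleN1r.
Unshelve. all: by end_near. Qed.

Lemma smB V (f g : 'rV[R]_m -> V) x : sm f x -> sm g x -> sm (fun y => f y - g y) x.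
Proof. by move=> sf sg; apply: smD => //; exact: smN. Qed.

Lemma sm_sum V (I : Type) (r : seq I) (P : pred I) (F : I -> 'rV[R]_m -> V) x :
  (forall i, P i -> sm (F i) x) -> sm (fun y => \sum_(i <- r | P i) F i y) x.
Proof.
move=> H; elim: r => [|i r IH].
  apply: (@sm_eq V (fun=> 0)); last exact: sm_cst.
  by near=> y; rewrite big_nil.
case Pi : (P i); last by apply: (sm_eq _ IH); near=> y; rewrite big_cons Pi.
apply: (@sm_eq _ (fun y => F i y + \sum_(j <- r | P j) F j y)); last by apply: smD => //; exact: H.
by near=> y; rewrite big_cons Pi.
Unshelve. all: by end_near. Qed.

Lemma smM (f g : 'rV[R]_m -> R) x : sm f x -> sm g x -> sm (fun y => f y * g y) x.
Proof. by apply: sm_lift2 => D n oD; exact: smnM. Qed.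

Lemma sm_prod (I : Type) (r : seq I) (P : pred I) (F : I -> 'rV[R]_m -> R) x :
  (forall i, P i -> sm (F i) x) -> sm (fun y => \prod_(i <- r | P i) F i y) x.
Proof.
move=> H; elim: r => [|i r IH].
  apply: (@sm_eq R^o (fun=> 1 : R^o)); last exact: sm_cst.
  by near=> y; rewrite big_nil.
case Pi : (P i); last by apply: (sm_eq _ IH); near=> y; rewrite big_cons Pi.
apply: (@sm_eq _ (fun y => F i y * \prod_(j <- r | P j) F j y)); last by apply: smM => //; exact: H.
by near=> y; rewrite big_cons Pi.
Unshelve. all: by end_near. Qed.

Lemma near_neq0 (f : 'rV[R]_m -> R) x : {for x, continuous f} -> f x != 0 ->
  \forall y \near x, f y != 0.
Proof.
move=> cf fx0.
exact: (cf _ (open_nbhs_nbhs (conj (@open_neq _ 0) fx0))).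
Qed.

Lemma smV (f : 'rV[R]_m -> R) x : f x != 0 -> sm f x -> sm (fun y => (f y)^-1) x.
Proof.
move=> fx0 sf; have [D [oD Dx K]] := sf.
have N := near_neq0 (sm_cont sf) fx0.
have oE : open (D `&` [set y | f y != 0]^°) by apply: openI => //; exact: open_interior.
exists (D `&` [set y | f y != 0]^°); split; [by []|by split|].
apply/smooth_onE => n; apply: smnV => // [y [_ /interior_subset]//|].
by move=> s _ y [Dy _]; exact: K.
Qed.

Lemma sm_rVP k (f : 'rV[R]_m -> 'rV[R]_k) x :
  sm f x <-> forall j, sm (fun y => f y 0 j) x.
Proof.
split=> [sf j|H].
  by apply: (@sm_linrV _ _ (@mxcoord R 1 k 0 j)).
apply: (@sm_eq _ (fun y => \sum_j f y 0 j *: (delta_mx 0 j : 'rV[R]_k))).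
  by near=> y; rewrite -row_sum_delta.
apply: sm_sum => j _.
apply: (@sm_lin _ _ (scalel (delta_mx 0 j : 'rV[R]_k)) (fun y => f y 0 j)) => //.
exact: scalel_continuous.
Unshelve. all: by end_near. Qed.

Lemma sm_coord k (f : 'rV[R]_m -> 'rV[R]_k) x j : sm f x -> sm (fun y => f y 0 j) x.
Proof. by move=> /sm_rVP. Qed.

Lemma smZr k (f : 'rV[R]_m -> R) (g : 'rV[R]_m -> 'rV[R]_k) x :
  sm f x -> sm g x -> sm (fun y => f y *: g y) x.
Proof.
move=> sf sg; apply/sm_rVP => j.
apply: (@sm_eq _ (fun y => f y * g y 0 j)); first by near=> y; rewrite mxE.
by apply: smM => //; exact: sm_coord.
Unshelve. all: by end_near. Qed.

Lemma sm_det n (A : 'rV[R]_m -> 'M[R]_n) x :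
  (forall i j, sm (fun y => A y i j) x) -> sm (fun y => \det (A y)) x.
Proof.
move=> H; rewrite /determinant; apply: sm_sum => s _; apply: smM.
  exact: sm_cst.
by apply: sm_prod => i _.
Qed.

Lemma sm_invmx n (A : 'rV[R]_m -> 'M[R]_n) x :
  (forall i j, sm (fun y => A y i j) x) -> A x \in unitmx ->
  forall i j, sm (fun y => invmx (A y) i j) x.
Proof.
move=> H uA i j; have sd := sm_det H.
have d0 : \det (A x) != 0 by rewrite -unitfE.
apply: (@sm_eq _ (fun y => (\det (A y))^-1 * ((-1) ^+ (j + i) * \det (row' j (col' i (A y)))))).
  apply: filterS (near_neq0 (sm_cont sd) d0) => y Ay0.
  by rewrite /invmx unitmxE unitfE Ay0 !mxE.
apply: smM; first exact: smV.
apply: smM; first exact: sm_cst.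
apply: sm_det => k l; apply: (sm_eq _ (H (lift j k) (lift i l))).
by near=> y; rewrite !mxE.
Unshelve. all: by end_near. Qed.

Lemma near_unitmx n (A : 'rV[R]_m -> 'M[R]_n) x :
  (forall i j, sm (fun y => A y i j) x) -> A x \in unitmx ->
  \forall y \near x, A y \in unitmx.
Proof.
move=> H uA; have sd := sm_det H.
have d0 : \det (A x) != 0 by rewrite -unitfE.
by apply: filterS (near_neq0 (sm_cont sd) d0) => y; rewrite unitmxE unitfE.
Qed.

End Basic.

Lemma sm_comp m k l (f : 'rV[R]_m -> 'rV[R]_k) (g : 'rV[R]_k -> 'rV[R]_l) x :
  sm f x -> sm g (f x) -> sm (fun y => g (f y)) x.
Proof.
move=> sf [E [oE Ex L]]; have [D [oD Dx K]] := sf.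
have N : \forall y \near x, E (f y).
  exact: (sm_cont sf (open_nbhs_nbhs (conj oE Ex))).
exists (D `&` [set y | E (f y)]^°); split.
- by apply: openI => //; exact: open_interior.
- by split.
apply/smooth_onE => n; apply: (@smn_comp _ _ _ _ _ _ E f g) => //.
- by apply: openI => //; exact: open_interior.
- by move=> y [_ /interior_subset].
- by move=> s _ y [Dy _]; exact: K.
- by move=> s _; exact: L.
Qed.

Lemma sm_compR m k (f : 'rV[R]_m -> 'rV[R]_k) (g : 'rV[R]_k -> R) x :
  sm f x -> sm g (f x) -> sm (fun y => g (f y)) x.
Proof.
move=> sf sg.
have : sm (fun y => (fun z => const_mx (g z) : 'rV[R]_1) (f y)) x.
  apply: (@sm_comp _ _ _ _ (fun z => const_mx (g z) : 'rV[R]_1)) => //.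
  by apply/sm_rVP => j; apply: (sm_eq _ sg); near=> y; rewrite mxE.
by move=> /(sm_coord 0); apply: sm_eq; near=> y; rewrite mxE.
Unshelve. all: by end_near. Qed.

Lemma sm_diffv m k (f : 'rV[R]_m -> 'rV[R]_k) (v : 'rV[R]_m -> 'rV[R]_m) x :
  sm f x -> sm v x -> sm (fun y => 'd f y (v y)) x.
Proof.
move=> sf sv; apply: (@sm_eq _ _ (fun y => \sum_i v y 0 i *: pd i f y)).
  by apply: filterS (sm_near sf) => y /sm_diff dy; rewrite diff_pd.
by apply: sm_sum => i _; apply: smZr; [exact: sm_coord|exact: sm_pd].
Qed.

Lemma sm_derive m k (f : 'rV[R]_m -> 'rV[R]_k) v x :
  sm f x -> sm (fun y => 'D_v f y) x.
Proof.
move=> sf; apply: (@sm_eq _ _ (fun y => 'd f y v)).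
  by apply: filterS (sm_near sf) => y /sm_diff dy; rewrite deriveE.
by apply: sm_diffv => //; exact: sm_cst.
Qed.

End Germs.

(** * Taylor estimates and symmetry of second derivatives *)

Section Estimates.
Variables (R : realType).

Lemma is_derive_curve (V W : normedModType R) (g : R -> V) (f : V -> W) (t : R) dg :
  is_derive t (1 : R) g dg -> differentiable f (g t) ->
  is_derive t (1 : R) (f \o g) ('d f (g t) dg).
Proof.
move=> [dg1 dg2] df.
have dg' : differentiable g t by apply/derivable1_diffP.
split; first by apply/derivable1_diffP/differentiable_comp.
rewrite deriveE; last exact: differentiable_comp.
by rewrite diff_comp //= -(deriveE _ dg') dg2.
Qed.

Lemma is_derive_line (V : normedModType R) (y v : V) t :
  is_derive t (1 : R) (fun t : R => y + t *: v) v.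
Proof.
have H : is_derive t (1 : R) (fun t : R => t *: v) v.
  have d : differentiable (fun t : R => t *: v) t by apply: differentiableZl.
  split; first exact: diff_derivable.
  by rewrite deriveE // diff_val scale1r.
by have := is_deriveD (is_derive_cst y t 1) H; rewrite add0r.
Qed.

Lemma MVTR (f df : R -> R) (a b : R) : a <= b ->
  (forall x : R, a <= x <= b -> is_derive x (1 : R) f (df x)) ->
  exists2 c : R, a <= c <= b & f b - f a = df c * (b - a).
Proof.
move=> ab H; have [x|x| c] := @MVT_segment R f df a b ab.
- by rewrite in_itv /= => /andP[x0 x1]; apply: H; rewrite !ltW.
- by apply: derivable_within_continuous => z; rewrite in_itv /= => /H[].
- by rewrite in_itv /= => cab E; exists c.
Qed.

Lemma segMVT m (f : 'rV[R]_m -> R) y z :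
  (forall t : R, t \in `[0, 1] -> differentiable f (y + t *: (z - y))) ->
  exists2 t : R, t \in `[0, 1] & f z - f y = 'd f (y + t *: (z - y)) (z - y).
Proof.
move=> df.
pose g (t : R) := y + t *: (z - y).
pose phi (t : R) : R := f (g t); pose dphi (t : R) : R := 'd f (g t) (z - y).
have [t t01 E] : exists2 c : R, 0 <= c <= 1 & phi 1 - phi 0 = dphi c * (1 - 0).
  apply: MVTR => // t t01; apply: (is_derive_curve (is_derive_line _ _ _)).
  by apply: df; rewrite in_itv.
exists t; first by rewrite in_itv.
by move: E; rewrite /phi /g /= scale1r scale0r addr0 (addrC y) subrK subr0 mulr1.
Qed.

Lemma ball_seg (V : normedModType R) (x y z : V) d (t : R) : ball x d y -> ball x d z ->
  t \in `[0, 1] -> ball x d (y + t *: (z - y)).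
Proof.
rewrite -ball_normE /= in_itv /= => xy xz /andP[t0 t1].
rewrite (_ : x - _ = (1 - t) *: (x - y) + t *: (x - z)); last first.
  have -> : z - y = (x - y) - (x - z) by rewrite [in RHS]opprB [RHS]addrC subrKA.
  by rewrite opprD addrA scalerBl scale1r scalerBr opprB [t *: _ - _]addrC addrA.
apply: (le_lt_trans (ler_normD _ _)); rewrite !normrZ ger0_norm ?subr_ge0 // ger0_norm //.
have [->|tn0] := eqVneq t 0; first by rewrite subr0 mul1r mul0r addr0.
rewrite (_ : d = (1 - t) * d + t * d); last by rewrite -mulrDl subrK mul1r.
apply: ler_ltD; first by rewrite ler_wpM2l ?subr_ge0 // ltW.
by rewrite ltr_pM2l // lt_neqAle eq_sym tn0.
Qed.

Lemma near_ball_right (V : normedModType R) (x : V) (P : V -> Prop) :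
  (\forall y \near x, P y) ->
  \forall d \near (0 : R)^'+, forall y, ball x d y -> P y.
Proof.
move=> /nbhs_ballP[d /= d0 H]; near=> e => y xy; apply: H; apply: le_ball xy.
by near: e; exact: nbhs_right_le.
Unshelve. all: by end_near. Qed.

(** The constant is chosen before the radius, so that several estimates can be met on a common
    ball. *)
Lemma sm_lipschitz m k (f : 'rV[R]_m -> 'rV[R]_k) x : sm f x ->
  exists2 C, 0 <= C & \forall d \near (0 : R)^'+, forall y z, ball x d y -> ball x d z ->
    `|f z - f y| <= C * `|z - y|.
Proof.
move=> sf; exists (\sum_i (`|pd i f x| + 1)); first by rewrite sumr_ge0.
have N : \forall y \near x, differentiable f y /\ forall i, `|pd i f y| <= `|pd i f x| + 1.
  near=> y; split; first by near: y; apply: filterS (sm_near sf) => y /sm_diff.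
  near: y; apply: filter_forall => i.
  have /sm_cont/cvgr_dist_le/(_ _ ltr01) := sm_pd i sf.
  apply: filterS => y; rewrite distrC => H; rewrite -lerBlDl.
  exact: le_trans (lerB_dist _ _) H.
near=> d => y z xy xz.
have B : forall y, ball x d y -> differentiable f y /\ forall i, `|pd i f y| <= `|pd i f x| + 1.
  by near: d; exact: near_ball_right.
apply: norm_rV_le => [|j]; first by rewrite mulr_ge0 // sumr_ge0.
have dj c : ball x d c -> differentiable (fun y => f y 0 j) c.
  by move=> /B[/differentiable_rVP].
have [t t01 E] := @segMVT m (fun y => f y 0 j) y z (fun t t01 => dj _ (ball_seg xy xz t01)).
rewrite !mxE E; have xc := ball_seg xy xz t01; rewrite diff_pd; last exact: dj.
rewrite mulr_suml; apply: le_trans (ler_norm_sum _ _ _) _; apply: ler_sum => i _.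
rewrite normrM mulrC ler_pM //; last first.
  by apply: le_trans (norm_coord (z - y) i); rewrite mxE.
have [df /(_ i)] := B _ xc; apply: le_trans; rewrite /pd -derive_coord; last exact: diff_derivable.
exact: norm_coord.
Unshelve. all: by end_near. Qed.

(** By the mean value theorem each coordinate of the remainder is a difference of two differentials
    applied to z - y, and the partial derivatives are Lipschitz. *)
Lemma sm_quad m k (f : 'rV[R]_m -> 'rV[R]_k) x : sm f x ->
  exists2 C, 0 <= C & \forall d \near (0 : R)^'+, forall y z, ball x d y -> ball x d z ->
    `|f z - f y - 'd f y (z - y)| <= C * `|z - y| ^+ 2.
Proof.
move=> sf.
have /choice[C HC] : forall i, exists C, 0 <= C /\ \forall d \near (0 : R)^'+, forall y z, ball x d y -> ball x d z ->
    `|pd i f z - pd i f y| <= C * `|z - y|.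
  by move=> i; have [C C0 H] := sm_lipschitz (sm_pd i sf); exists C.
exists (\sum_i C i); first by apply: sumr_ge0 => i _; have [] := HC i.
near=> d => y z xy xz.
have L i : forall y z, ball x d y -> ball x d z -> `|pd i f z - pd i f y| <= C i * `|z - y|.
  by move: i; near: d; apply: filter_forall => i; have [_] := HC i.
have B : forall y, ball x d y -> differentiable f y.
  by near: d; apply: near_ball_right; apply: filterS (sm_near sf) => ? /sm_diff.
have C0 i : 0 <= C i by have [] := HC i.
apply: norm_rV_le => [|j]; first by rewrite mulr_ge0 ?exprn_ge0 // sumr_ge0.
have dj c : ball x d c -> differentiable (fun y => f y 0 j) c.
  by move=> /B/differentiable_rVP.
have [t t01 E] := @segMVT m (fun y => f y 0 j) y z (fun t t01 => dj _ (ball_seg xy xz t01)).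
have xc := ball_seg xy xz t01; rewrite !mxE E !diff_pd; [|exact: B|exact: dj].
rewrite summxE -sumrB mulr_suml; apply: le_trans (ler_norm_sum _ _ _) _; apply: ler_sum => i _.
set c := y + _ in xc *.
rewrite [X in `|_ - X|]mxE -mulrBr normrM expr2 mulrA mulrC ler_pM //; last first.
  by apply: le_trans (norm_coord (z - y) i); rewrite mxE.
rewrite /pd -derive_coord; last exact/diff_derivable/B.
apply: (@le_trans _ _ (C i * `|c - y|)).
  apply: le_trans (L i y c xy xc).
  by apply: le_trans (norm_coord _ j); rewrite !mxE.
rewrite ler_wpM2l // /c addrC addKr normrZ ler_piMl //.
by move: t01; rewrite in_itv /= => /andP[t0 t1]; rewrite ger0_norm.
Unshelve. all: by end_near. Qed.

Lemma sm_const_mx m (f : 'rV[R]_m -> R) x :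
  sm f x -> sm (fun y => const_mx (f y) : 'rV_1) x.
Proof.
move=> sf; apply/sm_rVP => j; apply: (sm_eq _ sf); near=> y.
by rewrite mxE.
Unshelve. all: by end_near. Qed.

Lemma sm_quadR m (f : 'rV[R]_m -> R) x : sm f x ->
  exists2 C, 0 <= C & \forall d \near (0 : R)^'+, forall y z, ball x d y -> ball x d z ->
    `|f z - f y - 'd f y (z - y)| <= C * `|z - y| ^+ 2.
Proof.
move=> sf; have [C C0 H] := sm_quad (sm_const_mx sf); exists C => //.
near=> d => y z xy xz.
have H' : forall y z, ball x d y -> ball x d z ->
    `|(const_mx (f z) : 'rV_1) - const_mx (f y) - 'd (fun y => const_mx (f y) : 'rV_1) y (z - y)| <= C * `|z - y| ^+ 2.
  by near: d.
have B : forall y, ball x d y -> sm f y.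
  by near: d; apply: near_ball_right; exact: sm_near.
apply: le_trans (H' _ _ xy xz); apply: le_trans (norm_coord _ 0).
have dc := sm_diff (sm_const_mx (B _ xy)).
have E : ('d (fun y => const_mx (f y) : 'rV_1) y (z - y)) 0 0 = 'd f y (z - y).
  rewrite -deriveE // derive_coord; last exact: diff_derivable.
  rewrite (_ : (fun y0 : 'rV_m => _) = f) ?deriveE //; first exact/sm_diff/B.
  by apply/funext => w; rewrite mxE.
by rewrite !mxE E.
Unshelve. all: by end_near. Qed.

Lemma smR_derive m (f : 'rV[R]_m -> R) v x : sm f x -> sm (fun y => 'D_v f y) x.
Proof.
move=> sf; have : sm (fun y => 'D_v (fun y => const_mx (f y) : 'rV_1) y 0 0) x.
  exact/sm_coord/sm_derive/sm_const_mx.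
apply: sm_eq; apply: filterS (sm_near sf) => y /sm_const_mx/sm_diff dc.
rewrite derive_coord; last exact: diff_derivable.
by congr ('D_v _ y); apply/funext => w; rewrite mxE.
Qed.

(** The mean value theorem in the direction [a] turns the second difference into h times an
    increment of D_a f along h b. Two applications of [sm_quadR] from the base point x then leave an
    error of order h^3. *)
Lemma schwarz_half m (f : 'rV[R]_m -> R) x a b : sm f x ->
  exists C, \forall h \near (0 : R)^'+,
   `|f (x + h *: a + h *: b) - f (x + h *: b) - (f (x + h *: a) - f x)
     - h ^+ 2 * 'D_b (fun y => 'D_a f y) x| <= C * h ^+ 3.
Proof.
move=> sf; pose g y := 'D_a f y.
have sg : sm g x by exact: smR_derive.
have [C C0 HC] := sm_quadR sg.
pose N := `|a| + `|b|; have N0 : 0 <= N by rewrite addr_ge0.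
exists (C * N ^+ 2 + C * N ^+ 2).
have [d /= d0 [Q B]] : exists2 d, 0 < d & (forall y z, ball x d y -> ball x d z ->
    `|g z - g y - 'd g y (z - y)| <= C * `|z - y| ^+ 2) /\
    forall y, ball x d y -> sm f y.
  have : \forall d \near (0 : R)^'+, 0 < d /\ (forall y z, ball x d y -> ball x d z ->
    `|g z - g y - 'd g y (z - y)| <= C * `|z - y| ^+ 2) /\
    forall y, ball x d y -> sm f y.
    near=> d; split; first by [].
    by split; near: d; [exact: HC|apply: near_ball_right; exact: sm_near].
  by move=> /filter_ex[d [d0 ?]]; exists d.
near=> h; have h0 : 0 < h by [].
have hN : h * N < d.
  have : h < d / (N + 1) by near: h; apply: nbhs_right_lt; rewrite divr_gt0 // ltr_wpDl.
  rewrite ltr_pdivlMr ?ltr_wpDl //; apply: le_lt_trans.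
  by rewrite ler_pM2l // lerDl.
have inB s e : 0 <= s <= h -> 0 <= e <= h -> ball x d (x + s *: a + e *: b) /\
    `|s *: a + e *: b| <= h * N.
  move=> /andP[s0 sh] /andP[e0 eh].
  have L : `|s *: a + e *: b| <= h * N.
    rewrite (le_trans (ler_normD _ _)) // /N mulrDr lerD // normrZ ger0_norm //.
      by rewrite ler_wpM2r.
    by rewrite ler_wpM2r.
  split=> //; rewrite -ball_normE /= -addrA opprD addrA subrr sub0r normrN.
  exact: le_lt_trans hN.
have xx : ball x d x by exact: ballxx.
pose phi (t : R) := f (x + h *: b + t *: a) - f (x + t *: a).
have dphi (t : R) : t \in `[0, h] ->
    is_derive t (1 : R) phi (g (x + h *: b + t *: a) - g (x + t *: a)).
  rewrite in_itv /= => th.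
  have b1 : ball x d (x + h *: b + t *: a).
    by rewrite addrAC; have [] := inB t h th _; rewrite // lexx ltW.
  have b2 : ball x d (x + t *: a).
    by rewrite -[x + _]addr0 -(scale0r b); have [] := inB t 0 th _; rewrite // lexx ltW.
  have d1 := sm_diff (B _ b1); have d2 := sm_diff (B _ b2).
  by rewrite /g !deriveE //; apply: is_deriveB; apply: is_derive_curve => //; exact: is_derive_line.
pose dp (t : R) : R := g (x + h *: b + t *: a) - g (x + t *: a).
have [xi xih E] : exists2 c : R, 0 <= c <= h & phi h - phi 0 = dp c * (h - 0).
  by apply: (@MVTR phi dp 0 h (ltW h0)) => t th; apply: dphi; rewrite in_itv.
move: E; rewrite /phi /dp !scale0r !addr0 subr0 (addrAC x (h *: b)) => E.
rewrite [X in `|X - _|](_ : _ = f (x + h *: a + h *: b) - f (x + h *: a) - (f (x + h *: b) - f x)); last by ring.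
rewrite E (addrAC x (h *: b)).
have [|b1 n1] := inB xi h xih; first by rewrite lexx ltW.
have [|b2 n2] := inB xi 0 xih; first by rewrite lexx ltW.
rewrite scale0r !addr0 in b2 n2.
have := Q _ _ xx b1; have := Q _ _ xx b2.
rewrite -(addrA x) !(addrC x) !addrK => q2 q1.
rewrite [X in `|X|](_ : _ = h * ((g (xi *: a + h *: b + x) - g x - 'd g x (xi *: a + h *: b))
   - (g (xi *: a + x) - g x - 'd g x (xi *: a)))); last first.
  rewrite deriveE; last exact: sm_diff.
  have -> : 'd g x (xi *: a + h *: b) = 'd g x (xi *: a) + h * 'd g x b.
    by rewrite linearD; congr (_ + _); exact: linearZ.
  by rewrite -/g; ring.
rewrite normrM gtr0_norm // [C * N ^+ 2 + _]addrC (_ : _ * h ^+ 3 = h * (C * (h * N) ^+ 2 + C * (h * N) ^+ 2)); last by ring.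
rewrite ler_pM2l //; apply: (le_trans (ler_normB _ _)); rewrite lerD //.
  apply: (le_trans q1); rewrite ler_wpM2l // lerXn2r ?nnegrE //.
  by rewrite mulr_ge0 // ltW.
apply: (le_trans q2); rewrite ler_wpM2l // lerXn2r ?nnegrE //.
by rewrite mulr_ge0 // ltW.
Unshelve. all: by end_near. Qed.

(** The second difference is symmetric in [a] and [b]: both mixed derivatives, multiplied by h^2,
    are within O(h^3) of the same number. *)
Lemma schwarzR m (f : 'rV[R]_m -> R) x a b : sm f x ->
  'D_b (fun y => 'D_a f y) x = 'D_a (fun y => 'D_b f y) x.
Proof.
move=> sf; have [C HC] := schwarz_half a b sf; have [K HK] := schwarz_half b a sf.
apply/eqP; rewrite -subr_eq0 -normr_eq0 eq_le normr_ge0 andbT.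
apply/ler_addgt0Pl => e e0; rewrite addr0.
pose h0 := e / (`|C| + `|K| + 1).
have P0 : 0 < `|C| + `|K| + 1 by rewrite ltr_wpDl // addr_ge0.
have : \forall h \near (0 : R)^'+, `|'D_b (fun y => 'D_a f y) x - 'D_a (fun y => 'D_b f y) x| <= e.
  near=> h; have hp : 0 < h by [].
  have : `|f (x + h *: a + h *: b) - f (x + h *: b) - (f (x + h *: a) - f x)
     - h ^+ 2 * 'D_b (fun y => 'D_a f y) x| <= C * h ^+ 3 by near: h.
  have : `|f (x + h *: b + h *: a) - f (x + h *: a) - (f (x + h *: b) - f x)
     - h ^+ 2 * 'D_a (fun y => 'D_b f y) x| <= K * h ^+ 3 by near: h.
  rewrite (addrAC x (h *: b)); move: ('D_b _ _) ('D_a _ _) => A B q p.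
  have h2 : 0 < h ^+ 2 by rewrite exprn_gt0.
  rewrite -(ler_pM2l h2) -{1}(gtr0_norm h2) -normrM.
  move: p q; move: (f _) (f _) (f _) (f _) => u v w z p q.
  rewrite (_ : h ^+ 2 * (A - B) = (z - v - (w - u) - h ^+ 2 * B) - (z - w - (v - u) - h ^+ 2 * A)); last by ring.
  apply: (le_trans (ler_normB _ _)); apply: (le_trans (lerD q p)).
  have hh : h < h0 by near: h; apply: nbhs_right_lt; rewrite divr_gt0.
  rewrite -mulrDl (_ : h ^+ 3 = h ^+ 2 * h); last by ring.
  rewrite mulrCA ler_pM2l //.
  rewrite ltr_pdivlMr // in hh; apply: le_trans (ltW hh).
  by rewrite mulrC ler_pM2l // addrC -[leLHS]addr0; do ! [apply: lerD => //; try exact: ler_norm].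
by move=> /filter_ex[].
Unshelve. all: by end_near. Qed.

Lemma schwarz m k (f : 'rV[R]_m -> 'rV[R]_k) x a b : sm f x ->
  'D_b (fun y => 'D_a f y) x = 'D_a (fun y => 'D_b f y) x.
Proof.
move=> sf; apply/rowP => j.
have E v w : ('D_v (fun y => 'D_w f y) x) 0 j = 'D_v (fun y => 'D_w (fun z => f z 0 j) y) x.
  rewrite derive_coord; last exact/diff_derivable/sm_diff/sm_derive.
  apply: near_eq_derive; apply: filterS (sm_near sf) => y /sm_diff dy.
  by rewrite derive_coord //; exact: diff_derivable.
exact: (etrans (E b a) (etrans (schwarzR a b (sm_coord j sf)) (esym (E a b)))).
Qed.

End Estimates.

(** * Ordinary differential equations and flows *)

Section ODE.
Variables (R : realType).

Lemma is_derive_rV N (f : R -> 'rV[R]_N) (s : R) (df : 'rV[R]_N) :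
  (forall j, is_derive s (1 : R) (fun t => f t 0 j) (df 0 j)) -> is_derive s (1 : R) f df.
Proof.
move=> H; have df' : derivable f s 1.
  by apply/derivable_mxP => i j; rewrite (ord1 i); have [] := H j.
split=> //; apply/rowP => j; rewrite derive_coord //.
by have [_ ->] := H j.
Qed.

Lemma is_derive_coord N (f : R -> 'rV[R]_N) (s : R) (df : 'rV[R]_N) j :
  is_derive s (1 : R) f df -> is_derive s (1 : R) (fun t => f t 0 j) (df 0 j).
Proof.
move=> [d <-]; split; first by have /derivable_mxP := d.
by rewrite derive_coord.
Qed.

Lemma is_derive_cont (V : normedModType R) (f : R -> V) (s : R) df :
  is_derive s (1 : R) f df -> {for s, continuous f}.
Proof. by move=> [d _]; apply/differentiable_continuous/derivable1_diffP. Qed.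

(** Both g - f and g + f are nondecreasing. *)
Lemma cmp_le (f g df dg : R -> R) :
  (forall s : R, 0 <= s <= 1 -> is_derive s (1 : R) f (df s)) ->
  (forall s : R, 0 <= s <= 1 -> is_derive s (1 : R) g (dg s)) ->
  (forall s : R, 0 <= s <= 1 -> `|df s| <= dg s) -> `|f 0| <= g 0 ->
  forall s : R, 0 <= s <= 1 -> `|f s| <= g s.
Proof.
move=> Hf Hg H H0 s /andP[s0 s1].
have B (c : R) : 0 <= c <= s -> 0 <= c <= 1.
  by move=> /andP[c0 cs]; rewrite c0 (le_trans cs).
have [c cs Ec] := @MVTR R (fun x => g x - f x) (fun x => dg x - df x) 0 s s0
  (fun x xs => is_deriveB (Hg x (B x xs)) (Hf x (B x xs))).
have [e es Ee] := @MVTR R (fun x => g x + f x) (fun x => dg x + df x) 0 s s0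
  (fun x xs => is_deriveD (Hg x (B x xs)) (Hf x (B x xs))).
have := H c (B c cs); have := H e (B e es); move: H0; rewrite !ler_norml.
move=> /andP[a1 a2] /andP[b1 b2] /andP[d1 d2].
have P1 : 0 <= (dg c - df c) * (s - 0) by rewrite subr0 mulr_ge0 // subr_ge0.
have P2 : 0 <= (dg e + df e) * (s - 0) by rewrite subr0 mulr_ge0 //; lra.
by rewrite -Ec in P1; rewrite -Ee in P2; apply/andP; split; lra.
Qed.

Lemma is_derive_exp (a s : R) : is_derive s (1 : R) (fun t => expR (a * t)) (a * expR (a * s)).
Proof.
have H : is_derive s (1 : R) (fun t : R => a * t) a.
  by have := is_deriveZ a (is_derive_id s (1 : R)); rewrite /GRing.scale /= mulr1.
have := is_derive1_comp (is_derive_expR (a * s)) H.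
by rewrite mulrC.
Qed.

Definition gronwall_const (L : R) : R := 2 * expR (2 * L).

(** The weighted norm w(s) = exp(-2Ls) |y s| attains its maximum at some c. Bounding |y s| by w(c)
    exp(2Ls) in the derivative and integrating gives exp(2Lc) w(c) <= |y 0| + e + exp(2Lc) w(c) / 2,
    because the rate 2L halves the integral of L exp(2Ls). The norm itself is never
    differentiated. *)
Lemma gronwall N (y dy : R -> 'rV[R]_N) (L e : R) : 0 <= L -> 0 <= e ->
  (forall s : R, 0 <= s <= 1 -> is_derive s (1 : R) y (dy s)) ->
  (forall s : R, 0 <= s <= 1 -> `|dy s| <= L * `|y s| + e) ->
  forall s : R, 0 <= s <= 1 -> `|y s| <= gronwall_const L * (`|y 0| + e).
Proof.
move=> L0 e0 Hy Hd.
pose w (s : R) := expR (- (2 * L) * s) * `|y s|.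
have cw : {within `[0, 1], continuous w}.
  apply: continuous_in_subspaceT => s /set_mem; rewrite /= in_itv /= => /Hy H.
  apply: cvgM; first exact: is_derive_cont (is_derive_exp _ _).
  by apply: cvg_norm; exact: is_derive_cont H.
have [c c01 Hc] := EVT_max ler01 cw.
have Hw (s : R) : 0 <= s <= 1 -> `|y s| = expR (2 * L * s) * w s.
  by rewrite /w mulrA -expRD mulNr subrr expR0 mul1r.
have D0 : 0 <= w c by rewrite mulr_ge0 // expR_ge0.
pose g (s : R) := (`|y 0| + w c / 2 * expR (2 * L * s)) + e * s.
pose dg (s : R) := (0 + w c / 2 * (2 * L * expR (2 * L * s))) + e * 1.
have Hg (s : R) : is_derive s (1 : R) g (dg s).
  apply: is_deriveD; first apply: is_deriveD.
    by apply: is_deriveZ; exact: is_derive_exp.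
have B (s : R) : 0 <= s <= 1 -> `|y s| <= g s.
  move=> s01; apply: norm_rV_le => [|j].
    rewrite /g addr_ge0 ?addr_ge0 ?mulr_ge0 ?expR_ge0 ?invr_ge0 //.
    by case/andP: s01.
  apply: (@cmp_le (fun s => y s 0 j) g (fun s => dy s 0 j) dg) => //.
  - by move=> t t01; apply: is_derive_coord; exact: Hy.
  - move=> t t01; apply: (le_trans (norm_coord _ _)); apply: (le_trans (Hd t t01)).
    rewrite /dg mulr1 add0r lerD2r Hw // [leRHS](_ : _ = L * (expR (2 * L * t) * w c)); last by field.
    rewrite ler_wpM2l // ler_wpM2l ?expR_ge0 //; apply: Hc; by rewrite in_itv.
  - apply: (le_trans (norm_coord _ _)); rewrite /g [e * 0]mulr0 addr0.
    by rewrite lerDl mulr_ge0 ?divr_ge0 ?expR_ge0.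
rewrite in_itv /= in c01.
have D : w c <= 2 * (`|y 0| + e).
  have := B c c01; rewrite (Hw c c01) /g; set E := expR _.
  have E1 : 1 <= E.
    by rewrite -expR0 ler_expR mulr_ge0 // ?mulr_ge0 //; case/andP: c01.
  have c1 : e * c <= e by rewrite ler_piMr //; case/andP: c01.
  move=> Q; have {}Q : E * w c / 2 <= `|y 0| + e by lra.
  have : w c <= E * w c by rewrite ler_peMl.
  by lra.
move=> s s01; rewrite (Hw s s01) /gronwall_const.
have ws : w s <= 2 * (`|y 0| + e) by apply: le_trans D; apply: Hc; rewrite in_itv.
rewrite (_ : _ * (_ + _) = expR (2 * L) * (2 * (`|y 0| + e))); last by ring.
apply: ler_pM => //; rewrite ?expR_ge0 //; first by rewrite mulr_ge0 // expR_ge0.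
by rewrite ler_expR ler_piMr ?mulr_ge0 //; case/andP: s01.
Qed.

(** The projection of the line onto [0, 1]. It turns functions that are controlled on [0, 1] only
    into continuous functions on the line, which have primitives. *)
Definition c01 (s : R) : R := Num.max 0 (Num.min 1 s).

Lemma c01_in s : 0 <= c01 s <= 1.
Proof. by rewrite /c01 le_max lexx /= ge_max ler01 ge_min lexx. Qed.

Lemma c01_id s : 0 <= s <= 1 -> c01 s = s.
Proof. by move=> /andP[s0 s1]; rewrite /c01 min_r // max_r. Qed.

Lemma c01_lip s t : `|c01 s - c01 t| <= `|s - t|.
Proof.
rewrite /c01.
case: (leP 1 s) => a; case: (leP 1 t) => b;
 rewrite ?(max_r ler01) ?subrr ?normr0 //;
 first [case: (leP 0 t) => c | idtac]; first [case: (leP 0 s) => d | idtac];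
 rewrite ?subrr ?normr0 //; rewrite ler_norml; apply/andP; split;
 first [have := ler_norm (s - t); have := ler_norm (t - s); rewrite distrC | idtac]; lra.
Qed.

Lemma c01_cont (V : normedModType R) (y : R -> V) :
  (forall s : R, 0 <= s <= 1 -> {for s, continuous y}) -> continuous (y \o c01).
Proof.
move=> H s; apply: continuous_comp; last exact/H/c01_in.
apply/cvgrPdist_le => e e0; near=> t; apply: (le_trans (c01_lip _ _)).
near: t; exact: (cvgr_dist_le id s cvg_id).
Unshelve. all: by end_near. Qed.

Lemma primitiveR (h : R -> R) : continuous h ->
  exists H : R -> R, H 0 = 0 /\ forall s : R, 0 <= s <= 1 -> is_derive s (1 : R) H (h s).
Proof.
(* Integration starts at -1 so that [0, 1] lies in the interior of the interval, where the
   derivative of the integral is two-sided. *)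
move=> ch; pose F (x : R) := (\int[lebesgue_measure]_(t in `[-1, x]) h t)%R.
have dF (s : R) : 0 <= s <= 1 -> is_derive s (1 : R) F (h s).
  move=> /andP[s0 s1].
  have s2 : s < 2 by lra.
  have s3 : -1 < s by lra.
  have ih : lebesgue_measure.-integrable `[-1, 2] (EFin \o h).
    apply: continuous_compact_integrable; first exact: segment_compact.
    exact: continuous_subspaceT.
  have [d E] := continuous_FTC1_closed s2 ih s3 (ch s).
  apply: (@DeriveDef _ _ _ s (1 : R) F (h s) d).
  by rewrite -derive1E; exact: E.
exists (fun x => F x - F 0); split; first by rewrite subrr.
move=> s s01; have := is_deriveB (dF s s01) (is_derive_cst (F 0) s 1).
by rewrite subr0.
Qed.

Lemma primitive N (h : R -> 'rV[R]_N) : continuous h ->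
  exists H : R -> 'rV[R]_N, H 0 = 0 /\ forall s : R, 0 <= s <= 1 -> is_derive s (1 : R) H (h s).
Proof.
move=> ch.
have /choice[H HP] : forall j, exists H : R -> R, H 0 = 0 /\ forall s : R, 0 <= s <= 1 -> is_derive s (1 : R) H (h s 0 j).
  move=> j; apply: primitiveR => s.
  apply: (@continuous_comp _ _ _ h (fun M : 'rV[R]_N => M 0 j)); first exact: ch.
  exact: coord_continuous.
exists (fun s => \row_j H j s); split.
  by apply/rowP => j; rewrite !mxE; have [] := HP j.
move=> s s01; apply: is_derive_rV => j.
rewrite (_ : (fun t => _) = H j); last by apply/funext => t; rewrite mxE.
by have [_] := HP j; apply.
Qed.

Lemma geomR (u : nat -> R) (M : R) : 0 <= M ->
  (forall n, `|u n.+1 - u n| <= M * 2^-1 ^+ n) ->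
  exists l, forall n, `|u n - l| <= 2 * M * 2^-1 ^+ n.
Proof.
move=> M0 H.
have B n k : `|u (n + k)%N - u n| <= 2 * M * 2^-1 ^+ n * (1 - 2^-1 ^+ k).
  elim: k => [|k IH]; first by rewrite addn0 subrr normr0 expr0 subrr mulr0.
  rewrite addnS; have -> : u (n + k).+1 - u n = (u (n + k).+1 - u (n + k)%N) + (u (n + k)%N - u n) by ring.
  apply: (le_trans (ler_normD _ _)); apply: (le_trans (lerD (H _) IH)).
  by rewrite exprD exprSr le_eqVlt; apply/orP; left; apply/eqP; field.
have cu : cvgn u.
  have -> : u = (fun n => u 0%N + series (telescope u) n).
    by apply/funext => n; rewrite -eq_sum_telescope.
  apply: is_cvgD; first exact: is_cvg_cst.
  apply: (@normed_cvg R R^o); apply: (@series_le_cvg R _ (geometric M 2^-1)) => [n|n|n|].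
  - exact: normr_ge0.
  - by rewrite /geometric /= mulr_ge0 // exprn_ge0 // invr_ge0.
  - exact: H.
  - by apply: is_cvg_geometric_series; rewrite gtr0_norm ?invf_lt1 ?ltr1n // invr_gt0.
exists (limn u) => n; rewrite distrC.
have -> : limn u - u n = limn (fun k => u k - u n).
  by rewrite limB //; [rewrite lim_cst|exact: is_cvg_cst].
have cn : cvgn (fun k => u k - u n) by apply: is_cvgB => //; exact: is_cvg_cst.
rewrite -lim_norm //; apply: limr_le; first exact: is_cvg_norm.
exists n => // k /= nk; rewrite -(subnKC nk); apply: (le_trans (B _ _)).
by rewrite ler_piMr ?mulr_ge0 ?exprn_ge0 ?invr_ge0 // gerBl exprn_ge0 // invr_ge0.
Qed.

Lemma geom_rV N (u : nat -> 'rV[R]_N) (M : R) : 0 <= M ->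
  (forall n, `|u n.+1 - u n| <= M * 2^-1 ^+ n) ->
  exists l, forall n, `|u n - l| <= 2 * M * 2^-1 ^+ n.
Proof.
move=> M0 H.
have /choice[l Hl] : forall j, exists l, forall n, `|u n 0 j - l| <= 2 * M * 2^-1 ^+ n.
  move=> j; apply: geomR => // n; apply: le_trans (H n).
  by have := norm_coord (u n.+1 - u n) j; rewrite !mxE.
exists (\row_j l j) => n; apply: norm_rV_le => [|j].
  by rewrite !mulr_ge0 // exprn_ge0 // invr_ge0.
by rewrite !mxE.
Qed.

Lemma half_small (C e : R) : 0 <= C -> 0 < e -> exists n, C * 2^-1 ^+ n <= e.
Proof.
move=> C0 e0.
have : (fun n => C * 2^-1 ^+ n) @ \oo --> 0.
  by apply: cvg_geometric; rewrite gtr0_norm ?invf_lt1 ?ltr1n // invr_gt0.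
move=> /cvgr_le/(_ e e0)/filter_ex[n Hn]; by exists n.
Qed.

Lemma cmp_rV N (f df : R -> 'rV[R]_N) (g dg : R -> R) :
  (forall s : R, 0 <= s <= 1 -> is_derive s (1 : R) f (df s)) ->
  (forall s : R, 0 <= s <= 1 -> is_derive s (1 : R) g (dg s)) ->
  (forall s : R, 0 <= s <= 1 -> `|df s| <= dg s) -> `|f 0| <= g 0 ->
  (forall s : R, 0 <= s <= 1 -> 0 <= g s) ->
  forall s : R, 0 <= s <= 1 -> `|f s| <= g s.
Proof.
move=> Hf Hg H H0 g0 s s01; apply: norm_rV_le => [|j]; first exact: g0.
apply: (@cmp_le (fun s => f s 0 j) g (fun s => df s 0 j) dg) => //.
- by move=> t t01; apply: is_derive_coord; exact: Hf.
- by move=> t t01; apply: le_trans (H t t01); exact: norm_coord.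
- by apply: le_trans H0; exact: norm_coord.
Qed.

(** Picard iteration in the norm weighted by E(s) = exp(2Ls): the integral of L E is at most E / 2,
    so successive increments are halved on the whole of [0, 1]. *)
Lemma ode_exists N (g : R -> 'rV[R]_N -> 'rV[R]_N) (L : R) q : 1 <= L ->
  (forall y : R -> 'rV[R]_N, continuous y -> continuous (fun s => g (c01 s) (y s))) ->
  (forall (s : R) y z, 0 <= s <= 1 -> `|g s y - g s z| <= L * `|y - z|) ->
  exists y : R -> 'rV[R]_N, y 0 = q /\
    forall s : R, 0 <= s <= 1 -> is_derive s (1 : R) y (g s (y s)).
Proof.
move=> L1 cg Lg; have L0 : 0 <= L by exact: le_trans L1.
(* [pr] returns a primitive of a continuous function and an arbitrary function otherwise. *)
have /choice[pr Hpr] : forall h : R -> 'rV[R]_N, exists H : R -> 'rV[R]_N,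
    continuous h -> H 0 = 0 /\ forall s : R, 0 <= s <= 1 -> is_derive s (1 : R) H (h s).
  move=> h; have [ch|nch] := pselect (continuous h).
    by have [H HH] := primitive ch; exists H.
  by exists (fun=> 0).
pose T (y : R -> 'rV[R]_N) (s : R) := q + pr (fun s => g (c01 s) (y (c01 s))) s.
have Tder y : (forall s : R, 0 <= s <= 1 -> {for s, continuous y}) ->
    T y 0 = q /\ forall s : R, 0 <= s <= 1 -> is_derive s (1 : R) (T y) (g s (y s)).
  move=> cy; have [h0 hs] := Hpr _ (cg _ (c01_cont cy)).
  split; first by rewrite /T h0 addr0.
  move=> s s01; have := is_deriveD (is_derive_cst q s (1 : R)) (hs s s01).
  by rewrite add0r /= c01_id.
pose Y := fix Y n := if n is n'.+1 then T (Y n') else (fun=> q).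
have cY n (s : R) : 0 <= s <= 1 -> {for s, continuous (Y n)}.
  elim: n s => [|n IH] s s01; first exact: cvg_cst.
  by have [_ H] := Tder _ IH; exact: is_derive_cont (H s s01).
have Y0 n : Y n 0 = q by case: n => // n; have [] := Tder _ (cY n).
have dY n (s : R) : 0 <= s <= 1 -> is_derive s (1 : R) (Y n.+1) (g s (Y n s)).
  by have [_] := Tder _ (cY n); apply.
have [B B0 HB] : exists2 B, 0 <= B & forall s : R, 0 <= s <= 1 -> `|g s q| <= B.
  have cq : continuous (fun s => `|g (c01 s) q|).
    by move=> s; apply: cvg_norm; apply: (cg (fun=> q)); exact: cst_continuous.
  have [c _ Hc] := EVT_max ler01 (continuous_subspaceT cq).
  exists `|g (c01 c) q| => // s s01.
  by have := Hc s; rewrite in_itv /= (c01_id s01); apply.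
pose E (s : R) := expR (2 * L * s).
have dE a (s : R) : is_derive s (1 : R) (fun s => a * E s) (a * (2 * L * E s)).
  by apply: is_deriveZ; exact: is_derive_exp.
have E0 s : 0 <= E s by exact: expR_ge0.
have E1 (s : R) : 0 <= s -> 1 <= E s.
  by move=> s0; rewrite -expR0 ler_expR !mulr_ge0.
have step n (s : R) : 0 <= s <= 1 -> `|Y n.+1 s - Y n s| <= B * 2^-1 ^+ n * E s.
  elim: n s => [|n IH].
    rewrite expr0 mulr1.
    apply: (@cmp_rV _ (fun s => Y 1%N s - Y 0%N s) (fun s => g s q - 0) _ _ _ (fun s _ => dE B s)).
    - by move=> s s01; apply: is_deriveB; exact: dY.
    (* The derivative of the bound B E is 2 L B E, which is at least B because 1 <= L. *)
    - move=> s s01; rewrite subr0; apply: (le_trans (HB s s01)).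
      rewrite ler_peMr // mulr_ege1 //; last by apply: E1; case/andP: s01.
      by rewrite (le_trans L1) // ler_peMl // ler1n.
    - by rewrite !Y0 subrr normr0 mulr_ge0.
    - by move=> s s01; rewrite mulr_ge0.
  apply: (@cmp_rV _ (fun s => Y n.+2 s - Y n.+1 s) (fun s => g s (Y n.+1 s) - g s (Y n s)) _ _ _ (fun s _ => dE _ s)).
  - by move=> s s01; apply: is_deriveB; exact: dY.
  - move=> s s01; apply: (le_trans (Lg _ _ _ s01)).
    apply: (@le_trans _ _ (L * (B * 2^-1 ^+ n * E s))); first by rewrite ler_wpM2l // IH.
    by rewrite exprSr le_eqVlt; apply/orP; left; apply/eqP; field.
  - by rewrite !Y0 subrr normr0 !mulr_ge0 // exprn_ge0 // invr_ge0.
  - by move=> s s01; rewrite !mulr_ge0 // exprn_ge0 // invr_ge0.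
pose M := B * E 1.
have M0 : 0 <= M by rewrite mulr_ge0.
have /choice[y Hy] : forall s : R, exists l, 0 <= s <= 1 -> forall n, `|Y n s - l| <= 2 * M * 2^-1 ^+ n.
  move=> s; have [s01|ns] := boolP (0 <= s <= 1); last by exists 0.
  have [|l Hl] := @geom_rV _ (fun n => Y n s) M M0; last by exists l.
  move=> n; apply: (le_trans (step n s s01)); rewrite /M -mulrA [_ * E s]mulrC mulrA.
  rewrite ler_wpM2r ?exprn_ge0 ?invr_ge0 // ler_wpM2l // ler_expR.
  by rewrite ler_wpM2l ?mulr_ge0 //; case/andP: s01.
have cy : continuous (y \o c01).
  move=> s; apply/cvgrPdist_le => e e0.
  have [n Hn] := @half_small (2 * M) (e / 3) (mulr_ge0 (ler0n _ 2) M0) (divr_gt0 e0 (ltr0Sn _ 2)).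
  have cc := c01_cont (cY n); have /cvgrPdist_le/(_ (e / 3) (divr_gt0 e0 (ltr0Sn _ 2))) := cc s.
  apply: filterS => t /= Ht.
  have a1 := Hy _ (c01_in s) n; have a2 := Hy _ (c01_in t) n.
  have -> : y (c01 s) - y (c01 t) = (Y n (c01 t) - y (c01 t)) - (Y n (c01 s) - y (c01 s)) + (Y n (c01 s) - Y n (c01 t)).
    by apply/rowP => j; rewrite !mxE; ring.
  apply: (le_trans (ler_normD _ _)); apply: (le_trans (lerD (ler_normB _ _) Ht)).
  by lra.
have [H Hprim] := Hpr _ (cg _ cy).
(* The limit y is continuous but not yet known to be differentiable. Its Picard image z is
   differentiable by construction, and z = y follows by comparing both with the iterates. *)
pose z (s : R) := q + pr (fun s => g (c01 s) (y (c01 s))) s.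
have dz (s : R) : 0 <= s <= 1 -> is_derive s (1 : R) z (g s (y s)).
  move=> s01; have := is_deriveD (is_derive_cst q s (1 : R)) (Hprim s s01).
  by rewrite add0r /= c01_id.
have z0 : z 0 = q by rewrite /z H addr0.
have zy (s : R) : 0 <= s <= 1 -> z s = y s.
  move=> s01; apply/eqP; rewrite -subr_eq0 -normr_eq0 eq_le normr_ge0 andbT.
  apply/ler_addgt0Pl => e e0; rewrite addr0.
  have [n Hn] := @half_small ((L + 1) * (2 * M)) e (mulr_ge0 (addr_ge0 L0 ler01) (mulr_ge0 (ler0n _ 2) M0)) e0.
  have F : `|z s - Y n.+1 s| <= (L * (2 * M * 2^-1 ^+ n)) * s.
    apply: (@cmp_rV _ (fun s => z s - Y n.+1 s) (fun s => g s (y s) - g s (Y n s)) (fun s => (L * (2 * M * 2^-1 ^+ n)) * s) (fun=> L * (2 * M * 2^-1 ^+ n) * 1)) => //.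
    - by move=> t t01; apply: is_deriveB; [exact: dz|exact: dY].
    - move=> t t01; rewrite mulr1; apply: (le_trans (Lg _ _ _ t01)); rewrite ler_wpM2l // distrC.
      exact: Hy.
    - by rewrite z0 Y0 subrr normr0 mulr0.
    - by move=> t /andP[t0 _]; rewrite !mulr_ge0 // exprn_ge0 // invr_ge0.
  have G := Hy s s01 n.+1.
  have -> : z s - y s = (z s - Y n.+1 s) + (Y n.+1 s - y s) by rewrite addrA subrK.
  apply: (le_trans (ler_normD _ _)); apply: (le_trans (lerD F G)); apply: le_trans Hn.
  rewrite exprSr -[(L + 1) * _ * _]mulrA [2 * M * (_ * _)]mulrA.
  have X0 : 0 <= 2 * M * 2^-1 ^+ n by rewrite !mulr_ge0 // exprn_ge0 // invr_ge0.
  move: X0; set X := 2 * M * _ => X0.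
  have : L * X * s <= L * X by rewrite ler_piMr ?mulr_ge0 //; case/andP: s01.
  by lra.
exists z; split=> // s s01; rewrite zy //; exact: dz.
Qed.

End ODE.

(** * Flows and their smooth dependence on the initial point *)

Section Flow.
Variables (R : realType).

Lemma near_dist N (x : 'rV[R]_N) e : 0 < e -> \forall y \near x, `|x - y| <= e.
Proof.
move=> e0; apply: filterS (nbhsx_ballx x e e0) => y.
by rewrite -ball_normE /= => /ltW.
Qed.

Lemma norm_lsubmx m n (w : 'rV[R]_(m + n)) : `|lsubmx w| <= `|w|.
Proof. by apply: norm_rV_le => // j; rewrite mxE; exact: norm_coord. Qed.

Lemma norm_rsubmx m n (w : 'rV[R]_(m + n)) : `|rsubmx w| <= `|w|.
Proof. by apply: norm_rV_le => // j; rewrite mxE; exact: norm_coord. Qed.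

Lemma norm_row_mx m n (u : 'rV[R]_m) (v : 'rV[R]_n) C :
  `|u| <= C -> `|v| <= C -> `|row_mx u v| <= C.
Proof.
move=> uC vC; apply: norm_rV_le => [|j]; first exact: le_trans uC.
by rewrite mxE; case: splitP => k _; [apply: le_trans uC|apply: le_trans vC]; exact: norm_coord.
Qed.

Lemma sm_row_mx k m n (f : 'rV[R]_k -> 'rV[R]_m) (g : 'rV[R]_k -> 'rV[R]_n) x :
  sm f x -> sm g x -> sm (fun y => row_mx (f y) (g y)) x.
Proof.
move=> sf sg; apply/sm_rVP => j; case: (splitP j) => i ji.
  apply: (sm_eq _ (sm_coord i sf)); near=> y.
  by rewrite (_ : j = lshift n i) ?row_mxEl //; exact: val_inj.
apply: (sm_eq _ (sm_coord i sg)); near=> y.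
by rewrite (_ : j = rshift m i) ?row_mxEr //; exact: val_inj.
Unshelve. all: by end_near. Qed.

Lemma is_derive_row_mx m n (f : R -> 'rV[R]_m) (g : R -> 'rV[R]_n) (s : R) df dg :
  is_derive s (1 : R) f df -> is_derive s (1 : R) g dg ->
  is_derive s (1 : R) (fun t => row_mx (f t) (g t)) (row_mx df dg).
Proof.
move=> Hf Hg; apply: is_derive_rV => j; case: (splitP j) => i ji.
  rewrite (_ : j = lshift n i) ?row_mxEl; last exact: val_inj.
  under eq_fun do rewrite row_mxEl; exact: is_derive_coord.
rewrite (_ : j = rshift m i) ?row_mxEr; last exact: val_inj.
under eq_fun do rewrite row_mxEr; exact: is_derive_coord.
Qed.

Lemma sm_lsubmx k m n (f : 'rV[R]_k -> 'rV[R]_(m + n)) x :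
  sm f x -> sm (fun y => lsubmx (f y)) x.
Proof. exact: (@sm_linrV _ _ _ _ (@lsubmx R 1 m n)). Qed.

Lemma sm_rsubmx k m n (f : 'rV[R]_k -> 'rV[R]_(m + n)) x :
  sm f x -> sm (fun y => rsubmx (f y)) x.
Proof. exact: (@sm_linrV _ _ _ _ (@rsubmx R 1 m n)). Qed.

Section Good.
Variables (N : nat) (B : 'rV[R]_N -> 'rV[R]_N).

(** The number [d] is both the radius and the inverse of all the constants. The property therefore
    persists when [d] decreases, and a single [d] can serve a whole trajectory. *)
Definition good (d : R) (x : 'rV[R]_N) := forall y z, ball x d y -> ball x d z ->
  [/\ sm B y, `|B z - B y| <= d^-1 * `|z - y|,
      `|B z - B y - 'd B y (z - y)| <= d^-1 * `|z - y| ^+ 2,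
      forall v, `|'d B z v - 'd B y v| <= d^-1 * `|z - y| * `|v| &
      forall v, `|'d B y v| <= d^-1 * `|v| ].

Lemma sm_diff_lipschitz (x : 'rV[R]_N) : sm B x ->
  exists2 C, 0 <= C & \forall d \near (0 : R)^'+, forall y z, ball x d y -> ball x d z ->
    (forall v, `|'d B z v - 'd B y v| <= C * `|z - y| * `|v|) /\
    (forall v, `|'d B y v| <= C * `|v|).
Proof.
move=> sB.
have /choice[C HC] : forall i, exists C, 0 <= C /\ \forall d \near (0 : R)^'+, forall y z, ball x d y -> ball x d z ->
    `|pd i B z - pd i B y| <= C * `|z - y|.
  by move=> i; have [C C0 H] := sm_lipschitz (sm_pd i sB); exists C.
have C0 i : 0 <= C i by have [] := HC i.
have S0 : 0 <= \sum_i C i by apply: sumr_ge0.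
have N0 : 0 <= \sum_i (`|pd i B x| + 1) by apply: sumr_ge0.
exists (\sum_i C i + \sum_i (`|pd i B x| + 1)); first exact: addr_ge0.
have N1 : \forall y \near x, differentiable B y /\ forall i, `|pd i B y| <= `|pd i B x| + 1.
  near=> y; split; first by near: y; apply: filterS (sm_near sB) => y /sm_diff.
  near: y; apply: filter_forall => i.
  have /sm_cont/cvgr_dist_le/(_ _ ltr01) := sm_pd i sB.
  apply: filterS => y; rewrite distrC => H; rewrite -lerBlDl.
  exact: le_trans (lerB_dist _ _) H.
near=> d => y z xy xz.
have L i : forall y z, ball x d y -> ball x d z -> `|pd i B z - pd i B y| <= C i * `|z - y|.
  by move: i; near: d; apply: filter_forall => i; have [_] := HC i.
have P : forall y, ball x d y -> differentiable B y /\ forall i, `|pd i B y| <= `|pd i B x| + 1.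
  by near: d; exact: near_ball_right.
have [dy by_] := P y xy; have [dz _] := P z xz.
split=> v.
  have -> : 'd B z v - 'd B y v = \sum_i v 0 i *: (pd i B z - pd i B y).
    have Ez := diff_pd v dz; have Ey := diff_pd v dy.
    rewrite [LHS](_ : _ = \sum_i v 0 i *: pd i B z - \sum_i v 0 i *: pd i B y); last by congr (_ - _).
    by rewrite -sumrB; apply: eq_bigr => i _; rewrite scalerBr.
  apply: (@le_trans _ _ ((\sum_i C i) * `|z - y| * `|v|)); last first.
    by rewrite ler_wpM2r // ler_wpM2r // lerDl.
  rewrite !mulr_suml; apply: (le_trans (ler_norm_sum _ _ _)); apply: ler_sum => i _.
  by rewrite normrZ mulrC ler_pM //; [exact: L|exact: norm_coord].
have Ey := diff_pd v dy.
rewrite Ey mulrDl -[leLHS]add0r lerD //; first by rewrite mulr_ge0.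
rewrite mulr_suml; apply: (le_trans (ler_norm_sum _ _ _)); apply: ler_sum => i _.
by rewrite normrZ mulrC ler_pM //; exact: norm_coord.
Unshelve. all: by end_near. Qed.

Lemma good_near (x : 'rV[R]_N) : sm B x ->
  \forall d \near (0 : R)^'+, forall x', ball x d x' -> good d x'.
Proof.
move=> sB.
have [C1 C10 H1] := sm_lipschitz sB.
have [C2 C20 H2] := sm_quad sB.
have [C3 C30 H3] := sm_diff_lipschitz sB.
have [e [e0 [G1 [G2 [G3 G4]]]]] : exists e, 0 < e /\
  (forall y z, ball x e y -> ball x e z -> `|B z - B y| <= C1 * `|z - y|) /\
  (forall y z, ball x e y -> ball x e z -> `|B z - B y - 'd B y (z - y)| <= C2 * `|z - y| ^+ 2) /\
  (forall y z, ball x e y -> ball x e z ->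
    (forall v, `|'d B z v - 'd B y v| <= C3 * `|z - y| * `|v|) /\
    (forall v, `|'d B y v| <= C3 * `|v|)) /\
  (forall y, ball x e y -> sm B y).
  apply: (@filter_ex _ (0 : R)^'+); near=> e; split; first by [].
  split; first by near: e.
  split; first by near: e.
  split; first by near: e.
  by near: e; apply: near_ball_right; exact: sm_near.
pose C := C1 + C2 + C3 + 1.
have Cp : 0 < C by rewrite /C ltr_wpDl // !addr_ge0.
near=> d => x' xx' y z x'y x'z.
have d0 : 0 < d by [].
have de : d + d <= e.
  have : d <= e / 2 by near: d; apply: nbhs_right_le; rewrite divr_gt0.
  lra.
have dC : C <= d^-1.
  have : d <= C^-1 by near: d; apply: nbhs_right_le; rewrite invr_gt0.
  by move=> h; rewrite -[C]invrK lef_pV2 // posrE // invr_gt0.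
have U w : ball x' d w -> ball x e w by move=> h; apply: le_ball de _ _; exact: ball_triangle h.
have [U1 U2] := G3 _ _ (U _ x'y) (U _ x'z).
have [D1 D2 D3] : [/\ C1 <= d^-1, C2 <= d^-1 & C3 <= d^-1].
  by split; apply: le_trans dC; rewrite /C; lra.
split=> //.
- exact/G4/U.
- by apply: (le_trans (G1 _ _ (U _ x'y) (U _ x'z))); rewrite ler_wpM2r.
- by apply: (le_trans (G2 _ _ (U _ x'y) (U _ x'z))); rewrite ler_wpM2r // exprn_ge0.
- by move=> v; apply: (le_trans (U1 v)); rewrite ler_wpM2r // ler_wpM2r.
- by move=> v; apply: (le_trans (U2 v)); rewrite ler_wpM2r.
Unshelve. all: by end_near. Qed.

(** Compactness of [0, 1]: near each time the estimates hold on a ball of fixed radius around all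
    nearby points of the curve. *)
Lemma tube (g : R -> 'rV[R]_N) :
  (forall s : R, 0 <= s <= 1 -> {for s, continuous g}) ->
  (forall s : R, 0 <= s <= 1 -> sm B (g s)) ->
  exists2 d, 0 < d & forall s : R, 0 <= s <= 1 -> good d (g s).
Proof.
move=> cg sB.
have cK : compact `[(0 : R), 1] by exact: segment_compact.
have cov := (compact_near_coveringP _).1 cK R (0 : R)^'+ (fun d s => 0 <= s <= 1 -> good d (g s)) _.
suff : \forall d \near (0 : R)^'+, 0 < d /\ forall s : R, 0 <= s <= 1 -> good d (g s).
  by move=> /filter_ex[d [d0 H]]; exists d.
near=> d; split; first by [].
move=> s s01; have : `[(0 : R), 1]%classic `<=` (fun s => 0 <= s <= 1 -> good d (g s)).
  near: d; apply: cov => t; rewrite /= in_itv /= => t01.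
  have [e [e0 He]] : exists e, 0 < e /\ forall x', ball (g t) e x' -> good e x'.
    apply: (@filter_ex _ (0 : R)^'+); near=> e; split; first by [].
    by near: e; exact: good_near (sB t t01).
  near=> u d => u01.
  have gu : ball (g t) e (g u).
    near: u; exact: (cg t t01 _ (nbhsx_ballx _ _ e0)).
  have de : d <= e by near: d; exact: nbhs_right_le.
  have d0 : 0 < d by near: d; exact: nbhs_right_gt.
  have ed : e^-1 <= d^-1 by rewrite lef_pV2.
  move=> y z uy uz; have [a1 a2 a3 a4 a5] := He _ gu y z (le_ball de uy) (le_ball de uz).
  split=> //.
  - by apply: (le_trans a2); rewrite ler_wpM2r.
  - by apply: (le_trans a3); rewrite ler_wpM2r // exprn_ge0.
  - by move=> v; apply: (le_trans (a4 v)); rewrite ler_wpM2r // ler_wpM2r.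
  - by move=> v; apply: (le_trans (a5 v)); rewrite ler_wpM2r.
by move=> /(_ s); apply=> //=; rewrite in_itv.
Unshelve. all: by end_near. Qed.

End Good.

(** The tangent lift of [B]: its flow consists of the flow of [B] and of the differential of that
    flow. *)
Definition tangent_map N (B : 'rV[R]_N -> 'rV[R]_N) (w : 'rV[R]_(N + N)) : 'rV[R]_(N + N) :=
  row_mx (B (lsubmx w)) ('d B (lsubmx w) (rsubmx w)).

Lemma sm_tangent_map N (B : 'rV[R]_N -> 'rV[R]_N) w :
  sm B (lsubmx w) -> sm (tangent_map B) w.
Proof.
move=> sB; have sl : sm (fun w : 'rV[R]_(N + N) => lsubmx w) w by exact/sm_lsubmx/sm_id.
apply: sm_row_mx; first exact: sm_comp.
apply: (@sm_eq _ _ _ (fun w => \sum_i (rsubmx w) 0 i *: pd i B (lsubmx w))).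
  have : \forall w' \near w, sm B (lsubmx w') by exact: (sm_cont sl (sm_near sB)).
  by apply: filterS => w' /sm_diff dw; have E := diff_pd (rsubmx w') dw; rewrite E.
apply: sm_sum => i _; apply: smZr; first exact/sm_coord/sm_rsubmx/sm_id.
by apply: (@sm_comp _ _ _ _ _ (pd i B)) => //; exact: sm_pd.
Qed.

(* Besides the differential equation, only continuity in [q], uniform in [s], is
   required; smoothness in [q] is a consequence. *)
Definition flow N (B : 'rV[R]_N -> 'rV[R]_N) (D : set 'rV[R]_N)
    (P : R -> 'rV[R]_N -> 'rV[R]_N) :=
  open D /\ forall q, D q ->
  [/\ P 0 q = q,
      forall s : R, 0 <= s <= 1 -> is_derive s (1 : R) (P^~ q) (B (P s q)),
      forall s : R, 0 <= s <= 1 -> sm B (P s q) &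
      forall e, 0 < e -> \forall p \near q, forall s : R, 0 <= s <= 1 -> `|P s p - P s q| <= e].

Lemma flow_open N (B : 'rV[R]_N -> 'rV[R]_N) D P : flow B D P -> open D.
Proof. by case. Qed.

Lemma flow_near N (B : 'rV[R]_N -> 'rV[R]_N) D P q : flow B D P -> D q -> \forall p \near q, D p.
Proof. by move=> [oD _] Dq; exact: open_nbhs_nbhs. Qed.

Lemma continuous_sum (V : normedModType R) n (F : 'I_n -> R -> V) (s : R) :
  (forall i, {for s, continuous (F i)}) -> {for s, continuous (fun s => \sum_i F i s)}.
Proof.
move=> H; rewrite (_ : (fun s => _) = \sum_i F i); last by apply/funext => t; rewrite fct_sumE.
elim/big_ind: _ => [|f g cf cg|i _]; [exact: cvg_cst| |exact: H].
by apply: continuousD; [exact: cf|exact: cg].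
Qed.

Lemma gronwall_diff N (V W dV dW : R -> 'rV[R]_N) (L e : R) : 0 <= L -> 0 <= e ->
  (forall s : R, 0 <= s <= 1 -> is_derive s (1 : R) V (dV s)) ->
  (forall s : R, 0 <= s <= 1 -> is_derive s (1 : R) W (dW s)) ->
  (forall s : R, 0 <= s <= 1 -> `|dV s - dW s| <= L * `|V s - W s| + e) ->
  forall s : R, 0 <= s <= 1 -> `|V s - W s| <= gronwall_const L * (`|V 0 - W 0| + e).
Proof.
move=> L0 e0 HV HW H s s01.
apply: (@gronwall _ _ (fun s => V s - W s) (fun s => dV s - dW s)) => //.
by move=> t t01; apply: is_deriveB; [exact: HV|exact: HW].
Qed.

Section Variation.
Variables (N : nat) (B : 'rV[R]_N -> 'rV[R]_N) (D : set 'rV[R]_N)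
  (P : R -> 'rV[R]_N -> 'rV[R]_N).
Hypothesis fl : flow B D P.

Lemma flow_tube q : D q -> exists2 d, 0 < d & forall s : R, 0 <= s <= 1 -> good B d (P s q).
Proof.
move=> Dq; have [_ H1 H2 _] := fl.2 q Dq; apply: tube => // s s01.
exact: is_derive_cont (H1 s s01).
Qed.

Lemma variation_unique q (V W : R -> 'rV[R]_N) : D q ->
  (forall s : R, 0 <= s <= 1 -> is_derive s (1 : R) V ('d B (P s q) (V s))) ->
  (forall s : R, 0 <= s <= 1 -> is_derive s (1 : R) W ('d B (P s q) (W s))) ->
  V 0 = W 0 -> forall s : R, 0 <= s <= 1 -> V s = W s.
Proof.
move=> Dq HV HW E s s01; have [d d0 T] := flow_tube Dq.
have : `|V s - W s| <= gronwall_const d^-1 * (`|V 0 - W 0| + 0).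
  apply: (@gronwall _ _ (fun s => V s - W s) (fun s => 'd B (P s q) (V s) - 'd B (P s q) (W s))) => //.
  - by rewrite invr_ge0 ltW.
  - by move=> t t01; apply: is_deriveB; [exact: HV|exact: HW].
  - move=> t t01; rewrite addr0 -linearB.
    by have [_ _ _ _] := T t t01 _ _ (ballxx _ d0) (ballxx _ d0); apply.
by rewrite E subrr normr0 addr0 mulr0 normr_le0 subr_eq0 => /eqP.
Qed.

Lemma variation_exists q h : D q -> exists V : R -> 'rV[R]_N, V 0 = h /\
  forall s : R, 0 <= s <= 1 -> is_derive s (1 : R) V ('d B (P s q) (V s)).
Proof.
move=> Dq; have [d d0 T] := flow_tube Dq; have [_ H1 H2 _] := fl.2 q Dq.
apply: (@ode_exists _ _ (fun s => 'd B (P s q)) (Num.max 1 d^-1)).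
- by rewrite le_max lexx.
- move=> y cy.
  rewrite (_ : (fun s => _) = (fun s => \sum_i y s 0 i *: pd i B (P (c01 s) q))); last first.
    by apply/funext => s; rewrite (diff_pd _ (sm_diff (H2 _ (c01_in s)))).
  move=> s; apply: continuous_sum => i.
  apply: cvgZ.
    apply: (@continuous_comp _ _ _ y (fun M : 'rV[R]_N => M 0 i)); first exact: cy.
    exact: coord_continuous.
  have cP : continuous ((P^~ q) \o @c01 R).
    by apply: c01_cont => t t01; exact: is_derive_cont (H1 t t01).
  apply: (@continuous_comp _ _ _ ((P^~ q) \o @c01 R) (pd i B)); first exact: cP.
  by apply/sm_cont/sm_pd/H2/c01_in.
- move=> s y z s01; rewrite -linearB.
  have [_ _ _ _ /(_ (y - z))] := T s s01 _ _ (ballxx _ d0) (ballxx _ d0).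
  by move=> H; apply: (le_trans H); rewrite ler_wpM2r // le_max lexx orbT.
Qed.

Definition vbasis (q : 'rV[R]_N) (i : 'I_N) : R -> 'rV[R]_N :=
  xget (fun=> 0) [set V : R -> 'rV[R]_N | V 0 = delta_mx 0 i /\
    forall s : R, 0 <= s <= 1 -> is_derive s (1 : R) V ('d B (P s q) (V s))].

Lemma vbasisP q i : D q -> vbasis q i 0 = delta_mx 0 i /\
  forall s : R, 0 <= s <= 1 -> is_derive s (1 : R) (vbasis q i) ('d B (P s q) (vbasis q i s)).
Proof.
move=> Dq; have [V HV] := variation_exists (delta_mx 0 i) Dq.
have SV : exists V, [set V : R -> 'rV[R]_N | V 0 = delta_mx 0 i /\
    forall s : R, 0 <= s <= 1 -> is_derive s (1 : R) V ('d B (P s q) (V s))] V by exists V.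
by have := xgetPex (fun=> 0) SV.
Qed.

(** Built from the solutions issued from the basis vectors, so that linearity in [h], which a
    differential must have, is immediate. *)
Definition variation (s : R) (q h : 'rV[R]_N) : 'rV[R]_N :=
  lincomb (fun i => vbasis q i s) h.

Lemma variationP q h : D q -> variation 0 q h = h /\
  forall s : R, 0 <= s <= 1 -> is_derive s (1 : R) (fun s => variation s q h) ('d B (P s q) (variation s q h)).
Proof.
move=> Dq; split.
  rewrite /variation /lincomb [RHS]row_sum_delta; apply: eq_bigr => i _.
  by have [-> _] := vbasisP i Dq.
move=> s s01.
have -> : 'd B (P s q) (variation s q h) = \sum_i h 0 i *: 'd B (P s q) (vbasis q i s).
  by rewrite [LHS]linear_sum; apply: eq_bigr => i _; rewrite [LHS]linearZ.
have -> : (fun s => variation s q h) = \sum_i (fun s => h 0 i *: vbasis q i s).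
  by apply/funext => t; rewrite fct_sumE.
apply: is_derive_sum => i; apply: is_deriveZ.
by have [_] := vbasisP i Dq; apply.
Qed.

Lemma flow_lipschitz q : D q -> exists K, 0 <= K /\
  \forall p \near q, forall s : R, 0 <= s <= 1 -> `|P s p - P s q| <= K * `|p - q|.
Proof.
move=> Dq; have [d d0 T] := flow_tube Dq; have [P0 H1 H2 H3] := fl.2 q Dq.
exists (gronwall_const d^-1); split; first by rewrite mulr_ge0 // expR_ge0.
near=> p => s s01.
have Dp : D p by near: p; exact: (flow_near fl Dq).
have [P0' H1' _ _] := fl.2 p Dp.
have S t : 0 <= t <= 1 -> `|P t p - P t q| <= d / 2.
  by move: t; near: p; apply: H3; rewrite divr_gt0.
rewrite -{2}P0' -{2}P0 -[`|_ 0 _ - _|]addr0.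
apply: (@gronwall _ _ (fun s => P s p - P s q) (fun s => B (P s p) - B (P s q))) => //.
- by rewrite invr_ge0 ltW.
- by move=> t t01; apply: is_deriveB; [exact: H1'|exact: H1].
- move=> t t01; rewrite addr0.
  have Bt : ball (P t q) d (P t p).
    rewrite -ball_normE /= distrC; apply: (le_lt_trans (S t t01)); lra.
  by have [] := T t t01 _ _ (ballxx _ d0) Bt.
Unshelve. all: by end_near. Qed.

(** The error P s p - P s q - variation solves the variational equation up to the second-order
    remainder of [B]. By [flow_lipschitz] this remainder is O(|p - q|^2), and Gronwall's inequality
    gives the error the same order. *)
Lemma flow_diff q (s : R) : D q -> 0 <= s <= 1 ->
  differentiable (P s) q /\ 'd (P s) q = variation s q :> (_ -> _).
Proof.
move=> Dq s01; have [d d0 T] := flow_tube Dq; have [P0 H1 H2 H3] := fl.2 q Dq.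
have [K [K0 HK]] := flow_lipschitz Dq.
apply: (@differentiable_quad _ _ _ _ (lincomb _) _ (gronwall_const d^-1 * (d^-1 * K ^+ 2))).
  exact: lincomb_continuous.
have tr : \forall p \near q, `|P s p - P s q - variation s q (p - q)| <=
    gronwall_const d^-1 * (d^-1 * K ^+ 2) * `|p - q| ^+ 2.
  near=> p.
  have Dp : D p by near: p; exact: (flow_near fl Dq).
  have [P0' H1' _ _] := fl.2 p Dp.
  have S t : 0 <= t <= 1 -> `|P t p - P t q| <= d / 2.
    by move: t; near: p; apply: H3; rewrite divr_gt0.
  have LK : forall t : R, 0 <= t <= 1 -> `|P t p - P t q| <= K * `|p - q| by near: p.
  have [Z0 HZ] := variationP (p - q) Dq.
  have := @gronwall _ _ (fun s => P s p - P s q - variation s q (p - q))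
    (fun s => B (P s p) - B (P s q) - 'd B (P s q) (variation s q (p - q))) d^-1
    (d^-1 * K ^+ 2 * `|p - q| ^+ 2) _ _ _ _ s s01.
  rewrite P0 P0' Z0 subrr normr0 add0r !mulrA; apply.
  - by rewrite invr_ge0 ltW.
  - by rewrite !mulr_ge0 ?exprn_ge0 // invr_ge0 ltW.
  - by move=> t t01; apply: is_deriveB; [apply: is_deriveB; [exact: H1'|exact: H1]|exact: HZ].
  - move=> t t01.
    have Bt : ball (P t q) d (P t p).
      rewrite -ball_normE /= distrC; apply: (le_lt_trans (S t t01)); lra.
    have [_ _ a3 _ a5] := T t t01 _ _ (ballxx _ d0) Bt.
    have -> : B (P t p) - B (P t q) - 'd B (P t q) (variation t q (p - q)) =
      'd B (P t q) (P t p - P t q - variation t q (p - q)) +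
      (B (P t p) - B (P t q) - 'd B (P t q) (P t p - P t q)).
      rewrite [in RHS]linearB; apply/rowP => j; rewrite !mxE; ring.
    apply: (le_trans (ler_normD _ _)); rewrite lerD //.
    apply: (le_trans a3); rewrite (_ : d^-1 * K * K * _ * _ = d^-1 * (K * `|p - q|) ^+ 2); last by ring.
    rewrite ler_wpM2l ?invr_ge0 ?(ltW d0) // lerXn2r ?nnegrE ?mulr_ge0 //.
    exact: LK.
by rewrite (near_shift 0) subr0 in tr; apply: filterS tr => h; rewrite /= addrK.
Unshelve. all: by end_near. Qed.

(** The work is in the continuity clause. Solutions of the variational equations along two
    neighbouring trajectories differ by the effect of a source term d^-1 K |p - q| M, where M bounds
    the solution along the trajectory of q. *)
Lemma flow_tangent : flow (tangent_map B) [set w : 'rV[R]_(N + N) | D (lsubmx w)]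
  (fun s w => row_mx (P s (lsubmx w)) (variation s (lsubmx w) (rsubmx w))).
Proof.
split.
  rewrite openE => w /= Dw; have := flow_near fl Dw.
  exact: (sm_cont (sm_lsubmx (sm_id w))).
move=> w /= Dw; have [P0 H1 H2 H3] := fl.2 _ Dw.
have [Z0 HZ] := variationP (rsubmx w) Dw.
split.
- by rewrite P0 Z0 hsubmxK.
- move=> s s01; rewrite /tangent_map row_mxKl row_mxKr; apply: is_derive_row_mx; [exact: H1|exact: HZ].
- by move=> s s01; apply: sm_tangent_map; rewrite row_mxKl; exact: H2.
move=> e e0; set q := lsubmx w in Dw P0 H1 H2 H3 Z0 HZ *.
have [d d0 T] := flow_tube Dw.
have [K [K0 HK]] := flow_lipschitz Dw.
have [M M0 HM] : exists2 M, 0 <= M & forall s : R, 0 <= s <= 1 -> `|variation s q (rsubmx w)| <= M.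
  exists (gronwall_const d^-1 * (`|variation 0 q (rsubmx w)| + 0)).
    by rewrite mulr_ge0 // ?mulr_ge0 ?expR_ge0 ?addr_ge0.
  apply: (@gronwall _ _ _ (fun s => 'd B (P s q) (variation s q (rsubmx w)))) => //.
    by rewrite invr_ge0 ltW.
  move=> t t01; rewrite addr0.
  by have [_ _ _ _] := T t t01 _ _ (ballxx _ d0) (ballxx _ d0); apply.
pose C := K + gronwall_const d^-1 * (1 + d^-1 * K * M).
have C0 : 0 <= C.
  by rewrite addr_ge0 // mulr_ge0 ?addr_ge0 ?mulr_ge0 ?expR_ge0 ?invr_ge0 // ltW.
have pq : \forall w' \near w, (fun p => D p /\ (forall s : R, 0 <= s <= 1 -> `|P s p - P s q| <= d / 2) /\
    (forall s : R, 0 <= s <= 1 -> `|P s p - P s q| <= K * `|p - q|)) (lsubmx w').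
  have H : \forall p \near q, D p /\ (forall s : R, 0 <= s <= 1 -> `|P s p - P s q| <= d / 2) /\
    (forall s : R, 0 <= s <= 1 -> `|P s p - P s q| <= K * `|p - q|).
    near=> p'; split; [|split]; near: p' => //; first exact: (flow_near fl Dw).
    by apply: H3; rewrite divr_gt0.
  exact: (sm_cont (sm_lsubmx (sm_id w)) H).
have C1 : 0 < C + 1 by rewrite ltr_wpDl.
near=> w'.
have [Dp [S LK]] : (fun p => D p /\ (forall s : R, 0 <= s <= 1 -> `|P s p - P s q| <= d / 2) /\
    (forall s : R, 0 <= s <= 1 -> `|P s p - P s q| <= K * `|p - q|)) (lsubmx w') by near: w'.
have ww : `|w - w'| <= e / (C + 1).
  by near: w'; apply: (near_dist _ (divr_gt0 _ _)).
move=> s s01; set p := lsubmx w' in Dp S LK *.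
have [P0' H1' _ _] := fl.2 p Dp.
have [Z0' HZ'] := variationP (rsubmx w') Dp.
have {}ww : C * `|w' - w| <= e.
  rewrite ler_pdivlMr // distrC mulrC in ww; apply: le_trans ww.
  by rewrite ler_wpM2r // lerDl.
have npq : `|p - q| <= `|w' - w| by rewrite /p /q -linearB; exact: norm_lsubmx.
rewrite opp_row_mx add_row_mx; apply: (@le_trans _ _ (C * `|w' - w|)) => //; apply: norm_row_mx.
  apply: (le_trans (LK s s01)); apply: ler_pM => //.
  by rewrite lerDl mulr_ge0 ?addr_ge0 ?mulr_ge0 ?expR_ge0 ?invr_ge0 // ltW.
have E0 : variation 0 p (rsubmx w') - variation 0 q (rsubmx w) = rsubmx (w' - w).
  rewrite [RHS]linearB; congr (_ - _); [exact: Z0'|exact: Z0].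
have L0 : 0 <= d^-1 by rewrite invr_ge0 ltW.
have e0' : 0 <= d^-1 * (K * `|p - q|) * M by rewrite !mulr_ge0 // invr_ge0 ltW.
have cmp (t : R) : 0 <= t <= 1 ->
  `|'d B (P t p) (variation t p (rsubmx w')) - 'd B (P t q) (variation t q (rsubmx w))| <=
  d^-1 * `|variation t p (rsubmx w') - variation t q (rsubmx w)| + d^-1 * (K * `|p - q|) * M.
  move=> t01.
  have Bt : ball (P t q) d (P t p).
    rewrite -ball_normE /= distrC; apply: (le_lt_trans (S t t01)); lra.
  have [_ _ _ a4 _] := T t t01 _ _ (ballxx _ d0) Bt.
  have [_ _ _ _ a5] := T t t01 _ _ Bt Bt.
  move: (HM t t01) (LK t t01); set v := variation t q _; set u := variation t p _ => nv lk.
  have -> : 'd B (P t p) u - 'd B (P t q) v =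
     'd B (P t p) (u - v) + ('d B (P t p) v - 'd B (P t q) v).
    by rewrite [X in _ = X + _]linearB addrA subrK.
  apply: (le_trans (ler_normD _ _)); rewrite lerD //.
  apply: (le_trans (a4 _)); apply: ler_pM => //; first by rewrite mulr_ge0.
  by rewrite ler_wpM2l.
have G := gronwall_diff L0 e0' HZ' HZ cmp s01.
apply: (le_trans G); rewrite E0 mulrDl -[leLHS]add0r lerD ?mulr_ge0 //.
rewrite -[leRHS]mulrA; apply: ler_wpM2l; first by rewrite mulr_ge0 // expR_ge0.
rewrite mulrDl mul1r; apply: lerD; first exact: norm_rsubmx.
rewrite (_ : d^-1 * K * M * _ = d^-1 * (K * `|w' - w|) * M); last by ring.
by rewrite ler_wpM2r // ler_wpM2l // ler_wpM2l.
Unshelve. all: by end_near. Qed.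

End Variation.

(** A partial derivative of the flow is the second half of the flow of the tangent lift started at
    (q, e_i). The lift of a flow is again a flow, so each further derivative costs a doubling of the
    dimension. *)
Lemma flow_smn n N (B : 'rV[R]_N -> 'rV[R]_N) D P (s : R) : 0 <= s <= 1 ->
  flow B D P -> smn n D (P s).
Proof.
move=> s01; elim: n N B D P => [|n IH] N B D P fl.
  by apply/smn0 => q Dq; have [] := flow_diff fl Dq s01.
have oD := flow_open fl.
apply/smnS; split=> [q Dq|i]; first by have [] := flow_diff fl Dq s01.
have H := IH _ _ _ _ (flow_tangent fl).
have : smn n D (fun q => row_mx (P s (lsubmx (row_mx q (delta_mx 0 i : 'rV[R]_N))))
    (variation B P s (lsubmx (row_mx q (delta_mx 0 i : 'rV[R]_N))) (rsubmx (row_mx q (delta_mx 0 i : 'rV[R]_N))))).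
  apply: (@smn_comp _ _ _ _ n D [set w : 'rV[R]_(N + N) | D (lsubmx w)] (fun q => row_mx q (delta_mx 0 i : 'rV[R]_N)) (fun w => row_mx (P s (lsubmx w)) (variation B P s (lsubmx w) (rsubmx w)))) => //.
  - exact: flow_open (flow_tangent fl).
  - by move=> q Dq /=; rewrite row_mxKl.
  - move=> t _ q Dq; have : smooth_on D (fun q => row_mx q (delta_mx 0 i : 'rV[R]_N)).
      by apply/smooth_onP => // q' _; apply: sm_row_mx; [exact: sm_id|exact: sm_cst].
    by apply.
move=> /(smn_lin oD (@rV_linear_continuous _ _ _ (@rsubmx R 1 N N))).
apply: smn_eq => // q Dq; rewrite /= row_mxKr row_mxKl row_mxKr /pd deriveE.
  by have [_ ->] := flow_diff fl Dq s01.
by have [] := flow_diff fl Dq s01.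
Qed.

Lemma flow_smooth N (B : 'rV[R]_N -> 'rV[R]_N) D P (s : R) q : 0 <= s <= 1 ->
  flow B D P -> D q -> sm (P s) q.
Proof.
move=> s01 fl Dq; exists D; split=> //; first exact: flow_open fl.
by apply/smooth_onE => n; exact: flow_smn fl.
Qed.

(** A way to compute the differential of a flow: exhibit a solution of the variational equation with
    the right initial value. The Frobenius theorem does this with explicit solutions. *)
Lemma flow_variation N (B : 'rV[R]_N -> 'rV[R]_N) D P q (W : R -> 'rV[R]_N) (s : R) :
  flow B D P -> D q ->
  (forall s : R, 0 <= s <= 1 -> is_derive s (1 : R) W ('d B (P s q) (W s))) ->
  0 <= s <= 1 -> 'd (P s) q (W 0) = W s.
Proof.
move=> fl Dq HW s01; have [_ ->] := flow_diff fl Dq s01.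
have [Z0 HZ] := variationP fl (W 0) Dq.
exact: (variation_unique fl Dq HZ HW Z0 s01).
Qed.

Definition clamp (r x : R) : R := Num.max (- r) (Num.min r x).

Lemma clamp_le r x : 0 <= r -> `|clamp r x| <= r.
Proof.
move=> r0; rewrite ler_norml /clamp le_max lexx /= ge_max ge_min lexx /= andbT; lra.
Qed.

Lemma clamp_id r x : `|x| <= r -> clamp r x = x.
Proof. by rewrite ler_norml => /andP[a b]; rewrite /clamp min_r // max_r. Qed.

Lemma clamp_lip r x y : 0 <= r -> `|clamp r x - clamp r y| <= `|x - y|.
Proof.
move=> r0; have a1 := ler_norm (x - y); have a2 := ler_norm (y - x); rewrite distrC in a2.
have a3 := normr_ge0 (x - y); move: a1 a2 a3; set n := `|x - y| => a1 a2 a3.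
rewrite /clamp ler_norml.
by case: (leP r x) => b1; case: (leP r y) => b2;
  do ? (case: (leP (- r) _) => ?); apply/andP; split; lra.
Qed.

(** Composition with the projection onto a cube of radius r around the equilibrium y0 makes the
    field globally Lipschitz. Comparison with the constant solution y0 keeps the trajectories that
    start within r / K in the cube, where the field is unchanged, up to time 1. *)
Lemma flow_exists N (B : 'rV[R]_N -> 'rV[R]_N) y0 : sm B y0 -> B y0 = 0 ->
  exists D P K, [/\ flow B D P, D y0, 0 <= K & forall q (s : R), D q -> 0 <= s <= 1 ->
    `|P s q - y0| <= K * `|q - y0| ].
Proof.
move=> sB B0.
have [d [d0 G]] : exists d, 0 < d /\ forall x', ball y0 d x' -> good B d x'.
  apply: (@filter_ex _ (0 : R)^'+); near=> e; split; first by [].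
  by near: e; exact: good_near sB.
have {}G := G _ (ballxx _ d0).
pose r := d / 2; have r0 : 0 < r by rewrite divr_gt0.
pose cl (y : 'rV[R]_N) : 'rV[R]_N := y0 + \row_j clamp r ((y - y0) 0 j).
have clB y : ball y0 d (cl y).
  rewrite -ball_normE /= /cl opprD addNKr normrN; apply: (@le_lt_trans _ _ r); last by rewrite /r; lra.
  by apply: norm_rV_le => [|j]; [exact: ltW|rewrite mxE clamp_le // ltW].
have cl_lip y z : `|cl y - cl z| <= `|y - z|.
  apply: norm_rV_le => // j; rewrite !mxE opprD addrACA subrr add0r.
  apply: (le_trans (clamp_lip _ _ (ltW r0))).
  have := norm_coord (y - z) j; rewrite !mxE; apply: le_trans.
  by rewrite le_eqVlt; apply/orP; left; apply/eqP; congr (`|_|); ring.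
have cl_id y : `|y - y0| <= r -> cl y = y.
  move=> yr; apply/rowP => j; rewrite mxE [X in _ + X]mxE clamp_id.
    by rewrite !mxE addrC subrK.
  exact: le_trans (norm_coord _ _) yr.
pose L := Num.max 1 d^-1.
have L0 : 0 <= L by rewrite le_max ler01.
have Lip y z : `|B (cl y) - B (cl z)| <= L * `|y - z|.
  have [_ a _ _ _] := G _ _ (clB z) (clB y); apply: (le_trans a).
  by apply: ler_pM => //; rewrite ?invr_ge0 ?(ltW d0) // le_max lexx orbT.
have /choice[P HP] : forall q, exists y : R -> 'rV[R]_N, y 0 = q /\
    forall s : R, 0 <= s <= 1 -> is_derive s (1 : R) y (B (cl (y s))).
  move=> q; apply: (@ode_exists _ _ (fun _ y => B (cl y)) L) => [|y cy s|s y z _].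
  - by rewrite le_max lexx.
  - apply/cvgrPdist_le => e e0.
    have /cvgrPdist_le/(_ (e / (L + 1))) := cy s.
    have L1 : 0 < L + 1 by rewrite ltr_wpDl.
    move=> /(_ (divr_gt0 e0 L1)); apply: filterS => t H.
    apply: (le_trans (Lip _ _)); rewrite ler_pdivlMr // mulrC in H; apply: le_trans H.
    by rewrite ler_wpM2r // lerDl.
  - exact: Lip.
pose K := gronwall_const L.
have K1 : 1 <= K.
  rewrite /K /gronwall_const; have : expR 0 <= expR (2 * L) by rewrite ler_expR mulr_ge0.
  by rewrite expR0; lra.
have K0 : 0 < K by exact: lt_le_trans K1.
have B1 q (s : R) : 0 <= s <= 1 -> `|P q s - y0| <= K * `|q - y0|.
  move=> s01; have [P0 P1] := HP q.
  rewrite -{2}P0 -[`|_ - y0| in leRHS]addr0.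
  apply: (@gronwall _ _ (fun s => P q s - y0) (fun s => B (cl (P q s)) - 0)) => //.
    by move=> t t01; apply: is_deriveB; exact: P1.
  move=> t t01; rewrite -B0 addr0 -{1}(cl_id y0); first exact: Lip.
  by rewrite subrr normr0 ltW.
exists (ball y0 (r / K)), (fun s q => P q s), K.
have rK : 0 < r / K by rewrite divr_gt0.
have inr q (s : R) : ball y0 (r / K) q -> 0 <= s <= 1 -> `|P q s - y0| <= r.
  rewrite -ball_normE /= => qb s01; apply: (le_trans (B1 q s s01)).
  by rewrite distrC mulrC -ler_pdivlMr // ltW.
split=> //; [|exact: ballxx|exact: ltW|by move=> q s _; exact: B1].
split; first exact: ball_open.
move=> q qb; have [P0 P1] := HP q; split=> //.
- by move=> s s01; have := P1 s s01; rewrite cl_id //; exact: inr.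
- move=> s s01; rewrite -(cl_id (P q s)); last exact: inr.
  by have [] := G _ _ (clB (P q s)) (clB (P q s)).
move=> e e0; near=> p => s s01.
have [Q0 Q1] := HP p.
have : `|P p s - P q s| <= K * (`|P p 0 - P q 0| + 0).
  apply: (@gronwall _ _ (fun s => P p s - P q s) (fun s => B (cl (P p s)) - B (cl (P q s)))) => //.
    by move=> t t01; apply: is_deriveB; [exact: Q1|exact: P1].
  by move=> t t01; rewrite addr0.
rewrite P0 Q0 addr0 => H; apply: (le_trans H).
rewrite mulrC -ler_pdivlMr // distrC.
by near: p; apply: (near_dist _ (divr_gt0 _ _)).
Unshelve. all: by end_near. Qed.

End Flow.

(** * The inverse function and Frobenius theorems *)

Section InverseFunction.
Variables (R : realType).

Lemma is_derive_scalel (V : normedModType R) (v : V) (t : R) :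
  is_derive t (1 : R) (fun t : R => t *: v) v.
Proof.
have d : differentiable (fun t : R => t *: v) t by apply: differentiableZl.
split; first exact: diff_derivable.
by rewrite deriveE // diff_val scale1r.
Qed.

Lemma derive0_const N (f : R -> 'rV[R]_N) :
  (forall s : R, 0 <= s <= 1 -> is_derive s (1 : R) f 0) ->
  forall s : R, 0 <= s <= 1 -> f s = f 0.
Proof.
move=> H s s01.
have : `|f s - f 0| <= gronwall_const 0 * (`|f 0 - f 0| + 0).
  apply: (@gronwall_diff _ _ f (fun=> f 0) (fun=> 0) (fun=> 0)) => //.
  by move=> t _; rewrite subrr normr0 addr0 mul0r.
by rewrite subrr normr0 addr0 mulr0 normr_le0 subr_eq0 => /eqP.
Qed.

Lemma unitmx_inj m (A : 'M[R]_m) : (forall v : 'rV[R]_m, v *m A = 0 -> v = 0) -> A \in unitmx.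
Proof.
move=> H; rewrite -row_free_unit -kermx_eq0; apply/eqP/row_matrixP => i.
by rewrite row0; apply: H; rewrite -row_mul mulmx_ker row0.
Qed.

Definition jac m k (f : 'rV[R]_m -> 'rV[R]_k) (x : 'rV[R]_m) : 'M[R]_(m, k) :=
  \matrix_(i, j) (pd i f x) 0 j.

Lemma diff_jac m k (f : 'rV[R]_m -> 'rV[R]_k) x v :
  differentiable f x -> 'd f x v = v *m jac f x.
Proof.
move=> df; have E := diff_pd v df; rewrite E mulmx_sum_row; apply: eq_bigr => i _.
by congr (_ *: _); apply/rowP => j; rewrite !mxE.
Qed.

Lemma sm_jac m k (f : 'rV[R]_m -> 'rV[R]_k) x i j : sm f x -> sm (fun y => jac f y i j) x.
Proof.
move=> sf; apply: (sm_eq _ (sm_coord j (sm_pd i sf))); near=> y.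
by rewrite mxE.
Unshelve. all: by end_near. Qed.

(** The equation x' = (w - f x0) J(x)^-1 moves f(x) along the segment from f x0 to w, so its
    solution at time 1 is a preimage of w. The direction w - f x0 is stored as a constant second
    component of the state: the field then has an equilibrium at (x0, 0), and the inverse is smooth
    because a flow is smooth in its initial point. *)
Lemma right_inverse m (f : 'rV[R]_m -> 'rV[R]_m) x0 : sm f x0 ->
  (forall v, 'd f x0 v = 0 -> v = 0) ->
  exists g, [/\ sm g (f x0), g (f x0) = x0 & \forall w \near f x0, f (g w) = w].
Proof.
move=> sf inj.
have uJ : jac f x0 \in unitmx.
  by apply: unitmx_inj => v; rewrite -diff_jac //; [exact: inj|exact: sm_diff].
pose B (y : 'rV[R]_(m + m)) : 'rV[R]_(m + m) :=
  row_mx (rsubmx y *m invmx (jac f (lsubmx y))) (0 : 'rV[R]_m).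
pose y0 : 'rV[R]_(m + m) := row_mx x0 (0 : 'rV[R]_m).
have sl : sm (fun y : 'rV[R]_(m + m) => lsubmx y) y0 by exact/sm_lsubmx/sm_id.
have sB : sm B y0.
  apply: sm_row_mx; last exact: sm_cst.
  apply/sm_rVP => j.
  apply: (@sm_eq _ _ _ (fun y => \sum_i (rsubmx y) 0 i * invmx (jac f (lsubmx y)) i j)).
    by near=> y; rewrite mxE.
  apply: sm_sum => i _; apply: smM; first exact/sm_coord/sm_rsubmx/sm_id.
  apply: (@sm_invmx _ _ _ (fun y => jac f (lsubmx y))); last by rewrite /y0 row_mxKl.
  move=> k l; apply: (@sm_compR _ _ _ (fun y : 'rV[R]_(m + m) => lsubmx y) (fun x => jac f x k l)) => //.
  by rewrite /y0 row_mxKl; exact: sm_jac.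
have B0 : B y0 = 0 by rewrite /B /y0 row_mxKr mul0mx row_mx0.
have [D [P [K [fl Dy0 K0 bd]]]] := flow_exists sB B0.
have [e e0 He] : exists2 e, 0 < e & forall x, `|x - x0| <= e -> sm f x /\ jac f x \in unitmx.
  have : \forall x \near x0, sm f x /\ jac f x \in unitmx.
    near=> x; split; near: x; first exact: sm_near.
    by apply: near_unitmx => // i j; exact: sm_jac.
  move=> /nbhs_ballP[e /= e0 H]; exists (e / 2); first by rewrite divr_gt0.
  move=> x xe; apply: H; rewrite -ball_normE /= distrC; apply: (le_lt_trans xe); lra.
pose em (w : 'rV[R]_m) : 'rV[R]_(m + m) := row_mx x0 (w - f x0).
have em0 : em (f x0) = y0 by rewrite /em subrr.
have sem w : sm em w.
  by apply: sm_row_mx; [exact: sm_cst|apply: smB; [exact: sm_id|exact: sm_cst]].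
have I1 : 0 <= (1 : R) <= 1 by rewrite ler01 lexx.
have Py0 (s : R) : 0 <= s <= 1 -> P s y0 = y0.
  move=> s01; have := bd y0 s Dy0 s01; rewrite subrr normr0 mulr0 normr_le0 subr_eq0.
  by move=> /eqP.
exists (fun w => lsubmx (P 1 (em w))); split.
- apply: sm_lsubmx; apply: sm_comp; first exact: sem.
  by rewrite em0; exact: (flow_smooth I1 fl).
- by rewrite em0 Py0 // /y0 row_mxKl.
have N : \forall w \near f x0, D (em w) /\ K * `|em w - y0| <= e.
  have cem := sm_cont (sem (f x0)).
  have Dn : \forall y \near em (f x0), D y /\ K * `|y - y0| <= e.
    rewrite em0; near=> y; split; near: y; first exact: (flow_near fl Dy0).
    have K1 : 0 < K + 1 by rewrite ltr_wpDl.
    apply: filterS (near_dist y0 (divr_gt0 e0 K1)) => y.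
    rewrite ler_pdivlMr // distrC mulrC; apply: le_trans.
    by rewrite ler_wpM2r // lerDl.
  exact: (cem _ Dn).
apply: filterS N => w [Dw Kw].
have [P0 P1 _ _] := fl.2 _ Dw.
have Pr (s : R) : 0 <= s <= 1 -> rsubmx (P s (em w)) = w - f x0.
  move=> s01.
  have Hd (t : R) : 0 <= t <= 1 -> is_derive t (1 : R) (fun s => rsubmx (P s (em w))) 0.
    move=> t01; apply: is_derive_rV => j; rewrite mxE.
    have := is_derive_coord (rshift m j) (P1 t t01); rewrite /B row_mxEr mxE.
    by apply: near_eq_is_derive; near=> u; rewrite mxE.
  by have := derive0_const Hd s01; rewrite P0 /em row_mxKr.
have xe (s : R) : 0 <= s <= 1 -> sm f (lsubmx (P s (em w))) /\ jac f (lsubmx (P s (em w))) \in unitmx.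
  move=> s01; apply: He; apply: le_trans Kw; apply: le_trans (bd _ _ Dw s01).
  by rewrite (_ : _ - x0 = lsubmx (P s (em w) - y0)) ?norm_lsubmx // linearB /= /y0 row_mxKl.
have dl (s : R) : 0 <= s <= 1 -> is_derive s (1 : R) (fun s => lsubmx (P s (em w))) ((w - f x0) *m invmx (jac f (lsubmx (P s (em w))))).
  move=> s01; apply: is_derive_rV => j.
  have := is_derive_coord (lshift m j) (P1 s s01); rewrite /B row_mxEl Pr //.
  by apply: near_eq_is_derive; near=> u; rewrite mxE.
have E (s : R) : 0 <= s <= 1 -> f (lsubmx (P s (em w))) - s *: (w - f x0) = f (lsubmx (P 0 (em w))) - 0 *: (w - f x0).
  apply: (@derive0_const _ (fun s => f (lsubmx (P s (em w))) - s *: (w - f x0))) => t t01.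
  have [st ut] := xe t t01.
  have H := is_derive_curve (dl t t01) (sm_diff st).
  have E := diff_jac ((w - f x0) *m invmx (jac f (lsubmx (P t (em w))))) (sm_diff st).
  rewrite E mulmxKV // in H.
  by have := is_deriveB H (is_derive_scalel (w - f x0) t); rewrite subrr.
have := E 1 I1; rewrite P0 /em row_mxKl scale1r scale0r subr0.
by move=> /(canRL (subrK _)) ->; rewrite addrC subrK.
Unshelve. all: by end_near. Qed.

(** The right inverse g has an injective differential, hence a right inverse h of its own. Near x0,
    h = f g h = f since g h is the identity, and g is also a left inverse. *)
Theorem inverse_function m (f : 'rV[R]_m -> 'rV[R]_m) x0 : sm f x0 ->
  (forall v, 'd f x0 v = 0 -> v = 0) ->
  exists g, [/\ sm g (f x0), g (f x0) = x0, \forall x \near x0, g (f x) = x &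
    \forall w \near f x0, f (g w) = w].
Proof.
move=> sf inj; have [g [sg g0 fg]] := right_inverse sf inj.
have injg v : 'd g (f x0) v = 0 -> v = 0.
  move=> gv; have : 'd (f \o g) (f x0) v = 0.
    rewrite diff_comp /=; [|exact: sm_diff|rewrite g0; exact: sm_diff].
    exact: (etrans (congr1 _ gv) (linear0 _)).
  have [_ ->] : differentiable (f \o g) (f x0) /\ 'd (f \o g) (f x0) = 'd id (f x0) :> (_ -> _).
    apply: near_eq_differentiable => //.
    by apply: filterS fg => w /= ->.
  by rewrite diff_val.
have [h [sh h0 gh]] := right_inverse sg injg.
rewrite g0 in sh h0 gh.
exists g; split=> //.
have fgh : \forall x \near x0, f (g (h x)) = h x.
  have fg' : \forall w \near h x0, f (g w) = w by rewrite h0.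
  exact: (sm_cont sh fg').
near=> x.
have E1 : g (h x) = x by near: x.
have E2 : f (g (h x)) = h x by near: x.
by rewrite -{1}E1 E2 E1.
Unshelve. all: by end_near. Qed.

End InverseFunction.

(** * Rules of differentiation for row vectors *)

Section DiffRules.
Variables (R : realType).

Lemma diff_coord m k (f : 'rV[R]_m -> 'rV[R]_k) x v j : differentiable f x ->
  ('d f x v) 0 j = 'd (fun y => f y 0 j) x v.
Proof.
move=> df; have E := deriveE v df; rewrite -E derive_coord; last exact: diff_derivable.
by rewrite deriveE //; move/differentiable_rVP: df.
Qed.

Lemma differentiable_row_mx l m n (f : 'rV[R]_l -> 'rV[R]_m) (g : 'rV[R]_l -> 'rV[R]_n) x :
  differentiable f x -> differentiable g x -> differentiable (fun y => row_mx (f y) (g y)) x.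
Proof.
move=> /differentiable_rVP df /differentiable_rVP dg; apply/differentiable_rVP => j.
case: (splitP j) => i ji.
  rewrite (_ : (fun y => _) = (fun y => f y 0 i)) //; apply/funext => y.
  by rewrite (_ : j = lshift n i) ?row_mxEl //; exact: val_inj.
rewrite (_ : (fun y => _) = (fun y => g y 0 i)) //; apply/funext => y.
by rewrite (_ : j = rshift m i) ?row_mxEr //; exact: val_inj.
Qed.

Lemma diff_row_mx l m n (f : 'rV[R]_l -> 'rV[R]_m) (g : 'rV[R]_l -> 'rV[R]_n) x v :
  differentiable f x -> differentiable g x ->
  'd (fun y => row_mx (f y) (g y)) x v = row_mx ('d f x v) ('d g x v).
Proof.
move=> df dg; have d := differentiable_row_mx df dg; apply/rowP => j.
have E1 := diff_coord v j d.
case: (splitP j) => i ji.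
  have ej : j = lshift n i by exact: val_inj.
  subst j; apply: (etrans E1); rewrite row_mxEl; apply: etrans (esym (diff_coord v i df)).
  by congr ('d _ x v); apply/funext => y; rewrite row_mxEl.
have ej : j = rshift m i by exact: val_inj.
subst j; apply: (etrans E1); rewrite row_mxEr; apply: etrans (esym (diff_coord v i dg)).
by congr ('d _ x v); apply/funext => y; rewrite row_mxEr.
Qed.

Lemma diff_linc (U V W : normedModType R) (L : {linear V -> W}) (f : U -> V) x v :
  continuous L -> differentiable f x -> 'd (fun y => L (f y)) x v = L ('d f x v).
Proof.
move=> cL df; have := derive_lin v cL df; rewrite deriveE.
  by move=> ->; congr (L _); rewrite deriveE.
by apply: differentiable_comp => //; exact: linear_differentiable.
Qed.

Lemma diff_sum m (V : normedModType R) n (F : 'I_n -> 'rV[R]_m -> V) x v :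
  (forall i, differentiable (F i) x) ->
  differentiable (fun y => \sum_i F i y) x /\
  'd (fun y => \sum_i F i y) x v = \sum_i 'd (F i) x v.
Proof.
move=> H; have E : (fun y => \sum_i F i y) = \sum_i F i by apply/funext => y; rewrite fct_sumE.
have d : differentiable (fun y => \sum_i F i y) x by rewrite E; exact: differentiable_sum.
split=> //; apply: (etrans (esym (deriveE v d))); rewrite E derive_sum.
  by apply: eq_bigr => i _; exact: deriveE.
by move=> i; exact: diff_derivable.
Qed.

Lemma differentiable_scale m n (k : 'rV[R]_m -> R) (f : 'rV[R]_m -> 'rV[R]_n) x :
  differentiable k x -> differentiable f x -> differentiable (fun y => k y *: f y) x.
Proof.
move=> dk /differentiable_rVP df; apply/differentiable_rVP => j.
rewrite (_ : (fun y => _) = k * (fun y => f y 0 j)); first exact: differentiableM.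
by apply/funext => y; rewrite mxE.
Qed.

Lemma diff_scale m n (k : 'rV[R]_m -> R) (f : 'rV[R]_m -> 'rV[R]_n) x v :
  differentiable k x -> differentiable f x ->
  'd (fun y => k y *: f y) x v = 'd k x v *: f x + k x *: 'd f x v.
Proof.
move=> dk df; have d := differentiable_scale dk df; apply/rowP => j.
have dfj : differentiable (fun y => f y 0 j) x by move/differentiable_rVP: df.
apply: (etrans (diff_coord v j d)).
have -> : (fun y => (k y *: f y) 0 j) = k * (fun y => f y 0 j) by apply/funext => y; rewrite mxE.
have E1 := diff_coord v j df; have E2 := deriveE v (differentiableM dk dfj).
apply: (etrans (esym E2)); rewrite deriveM; [|exact: diff_derivable|exact: diff_derivable].
have E3 := deriveE v dk; have E4 := deriveE v dfj.
rewrite E3 E4 !mxE -E1 addrC; congr (_ + _).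
exact: mulrC.
Qed.

Lemma diff_compE m k (V : normedModType R) (f : 'rV[R]_m -> 'rV[R]_k) (g : 'rV[R]_k -> V) x v :
  differentiable f x -> differentiable g (f x) ->
  'd (fun y => g (f y)) x v = 'd g (f x) ('d f x v).
Proof. by move=> df dg; rewrite (_ : (fun y => g (f y)) = g \o f) // diff_comp. Qed.

Lemma is_derive_onemZ d (g : R -> 'rV[R]_d) (s : R) dg : is_derive s (1 : R) g dg ->
  is_derive s (1 : R) (fun s => (1 - s) *: g s) ((1 - s) *: dg - g s).
Proof.
move=> Hg; apply: is_derive_rV => j.
have H1 : is_derive s (1 : R) (fun s : R => 1 - s) (-1).
  by have := is_deriveB (is_derive_cst (1 : R) s (1 : R)) (is_derive_id s (1 : R)); rewrite sub0r.
have H2 := is_deriveM H1 (is_derive_coord j Hg).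
have H3 : is_derive s (1 : R) (fun t => ((1 - t) *: g t) 0 j) ((1 - s) *: dg 0 j + g s 0 j *: -1).
  by apply: near_eq_is_derive H2; near=> t; rewrite !mxE.
apply: is_derive_eq H3 _; rewrite !mxE; congr (_ + _).
by rewrite -[LHS]/(g s 0 j * -1) mulrN1.
Unshelve. all: by end_near. Qed.

Lemma is_derive_lsubmx m n (f : R -> 'rV[R]_(m + n)) (s : R) df :
  is_derive s (1 : R) f df -> is_derive s (1 : R) (fun s => lsubmx (f s)) (lsubmx df).
Proof.
move=> H; apply: is_derive_rV => j; rewrite mxE.
by apply: near_eq_is_derive (is_derive_coord (lshift n j) H); near=> u; rewrite mxE.
Unshelve. all: by end_near. Qed.

Lemma is_derive_rsubmx m n (f : R -> 'rV[R]_(m + n)) (s : R) df :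
  is_derive s (1 : R) f df -> is_derive s (1 : R) (fun s => rsubmx (f s)) (rsubmx df).
Proof.
move=> H; apply: is_derive_rV => j; rewrite mxE.
by apply: near_eq_is_derive (is_derive_coord (rshift m j) H); near=> u; rewrite mxE.
Unshelve. all: by end_near. Qed.

Lemma sum_row_mx m n p (A : 'I_p -> 'rV[R]_m) (B : 'I_p -> 'rV[R]_n) :
  \sum_i row_mx (A i) (B i) = row_mx (\sum_i A i) (\sum_i B i).
Proof.
rewrite -[LHS]hsubmxK !linear_sum; congr row_mx; apply: eq_bigr => i _.
  exact: row_mxKl.
exact: row_mxKr.
Qed.

End DiffRules.

(** * First integrals of an involutive distribution *)

Section Frobenius.
Variables (R : realType) (k d : nat) (c : 'I_k -> 'rV[R]_(k + d) -> 'rV[R]_d).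

Hypothesis sc : forall i, sm (c i) 0.

Hypothesis compat : \forall z \near (0 : 'rV[R]_(k + d)), forall i j,
  'd (c j) z (row_mx (delta_mx 0 i) (c i z)) = 'd (c i) z (row_mx (delta_mx 0 j) (c j z)).

Let T := 'rV[R]_(k + (k + d)).
Let pX (y : T) : 'rV[R]_k := lsubmx y.
Let px (y : T) : 'rV[R]_k := lsubmx (rsubmx y).
Let pz (y : T) : 'rV[R]_d := rsubmx (rsubmx y).
Let pos (y : T) : 'rV[R]_(k + d) := row_mx (pX y) (pz y).

(* The leaf through (x, zeta) is followed back to the fibre over 0 along the
   segment from x to 0; the state is (position, x, fibre coordinate). *)
Definition leaf_field (y : T) : T :=
  row_mx (- px y) (row_mx 0 (- \sum_j px y 0 j *: c j (pos y))).

Let spX y : sm pX y. Proof. exact/sm_lsubmx/sm_id. Qed.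
Let spx y : sm px y. Proof. exact/sm_lsubmx/sm_rsubmx/sm_id. Qed.
Let spz y : sm pz y. Proof. exact/sm_rsubmx/sm_rsubmx/sm_id. Qed.
Let spos y : sm pos y. Proof. by apply: sm_row_mx. Qed.

Let pos0 : pos 0 = 0.
Proof. by rewrite /pos /pX /pz !linear0 row_mx0. Qed.

Lemma sm_leaf_field : sm leaf_field 0.
Proof.
apply: sm_row_mx; first exact: smN.
apply: sm_row_mx; first exact: sm_cst.
apply/smN/sm_sum => j _; apply: smZr; first exact: sm_coord.
by apply: sm_comp => //; rewrite pos0.
Qed.

Lemma leaf_field0 : leaf_field 0 = 0.
Proof.
rewrite /leaf_field big1 ?oppr0 ?row_mx0; last first.
  by move=> j _; rewrite /px !linear0 mxE scale0r.
have -> : px 0 = 0 by rewrite /px !linear0.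
by rewrite oppr0 row_mx0.
Qed.

Lemma diff_leaf_field y v : (forall j, differentiable (c j) (pos y)) ->
  'd leaf_field y v = row_mx (- px v) (row_mx 0
    (- \sum_j (px v 0 j *: c j (pos y) + px y 0 j *: 'd (c j) (pos y) (pos v)))).
Proof.
move=> dc.
have dpx : differentiable px y by exact: sm_diff.
have dpos : differentiable pos y by exact: sm_diff.
have Epx : 'd px y v = px v.
  have E1 := diff_linc v (@rV_linear_continuous _ _ _ (@lsubmx R 1 k d)) (sm_diff (sm_rsubmx (sm_id y))).
  apply: (etrans E1); congr lsubmx.
  have E2 := diff_linc v (@rV_linear_continuous _ _ _ (@rsubmx R 1 k (k + d))) (sm_diff (sm_id y)).
  by apply: (etrans E2); congr rsubmx; rewrite diff_val.
have Epos : 'd pos y v = pos v.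
  apply: (etrans (diff_row_mx v (sm_diff (spX y)) (sm_diff (spz y)))); congr row_mx.
    have E2 := diff_linc v (@rV_linear_continuous _ _ _ (@lsubmx R 1 k (k + d))) (sm_diff (sm_id y)).
    by apply: (etrans E2); congr lsubmx; rewrite diff_val.
  have E1 := diff_linc v (@rV_linear_continuous _ _ _ (@rsubmx R 1 k d)) (sm_diff (sm_rsubmx (sm_id y))).
  apply: (etrans E1); congr rsubmx.
  have E2 := diff_linc v (@rV_linear_continuous _ _ _ (@rsubmx R 1 k (k + d))) (sm_diff (sm_id y)).
  by apply: (etrans E2); congr rsubmx; rewrite diff_val.
have dcp j : differentiable (fun y => c j (pos y)) y.
  by apply: (@differentiable_comp _ _ _ _ pos (c j)).
have dpj j : differentiable (fun y => px y 0 j) y by exact/sm_diff/sm_coord.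
have dt j : differentiable (fun y => px y 0 j *: c j (pos y)) y by exact: differentiable_scale.
have [dS ES] := diff_sum v dt.
apply: (etrans (diff_row_mx v _ _)).
- exact/sm_diff/smN.
- by apply: differentiable_row_mx; [exact: differentiable_cst|exact: differentiableN].
congr row_mx.
  have dN := differentiableN dpx; apply: (etrans (esym (deriveE v dN))).
  rewrite deriveN; last exact: diff_derivable.
  by congr (- _); apply: etrans (deriveE v dpx) Epx.
apply: (etrans (diff_row_mx v _ _)); [exact: differentiable_cst|exact: differentiableN|].
congr row_mx; first by rewrite diff_val.
have dN := differentiableN dS; apply: (etrans (esym (deriveE v dN))).
rewrite deriveN; last exact: diff_derivable.
congr (- _); apply: (etrans (deriveE v dS)); apply: (etrans ES); apply: eq_bigr => j _.
apply: (etrans (diff_scale v (dpj j) (dcp j))); congr (_ *: _ + _ *: _).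
  by apply: (etrans (esym (diff_coord v j dpx))); rewrite Epx.
by apply: (etrans (diff_compE v dpos (dc j))); rewrite Epos.
Qed.

(* F is a first integral of the distribution spanned by d/dx_i + c_i d/dzeta. The
   last clause makes F differentiable over an algebra when the c_i are. *)
Theorem frobenius : exists F : 'rV[R]_(k + d) -> 'rV[R]_d,
  [/\ sm F 0, \forall h \near (0 : 'rV[R]_d), F (row_mx 0 h) = h,
   \forall z \near (0 : 'rV[R]_(k + d)), forall i, 'd F z (row_mx (delta_mx 0 i) (c i z)) = 0 &
   forall A : 'M[R]_d,
    (\forall z \near (0 : 'rV[R]_(k + d)), forall i h, 'd (c i) z (row_mx 0 (h *m A)) = 'd (c i) z (row_mx 0 h) *m A) ->
    \forall z \near (0 : 'rV[R]_(k + d)), forall h, 'd F z (row_mx 0 (h *m A)) = 'd F z (row_mx 0 h) *m A].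
Proof.
have [D [P [K [fl D0 K0 bd]]]] := flow_exists sm_leaf_field leaf_field0.
(* The motion starts at the position x with velocity -x, so it is over 0 at time 1. *)
pose em (z : 'rV[R]_(k + d)) : T := row_mx (lsubmx z) z.
have I1 : 0 <= (1 : R) <= 1 by rewrite ler01 lexx.
have sem z : sm em z by apply: sm_row_mx; [exact/sm_lsubmx/sm_id|exact: sm_id].
have em0 : em 0 = 0 by rewrite /em linear0 row_mx0.
have posem z : pos (em z) = z by rewrite /pos /pX /pz /em row_mxKl row_mxKr hsubmxK.
have Dem : \forall z \near (0 : 'rV[R]_(k + d)), D (em z).
  have H := flow_near fl D0; rewrite -em0 in H; exact: (sm_cont (sem 0) H).
pose F z := pz (P 1 (em z)).
have dF z v : D (em z) -> 'd F z v = pz ('d (P 1) (em z) (em v)).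
  move=> Dz; have dP : differentiable (P 1) (em z) by exact/sm_diff/(flow_smooth I1 fl).
  have dem : differentiable em z by exact: sm_diff.
  have dPe : differentiable (fun z => P 1 (em z)) z by exact: (@differentiable_comp _ _ _ _ em (P 1)).
  have E1 : 'd em z v = em v.
    apply: (etrans (diff_row_mx v (sm_diff (sm_lsubmx (sm_id z))) (sm_diff (sm_id z)))).
    congr row_mx; last by rewrite diff_val.
    have E2 := diff_linc v (@rV_linear_continuous _ _ _ (@lsubmx R 1 k d)) (sm_diff (sm_id z)).
    by apply: (etrans E2); congr lsubmx; rewrite diff_val.
  have dr : differentiable (fun z => rsubmx (P 1 (em z))) z.
    by apply: sm_diff; apply: sm_rsubmx; apply: (@sm_comp _ _ _ _ em (P 1)) => //; exact: (flow_smooth I1 fl).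
  apply: (etrans (diff_linc v (@rV_linear_continuous _ _ _ (@rsubmx R 1 k d)) dr)); congr rsubmx.
  apply: (etrans (diff_linc v (@rV_linear_continuous _ _ _ (@rsubmx R 1 k (k + d))) dPe)); congr rsubmx.
  by apply: (etrans (diff_compE v dem dP)); rewrite E1.
(* As 0 is an equilibrium, trajectories issued from nearby points stay close to it: what holds near
   0 holds along them. *)
have traj (Q : 'rV[R]_(k + d) -> Prop) : (\forall z \near (0 : 'rV[R]_(k + d)), Q z) ->
    \forall z \near (0 : 'rV[R]_(k + d)), D (em z) /\ forall s : R, 0 <= s <= 1 -> Q (pos (P s (em z))).
  move=> HQ.
  have H1 : \forall y \near (0 : T), Q (pos y).
    by have := HQ; rewrite -{1}pos0 => H; exact: (sm_cont (spos 0) H).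
  move: H1 => /nbhs_ballP[e /= e0 He].
  have K1 : 0 < K + 1 by rewrite ltr_wpDl.
  have e2 : 0 < e / 2 by rewrite divr_gt0.
  have nz : \forall z \near (0 : 'rV[R]_(k + d)), `|em z| <= e / 2 / (K + 1).
    have N := near_dist (0 : T) (divr_gt0 e2 K1); rewrite -{1}em0 in N.
    have N' : \forall z \near (0 : 'rV[R]_(k + d)), `|0 - em z| <= e / 2 / (K + 1) by exact: (sm_cont (sem 0) N).
    by apply: filterS N' => z; rewrite sub0r normrN.
  near=> z; have Dz : D (em z) by near: z.
  split=> // s s01; apply: He; rewrite -ball_normE /= sub0r normrN.
  have := bd (em z) s Dz s01; rewrite !subr0 => H; apply: (le_lt_trans H).
  have nz' : `|em z| <= e / 2 / (K + 1) by near: z.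
  rewrite ler_pdivlMr // in nz'; apply: (@le_lt_trans _ _ (e / 2)); last by lra.
  by apply: le_trans nz'; rewrite mulrC ler_wpM2l // lerDl.
have solX z (s : R) : D (em z) -> 0 <= s <= 1 -> px (P s (em z)) = lsubmx z.
  move=> Dz s01; have [P0 P1 _ _] := fl.2 _ Dz.
  have Hd (t : R) : 0 <= t <= 1 -> is_derive t (1 : R) (fun s => px (P s (em z))) 0.
    move=> t01; apply: is_derive_rV => j; rewrite mxE.
    have := is_derive_coord (rshift k (lshift d j)) (P1 t t01).
    rewrite /leaf_field row_mxEr row_mxEl mxE.
    by apply: near_eq_is_derive; near=> u; rewrite !mxE.
  by have := derive0_const Hd s01; rewrite P0 /px /em row_mxKr.
have cdiff : \forall z \near (0 : 'rV[R]_(k + d)), forall j, differentiable (c j) z.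
  by near=> z => j; move: j; near: z; apply: filter_forall => j; apply: filterS (sm_near (sc j)) => z /sm_diff.
exists F; split.
- rewrite /F /pz; apply/sm_rsubmx/sm_rsubmx; apply: (@sm_comp _ _ _ _ em (P 1)); first exact: sem.
  by rewrite em0; exact: (flow_smooth I1 fl).
- have l0 : \forall h \near (0 : 'rV[R]_d), D (em (row_mx (0 : 'rV[R]_k) h)).
    have sr : sm (fun h : 'rV[R]_d => row_mx (0 : 'rV[R]_k) h) 0.
      by apply: sm_row_mx; [exact: sm_cst|exact: sm_id].
    have Dem' : \forall z \near (row_mx (0 : 'rV[R]_k) (0 : 'rV[R]_d)), D (em z) by rewrite row_mx0.
    exact: (sm_cont sr Dem').
  apply: filterS l0 => h Dh; have [P0 P1 _ _] := fl.2 _ Dh.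
  have Hd (t : R) : 0 <= t <= 1 -> is_derive t (1 : R) (fun s => pz (P s (em (row_mx (0 : 'rV[R]_k) h)))) 0.
    move=> t01; apply: is_derive_rV => j; rewrite mxE.
    have := is_derive_coord (rshift k (rshift k j)) (P1 t t01).
    rewrite /leaf_field row_mxEr row_mxEr (solX _ _ Dh t01) row_mxKl big1 ?oppr0 ?mxE; last first.
      by move=> i _; rewrite mxE scale0r.
    by apply: near_eq_is_derive; near=> u; rewrite !mxE.
  by have := derive0_const Hd I1; rewrite /F P0 /pz /em !row_mxKr.
- pose Q (z : 'rV[R]_(k + d)) := (forall j, differentiable (c j) z) /\ forall i j,
    'd (c j) z (row_mx (delta_mx 0 i) (c i z)) = 'd (c i) z (row_mx (delta_mx 0 j) (c j z)).
  have HQ : \forall z \near (0 : 'rV[R]_(k + d)), Q z by near=> z; split; near: z.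
  have H := traj Q HQ.
  near=> z; have [Dz Hz] : D (em z) /\ forall s : R, 0 <= s <= 1 -> Q (pos (P s (em z))) by near: z.
  move=> i; have [P0 P1 _ _] := fl.2 _ Dz.
  rewrite dF //.
  (* The variation of the trajectory when its initial point moves along the leaf in the direction i:
     the position (1 - s) x moves by (1 - s) e_i and the fibre coordinate by the slope c_i times
     that. The compatibility condition makes [W] a solution of the variational equation, and its
     fibre part vanishes at time 1, so F does not change. *)
  pose W (s : R) : T := row_mx ((1 - s) *: delta_mx 0 i) (row_mx (delta_mx 0 i) ((1 - s) *: c i (pos (P s (em z))))).
  have W0 : W 0 = em (row_mx (delta_mx 0 i) (c i z)).
    by rewrite /W subr0 !scale1r P0 posem /em row_mxKl.
  have dW (s : R) : 0 <= s <= 1 -> is_derive s (1 : R) W ('d leaf_field (P s (em z)) (W s)).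
    move=> s01; have [dc cp] := Hz s s01.
    set y := P s (em z) in dc cp *.
    have d1 (V : normedModType R) (u : V) : is_derive s (1 : R) (fun s : R => (1 - s) *: u) (- u).
      have := is_deriveB (is_derive_cst u s (1 : R)) (is_derive_scalel u s); rewrite sub0r.
      by apply: near_eq_is_derive; near=> t; rewrite /= scalerBl scale1r.
    have dcz : is_derive s (1 : R) (fun s => c i (pos (P s (em z)))) ('d (c i) (pos y) (pos (leaf_field y))).
      have dp : is_derive s (1 : R) (fun s => pos (P s (em z))) (pos (leaf_field y)).
        apply: is_derive_row_mx; first exact: is_derive_lsubmx (P1 s s01).
        exact: (is_derive_rsubmx (is_derive_rsubmx (P1 s s01))).
      exact: (is_derive_curve dp (dc i)).
    have Ed := diff_leaf_field (W s) dc; rewrite Ed.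
    have -> : px (W s) = delta_mx 0 i by rewrite /px /W row_mxKr row_mxKl.
    have -> : pos (W s) = (1 - s) *: row_mx (delta_mx 0 i) (c i (pos y)).
      by rewrite /pos /pX /pz /W !(row_mxKl, row_mxKr) scale_row_mx.
    apply: is_derive_row_mx; first exact: d1.
    apply: is_derive_row_mx; first exact: is_derive_cst.
    have -> : - \sum_j ((delta_mx 0 i : 'rV[R]_k) 0 j *: c j (pos y) + px y 0 j *:
        'd (c j) (pos y) ((1 - s) *: row_mx (delta_mx 0 i) (c i (pos y)))) =
        (1 - s) *: 'd (c i) (pos y) (pos (leaf_field y)) - c i (pos y).
      rewrite big_split /= opprD addrC; congr (_ - _); last first.
        rewrite (bigD1 i) //= big1 ?addr0 ?mxE ?eqxx ?scale1r // => j ji.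
        by rewrite mxE eqxx /= (negPf ji) scale0r.
      have -> : pos (leaf_field y) = - \sum_j px y 0 j *: row_mx (delta_mx 0 j) (c j (pos y)).
        rewrite /pos /pX /pz /leaf_field !(row_mxKl, row_mxKr).
        rewrite (eq_bigr (fun j => row_mx (px y 0 j *: delta_mx 0 j) (px y 0 j *: c j (pos y)))); last first.
          by move=> j _; rewrite scale_row_mx.
        by rewrite sum_row_mx opp_row_mx -row_sum_delta.
      have E1 : 'd (c i) (pos y) (- \sum_j px y 0 j *: row_mx (delta_mx 0 j) (c j (pos y))) =
         - \sum_j px y 0 j *: 'd (c i) (pos y) (row_mx (delta_mx 0 j) (c j (pos y))).
        apply: (etrans (linearN _ _)); congr (- _); apply: (etrans (linear_sum _ _ _ _)).
        by apply: eq_bigr => j _; exact: linearZ.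
      apply: etrans (esym (congr1 (fun v => (1 - s) *: v) E1)).
      rewrite scalerN; congr (- _); rewrite scaler_sumr; apply: eq_bigr => j _.
      rewrite scalerA mulrC -scalerA; congr (_ *: _).
      by apply: (etrans (linearZ _ _)); congr (_ *: _); exact: cp.
    exact: is_derive_onemZ.
  rewrite -W0; have E := flow_variation fl Dz dW I1; rewrite E /W subrr scale0r.
  by rewrite /pz !row_mxKr scale0r.
- move=> A HA; pose Q (z : 'rV[R]_(k + d)) := (forall j, differentiable (c j) z) /\
    forall i h, 'd (c i) z (row_mx 0 (h *m A)) = 'd (c i) z (row_mx 0 h) *m A.
  have HQ : \forall z \near (0 : 'rV[R]_(k + d)), Q z by near=> z; split; near: z.
  have H := traj Q HQ.
  near=> z; have [Dz Hz] : D (em z) /\ forall s : R, 0 <= s <= 1 -> Q (pos (P s (em z))) by near: z.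
  move=> h; have [P0 P1 _ _] := fl.2 _ Dz.
  pose V (s : R) := variation leaf_field P s (em z) (em (row_mx 0 h)).
  have [V0 dV] := variationP fl (em (row_mx 0 h)) Dz.
  have emh h' : em (row_mx 0 h') = row_mx 0 (row_mx 0 h') by rewrite /em row_mxKl.
  have Vx (s : R) : 0 <= s <= 1 -> px (V s) = 0.
    move=> s01.
    have Hd (t : R) : 0 <= t <= 1 -> is_derive t (1 : R) (fun s => px (V s)) 0.
      move=> t01; have [dc _] := Hz t t01; apply: is_derive_rV => j; rewrite mxE.
      have := is_derive_coord (rshift k (lshift d j)) (dV t t01).
      rewrite diff_leaf_field // row_mxEr row_mxEl mxE.
      by apply: near_eq_is_derive; near=> u; rewrite !mxE.
    by have := derive0_const Hd s01; rewrite /V V0 emh /px row_mxKr row_mxKl.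
  have VX (s : R) : 0 <= s <= 1 -> pX (V s) = 0.
    move=> s01.
    have Hd (t : R) : 0 <= t <= 1 -> is_derive t (1 : R) (fun s => pX (V s)) 0.
      move=> t01; have [dc _] := Hz t t01; apply: is_derive_rV => j; rewrite mxE.
      have := is_derive_coord (lshift (k + d) j) (dV t t01).
      rewrite diff_leaf_field // row_mxEl -/(V t) (Vx t t01) oppr0 mxE.
      by apply: near_eq_is_derive; near=> u; rewrite !mxE.
    by have := derive0_const Hd s01; rewrite /V V0 emh /pX row_mxKl.
  (* A vertical variation stays vertical, and its equation commutes with [A] by assumption; hence
     its image by [A] is again a variation. *)
  pose W (s : R) : T := row_mx 0 (row_mx 0 (pz (V s) *m A)).
  have dW (s : R) : 0 <= s <= 1 -> is_derive s (1 : R) W ('d leaf_field (P s (em z)) (W s)).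
    move=> s01; have [dc cA] := Hz s s01.
    have Ed := diff_leaf_field (W s) dc; rewrite Ed.
    have -> : px (W s) = 0 by rewrite /px /W row_mxKr row_mxKl.
    rewrite oppr0; apply: is_derive_row_mx; first exact: is_derive_cst.
    apply: is_derive_row_mx; first exact: is_derive_cst.
    have dz : is_derive s (1 : R) (fun s => pz (V s)) (- \sum_j px (P s (em z)) 0 j *: 'd (c j) (pos (P s (em z))) (row_mx 0 (pz (V s)))).
      have posV : pos (V s) = row_mx 0 (pz (V s)) by rewrite /pos VX.
      apply: is_derive_rV => j.
      have := is_derive_coord (rshift k (rshift k j)) (dV s s01).
      rewrite diff_leaf_field // !row_mxEr -/(V s) (Vx s s01) posV.
      rewrite (eq_bigr (fun j => px (P s (em z)) 0 j *: 'd (c j) (pos (P s (em z))) (row_mx 0 (pz (V s))))); last first.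
        by move=> i _; rewrite mxE scale0r add0r.
      by apply: near_eq_is_derive; near=> u; rewrite !mxE.
    have -> : - \sum_j ((0 : 'rV[R]_k) 0 j *: c j (pos (P s (em z))) + px (P s (em z)) 0 j *:
        'd (c j) (pos (P s (em z))) (pos (W s))) =
      (- \sum_j px (P s (em z)) 0 j *: 'd (c j) (pos (P s (em z))) (row_mx 0 (pz (V s)))) *m A.
      rewrite mulNmx mulmx_suml; congr (- _); apply: eq_bigr => j _.
      rewrite mxE scale0r add0r -scalemxAl; congr (_ *: _); apply: etrans (cA j _).
      by congr ('d _ _ _); rewrite /pos /pX /pz /W !(row_mxKl, row_mxKr).
    have dL := is_derive_curve dz (@linear_differentiable _ _ _ (mulmxr A) _ (@rV_linear_continuous _ _ _ (mulmxr A))).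
    by rewrite diff_lin in dL; last exact: rV_linear_continuous.
  have EV := flow_variation fl Dz dV I1.
  have EW := flow_variation fl Dz dW I1.
  rewrite !dF // {1}emh.
  have E0 : W 0 = row_mx 0 (row_mx 0 (h *m A)).
    by rewrite /W /V V0 emh /pz !row_mxKr.
  rewrite -E0 EW /W {1}/pz !row_mxKr; congr (pz _ *m A).
  exact: (etrans (esym EV) (congr1 _ V0)).
Unshelve. all: by end_near. Qed.

End Frobenius.

(** * Calculus over a commutative algebra *)

HB.lock Definition dd (R : realType) (V W : normedModType R) (f : V -> W) (x v : V) : W := 'd f x v.
Canonical dd_unlockable := Unlockable dd.unlock.

Section LockedDifferential.
Variable R : realType.

(* ['d] unfolds during unification, which is prohibitively slow; [dd] does not. *)
Lemma ddE (V W : normedModType R) (f : V -> W) x v : dd f x v = 'd f x v.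
Proof. by rewrite unlock. Qed.

Section Generic.
Variables (V W : normedModType R).
Implicit Types (f g : V -> W) (x v : V).

Lemma ddD f x u v : dd f x (u + v) = dd f x u + dd f x v.
Proof. by rewrite !ddE; exact: linearD. Qed.
Lemma ddZ f x r v : dd f x (r *: v) = r *: dd f x v.
Proof. by rewrite !ddE; exact: linearZ. Qed.
Lemma dd0 f x : dd f x 0 = 0.
Proof. by rewrite !ddE; exact: linear0. Qed.
Lemma ddN f x v : dd f x (- v) = - dd f x v.
Proof. by rewrite !ddE; exact: linearN. Qed.
Lemma ddB f x u v : dd f x (u - v) = dd f x u - dd f x v.
Proof. by rewrite ddD ddN. Qed.
Lemma dd_sum n (u : 'I_n -> V) f x : dd f x (\sum_i u i) = \sum_i dd f x (u i).
Proof. by elim/big_rec2: _ => [|i a b _ <-]; [exact: dd0|exact: ddD]. Qed.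

Lemma ddDe f x v : differentiable f x -> dd f x v = 'D_v f x.
Proof. by rewrite ddE => df; rewrite deriveE. Qed.

Lemma dd_near f g x v : (\forall y \near x, f y = g y) -> differentiable f x -> dd g x v = dd f x v.
Proof. by move=> H df; rewrite !ddE; have [_] := near_eq_differentiable H df; move=> ->. Qed.

Lemma dd_cst a x v : dd (fun=> a : W) x v = 0.
Proof. by rewrite ddDe; [rewrite derive_cst|exact: differentiable_cst]. Qed.

Lemma dd_add f g x v : differentiable f x -> differentiable g x ->
  dd (fun y => f y + g y) x v = dd f x v + dd g x v.
Proof.
move=> df dg; rewrite (ddDe v df) (ddDe v dg) ddDe; last exact: differentiableD.
by rewrite deriveD //; exact: diff_derivable.
Qed.

Lemma dd_sub f g x v : differentiable f x -> differentiable g x ->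
  dd (fun y => f y - g y) x v = dd f x v - dd g x v.
Proof.
move=> df dg; rewrite (ddDe v df) (ddDe v dg) ddDe; last exact: differentiableB.
by rewrite deriveB //; exact: diff_derivable.
Qed.

End Generic.

Lemma dd_comp m k (V : normedModType R) (f : 'rV[R]_m -> 'rV[R]_k) (g : 'rV[R]_k -> V) x v :
  differentiable f x -> differentiable g (f x) ->
  dd (fun y => g (f y)) x v = dd g (f x) (dd f x v).
Proof. by move=> df dg; rewrite !ddE; exact: diff_compE. Qed.

Lemma dd_linear m (W : normedModType R) (L : {linear 'rV[R]_m -> W}) x v : dd L x v = L v.
Proof.
rewrite ddE; have := @diff_lin _ _ _ L x (@rV_linear_continuous _ _ _ L).
by move=> ->.
Qed.

Lemma dd_coord m k (f : 'rV[R]_m -> 'rV[R]_k) x v j : differentiable f x ->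
  (dd f x v) 0 j = dd (fun y => f y 0 j) x v.
Proof. by rewrite !ddE => df; exact: diff_coord. Qed.

Lemma dd_scale m n (k : 'rV[R]_m -> R) (f : 'rV[R]_m -> 'rV[R]_n) x v :
  differentiable k x -> differentiable f x ->
  dd (fun y => k y *: f y) x v = dd k x v *: f x + k x *: dd f x v.
Proof. by move=> dk df; rewrite !ddE; exact: diff_scale. Qed.

Lemma dd_bigsum m (V : normedModType R) n (F : 'I_n -> 'rV[R]_m -> V) x v :
  (forall i, differentiable (F i) x) ->
  dd (fun y => \sum_i F i y) x v = \sum_i dd (F i) x v.
Proof.
move=> H; rewrite ddE; have [_ E] := diff_sum v H; apply: (etrans E).
by apply: eq_bigr => i _; rewrite ddE.
Qed.

Lemma sm_dd m k (f : 'rV[R]_m -> 'rV[R]_k) (v : 'rV[R]_m -> 'rV[R]_m) x :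
  sm f x -> sm v x -> sm (fun y => dd f y (v y)) x.
Proof.
move=> sf sv; apply: (sm_eq _ (sm_diffv sf sv)); near=> y; by rewrite ddE.
Unshelve. all: by end_near. Qed.

Lemma sm_ddc m k (f : 'rV[R]_m -> 'rV[R]_k) v x : sm f x -> sm (fun y => dd f y v) x.
Proof. by move=> sf; apply: sm_dd => //; exact: sm_cst. Qed.

Lemma dd_schwarz m k (f : 'rV[R]_m -> 'rV[R]_k) x u v : sm f x ->
  dd (fun y => dd f y u) x v = dd (fun y => dd f y v) x u.
Proof.
move=> sf.
have E w w' : dd (fun y => dd f y w) x w' = 'D_w' (fun y => 'D_w f y) x.
  rewrite ddDe; last exact/sm_diff/sm_ddc.
  apply: near_eq_derive; apply: filterS (sm_near sf) => y /sm_diff dy.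
  by rewrite ddDe.
by rewrite !E; exact: schwarz.
Qed.

End LockedDifferential.

Section Algebra.
Variables (R : realType) (d : nat).

Record calg := CAlg {
  amul : 'rV[R]_d -> 'rV[R]_d -> 'rV[R]_d;
  aone : 'rV[R]_d;
  amulA : associative amul;
  amulC : commutative amul;
  amul1 : left_id aone amul;
  amulDl : left_distributive amul +%R;
  amulZl : forall r a b, amul (r *: a) b = r *: amul a b }.

(** A copy of the row vectors that carries the multiplication of [S], so that identities proved by
    [ring] in an arbitrary commutative ring can be instantiated. The zero ring is allowed since d
    may be 0. *)
Definition asort (S : calg) := 'rV[R]_d.
HB.instance Definition _ (S : calg) := GRing.Zmodule.copy (asort S) 'rV[R]_d.
HB.instance Definition _ (S : calg) := GRing.Zmodule_isComPzRing.Build (asort S)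
  (@amulA S) (@amulC S) (@amul1 S) (@amulDl S).

Variable S : calg.
Local Notation "a ** b" := (amul S a b) (at level 40, left associativity).
Local Notation one := (aone S).

Lemma amulDr a b c : a ** (b + c) = a ** b + a ** c.
Proof. exact: (@mulrDr (asort S)). Qed.
Lemma amulZr r a b : a ** (r *: b) = r *: (a ** b).
Proof. by rewrite amulC amulZl amulC. Qed.
Lemma amulBr a b c : a ** (b - c) = a ** b - a ** c.
Proof. exact: (@mulrBr (asort S)). Qed.
Lemma amul1r a : a ** one = a. Proof. exact: (@mulr1 (asort S)). Qed.
Lemma amul0r a : a ** 0 = 0. Proof. exact: (@mulr0 (asort S)). Qed.
Lemma amul0l a : 0 ** a = 0. Proof. exact: (@mul0r (asort S)). Qed.

Lemma amul_suml a b : a ** b = \sum_i a 0 i *: (delta_mx 0 i ** b).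
Proof.
rewrite {1}(row_sum_delta a); elim/big_rec2: _ => [|i x y _ <-]; first exact: amul0l.
by rewrite amulDl amulZl.
Qed.

Lemma amul_sumr a b : a ** b = \sum_j b 0 j *: (a ** delta_mx 0 j).
Proof. by rewrite amulC amul_suml; apply: eq_bigr => j _; rewrite amulC. Qed.

Lemma amul_sum a b : a ** b = \sum_j b 0 j *: \sum_i a 0 i *: (delta_mx 0 i ** delta_mx 0 j).
Proof. by rewrite amul_sumr; apply: eq_bigr => j _; rewrite -amul_suml. Qed.

Definition mulmat (b : 'rV[R]_d) : 'M[R]_d := \matrix_(i, j) (delta_mx 0 i ** b) 0 j.

Lemma mulmatE a b : a *m mulmat b = a ** b.
Proof.
rewrite mulmx_sum_row amul_suml; apply: eq_bigr => i _.
by congr (_ *: _); apply/rowP => j; rewrite !mxE.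
Qed.

Lemma mulmat1 : mulmat one = 1%:M.
Proof. by apply/row_matrixP => i; rewrite !rowE mulmx1 mulmatE amul1r. Qed.

Section Calculus.
Variable m : nat.
Implicit Types (f g : 'rV[R]_m -> 'rV[R]_d).

Lemma sm_amul f g x : sm f x -> sm g x -> sm (fun y => f y ** g y) x.
Proof.
move=> sf sg; apply: (@sm_eq _ _ _ (fun y => \sum_j g y 0 j *: \sum_i f y 0 i *: (delta_mx 0 i ** delta_mx 0 j))).
  by near=> y; rewrite -amul_sum.
apply: sm_sum => j _; apply: smZr; first exact: sm_coord.
by apply: sm_sum => i _; apply: smZr; [exact: sm_coord|exact: sm_cst].
Unshelve. all: by end_near. Qed.

Lemma dd_amul f g x v : differentiable f x -> differentiable g x ->
  dd (fun y => f y ** g y) x v = dd f x v ** g x + f x ** dd g x v.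
Proof.
move=> df dg.
have E : (fun y => f y ** g y) = (fun y => \sum_j (g y 0 j) *: \sum_i (f y 0 i) *: (delta_mx 0 i ** delta_mx 0 j)).
  by apply/funext => y; rewrite amul_sum.
have df' i : differentiable (fun y => f y 0 i) x by move/differentiable_rVP: df.
have dg' i : differentiable (fun y => g y 0 i) x by move/differentiable_rVP: dg.
have dF i j : differentiable (fun y => f y 0 i *: (delta_mx 0 i ** delta_mx 0 j)) x.
  by apply: differentiable_scale; [exact: df'|exact: differentiable_cst].
have dS j : differentiable (fun y => \sum_i (f y 0 i) *: (delta_mx 0 i ** delta_mx 0 j)) x.
  by have [] := diff_sum 0 (fun i => dF i j).
have E1 j : dd (fun y => \sum_i (f y 0 i) *: (delta_mx 0 i ** delta_mx 0 j)) x v = dd f x v ** delta_mx 0 j.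
  rewrite dd_bigsum // amul_suml; apply: eq_bigr => i _.
  by rewrite dd_scale ?dd_cst ?scaler0 ?addr0 ?dd_coord //; exact: differentiable_cst.
have dG j : differentiable (fun y => g y 0 j *: \sum_i (f y 0 i) *: (delta_mx 0 i ** delta_mx 0 j)) x.
  by apply: differentiable_scale; [exact: dg'|exact: dS].
rewrite E dd_bigsum //.
rewrite (eq_bigr (fun j => (dd g x v) 0 j *: (f x ** delta_mx 0 j) + g x 0 j *: (dd f x v ** delta_mx 0 j))).
  by rewrite big_split /= -!amul_sumr addrC.
by move=> j _; rewrite dd_scale // E1 dd_coord // -amul_suml.
Qed.

(** Meaningful when the multiplication by [b] is invertible, which is how units of [S] are
    recognised. *)
Definition ainv (b : 'rV[R]_d) : 'rV[R]_d := one *m invmx (mulmat b).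

Lemma ainvP b : mulmat b \in unitmx -> ainv b ** b = one.
Proof. by move=> u; rewrite -mulmatE /ainv mulmxKV. Qed.

Lemma sm_mulmat f x i j : sm f x -> sm (fun y => mulmat (f y) i j) x.
Proof.
move=> sf; apply: (@sm_eq _ _ _ (fun y => (delta_mx 0 i ** f y) 0 j)).
  by near=> y; rewrite mxE.
by apply: sm_coord; apply: sm_amul => //; exact: sm_cst.
Unshelve. all: by end_near. Qed.

Lemma sm_ainv f x : sm f x -> f x = one ->
  sm (fun y => ainv (f y)) x /\ \forall y \near x, ainv (f y) ** f y = one.
Proof.
move=> sf fx; have u : mulmat (f x) \in unitmx by rewrite fx mulmat1 unitmx1.
have smm i j : sm (fun y => mulmat (f y) i j) x by exact: sm_mulmat.
split.
  apply/sm_rVP => j; apply: (@sm_eq _ _ _ (fun y => \sum_i one 0 i * invmx (mulmat (f y)) i j)).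
    by near=> y; rewrite mxE.
  apply: sm_sum => i _; apply: smM; first exact: sm_cst.
  exact: (@sm_invmx _ _ _ (fun y => mulmat (f y))).
by apply: filterS (near_unitmx smm u) => y; exact: ainvP.
Unshelve. all: by end_near. Qed.

End Calculus.

Section CauchyRiemann.
Variable k : nat.
Implicit Types (f g : 'rV[R]_(k + d) -> 'rV[R]_d) (z : 'rV[R]_(k + d)).

(* The Cauchy-Riemann equations: f is differentiable over the algebra S in the last
   d coordinates. *)
Record CR f z : Prop := CRdef {
  CRE : forall h, dd f z (row_mx 0 h) = h ** dd f z (row_mx 0 one) }.

Definition CRsm f := sm f 0 /\ \forall z \near (0 : 'rV[R]_(k + d)), CR f z.

Lemma CRsm_cst a : CRsm (fun=> a).
Proof.
split; first exact: sm_cst.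
by near=> z; split=> h; rewrite !dd_cst amul0r.
Unshelve. all: by end_near. Qed.

Lemma CRsm_amul f g : CRsm f -> CRsm g -> CRsm (fun z => f z ** g z).
Proof.
move=> [sf cf] [sg cg]; split; first exact: sm_amul.
have df := sm_near sf; have dg := sm_near sg.
near=> z.
have dfz : differentiable f z by apply: sm_diff; near: z; exact: df.
have dgz : differentiable g z by apply: sm_diff; near: z; exact: dg.
have ef : CR f z by near: z; exact: cf.
have eg : CR g z by near: z; exact: cg.
split=> h; rewrite !dd_amul // (CRE ef h) (CRE eg h) amulDr; congr (_ + _).
  by rewrite -amulA.
by rewrite !(amulA S) (amulC S (f z)).
Unshelve. all: by end_near. Qed.

Lemma CRsm_sub f g : CRsm f -> CRsm g -> CRsm (fun z => f z - g z).
Proof.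
move=> [sf cf] [sg cg]; split; first exact: smB.
have df := sm_near sf; have dg := sm_near sg.
near=> z.
have dfz : differentiable f z by apply: sm_diff; near: z; exact: df.
have dgz : differentiable g z by apply: sm_diff; near: z; exact: dg.
have ef : CR f z by near: z; exact: cf.
have eg : CR g z by near: z; exact: cg.
by split=> h; rewrite !dd_sub // (CRE ef h) (CRE eg h) amulBr.
Unshelve. all: by end_near. Qed.

Lemma CRsm_add f g : CRsm f -> CRsm g -> CRsm (fun z => f z + g z).
Proof.
move=> [sf cf] [sg cg]; split; first exact: smD.
have df := sm_near sf; have dg := sm_near sg.
near=> z.
have dfz : differentiable f z by apply: sm_diff; near: z; exact: df.
have dgz : differentiable g z by apply: sm_diff; near: z; exact: dg.
have ef : CR f z by near: z; exact: cf.
have eg : CR g z by near: z; exact: cg.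
by split=> h; rewrite !dd_add // (CRE ef h) (CRE eg h) amulDr.
Unshelve. all: by end_near. Qed.

(** The Cauchy-Riemann equations are differentiated along [v], and second derivatives commute. *)
Lemma CRsm_derive f v : CRsm f -> CRsm (fun z => dd f z v).
Proof.
move=> [sf cf]; split; first exact: sm_ddc.
near=> z.
have sfz : sm f z by near: z; exact: sm_near sf.
have cfz : \forall z' \near z, CR f z' by near: z; exact: nbhs_interior cf.
split=> h.
have E w : dd (fun y => dd f y v) z w = dd (fun y => dd f y w) z v by exact: dd_schwarz.
rewrite !E.
have H : \forall z' \near z, h ** dd f z' (row_mx 0 one) = dd f z' (row_mx 0 h).
  by near=> z'; apply/esym; apply: CRE; near: z'; exact: cfz.
have dh : differentiable (fun z => dd f z (row_mx 0 one)) z by exact/sm_diff/sm_ddc.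
rewrite (dd_near _ H); first by rewrite dd_amul ?dd_cst ?amul0l ?add0r //; exact: differentiable_cst.
by apply: sm_diff; apply: sm_amul; [exact: sm_cst|exact: sm_ddc].
Unshelve. all: by end_near. Qed.

Lemma dd_ainv f z v : sm f z -> sm (fun z => ainv (f z)) z ->
  (\forall z' \near z, ainv (f z') ** f z' = one) ->
  dd (fun z => ainv (f z)) z v = - (ainv (f z) ** ainv (f z) ** dd f z v).
Proof.
move=> /sm_diff dfz /sm_diff dgz nz; have n0 := nbhs_singleton nz.
have : dd (fun z => ainv (f z) ** f z) z v = 0.
  have E : \forall y \near z, one = ainv (f y) ** f y by apply: filterS nz => y ->.
  by rewrite (dd_near v E (differentiable_cst _ _)) dd_cst.
rewrite dd_amul // => H; move: n0 H; move: (f z) (ainv (f z)) (dd f z v) (dd _ z v) => e b c a n0 H.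
have H2 : (a ** e + b ** c) ** b = 0 by rewrite H amul0l.
apply/eqP; rewrite -subr_eq0 opprK; apply/eqP; rewrite -[RHS]H2.
have Er (A : comPzRingType) (x y u w : A) : y * w = 1 -> x + y * y * u = (x * w + y * u) * y.
  move=> yw; have -> : (x * w + y * u) * y = x * (y * w) + y * y * u by ring.
  by rewrite yw mulr1.
exact: (Er (asort S)).
Qed.

Lemma CRsm_ainv f : CRsm f -> f 0 = one -> CRsm (fun z => ainv (f z)).
Proof.
move=> [sf cf] f0; have [si ni] := sm_ainv sf f0; split; first exact: si.
have df := sm_near sf; have dg := sm_near si.
near=> z.
have sfz : sm f z by near: z; exact: df.
have sgz : sm (fun z => ainv (f z)) z by near: z; exact: dg.
have ef : CR f z by near: z; exact: cf.
have nz : \forall z' \near z, ainv (f z') ** f z' = one by near: z; exact: nbhs_interior ni.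
split=> h; rewrite !dd_ainv // (CRE ef h); move: (dd f z _) (ainv (f z)) => a b.
have Er (A : comPzRingType) (x y u : A) : - (y * y * (x * u)) = x * (- (y * y * u)) by ring.
exact: (Er (asort S)).
Unshelve. all: by end_near. Qed.

End CauchyRiemann.
End Algebra.

(** * The map adapted to a partial Nijenhuis operator *)

Lemma near_all (I : finType) (T : topologicalType) (x : T) (P : I -> T -> Prop) :
  (forall i, \forall y \near x, P i y) -> \forall y \near x, forall i, P i y.
Proof. exact: filter_forall. Qed.

Lemma sum3 (V : nmodType) (F : 'I_3 -> V) : \sum_i F i = F 0 + F 1 + F 2%:R.
Proof.
rewrite !big_ord_recl big_ord0 addr0 addrA.
by congr (F _ + F _ + F _); apply/val_inj.
Qed.

Lemma sum2 (V : nmodType) (F : 'I_2 -> V) : \sum_i F i = F 0 + F 1.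
Proof. by rewrite !big_ord_recl big_ord0 addr0; congr (F _ + F _); apply/val_inj. Qed.

Lemma ord3P (P : 'I_3 -> Prop) : P 0 -> P 1 -> P 2%:R -> forall i, P i.
Proof.
move=> P0 P1 P2 [[|[|[|//]]] i]; [move: P0|move: P1|move: P2];
  by congr P; apply/val_inj.
Qed.

Lemma ord2P (P : 'I_2 -> Prop) : P 0 -> P 1 -> forall i, P i.
Proof. by move=> P0 P1 [[|[|//]] i]; [move: P0|move: P1]; congr P; apply/val_inj. Qed.

(* The identity (X x Y) . curl (X x Y) = - (X x Y) . [X, Y]; here xij stands
   for the derivative of the component X_j in the direction i. *)
Lemma cross_curl (A : comPzRingType) (x0 x1 x2 y0 y1 y2 x00 x01 x02 x10 x11 x12 x20 x21 x22
    y00 y01 y02 y10 y11 y12 y20 y21 y22 : A) :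
  let a0 := x1 * y2 - x2 * y1 in
  let a1 := x2 * y0 - x0 * y2 in
  let a2 := x0 * y1 - x1 * y0 in
  a0 * ((x10 * y1 + x0 * y11 - (x11 * y0 + x1 * y10)) - (x22 * y0 + x2 * y20 - (x20 * y2 + x0 * y22))) +
  a1 * ((x21 * y2 + x1 * y22 - (x22 * y1 + x2 * y21)) - (x00 * y1 + x0 * y01 - (x01 * y0 + x1 * y00))) +
  a2 * ((x02 * y0 + x2 * y00 - (x00 * y2 + x0 * y02)) - (x11 * y2 + x1 * y12 - (x12 * y1 + x2 * y11))) =
  - (a0 * (x0 * y00 - y0 * x00 + (x1 * y10 - y1 * x10) + (x2 * y20 - y2 * x20)) +
     a1 * (x0 * y01 - y0 * x01 + (x1 * y11 - y1 * x11) + (x2 * y21 - y2 * x21)) +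
     a2 * (x0 * y02 - y0 * x02 + (x1 * y12 - y1 * x12) + (x2 * y22 - y2 * x22))).
Proof. by cbv zeta; ring. Qed.

(** Here b is the inverse of a2 and xij is the derivative of a_j in the direction i. The form a_0
    dx_0 + a_1 dx_1 + a_2 dzeta has the kernel spanned by d/dx_i + c_i d/dzeta with c_i = - a_i b.
    The two sides of the compatibility condition for these slopes differ by b^2 times a . curl a:
    this is the Frobenius criterion for a 1-form. *)
Lemma cross_compat (A : comPzRingType) (a0 a1 a2 b x01 x02 x10 x12 x20 x21 x22 : A) :
  a0 * (x12 - x21) + a1 * (x20 - x02) + a2 * (x01 - x10) = 0 -> b * a2 = 1 ->
  - (x01 * b - a1 * (b * b * x02)) + (- (a0 * b)) * (- (x21 * b - a1 * (b * b * x22))) =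
  - (x10 * b - a0 * (b * b * x12)) + (- (a1 * b)) * (- (x20 * b - a0 * (b * b * x22))).
Proof.
move=> H ba; apply/eqP; rewrite -subr_eq0.
have -> : - (x01 * b - a1 * (b * b * x02)) + (- (a0 * b)) * (- (x21 * b - a1 * (b * b * x22))) -
  (- (x10 * b - a0 * (b * b * x12)) + (- (a1 * b)) * (- (x20 * b - a0 * (b * b * x22)))) =
  - (b * b) * (a0 * (x12 - x21) + a1 * (x20 - x02) + a2 * (x01 - x10)) +
  (b * a2 - 1) * (b * (x01 - x10)) by ring.
by rewrite H ba subrr mulr0 mul0r addr0.
Qed.

Definition bracket (R : realType) m (f g : 'rV[R]_m -> 'rV[R]_m) (y : 'rV[R]_m) : 'rV[R]_m :=
  dd g y (f y) - dd f y (g y).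

Lemma bracket_coord (R : realType) m (f g : 'rV[R]_m -> 'rV[R]_m) y k : (bracket f g y) 0 k =
  \sum_j (f y 0 j * (dd g y (delta_mx 0 j)) 0 k - g y 0 j * (dd f y (delta_mx 0 j)) 0 k).
Proof.
have H (h : 'rV[R]_m -> 'rV[R]_m) w : (dd h y w) 0 k = \sum_j w 0 j * (dd h y (delta_mx 0 j)) 0 k.
  by rewrite {1}(row_sum_delta w) dd_sum summxE; apply: eq_bigr => j _; rewrite ddZ mxE.
by rewrite /bracket !mxE !H -sumrB.
Qed.

Section AlgebraicForm.
Variables (R : realType) (S : calg R 3) (mu : 'rV[R]_3).
Local Notation "a ** b" := (amul S a b) (at level 40, left associativity).
Local Notation one := (aone S).
Local Notation V5 := 'rV[R]_(2 + 3).
Local Notation V3 := 'rV[R]_3.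

(** The directions in which functions on R^2 x S are differentiated: the two real ones and the unit
    of [S], whose derivative determines all the vertical ones by [CR]. *)
Definition slicevec (j : 'I_3) : V5 :=
  match val j with
  | 0%N => row_mx (delta_mx 0 0) 0
  | 1%N => row_mx (delta_mx 0 1) 0
  | _ => row_mx 0 one
  end.
Local Notation E := slicevec.

(* The slice zeta = y_2 * one, a copy of R^3 in R^2 x S. *)
Definition slice : {linear V3 -> V5} := lincomb slicevec.

Lemma slice_delta j : slice (delta_mx 0 j) = E j.
Proof.
rewrite /slice /= /lincomb (bigD1 j) //= big1 ?addr0 ?mxE ?eqxx ?scale1r // => i ij.
by rewrite mxE (negPf ij) andbF scale0r.
Qed.

Lemma slice_expand w : slice w = w 0 0 *: E 0 + w 0 1 *: E 1 + w 0 2%:R *: E 2%:R.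
Proof. by rewrite /slice /= /lincomb sum3. Qed.

Lemma sm_slice y : sm slice y.
Proof. exact: (sm_linrV slice (sm_id y)). Qed.

Lemma slice_near (P : V5 -> Prop) : (\forall z \near (0 : V5), P z) -> \forall y \near (0 : V3), P (slice y).
Proof. by move=> H; apply: (sm_cont (sm_slice 0)); rewrite linear0. Qed.

Lemma slice_derive (g : V5 -> V3) (f : V3 -> V3) k : sm g 0 -> sm f 0 ->
  (\forall y \near (0 : V3), g (slice y) = f y 0 k *: one) ->
  \forall y \near (0 : V3), forall j, dd g (slice y) (E j) = (dd f y (delta_mx 0 j)) 0 k *: one.
Proof.
move=> sg sf H; have ng := slice_near (sm_near sg); have nf := sm_near sf.
near=> y => j.
have dg : differentiable g (slice y) by apply: sm_diff; near: y; exact: ng.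
have df : differentiable f y by apply: sm_diff; near: y; exact: nf.
have Hy : \forall y' \near y, g (slice y') = f y' 0 k *: one by near: y; exact: nbhs_interior H.
have ds : differentiable slice y by exact/sm_diff/sm_slice.
have dc : differentiable (fun y' => f y' 0 k) y by move/differentiable_rVP: df.
have dgs : differentiable (fun y' => g (slice y')) y by exact: differentiable_comp.
have := dd_near (delta_mx 0 j) Hy dgs.
rewrite (dd_comp _ ds dg) dd_linear slice_delta => <-.
by rewrite (dd_scale _ dc (differentiable_cst _ _)) dd_cst scaler0 addr0 dd_coord.
Unshelve. all: by end_near. Qed.

(** The bracket of X_0 and X_1 is quadratic in mu; its coefficients are the three brackets that
    occur in the partial Nijenhuis conditions. *)
Definition aquad (a b c : R) : V3 := a *: one - b *: mu + c *: (mu ** mu).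
Definition apair (a b : R) : V3 := a *: one - b *: mu.

Lemma apairM a b c e : apair a b ** apair c e = aquad (a * c) (a * e + b * c) (b * e).
Proof.
rewrite /apair /aquad amulBr !(amulC S (_ - _)) !amulBr !amulZr !amulZl amul1 amul1r !scalerA.
by apply/rowP => i; rewrite amul1 !mxE; ring.
Qed.

Lemma aquadB a b c a' b' c' : aquad a b c - aquad a' b' c' = aquad (a - a') (b - b') (c - c').
Proof. by apply/rowP => i; rewrite /aquad !mxE; ring. Qed.
Lemma aquadD a b c a' b' c' : aquad a b c + aquad a' b' c' = aquad (a + a') (b + b') (c + c').
Proof. by apply/rowP => i; rewrite /aquad !mxE; ring. Qed.

(* V i k and U i k extend the k-th components of v_i and of u_i = J v_i off the slice. *)
Variables (v u : 'I_2 -> V3 -> V3) (V U : 'I_2 -> 'I_3 -> V5 -> V3).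
(** The class in which the extensions live. [C_id] is unique continuation from the slice; the
    closure properties are those that put the cross product paired with the bracket in the class. *)
Variable C : (V5 -> V3) -> Prop.

Hypothesis sv : forall i, sm (v i) 0.
Hypothesis su : forall i, sm (u i) 0.
Hypothesis exV : forall i k, \forall y \near (0 : V3), V i k (slice y) = v i y 0 k *: one.
Hypothesis exU : forall i k, \forall y \near (0 : V3), U i k (slice y) = u i y 0 k *: one.
Hypothesis C_CRsm : forall f, C f -> CRsm S f.
Hypothesis C_cst : forall a, C (fun=> a).
Hypothesis C_sub : forall f g, C f -> C g -> C (fun z => f z - g z).
Hypothesis C_amul : forall f g, C f -> C g -> C (fun z => f z ** g z).
Hypothesis C_id : forall f, C f -> (\forall y \near (0 : V3), f (slice y) = 0) ->
  \forall z \near (0 : V5), f z = 0.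
Hypothesis CV : forall i k, C (V i k).
Hypothesis CU : forall i k, C (U i k).
Hypothesis CdV : forall i k j, C (fun z => dd (V i k) z (E j)).
Hypothesis CdU : forall i k j, C (fun z => dd (U i k) z (E j)).
Hypothesis v00 : v 0 0 = delta_mx 0 1.
Hypothesis v10 : v 1 0 = delta_mx 0 2%:R.
Hypothesis u00 : u 0 0 = delta_mx 0 0.
Hypothesis u10 : u 1 0 = delta_mx 0 1.
Hypothesis mu_indep : forall w : V3,
  w 0 2%:R *: one + w 0 1 *: mu + w 0 0 *: (mu ** mu) = 0 -> w = 0.
(** The partial Nijenhuis conditions on a frame: [a] holds the coefficients of [v_0, v_1] and [b]
    those of the deformed bracket, whose image by J is [u_0, u_1]. *)
Hypothesis nij : \forall y \near (0 : V3), exists a b : 'I_2 -> R,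
  [/\ bracket (v 0) (v 1) y = \sum_i a i *: v i y,
      bracket (u 0) (v 1) y + bracket (v 0) (u 1) y = \sum_i (a i *: u i y + b i *: v i y) &
      bracket (u 0) (u 1) y = \sum_i b i *: u i y].

(* X_i = u_i - mu v_i, and (al0, al1, al2) is the cross product of X_0 and X_1. *)
Definition Xf i k (z : V5) : V3 := U i k z - mu ** V i k z.
Definition br5 k (z : V5) : V3 :=
  \sum_j (Xf 0 j z ** dd (Xf 1 k) z (E j) - Xf 1 j z ** dd (Xf 0 k) z (E j)).
Definition al0 z := Xf 0 1 z ** Xf 1 2%:R z - Xf 0 2%:R z ** Xf 1 1 z.
Definition al1 z := Xf 0 2%:R z ** Xf 1 0 z - Xf 0 0 z ** Xf 1 2%:R z.
Definition al2 z := Xf 0 0 z ** Xf 1 1 z - Xf 0 1 z ** Xf 1 0 z.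

Lemma CX i k : C (Xf i k).
Proof. by apply: C_sub => //; exact: (C_amul (C_cst mu)). Qed.

Lemma sm_V i k : sm (V i k) 0. Proof. by have [] := C_CRsm (CV i k). Qed.
Lemma sm_U i k : sm (U i k) 0. Proof. by have [] := C_CRsm (CU i k). Qed.
Lemma sm_Xf i k : sm (Xf i k) 0. Proof. by have [] := C_CRsm (CX i k). Qed.

Lemma dd_X i k z w : sm (U i k) z -> sm (V i k) z ->
  dd (Xf i k) z w = dd (U i k) z w - mu ** dd (V i k) z w.
Proof.
move=> /sm_diff dU sV; have dV := sm_diff sV.
have dm : differentiable (fun z => mu ** V i k z) z.
  by apply/sm_diff/sm_amul; [exact: sm_cst|exact: sV].
by rewrite dd_sub // dd_amul ?dd_cst ?amul0l ?add0r //; exact: differentiable_cst.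
Qed.

Lemma C_sum3 (F : 'I_3 -> V5 -> V3) : (forall j, C (F j)) -> C (fun z => \sum_j F j z).
Proof.
have Cadd f g : C f -> C g -> C (fun z => f z + g z).
  move=> Cf Cg; have -> : (fun z => f z + g z) = (fun z => f z - (0 - g z)).
    by apply/funext => z; rewrite sub0r opprK.
  by apply: C_sub => //; apply: C_sub.
move=> CF; have -> : (fun z => \sum_j F j z) = (fun z => (F 0 z + F 1 z) + F 2%:R z).
  by apply/funext => z; rewrite sum3.
by apply: (Cadd (fun z => F 0 z + F 1 z)) => //; exact: (Cadd (F 0)).
Qed.

(* [al0, al1, al2] annihilates the bracket on the real slice, hence near 0. *)
Lemma integrable : \forall z \near (0 : V5),
  al0 z ** br5 0 z + al1 z ** br5 1 z + al2 z ** br5 2%:R z = 0.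
Proof.
pose G z := \sum_k (if k == 0 then al0 z else if k == 1 then al1 z else al2 z) ** br5 k z.
have EG z : al0 z ** br5 0 z + al1 z ** br5 1 z + al2 z ** br5 2%:R z = G z by rewrite /G sum3.
have Cdd i k j : C (fun z => dd (U i k) z (E j) - mu ** dd (V i k) z (E j)).
  by apply: C_sub => //; exact: (C_amul (C_cst mu)).
(* [bb] agrees with [br5] near 0, where [U] and [V] are differentiable. As [C] is a class of
   functions and not of germs, the identity is continued for [bb], whose terms are in [C]
   globally. *)
pose bb k z := \sum_j (Xf 0 j z ** (dd (U 1 k) z (E j) - mu ** dd (V 1 k) z (E j))
    - Xf 1 j z ** (dd (U 0 k) z (E j) - mu ** dd (V 0 k) z (E j))).
have Cbb k : C (bb k) by apply: C_sum3 => j; apply: C_sub; apply: C_amul => //; exact: CX.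
pose H z := \sum_k (if k == 0 then al0 z else if k == 1 then al1 z else al2 z) ** bb k z.
have CH : C H.
  apply: C_sum3 => k; apply: C_amul; last exact: Cbb.
  by case: (k == 0); [|case: (k == 1)]; apply: C_sub; apply: C_amul; exact: CX.
have Ebb : \forall z \near (0 : V5), forall k, br5 k z = bb k z.
  have nU i k := sm_near (sm_U i k); have nV i k := sm_near (sm_V i k).
  have nU' : \forall z \near (0 : V5), forall k i, sm (U i k) z.
    by apply: near_all => k; apply: near_all => i; exact: nU.
  have nV' : \forall z \near (0 : V5), forall k i, sm (V i k) z.
    by apply: near_all => k; apply: near_all => i; exact: nV.
  near=> z => k.
  have sUz : forall k i, sm (U i k) z by near: z; exact: nU'.
  have sVz : forall k i, sm (V i k) z by near: z; exact: nV'.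
  by apply: eq_bigr => j _; rewrite !dd_X.
have EH : \forall z \near (0 : V5), G z = H z.
  near=> z; apply: eq_bigr => k _; congr (_ ** _).
  have : forall k, br5 k z = bb k z by near: z; exact: Ebb.
  exact.
suff HH : \forall z \near (0 : V5), H z = 0.
  near=> z; rewrite EG; apply: (@etrans _ _ (H z)); near: z; [exact: EH|exact: HH].
apply: C_id => //.
have EV : \forall y \near (0 : V3), forall k i, V i k (slice y) = v i y 0 k *: one.
  by apply: near_all => k; apply: near_all => i; exact: exV.
have EU : \forall y \near (0 : V3), forall k i, U i k (slice y) = u i y 0 k *: one.
  by apply: near_all => k; apply: near_all => i; exact: exU.
have DV : \forall y \near (0 : V3), forall k i j, dd (V i k) (slice y) (E j) = (dd (v i) y (delta_mx 0 j)) 0 k *: one.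
  by apply: near_all => k; apply: near_all => i; exact: (slice_derive (sm_V i k) (sv i) (exV i k)).
have DU : \forall y \near (0 : V3), forall k i j, dd (U i k) (slice y) (E j) = (dd (u i) y (delta_mx 0 j)) 0 k *: one.
  by apply: near_all => k; apply: near_all => i; exact: (slice_derive (sm_U i k) (su i) (exU i k)).
near=> y.
have EVy : forall k i, V i k (slice y) = v i y 0 k *: one by near: y; exact: EV.
have EUy : forall k i, U i k (slice y) = u i y 0 k *: one by near: y; exact: EU.
have DVy : forall k i j, dd (V i k) (slice y) (E j) = (dd (v i) y (delta_mx 0 j)) 0 k *: one.
  by near: y; exact: DV.
have DUy : forall k i j, dd (U i k) (slice y) (E j) = (dd (u i) y (delta_mx 0 j)) 0 k *: one.
  by near: y; exact: DU.
have EX i k : Xf i k (slice y) = apair (u i y 0 k) (v i y 0 k).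
  by rewrite /Xf EUy EVy amulZr amul1r.
have [a [b [B1 B2 B3]]] : exists a b : 'I_2 -> R,
  [/\ bracket (v 0) (v 1) y = \sum_i a i *: v i y,
      bracket (u 0) (v 1) y + bracket (v 0) (u 1) y = \sum_i (a i *: u i y + b i *: v i y) &
      bracket (u 0) (u 1) y = \sum_i b i *: u i y] by near: y; exact: nij.
(* On the slice the three relations say together that [X_0, X_1] is the combination of the X_i with
   coefficients b_i - a_i mu. *)
have EB k : bb k (slice y) = \sum_i apair (b i) (a i) ** Xf i k (slice y).
  pose dv i j := (dd (v i) y (delta_mx 0 j)) 0 k; pose du i j := (dd (u i) y (delta_mx 0 j)) 0 k.
  have -> : bb k (slice y) = aquad ((bracket (u 0) (u 1) y) 0 k)
      ((bracket (u 0) (v 1) y + bracket (v 0) (u 1) y) 0 k) ((bracket (v 0) (v 1) y) 0 k).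
    rewrite [in X in aquad _ X _]mxE !bracket_coord.
    have -> : bb k (slice y) = \sum_j (apair (u 0 y 0 j) (v 0 y 0 j) ** apair (du 1 j) (dv 1 j)
        - apair (u 1 y 0 j) (v 1 y 0 j) ** apair (du 0 j) (dv 0 j)).
      by apply: eq_bigr => j _; rewrite !EX !DUy !DVy !amulZr !amul1r.
    rewrite !sum3 !apairM !aquadB !aquadD; congr aquad; rewrite /du /dv; ring.
  rewrite B1 B2 B3 !sum2 !EX !apairM aquadD; congr aquad; rewrite !mxE; ring.
rewrite /H !sum3 /= !EB !sum2 /al0 /al1 /al2.
move: (Xf 0 0 _) (Xf 0 1 _) (Xf 0 2%:R _) (Xf 1 0 _) (Xf 1 1 _) (Xf 1 2%:R _) (apair _ _) (apair _ _).
have Er (A : comPzRingType) (x0 x1 x2 y0 y1 y2 p q : A) :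
  (x1 * y2 - x2 * y1) * (p * x0 + q * y0) + (x2 * y0 - x0 * y2) * (p * x1 + q * y1)
   + (x0 * y1 - x1 * y0) * (p * x2 + q * y2) = 0 by ring.
move=> *; exact: (Er (asort S)).
Unshelve. all: by end_near. Qed.

Lemma Xf0 i k : Xf i k 0 = apair (u i 0 0 k) (v i 0 0 k).
Proof.
have := nbhs_singleton (exV i k); have := nbhs_singleton (exU i k).
by rewrite linear0 /Xf => -> ->; rewrite amulZr amul1r.
Qed.

Lemma al_0 : [/\ al0 0 = mu ** mu, al1 0 = mu & al2 0 = one].
Proof.
rewrite /al0 /al1 /al2 !Xf0 !u00 !u10 !v00 !v10 !apairM !aquadB !mxE /=.
by split; apply/rowP => i; rewrite !mxE; ring.
Qed.

Lemma C_al0 : C al0. Proof. by apply: C_sub; apply: C_amul; exact: CX. Qed.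
Lemma C_al1 : C al1. Proof. by apply: C_sub; apply: C_amul; exact: CX. Qed.
Lemma C_al2 : C al2. Proof. by apply: C_sub; apply: C_amul; exact: CX. Qed.

(** The slopes of the span of X_0 and X_1 over the two real directions: this span is the kernel of
    the form with coefficients [al0], [al1], [al2]. *)
Definition cf (i : 'I_2) z : V3 := - ((if i == 0 then al0 z else al1 z) ** ainv S (al2 z)).

Lemma CRsm_cf i : CRsm S (cf i).
Proof.
have Ci : CRsm S (fun z => ainv S (al2 z)).
  by apply: CRsm_ainv; [exact: C_CRsm C_al2|have [_ _] := al_0].
have -> : cf i = (fun z => 0 - (if i == 0 then al0 z else al1 z) ** ainv S (al2 z)).
  by apply/funext => z; rewrite sub0r.
apply: CRsm_sub; first exact: CRsm_cst.
by apply: CRsm_amul => //; case: (i == 0); apply: C_CRsm; [exact: C_al0|exact: C_al1].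
Qed.

Lemma dd_cross (f g h e : V5 -> V3) (z w : V5) : sm f z -> sm g z -> sm h z -> sm e z ->
  dd (fun z => f z ** g z - h z ** e z) z w =
  dd f z w ** g z + f z ** dd g z w - (dd h z w ** e z + h z ** dd e z w).
Proof.
move=> sf sg sh se.
rewrite -(dd_amul S _ (sm_diff sf) (sm_diff sg)) -(dd_amul S _ (sm_diff sh) (sm_diff se)).
exact: (dd_sub _ (sm_diff (sm_amul S sf sg)) (sm_diff (sm_amul S sh se))).
Qed.

(** By [cross_curl] this is [integrable] up to sign. *)
Lemma curl_free : \forall z \near (0 : V5),
  al0 z ** (dd al2 z (E 1) - dd al1 z (E 2%:R)) +
  al1 z ** (dd al0 z (E 2%:R) - dd al2 z (E 0)) +
  al2 z ** (dd al1 z (E 0) - dd al0 z (E 1)) = 0.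
Proof.
have nX : \forall z \near (0 : V5), forall k i, sm (Xf i k) z.
  by apply: near_all => k; apply: near_all => i; exact: sm_near (sm_Xf i k).
near=> z.
have dX i k : sm (Xf i k) z.
  by have : forall k i, sm (Xf i k) z by near: z; exact: nX.
have : al0 z ** br5 0 z + al1 z ** br5 1 z + al2 z ** br5 2%:R z = 0 by near: z; exact: integrable.
have e0 w : dd al0 z w = _ := dd_cross w (dX 0 1) (dX 1 2%:R) (dX 0 2%:R) (dX 1 1).
have e1 w : dd al1 z w = _ := dd_cross w (dX 0 2%:R) (dX 1 0) (dX 0 0) (dX 1 2%:R).
have e2 w : dd al2 z w = _ := dd_cross w (dX 0 0) (dX 1 1) (dX 0 1) (dX 1 0).
have Er := @cross_curl (asort S).
rewrite /br5 !sum3 !e0 !e1 !e2 => H; apply: (etrans (Er _ _ _ _ _ _ _ _ _ _ _ _ _ _ _ _ _ _ _ _ _ _ _ _)).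
apply/eqP; rewrite oppr_eq0; apply/eqP; exact: H.
Unshelve. all: by end_near. Qed.

(** By [CR], the derivative along the fibre vector [cf i] is [cf i] times the derivative along the
    unit; [cross_compat] then reduces the condition to [curl_free]. *)
Lemma cf_compat : \forall z \near (0 : V5), forall i j,
  'd (cf j) z (row_mx (delta_mx 0 i) (cf i z)) = 'd (cf i) z (row_mx (delta_mx 0 j) (cf j z)).
Proof.
have [_ c0] := CRsm_cf 0; have [_ c1] := CRsm_cf 1.
have [s0 _] := C_CRsm C_al0; have [s1 _] := C_CRsm C_al1; have [s2 _] := C_CRsm C_al2.
have [_ _ a20] := al_0; have [si ni] := sm_ainv s2 a20.
have n0 := sm_near s0; have n1 := sm_near s1; have n2 := sm_near s2; have nsi := sm_near si.
near=> z.
have K0 : CR S (cf 0) z by near: z; exact: c0.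
have K1 : CR S (cf 1) z by near: z; exact: c1.
have d0 : sm al0 z by near: z; exact: n0.
have d1 : sm al1 z by near: z; exact: n1.
have d2 : sm al2 z by near: z; exact: n2.
have di : sm (fun z => ainv S (al2 z)) z by near: z; exact: nsi.
have nz : \forall z' \near z, ainv S (al2 z') ** al2 z' = one by near: z; exact: nbhs_interior ni.
have curl : al0 z ** (dd al2 z (E 1) - dd al1 z (E 2%:R)) +
  al1 z ** (dd al0 z (E 2%:R) - dd al2 z (E 0)) +
  al2 z ** (dd al1 z (E 0) - dd al0 z (E 1)) = 0 by near: z; exact: curl_free.
have main : dd (cf 1) z (row_mx (delta_mx 0 0) (cf 0 z)) = dd (cf 0) z (row_mx (delta_mx 0 1) (cf 1 z)).
  have sp i h : row_mx (delta_mx 0 i) h = row_mx (delta_mx 0 i) 0 + row_mx 0 h :> V5.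
    by rewrite add_row_mx addr0 add0r.
  rewrite (sp 0) (sp 1) !ddD (CRE K0) (CRE K1).
  rewrite -[row_mx 0 one]/(E 2%:R) -[row_mx (delta_mx 0 0) 0]/(E 0) -[row_mx (delta_mx 0 1) 0]/(E 1).
  have dcf (f : V5 -> V3) w : sm f z -> dd (fun z => - (f z ** ainv S (al2 z))) z w =
      - (dd f z w ** ainv S (al2 z) - f z ** (ainv S (al2 z) ** ainv S (al2 z) ** dd al2 z w)).
    move=> sf; have dN (g : V5 -> V3) : sm g z -> dd (fun z => - g z) z w = - dd g z w.
      move=> sg; have -> : (fun z => - g z) = (fun z => 0 - g z) by apply/funext => z'; rewrite sub0r.
      by rewrite (dd_sub _ (differentiable_cst _ _) (sm_diff sg)) dd_cst sub0r.
    rewrite (dN _ (sm_amul S sf di)) (dd_amul S _ (sm_diff sf) (sm_diff di)).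
    congr (- (_ + _)); rewrite (dd_ainv _ d2 di nz); exact: (@mulrN (asort S)).
  rewrite !(dcf al0 _ d0) !(dcf al1 _ d1).
  exact: (@cross_compat (asort S) _ _ _ _ _ _ _ _ _ _ _ curl (nbhs_singleton nz)).
have : forall i j, dd (cf j) z (row_mx (delta_mx 0 i) (cf i z)) = dd (cf i) z (row_mx (delta_mx 0 j) (cf j z)).
  by apply: ord2P; apply: ord2P.
move=> H i j; exact: (etrans (esym (ddE _ _ _)) (etrans (H i j) (ddE _ _ _))).
Unshelve. all: by end_near. Qed.

Theorem adapted_map : exists f : V3 -> V3, [/\ sm f 0,
  \forall y \near (0 : V3), forall i, dd f y (u i y) = dd f y (v i y) ** mu &
  forall w, dd f 0 w = 0 -> w = 0].
Proof.
have sc i : sm (cf i) 0 by have [] := CRsm_cf i.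
have [F [sF F0 Fc FA]] := frobenius sc cf_compat.
have CRc : \forall z \near (0 : V5), forall i, CR S (cf i) z.
  by apply: near_all => i; have [] := CRsm_cf i.
(* The matrix given to [frobenius] is the multiplication by [mu], which commutes with the vertical
   derivatives of the slopes by [CR]. *)
have FM : \forall z \near (0 : V5), forall h, dd F z (row_mx 0 (h ** mu)) = dd F z (row_mx 0 h) ** mu.
  have H : \forall z \near (0 : V5), forall i h, 'd (cf i) z (row_mx 0 (h *m mulmat S mu)) =
      'd (cf i) z (row_mx 0 h) *m mulmat S mu.
    near=> z => i h.
    have K : CR S (cf i) z by move: i; near: z; exact: CRc.
    rewrite !mulmatE; apply: (etrans (esym (ddE _ _ _))).
    rewrite (CRE K); apply: esym.
    apply: (@etrans _ _ (dd (cf i) z (row_mx 0 h) ** mu)); first by rewrite ddE.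
    rewrite (CRE K) -!(amulA S); congr (_ ** _); exact: (amulC S).
  have := FA _ H; apply: filterS => z Hz h.
  by have := Hz h; rewrite -!ddE !mulmatE.
have Fh : \forall z \near (0 : V5), forall i, dd F z (row_mx (delta_mx 0 i) 0) = - dd F z (row_mx 0 (cf i z)).
  apply: filterS Fc => z Hz i; have := Hz i; rewrite -ddE => H.
  apply/eqP; rewrite -subr_eq0 opprK -ddD; apply/eqP.
  by rewrite add_row_mx addr0 add0r.
(* Modulo the kernel of the differential of F, the slice vector with components w is the vertical
   vector [th z w]. *)
pose th z (w : V3) := w 0 2%:R *: one - w 0 0 *: cf 0 z - w 0 1 *: cf 1 z.
have sFs : sm (fun y => F (slice y)) 0 by apply: (sm_comp (sm_slice 0)); rewrite linear0.
have dFs : \forall y \near (0 : V3), forall w,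
    dd (fun y => F (slice y)) y w = dd F (slice y) (row_mx 0 (th (slice y) w)).
  have nF := slice_near (sm_near sF); have nFh := slice_near Fh.
  near=> y => w.
  have dF : differentiable F (slice y) by apply: sm_diff; near: y; exact: nF.
  have Hh : forall i, dd F (slice y) (row_mx (delta_mx 0 i) 0) = - dd F (slice y) (row_mx 0 (cf i (slice y))).
    by near: y; exact: nFh.
  rewrite (dd_comp _ (sm_diff (sm_slice y)) dF) dd_linear (slice_expand w) !ddD !ddZ.
  rewrite -[E 0]/(row_mx (delta_mx 0 0) 0) -[E 1]/(row_mx (delta_mx 0 1) 0) -[E 2%:R]/(row_mx 0 one) !Hh.
  rewrite /th.
  have rZ a (h : V3) : row_mx 0 (a *: h) = a *: row_mx 0 h :> V5 by rewrite scale_row_mx scaler0.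
  have rB (h h' : V3) : row_mx 0 (h - h') = row_mx 0 h - row_mx 0 h' :> V5.
    by rewrite opp_row_mx add_row_mx subr0.
  rewrite !rB !rZ !ddB !ddZ !scalerN; set p := _ *: _; set q := _ *: _; set r := _ *: _.
  by rewrite addrC addrA.
exists (fun y => F (slice y)); split; first exact: sFs.
  have EV : \forall y \near (0 : V3), forall k i, V i k (slice y) = v i y 0 k *: one.
    by apply: near_all => k; apply: near_all => i; exact: exV.
  have EU : \forall y \near (0 : V3), forall k i, U i k (slice y) = u i y 0 k *: one.
    by apply: near_all => k; apply: near_all => i; exact: exU.
  have [s2 _] := C_CRsm C_al2; have [_ _ a20] := al_0; have [si /slice_near ni] := sm_ainv s2 a20.
  have nFM := slice_near FM.
  near=> y => i.
  have EVy : forall k i, V i k (slice y) = v i y 0 k *: one by near: y; exact: EV.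
  have EUy : forall k i, U i k (slice y) = u i y 0 k *: one by near: y; exact: EU.
  have inv : ainv S (al2 (slice y)) ** al2 (slice y) = one by near: y; exact: ni.
  have D w : dd (fun y => F (slice y)) y w = dd F (slice y) (row_mx 0 (th (slice y) w)).
    by move: w; near: y; exact: dFs.
  have M h : dd F (slice y) (row_mx 0 (h ** mu)) = dd F (slice y) (row_mx 0 h) ** mu.
    by move: h; near: y; exact: nFM.
  rewrite !D -M; congr (dd F _ (row_mx 0 _)).
  (* [th] is the pairing with the cross product divided by [al2]. It is orthogonal to X_i = u_i - mu
     v_i, hence th(u_i) = mu th(v_i). *)
  have thE w : th (slice y) w = ainv S (al2 (slice y)) ** (al0 (slice y) ** (w 0 0 *: one) +
      al1 (slice y) ** (w 0 1 *: one) + al2 (slice y) ** (w 0 2%:R *: one)).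
    rewrite /th /cf /= !amulDr !amulZr !amul1r inv !scalerN !opprK.
    by rewrite !(amulC S (ainv S _)) -addrA addrC.
  rewrite !thE; apply/eqP; rewrite -subr_eq0; apply/eqP.
  have Xz : al0 (slice y) ** Xf i 0 (slice y) + al1 (slice y) ** Xf i 1 (slice y) + al2 (slice y) ** Xf i 2%:R (slice y) = 0.
    move: i; apply: ord2P; rewrite /al0 /al1 /al2.
      have Er (A : comPzRingType) (x0 x1 x2 y0 y1 y2 : A) :
        (x1 * y2 - x2 * y1) * x0 + (x2 * y0 - x0 * y2) * x1 + (x0 * y1 - x1 * y0) * x2 = 0 by ring.
      exact: (Er (asort S)).
    have Er (A : comPzRingType) (x0 x1 x2 y0 y1 y2 : A) :
      (x1 * y2 - x2 * y1) * y0 + (x2 * y0 - x0 * y2) * y1 + (x0 * y1 - x1 * y0) * y2 = 0 by ring.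
    exact: (Er (asort S)).
  rewrite -!EUy -!EVy.
  move: Xz; rewrite /Xf => Xz.
  have Er (A : comPzRingType) (b a0 a1 a2 u0 u1 u2 v0 v1 v2 m : A) :
    a0 * (u0 - m * v0) + a1 * (u1 - m * v1) + a2 * (u2 - m * v2) = 0 ->
    b * (a0 * u0 + a1 * u1 + a2 * u2) - b * (a0 * v0 + a1 * v1 + a2 * v2) * m = 0.
    move=> H; have -> : b * (a0 * u0 + a1 * u1 + a2 * u2) - b * (a0 * v0 + a1 * v1 + a2 * v2) * m =
      b * (a0 * (u0 - m * v0) + a1 * (u1 - m * v1) + a2 * (u2 - m * v2)) by ring.
    by rewrite H mulr0.
  exact: (Er (asort S) _ _ _ _ _ _ _ _ _ _ _ Xz).
move=> w; rewrite (nbhs_singleton dFs) linear0.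
(* F is the identity on the fibre over 0. *)
have -> h : dd F 0 (row_mx 0 h) = h.
  pose L : {linear V3 -> V5} := lincomb (fun j => row_mx 0 (delta_mx 0 j)).
  have LE x : L x = row_mx 0 x.
    rewrite /L /= /lincomb {2}(row_sum_delta x).
    have -> : row_mx 0 (\sum_j x 0 j *: delta_mx 0 j) = \sum_j row_mx 0 (x 0 j *: delta_mx 0 j) :> V5.
      by rewrite sum_row_mx big1_eq.
    by apply: eq_bigr => j _; rewrite scale_row_mx scaler0.
  have F0' : \forall h \near (0 : V3), h = F (L h) by apply: filterS F0 => x; rewrite LE.
  have := dd_near h F0' (sm_diff (sm_id 0)).
  have dF0 : differentiable F (L 0) by rewrite linear0; exact: sm_diff.
  have e2 : dd (fun y => L y) 0 h = L h := dd_linear L 0 h.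
  rewrite (dd_comp h (sm_diff (sm_linrV L (sm_id 0))) dF0) e2 linear0 LE => ->.
  exact: (dd_linear (@idfun V3)).
have [a0 a1 a2] := al_0; move=> H; apply: mu_indep; rewrite -[RHS]H /th /cf a0 a1 a2 /=.
have -> : ainv S one = one by rewrite -[LHS](amul1r S) ainvP // mulmat1 unitmx1.
by rewrite !amul1r !scalerN !opprK -!addrA; congr (_ + _); rewrite addrC.
Unshelve. all: by end_near. Qed.

End AlgebraicForm.

(** * The algebras of the four types *)

Section Extensions.
Variable R : realType.
Local Notation V5 := 'rV[R]_(2 + 3).
Local Notation V3 := 'rV[R]_3.

Definition vec3 (a b c : R) : V3 := \row_j nth 0 [:: a; b; c] j.

Lemma vec30 a b c : vec3 a b c 0 0 = a. Proof. by rewrite mxE. Qed.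
Lemma vec31 a b c : vec3 a b c 0 1 = b. Proof. by rewrite mxE. Qed.
Lemma vec32 a b c : vec3 a b c 0 2%:R = c. Proof. by rewrite mxE. Qed.
Definition vec3E := (vec30, vec31, vec32).

Lemma rowP3 (x y : V3) : x 0 0 = y 0 0 -> x 0 1 = y 0 1 -> x 0 2%:R = y 0 2%:R -> x = y.
Proof. by move=> E0 E1 E2; apply/rowP; exact: ord3P. Qed.

Lemma sm_vec3 m (a b c : 'rV[R]_m -> R) x : sm a x -> sm b x -> sm c x ->
  sm (fun y => vec3 (a y) (b y) (c y)) x.
Proof.
move=> sa sb sc; apply/sm_rVP; apply: ord3P;
  [apply: (sm_eq _ sa)|apply: (sm_eq _ sb)|apply: (sm_eq _ sc)]; near=> y;
  by rewrite vec3E.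
Unshelve. all: by end_near. Qed.

(* The real point (x_0, x_1, zeta_j) below z = (x_0, x_1, zeta). *)
Definition proj3 (j : 'I_3) (z : V5) : V3 := vec3 (lsubmx z 0 0) (lsubmx z 0 1) (rsubmx z 0 j).

Lemma proj3_is_linear j : linear (proj3 j).
Proof. by move=> a x y; apply: rowP3; rewrite !mxE /= ?mxE. Qed.
HB.instance Definition _ j := GRing.isLinear.Build R V5 V3 _ (proj3 j) (proj3_is_linear j).

Lemma proj3_vert j (h : V3) : proj3 j (row_mx 0 h) = h 0 j *: delta_mx 0 2%:R.
Proof. by rewrite /proj3 row_mxKl row_mxKr; apply: rowP3; rewrite vec3E !mxE ?mulr0 ?mulr1. Qed.

Section Slice.
Variable S : calg R 3.
Local Notation one := (aone S).
Local Notation "a ** b" := (amul S a b) (at level 40, left associativity).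

Lemma sliceE y : slice S y = row_mx (\row_j nth 0 [:: y 0 0; y 0 1] j) (y 0 2%:R *: one).
Proof.
rewrite slice_expand /slicevec /= !scale_row_mx !add_row_mx !scaler0 !add0r addr0.
by congr row_mx; apply/rowP; apply: ord2P; rewrite !mxE /= ?mulr1 ?mulr0 ?addr0 ?add0r.
Qed.

Lemma proj3_slice j y : one 0 j = 1 -> proj3 j (slice S y) = y.
Proof.
by move=> o1; rewrite sliceE /proj3 row_mxKl row_mxKr; apply: rowP3; rewrite vec3E !mxE // o1 mulr1.
Qed.

Lemma slice_proj3 j z : z - slice S (proj3 j z) = row_mx 0 (rsubmx z - rsubmx z 0 j *: one).
Proof.
rewrite sliceE vec3E -{1}(hsubmxK z) opp_row_mx add_row_mx /proj3 !vec3E; congr row_mx.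
by apply/rowP; apply: ord2P; rewrite !mxE /= subrr.
Qed.

(* The segment from the real point below z to z is vertical. *)
Lemma slice_const_on (Q : set V3) (G : V5 -> V3) (j l : 'I_3) : sm G 0 -> one 0 j = 1 ->
  (\forall z \near (0 : V5), forall h : V3, Q h -> (dd G z (row_mx 0 h)) 0 l = 0) ->
  (\forall y \near (0 : V3), G (slice S y) 0 l = 0) ->
  \forall z \near (0 : V5), Q (rsubmx z - rsubmx z 0 j *: one) -> G z 0 l = 0.
Proof.
move=> sG o1 Dz Gz; have nG := sm_near sG.
have /nbhs_ballP[e /= e0 He] : \forall z \near (0 : V5), differentiable G z /\
    forall h : V3, Q h -> (dd G z (row_mx 0 h)) 0 l = 0.
  by near=> z; split; [apply: sm_diff|]; near: z.
pose P : {linear V5 -> V3} := proj3 j.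
have sL x : sm (fun z => P z) x by exact: (sm_linrV P (sm_id x)).
have nP (T : V3 -> Prop) : (\forall y \near (0 : V3), T y) -> \forall z \near (0 : V5), T (P z).
  by move=> H; apply: (sm_cont (sL 0)); rewrite linear0.
have nb : \forall z \near (0 : V5), ball 0 e (slice S (P z)).
  by apply: (nP (fun y => ball 0 e (slice S y))); apply: slice_near; exact: nbhsx_ballx.
near=> z => hj.
have bz : ball (0 : V5) e z by near: z; exact: nbhsx_ballx.
have bs : ball (0 : V5) e (slice S (P z)) by near: z; exact: nb.
have Gs : G (slice S (P z)) 0 l = 0 by near: z; exact: (nP (fun y => G (slice S y) 0 l = 0)).
pose h : V3 := rsubmx z - rsubmx z 0 j *: one.
have := @segMVT _ _ (fun z => G z 0 l) (slice S (P z)) z.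
case=> [t t01|t t01].
  by have [dG _] := He _ (ball_seg bs bz t01); move/differentiable_rVP: dG.
have [dG E] := He _ (ball_seg bs bz t01).
have hE : row_mx 0 h = z - slice S (P z) by rewrite slice_proj3.
by rewrite Gs subr0 => ->; rewrite -ddE -dd_coord // -{2}hE; exact: (E h hj).
Unshelve. all: by end_near. Qed.

Lemma slice_const (G : V5 -> V3) (j l : 'I_3) : sm G 0 -> one 0 j = 1 ->
  (\forall z \near (0 : V5), forall h : V3, h 0 j = 0 -> (dd G z (row_mx 0 h)) 0 l = 0) ->
  (\forall y \near (0 : V3), G (slice S y) 0 l = 0) ->
  \forall z \near (0 : V5), G z 0 l = 0.
Proof.
move=> sG o1 H Gz; apply: filterS (slice_const_on sG o1 H Gz) => z; apply.
by rewrite !mxE o1 mulr1 subrr.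
Qed.

End Slice.

Lemma dd_proj3 (f : V3 -> V3) j z w : differentiable f (proj3 j z) ->
  dd (fun z => f (proj3 j z)) z w = dd f (proj3 j z) (proj3 j w).
Proof.
move=> df; pose P : {linear V5 -> V3} := proj3 j.
have dP : differentiable P z by exact/sm_diff/(sm_linrV P (sm_id z)).
by rewrite (dd_comp w dP df) dd_linear.
Qed.

Lemma near_proj3 j (Q : V3 -> Prop) : (\forall y \near (0 : V3), Q y) ->
  \forall z \near (0 : V5), Q (proj3 j z).
Proof.
move=> H; pose P : {linear V5 -> V3} := proj3 j.
by apply: (sm_cont (sm_linrV P (sm_id 0))); rewrite linear0.
Qed.

Lemma sm_proj3 (f : V3 -> V3) j : sm f 0 -> sm (fun z => f (proj3 j z)) 0.
Proof.
move=> sf; pose P : {linear V5 -> V3} := proj3 j.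
by apply: (sm_comp (sm_linrV P (sm_id 0))); rewrite linear0.
Qed.

(* The algebras are R^3, R[e]/e^2 x R, R[e]/e^3 and C x R, in bases for which the matrix of
   the multiplication by a suitable mu has the type of the same name, with constant
   eigenvalues. *)
Definition mulA (a b : V3) := vec3 (a 0 0 * b 0 0) (a 0 1 * b 0 1) (a 0 2%:R * b 0 2%:R).
Fact mulAA : associative mulA.
Proof. by move=> a b c; apply: rowP3; rewrite !vec3E mulrA. Qed.
Fact mulAC : commutative mulA.
Proof. by move=> a b; apply: rowP3; rewrite !vec3E mulrC. Qed.
Fact mulA1 : left_id (vec3 1 1 1) mulA.
Proof. by move=> a; apply: rowP3; rewrite !vec3E mul1r. Qed.
Fact mulADl : left_distributive mulA +%R.
Proof. by move=> a b c; apply: rowP3; rewrite !mxE /= ?mxE mulrDl. Qed.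
Fact mulAZl r a b : mulA (r *: a) b = r *: mulA a b.
Proof. by apply: rowP3; rewrite !mxE /= ?mxE mulrA. Qed.
Definition algA := CAlg mulAA mulAC mulA1 mulADl mulAZl.

(** Coordinates 0 and 1 are those of e and 1 in R[e]/e^2; coordinate 2 is the factor R. *)
Definition mulB (a b : V3) := vec3 (a 0 0 * b 0 1 + a 0 1 * b 0 0) (a 0 1 * b 0 1) (a 0 2%:R * b 0 2%:R).
Fact mulBA : associative mulB.
Proof. by move=> a b c; apply: rowP3; rewrite !vec3E; ring. Qed.
Fact mulBC : commutative mulB.
Proof. by move=> a b; apply: rowP3; rewrite !vec3E; ring. Qed.
Fact mulB1 : left_id (vec3 0 1 1) mulB.
Proof. by move=> a; apply: rowP3; rewrite !vec3E; ring. Qed.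
Fact mulBDl : left_distributive mulB +%R.
Proof. by move=> a b c; apply: rowP3; rewrite !mxE /= ?mxE; ring. Qed.
Fact mulBZl r a b : mulB (r *: a) b = r *: mulB a b.
Proof. by apply: rowP3; rewrite !mxE /= ?mxE; ring. Qed.
Definition algB := CAlg mulBA mulBC mulB1 mulBDl mulBZl.

(** Coordinates 0, 1, 2 are those of e^2, e, 1. *)
Definition mulC (a b : V3) := vec3 (a 0 0 * b 0 2%:R + a 0 1 * b 0 1 + a 0 2%:R * b 0 0)
  (a 0 1 * b 0 2%:R + a 0 2%:R * b 0 1) (a 0 2%:R * b 0 2%:R).
Fact mulCA : associative mulC.
Proof. by move=> a b c; apply: rowP3; rewrite !vec3E; ring. Qed.
Fact mulCC : commutative mulC.
Proof. by move=> a b; apply: rowP3; rewrite !vec3E; ring. Qed.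
Fact mulC1 : left_id (vec3 0 0 1) mulC.
Proof. by move=> a; apply: rowP3; rewrite !vec3E; ring. Qed.
Fact mulCDl : left_distributive mulC +%R.
Proof. by move=> a b c; apply: rowP3; rewrite !mxE /= ?mxE; ring. Qed.
Fact mulCZl r a b : mulC (r *: a) b = r *: mulC a b.
Proof. by apply: rowP3; rewrite !mxE /= ?mxE; ring. Qed.
Definition algC := CAlg mulCA mulCC mulC1 mulCDl mulCZl.

(** Coordinates 0 and 1 are the real and imaginary parts; coordinate 2 is the factor R. *)
Definition mulD (a b : V3) := vec3 (a 0 0 * b 0 0 - a 0 1 * b 0 1) (a 0 0 * b 0 1 + a 0 1 * b 0 0)
  (a 0 2%:R * b 0 2%:R).
Fact mulDA : associative mulD.
Proof. by move=> a b c; apply: rowP3; rewrite !vec3E; ring. Qed.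
Fact mulDC : commutative mulD.
Proof. by move=> a b; apply: rowP3; rewrite !vec3E; ring. Qed.
Fact mulD1 : left_id (vec3 1 0 1) mulD.
Proof. by move=> a; apply: rowP3; rewrite !vec3E; ring. Qed.
Fact mulDDl : left_distributive mulD +%R.
Proof. by move=> a b c; apply: rowP3; rewrite !mxE /= ?mxE; ring. Qed.
Fact mulDZl r a b : mulD (r *: a) b = r *: mulD a b.
Proof. by apply: rowP3; rewrite !mxE /= ?mxE; ring. Qed.
Definition algD := CAlg mulDA mulDC mulD1 mulDDl mulDZl.

(** Along the fibres the l-th component depends on zeta_l alone, so it has the same value at the
    point of the slice that shares zeta_l. *)
Lemma algA_unique f : CRsm algA f -> (\forall y \near (0 : V3), f (slice algA y) = 0) ->
  \forall z \near (0 : V5), f z = 0.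
Proof.
move=> [sf cf] f0.
have main l : \forall z \near (0 : V5), f z 0 l = 0.
  apply: (@slice_const algA f l l) => //.
  - by move: l; apply: ord3P; rewrite /= vec3E.
  - apply: filterS cf => z K h hl; rewrite (CRE K) /=.
    by move: l hl; apply: ord3P => hl; rewrite /mulA vec3E hl mul0r.
  - by apply: filterS f0 => y ->; rewrite mxE.
have : \forall z \near (0 : V5), forall l, f z 0 l = 0 by exact: near_all.
by apply: filterS => z H; apply/rowP => l; rewrite H mxE.
Qed.

(** Components 2 and 1 depend, along the fibres, on their own coordinate of zeta. The derivative of
    component 0 in the nilpotent direction is the derivative of component 1 along the unit, which
    vanishes once component 1 does. *)
Lemma algB_unique f : CRsm algB f -> (\forall y \near (0 : V3), f (slice algB y) = 0) ->
  \forall z \near (0 : V5), f z = 0.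
Proof.
move=> [sf cf] f0; have f0l l : \forall y \near (0 : V3), f (slice algB y) 0 l = 0.
  by apply: filterS f0 => y ->; rewrite mxE.
have n2 : \forall z \near (0 : V5), f z 0 2%:R = 0.
  apply: (@slice_const algB f 2%:R 2%:R) => //; first by rewrite /= vec3E.
  by apply: filterS cf => z K h hl; rewrite (CRE K) /= vec3E hl mul0r.
have n1 : \forall z \near (0 : V5), f z 0 1 = 0.
  apply: (@slice_const algB f 1 1) => //; first by rewrite /= vec3E.
  by apply: filterS cf => z K h hl; rewrite (CRE K) /= vec3E hl mul0r.
have nf := sm_near sf.
have d1 : \forall z \near (0 : V5), forall w, (dd f z w) 0 1 = 0.
  near=> z => w.
  have df : differentiable f z by apply: sm_diff; near: z; exact: nf.
  have E : \forall z' \near z, 0 = f z' 0 1.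
    have : \forall z' \near z, f z' 0 1 = 0 by near: z; exact: nbhs_interior n1.
    by apply: filterS => z' ->.
  by rewrite dd_coord // (dd_near w E (differentiable_cst _ _)) dd_cst.
have n0 : \forall z \near (0 : V5), f z 0 0 = 0.
  apply: (@slice_const algB f 1 0) => //; first by rewrite /= vec3E.
  near=> z => h hl; have K : CR algB f z by near: z.
  have D w : dd f z w 0 1 = 0 by move: w; near: z.
  by rewrite (CRE K) /= vec3E D hl mulr0 mul0r addr0.
near=> z; apply: rowP3; rewrite [RHS]mxE; near: z; [exact: n0|exact: n1|exact: n2].
Unshelve. all: by end_near. Qed.

(** The components vanish in the order 2, 1, 0: along nilpotent directions the derivatives of each
    involve only those of the previous ones. *)
Lemma algC_unique f : CRsm algC f -> (\forall y \near (0 : V3), f (slice algC y) = 0) ->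
  \forall z \near (0 : V5), f z = 0.
Proof.
move=> [sf cf] f0; have f0l l : \forall y \near (0 : V3), f (slice algC y) 0 l = 0.
  by apply: filterS f0 => y ->; rewrite mxE.
have nf := sm_near sf.
have o2 : aone algC 0 2%:R = 1 by rewrite /= vec3E.
have dz l : (\forall z \near (0 : V5), f z 0 l = 0) -> \forall z \near (0 : V5), forall w, (dd f z w) 0 l = 0.
  move=> nl; near=> z => w.
  have df : differentiable f z by apply: sm_diff; near: z; exact: nf.
  have E : \forall z' \near z, 0 = f z' 0 l.
    have : \forall z' \near z, f z' 0 l = 0 by near: z; exact: nbhs_interior nl.
    by apply: filterS => z' ->.
  by rewrite dd_coord // (dd_near w E (differentiable_cst _ _)) dd_cst.
have n2 : \forall z \near (0 : V5), f z 0 2%:R = 0.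
  apply: (@slice_const algC f 2%:R 2%:R) => //.
  by apply: filterS cf => z K h hl; rewrite (CRE K) /= vec3E hl mul0r.
have n1 : \forall z \near (0 : V5), f z 0 1 = 0.
  apply: (@slice_const algC f 2%:R 1) => //.
  have d2 := dz _ n2; near=> z => h hl; have K : CR algC f z by near: z.
  have D w : dd f z w 0 2%:R = 0 by move: w; near: z; exact: d2.
  by rewrite (CRE K) /= vec3E D hl mulr0 mul0r addr0.
have n0 : \forall z \near (0 : V5), f z 0 0 = 0.
  apply: (@slice_const algC f 2%:R 0) => //.
  have d2 := dz _ n2; have d1 := dz _ n1; near=> z => h hl; have K : CR algC f z by near: z.
  have D2 w : dd f z w 0 2%:R = 0 by move: w; near: z; exact: d2.
  have D1 w : dd f z w 0 1 = 0 by move: w; near: z; exact: d1.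
  by rewrite (CRE K) /= vec3E D2 D1 hl !mulr0 mul0r !addr0.
near=> z; apply: rowP3; rewrite [RHS]mxE; near: z; [exact: n0|exact: n1|exact: n2].
Unshelve. all: by end_near. Qed.

Section Extend.
Variables (f : V3 -> V3) (k : 'I_3).
Hypothesis sf : sm f 0.
Local Notation e2 := (delta_mx 0 2%:R : V3).
Let f1 y := dd f y e2.
Let f2 y := dd f1 y e2.

Lemma sf1 : sm f1 0. Proof. exact: sm_ddc. Qed.
Lemma sf2 : sm f2 0. Proof. exact: sm_ddc sf1. Qed.

Lemma dd_vert (g : V3 -> V3) j z h : sm g (proj3 j z) ->
  dd (fun z => g (proj3 j z) 0 k) z (row_mx 0 h) = h 0 j * (dd g (proj3 j z) e2) 0 k.
Proof.
move=> sg; have dg : differentiable (fun z => g (proj3 j z)) z.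
  exact: (sm_diff (sm_comp (sm_linrV (proj3 j) (sm_id z)) sg)).
by rewrite -dd_coord // (dd_proj3 _ (sm_diff sg)) proj3_vert ddZ mxE.
Qed.

Lemma near_sm_proj3 (g : V3 -> V3) : sm g 0 -> \forall z \near (0 : V5), forall j, sm g (proj3 j z).
Proof. by move=> /sm_near H; apply: near_all => j; exact: near_proj3. Qed.

Lemma sm_coord_proj3 (g : V3 -> V3) j : sm g 0 -> sm (fun z => g (proj3 j z) 0 k) 0.
Proof. by move=> sg; apply: sm_coord; exact: sm_proj3. Qed.

Lemma sm_zeta j z0 : sm (fun z : V5 => rsubmx z 0 j) z0.
Proof. by apply: sm_coord; exact/sm_rsubmx/sm_id. Qed.

Lemma extendA : exists G, CRsm algA G /\ \forall y \near (0 : V3), G (slice algA y) = f y 0 k *: aone algA.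
Proof.
pose c j (z : V5) := f (proj3 j z) 0 k.
exists (fun z => vec3 (c 0 z) (c 1 z) (c 2%:R z)).
have s0 : sm (fun z => vec3 (c 0 z) (c 1 z) (c 2%:R z)) 0 by apply: sm_vec3; exact: sm_coord_proj3.
split; first split=> //.
  have nf := near_sm_proj3 sf; have ns := sm_near s0; near=> z; split=> h.
  have fz : forall j, sm f (proj3 j z) by near: z; exact: nf.
  have dG w j : dd (fun z => vec3 (c 0 z) (c 1 z) (c 2%:R z)) z w 0 j = dd (c j) z w.
    rewrite dd_coord; last by apply: sm_diff; near: z; exact: ns.
    by congr (dd _ _ _); apply/funext => z'; move: j; apply: ord3P; rewrite vec3E.
  apply/rowP => j; rewrite dG dd_vert // /amul /=.
  by move: j; apply: ord3P; rewrite vec3E dG dd_vert // !mxE mul1r.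
by near=> y; rewrite /c !proj3_slice ?vec3E //=; apply: rowP3; rewrite !mxE mulr1.
Unshelve. all: by end_near. Qed.

Lemma dd_vec3 (a b c : V5 -> R) z w : sm a z -> sm b z -> sm c z ->
  dd (fun z => vec3 (a z) (b z) (c z)) z w = vec3 (dd a z w) (dd b z w) (dd c z w).
Proof.
move=> sa sb sc'; have dG := sm_diff (sm_vec3 sa sb sc').
by apply: rowP3; rewrite dd_coord // vec3E; congr (dd _ _ _); apply/funext => z'; rewrite vec3E.
Qed.

Lemma dd_mul (a b : V5 -> R) z w : sm a z -> sm b z ->
  dd (fun z => a z * b z) z w = dd a z w * b z + a z * dd b z w.
Proof.
move=> /sm_diff da /sm_diff db.
rewrite (ddDe w da) (ddDe w db) ddDe; last exact: differentiableM.
rewrite deriveM; [|exact: diff_derivable|exact: diff_derivable].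
by rewrite addrC mulrC.
Qed.

Lemma dd_zeta j (z : V5) h : dd (fun z : V5 => rsubmx z 0 j) z (row_mx 0 h) = h 0 j.
Proof.
rewrite -dd_coord; last exact/sm_diff/sm_rsubmx/sm_id.
by rewrite (dd_linear (@rsubmx R 1 2 3 : {linear _ -> _})) /= row_mxKr.
Qed.

Lemma sm_coord_at (g : V3 -> V3) j z : sm g (proj3 j z) -> sm (fun z => g (proj3 j z) 0 k) z.
Proof. by move=> sg; apply: sm_coord; exact: (sm_comp (sm_linrV (proj3 j) (sm_id z)) sg). Qed.

(** The expansion f(s + e t) = f(s) + e t f'(s) in the last variable, on the factor R[e]/e^2, and
    the value f(zeta_2) on the factor R. *)
Lemma extendB : exists G, CRsm algB G /\ \forall y \near (0 : V3), G (slice algB y) = f y 0 k *: aone algB.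
Proof.
pose a z := rsubmx z 0 0 * f1 (proj3 1 z) 0 k.
pose b z := f (proj3 1 z) 0 k; pose c z := f (proj3 2%:R z) 0 k.
exists (fun z => vec3 (a z) (b z) (c z)).
split; first split.
- by apply: sm_vec3; [apply: smM; [exact: sm_zeta|exact: (sm_coord_proj3 _ sf1)]|exact: (sm_coord_proj3 _ sf)|exact: (sm_coord_proj3 _ sf)].
- have nf := near_sm_proj3 sf; have nf1 := near_sm_proj3 sf1; near=> z; split=> h.
  have fz : forall j, sm f (proj3 j z) by near: z; exact: nf.
  have fz1 : forall j, sm f1 (proj3 j z) by near: z; exact: nf1.
  have sa : sm a z by apply: smM; [exact: sm_zeta|exact: sm_coord_at].
  have sb : sm b z by exact: sm_coord_at.
  have sc' : sm c z by exact: sm_coord_at.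
  have da w : dd a z (row_mx 0 w) = w 0 0 * f1 (proj3 1 z) 0 k + rsubmx z 0 0 * (w 0 1 * f2 (proj3 1 z) 0 k).
    by rewrite (dd_mul _ (sm_zeta _ _) (sm_coord_at (fz1 1))) dd_zeta dd_vert.
  rewrite !(dd_vec3 _ sa sb sc') !da /b /c !dd_vert //=.
  by rewrite /mulB; apply: rowP3; rewrite !vec3E -/(f1 _) -?/(f2 _); ring.
near=> y; rewrite /a /b /c !proj3_slice ?vec3E //= sliceE row_mxKr.
by apply: rowP3; rewrite !mxE /=; ring.
Unshelve. all: by end_near. Qed.

(** The expansion of f(s + n) to second order with n = e zeta_1 + e^2 zeta_0: n^2 = e^2 zeta_1^2 and
    n^3 = 0, so the e^2 component is zeta_0 f'(s) + zeta_1^2 f''(s) / 2. *)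
Lemma extendC : exists G, CRsm algC G /\ \forall y \near (0 : V3), G (slice algC y) = f y 0 k *: aone algC.
Proof.
pose P (z : V5) : V3 := proj3 2%:R z.
pose h z := rsubmx z 0 0 * f1 (P z) 0 k; pose q (z : V5) : R := 2^-1 * (rsubmx z 0 1 * rsubmx z 0 1).
pose q' z := q z * f2 (P z) 0 k.
pose a z := h z + q' z.
pose b z := rsubmx z 0 1 * f1 (P z) 0 k; pose c z := f (P z) 0 k.
exists (fun z => vec3 (a z) (b z) (c z)).
have sq z : sm q z by apply: smM; [exact: sm_cst|apply: smM; exact: sm_zeta].
have sP (g : V3 -> V3) : sm g 0 -> sm (fun z => g (P z) 0 k) 0 by exact: sm_coord_proj3.
split; first split.
- apply: sm_vec3; last exact: (sP _ sf).
    by apply: smD; apply: smM; [exact: sm_zeta|exact: (sP _ sf1)|exact: sq|exact: (sP _ sf2)].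
  by apply: smM; [exact: sm_zeta|exact: (sP _ sf1)].
- have nf := near_sm_proj3 sf; have nf1 := near_sm_proj3 sf1; have nf2 := near_sm_proj3 sf2; near=> z; split=> w.
  have fz : forall j, sm f (proj3 j z) by near: z; exact: nf.
  have fz1 : forall j, sm f1 (proj3 j z) by near: z; exact: nf1.
  have fz2 : forall j, sm f2 (proj3 j z) by near: z; exact: nf2.
  have sh : sm h z by apply: smM; [exact: sm_zeta|exact: sm_coord_at].
  have sq' : sm q' z by apply: smM; [exact: sq|exact: sm_coord_at].
  have sa : sm a z by exact: smD.
  have sb : sm b z by apply: smM; [exact: sm_zeta|exact: sm_coord_at].
  have sc' : sm c z by exact: sm_coord_at.
  have dq u : dd q z (row_mx 0 u) = rsubmx z 0 1 * u 0 1.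
    have dc1 : dd (fun=> 2^-1 : R) z (row_mx 0 u) = 0 by exact: dd_cst.
    rewrite (dd_mul _ (sm_cst _ z) (smM (sm_zeta 1 z) (sm_zeta 1 z))) (dd_mul _ (sm_zeta 1 z) (sm_zeta 1 z)) dc1 !dd_zeta.
    by field.
  have da u : dd a z (row_mx 0 u) = u 0 0 * f1 (P z) 0 k + rsubmx z 0 0 * (u 0 2%:R * f2 (P z) 0 k) +
      (rsubmx z 0 1 * u 0 1 * f2 (P z) 0 k + q z * (u 0 2%:R * (dd f2 (P z) e2) 0 k)).
    rewrite (dd_add _ (sm_diff sh) (sm_diff sq')) (dd_mul _ (sm_zeta _ _) (sm_coord_at (fz1 _))) dd_zeta dd_vert //.
    by rewrite (dd_mul _ (sq _) (sm_coord_at (fz2 _))) dq dd_vert.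
  have db u : dd b z (row_mx 0 u) = u 0 1 * f1 (P z) 0 k + rsubmx z 0 1 * (u 0 2%:R * f2 (P z) 0 k).
    by rewrite (dd_mul _ (sm_zeta _ _) (sm_coord_at (fz1 _))) dd_zeta dd_vert.
  have dc u : dd c z (row_mx 0 u) = u 0 2%:R * f1 (P z) 0 k by rewrite dd_vert.
  rewrite !(dd_vec3 _ sa sb sc') !da !db !dc /=.
  by rewrite /mulC; apply: rowP3; rewrite !vec3E; ring.
near=> y; rewrite /a /h /q' /q /b /c /P !proj3_slice ?vec3E //= sliceE row_mxKr.
by apply: rowP3; rewrite !mxE /=; ring.
Unshelve. all: by end_near. Qed.

End Extend.

End Extensions.

(** * Charts, vector fields and operators *)

Section ManifoldCalculus.
Variables (R : realType) (m : nat) (M : manifold R m).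
Local Notation V := 'rV[R]_m.
Implicit Types (c : chart R m M) (q : M) (X Y : vfield M) (W : set M).

Lemma near_chart c q (P : M -> Prop) : cdom c q -> (\forall q' \near q, P q') ->
  \forall x \near cmap c q, P (cinv c x).
Proof.
move=> cq H; have := @cinv_continuous _ _ _ c (cmap c q) (ex_intro2 _ _ q cq erefl).
by move=> /(_ P); apply; rewrite cmapK.
Qed.

Lemma chart_near c q (P : V -> Prop) : cdom c q -> (\forall x \near cmap c q, P x) ->
  \forall q' \near q, P (cmap c q').
Proof. by move=> cq H; have := @cmap_continuous _ _ _ c q cq P; apply. Qed.

Lemma near_cdom c q : cdom c q -> \forall q' \near q, cdom c q'.
Proof. by move=> cq; exact: open_nbhs_nbhs (conj (cdom_open c) cq). Qed.

Lemma near_cinv c q : cdom c q ->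
  \forall x \near cmap c q, cmap c (cinv c x) = x /\ cdom c (cinv c x).
Proof.
move=> cq; have : nbhs (cmap c q) (cmap c @` cdom c).
  by apply: open_nbhs_nbhs; split; [exact: cimg_open|exists q].
by apply: filterS => x [q' cq' <-]; rewrite cmapK.
Qed.

Lemma open_img c W : open W -> open (cmap c @` (cdom c `&` W)).
Proof.
move=> oW; rewrite openE => x [q [cq Wq] <-].
have nW : \forall q' \near q, W q' by exact: open_nbhs_nbhs.
have H := near_chart cq nW; have H' := near_cinv cq.
rewrite /interior; near=> y.
have [E1 E2] : cmap c (cinv c y) = y /\ cdom c (cinv c y) by near: y; exact: H'.
by exists (cinv c y) => //; split=> //; near: y; exact: H.
Unshelve. all: by end_near. Qed.

Lemma sm_transition c c' q : atlas M c -> atlas M c' -> cdom c q -> cdom c' q ->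
  sm (transition c c') (cmap c q).
Proof.
move=> ac ac' cq cq'; have [H _] := atlas_compat ac ac'.
exists (cmap c @` (cdom c `&` cdom c')); split=> //.
  by apply: open_img; exact: cdom_open.
by exists q.
Qed.

Lemma transitionE c c' q : cdom c q -> transition c c' (cmap c q) = cmap c' q.
Proof. by move=> cq; rewrite /transition /= cmapK. Qed.

Lemma dd_transition c c' c'' q w : atlas M c -> atlas M c' -> atlas M c'' ->
  cdom c q -> cdom c' q -> cdom c'' q ->
  dd (transition c' c'') (cmap c' q) (dd (transition c c') (cmap c q) w) =
  dd (transition c c'') (cmap c q) w.
Proof.
move=> a a' a'' cq cq' cq''.
have d1 := sm_diff (sm_transition a a' cq cq'); have d2 := sm_diff (sm_transition a' a'' cq' cq'').
have d3 := sm_diff (sm_transition a a'' cq cq'').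
have E : \forall x \near cmap c q, transition c c'' x = transition c' c'' (transition c c' x).
  apply: filterS (near_chart cq (near_cdom cq')) => x cx.
  by rewrite /transition /= cmapK.
rewrite -(dd_near w E d3) dd_comp ?transitionE //.
Qed.

Lemma dd_transition_id c q w : atlas M c -> cdom c q -> dd (transition c c) (cmap c q) w = w.
Proof.
move=> a cq; have E : \forall x \near cmap c q, x = transition c c x.
  by apply: filterS (near_cinv cq) => x [E _]; rewrite /transition /= E.
rewrite (dd_near w E); first exact: (dd_linear (@idfun V)).
exact: (sm_diff (sm_id _)).
Qed.

Lemma chart_atP q : atlas M (chart_at q) /\ cdom (chart_at q) q.
Proof. exact: svalP (cid (atlas_cover q)). Qed.

Lemma componentsE c q (v : tangent q) :
  components c v = dd (transition (chart_at q) c) (cmap (chart_at q) q) v.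
Proof. by rewrite ddE. Qed.

Lemma components_change c c' q (v : tangent q) : atlas M c -> atlas M c' -> cdom c q -> cdom c' q ->
  components c' v = dd (transition c c') (cmap c q) (components c v).
Proof. by have [a0 c0] := chart_atP q; move=> a a' cq cq'; rewrite !componentsE dd_transition. Qed.

Lemma componentsP c q a (u v : tangent q) : components c (a *: u + v) = a *: components c u + components c v.
Proof. by rewrite !componentsE ddD ddZ. Qed.

Lemma componentsD c q (u v : tangent q) : components c (u + v) = components c u + components c v.
Proof. by rewrite !componentsE ddD. Qed.

Lemma componentsZ c q a (u : tangent q) : components c (a *: u) = a *: components c u.
Proof. by rewrite !componentsE ddZ. Qed.

Lemma componentsB c q (u v : tangent q) : components c (u - v) = components c u - components c v.
Proof. by rewrite !componentsE ddB. Qed.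

Lemma components_sum c q n (u : 'I_n -> tangent q) : components c (\sum_i u i) = \sum_i components c (u i).
Proof. by rewrite componentsE dd_sum; apply: eq_bigr => i _; rewrite componentsE. Qed.

Definition tangent_of c q (w : V) : tangent q := dd (transition c (chart_at q)) (cmap c q) w.

Lemma tangent_ofK c q w : atlas M c -> cdom c q -> components c (tangent_of c q w) = w.
Proof.
move=> a cq; have [a0 c0] := chart_atP q.
by rewrite componentsE dd_transition // dd_transition_id.
Qed.

Lemma componentsK c q (v : tangent q) : atlas M c -> cdom c q -> tangent_of c q (components c v) = v.
Proof.
move=> a cq; have [a0 c0] := chart_atP q.
by rewrite componentsE /tangent_of dd_transition // dd_transition_id.
Qed.

Lemma components_inj c q (u v : tangent q) : atlas M c -> cdom c q ->
  components c u = components c v -> u = v.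
Proof. by move=> a cq E; rewrite -(componentsK u a cq) E componentsK. Qed.

Lemma in_chart_cmap c X q : cdom c q -> in_chart c X (cmap c q) = components c (X q).
Proof. by move=> cq; rewrite /in_chart cmapK. Qed.

Lemma sm_in_chart c X W q : open W -> smooth_vfield W X -> atlas M c -> W q -> cdom c q ->
  sm (in_chart c X) (cmap c q).
Proof.
move=> oW sX a Wq cq; exists (cmap c @` (cdom c `&` W)); split; last exact: sX.
  exact: open_img.
by exists q.
Qed.

Lemma smooth_vfieldP X W : (forall c q, atlas M c -> cdom c q -> W q -> sm (in_chart c X) (cmap c q)) ->
  smooth_vfield W X.
Proof. by move=> H c a s x [q [cq Wq] <-]; have [D [oD Dx]] := H c q a cq Wq; apply. Qed.

Lemma in_chart_change c c' X q : atlas M c -> atlas M c' -> cdom c q -> cdom c' q ->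
  \forall x \near cmap c q, in_chart c' X (transition c c' x) = dd (transition c c') x (in_chart c X x).
Proof.
move=> a a' cq cq'; have H := near_cinv cq; have H' := near_chart cq (near_cdom cq').
near=> x.
have [Ex dx] : cmap c (cinv c x) = x /\ cdom c (cinv c x) by near: x; exact: H.
have dx' : cdom c' (cinv c x) by near: x; exact: H'.
by rewrite /transition /= in_chart_cmap // (components_change _ a a' dx dx') Ex.
Unshelve. all: by end_near. Qed.

End ManifoldCalculus.

Lemma dd_dd (R : realType) m k (f : 'rV[R]_m -> 'rV[R]_k) (A : 'rV[R]_m -> 'rV[R]_m) x w :
  sm f x -> sm A x ->
  dd (fun y => dd f y (A y)) x w = dd (fun y => dd f y (A x)) x w + dd f x (dd A x w).
Proof.
move=> sf sA.
have E (B : 'rV[R]_m -> 'rV[R]_m) : (fun y => dd f y (B y)) = (fun y => \sum_j B y 0 j *: dd f y (delta_mx 0 j)).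
  apply/funext => y; rewrite {1}(row_sum_delta (B y)) dd_sum.
  by apply: eq_bigr => j _; rewrite ddZ.
have dA j : differentiable (fun y => A y 0 j) x by move/sm_diff/differentiable_rVP: sA.
have df j : differentiable (fun y => dd f y (delta_mx 0 j)) x by exact/sm_diff/sm_ddc.
have dc j : differentiable (fun y : 'rV[R]_m => A x 0 j) x by exact: differentiable_cst.
rewrite E (E (fun=> A x)) !dd_bigsum; last 2 first.
- by move=> j; apply: differentiable_scale.
- by move=> j; apply: differentiable_scale.
rewrite {1}(row_sum_delta (dd A x w)) dd_sum -big_split /=; apply: eq_bigr => j _.
rewrite !dd_scale // dd_cst scale0r add0r ddZ addrC; congr (_ + _ *: _).
by rewrite dd_coord //; exact: sm_diff.
Qed.

(** * Lie brackets in an arbitrary chart *)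

Section LieBracket.
Variables (R : realType) (m : nat) (M : manifold R m).
Implicit Types (c : chart R m M) (q : M) (X Y : vfield M) (W : set M).

(** The change of coordinates adds to each derivative a term in the second differential of the
    transition map. This differential is symmetric, so the two terms cancel in the bracket. *)
Lemma lie_bracket_chart c X Y W q : open W -> smooth_vfield W X -> smooth_vfield W Y ->
  atlas M c -> cdom c q -> W q ->
  components c (lie_bracket X Y q) = bracket (in_chart c X) (in_chart c Y) (cmap c q).
Proof.
move=> oW sX sY a cq Wq; have [a0 c0] := chart_atP q; set c' := chart_at q.
have sA Z : smooth_vfield W Z -> sm (in_chart c' Z) (cmap c' q) by move=> sZ; exact: sm_in_chart sZ _ _ _.
have sA' Z : smooth_vfield W Z -> sm (in_chart c Z) (cmap c q) by move=> sZ; exact: sm_in_chart sZ _ _ _.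
pose phi := transition c' c; have sphi : sm phi (cmap c' q) by exact: sm_transition.
have phi0 : phi (cmap c' q) = cmap c q by exact: transitionE.
have K Z w : smooth_vfield W Z -> dd (in_chart c Z) (cmap c q) (dd phi (cmap c' q) w) =
    dd (fun y => dd phi y (in_chart c' Z (cmap c' q))) (cmap c' q) w + dd phi (cmap c' q) (dd (in_chart c' Z) (cmap c' q) w).
  move=> sZ; have := in_chart_change Z a0 a c0 cq; rewrite -/c' -/phi => E.
  rewrite -dd_dd //; last exact: sA.
  have dZ : differentiable (in_chart c Z) (phi (cmap c' q)) by rewrite phi0; exact/sm_diff/sA'.
  have dp := sm_diff sphi.
  rewrite (dd_near w E (differentiable_comp dp dZ)) dd_comp // phi0 //.
have I Z : in_chart c Z (cmap c q) = dd phi (cmap c' q) (in_chart c' Z (cmap c' q)).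
  by rewrite !in_chart_cmap // (components_change _ a0 a c0 cq).
have eX := K Y (in_chart c' X (cmap c' q)) sY; rewrite -I in eX.
have eY := K X (in_chart c' Y (cmap c' q)) sX; rewrite -I in eY.
have S : dd (fun y => dd phi y (in_chart c' Y (cmap c' q))) (cmap c' q) (in_chart c' X (cmap c' q)) =
  dd (fun y => dd phi y (in_chart c' X (cmap c' q))) (cmap c' q) (in_chart c' Y (cmap c' q)).
  exact: dd_schwarz.
have cancel (t u v : 'rV[R]_m) : t + u - (t + v) = u - v by rewrite opprD addrACA subrr add0r.
rewrite /bracket eX eY S cancel -ddB componentsE; congr (dd _ _ _).
by rewrite /lie_bracket !ddE.
Qed.

End LieBracket.

(** * Charts obtained from local diffeomorphisms *)

Section ChartFromMap.
Variables (R : realType) (m : nat) (M : manifold R m).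
Local Notation V := 'rV[R]_m.

(** After restriction to a neighbourhood where [psi] has a smooth inverse, its composite with [c] is
    compatible with every chart, hence in the atlas by maximality. *)
Lemma chart_of_map (c : chart R m M) (p : M) (psi : V -> V) : atlas M c -> cdom c p ->
  sm psi (cmap c p) -> (forall w, dd psi (cmap c p) w = 0 -> w = 0) ->
  exists c', [/\ atlas M c', cdom c' p, cdom c' `<=` cdom c,
    forall q, cmap c' q = psi (cmap c q) & forall q, cdom c' q -> sm psi (cmap c q)].
Proof.
move=> ac cp spsi inj.
have [|g [sg g0 gpsi psig]] := inverse_function spsi.
  by move=> v H; apply: inj; rewrite ddE.
(* Interiors make these conditions open, and the image of the new domain is then the open set of the
   w with [O' w] and [O (g w)]. *)
pose O := interior [set x | [/\ (cmap c @` cdom c) x, sm psi x & g (psi x) = x]].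
pose O' := interior [set w | sm g w /\ psi (g w) = w].
have oO : open O by exact: open_interior.
have oO' : open O' by exact: open_interior.
have Op : O (cmap c p).
  rewrite /O /interior /=; have := near_cinv cp => Hc; have Hs := sm_near spsi.
  near=> x; split.
  - have [E D] : cmap c (cinv c x) = x /\ cdom c (cinv c x) by near: x; exact: Hc.
    by exists (cinv c x).
  - by near: x; exact: Hs.
  - by near: x; exact: gpsi.
have Op' : O' (psi (cmap c p)).
  rewrite /O' /interior /=; have Hs := sm_near sg.
  by near=> x; split; near: x; [exact: Hs|exact: psig].
have OP x : O x -> [/\ (cmap c @` cdom c) x, sm psi x & g (psi x) = x] by exact: nbhs_singleton.
have OP' w : O' w -> sm g w /\ psi (g w) = w by exact: nbhs_singleton.
pose N := O `&` psi @^-1` O'.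
have NN x : N x -> \forall y \near x, N y.
  move=> [Ox Ox']; have [_ sx _] := OP _ Ox.
  have H1 : \forall y \near x, O y by exact: open_nbhs_nbhs.
  have H2 : \forall y \near x, O' (psi y) by apply: (sm_cont sx); exact: open_nbhs_nbhs.
  by near=> y; split; near: y.
pose D := cdom c `&` cmap c @^-1` N.
have oD : open D.
  rewrite openE => q [cq Nq]; rewrite /interior.
  have H1 := near_cdom cq; have H2 := chart_near cq (NN _ Nq).
  by near=> q'; split; near: q'.
have imgP w : ((fun q => psi (cmap c q)) @` D) w <-> O' w /\ O (g w).
  split=> [[q [cq [Oq Oq']] <-]|[Ow Ow']].
    by split=> //; have [_ _ ->] := OP _ Oq.
  have [[q cq Eq] _ _] := OP _ Ow'; have [_ Ew] := OP' _ Ow.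
  exists q; last by rewrite Eq.
  split; first exact: cq.
  have N1 : O (cmap c q) by rewrite Eq.
  have N2 : O' (psi (cmap c q)) by rewrite Eq Ew.
  exact: (conj N1 N2).
have oI : open ((fun q => psi (cmap c q)) @` D).
  rewrite openE => w /imgP [Ow Ow']; rewrite /interior.
  have [sw _] := OP' _ Ow.
  have H1 : \forall y \near w, O' y by exact: open_nbhs_nbhs.
  have H2 : \forall y \near w, O (g y) by apply: (sm_cont sw); exact: open_nbhs_nbhs.
  by near=> y; apply/imgP; split; near: y.
have cc q : D q -> {for q, continuous (fun q => psi (cmap c q))}.
  move=> [cq [Oq _]] /= P HP; have [_ sq _] := OP _ Oq.
  exact: (chart_near cq (sm_cont sq HP)).
have ci x : ((fun q => psi (cmap c q)) @` D) x -> {for x, continuous (fun x => cinv c (g x))}.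
  move=> /imgP [Ow Ow'] /= P HP; have [sw _] := OP' _ Ow; have [[q cq Eq] _ _] := OP _ Ow'.
  have H : \forall y \near g x, P (cinv c y).
    by rewrite -Eq; apply: (near_chart cq); rewrite -(cmapK cq) Eq; exact: HP.
  exact: (sm_cont sw H).
have cK q : D q -> cinv c (g (psi (cmap c q))) = q.
  by move=> [cq [Oq _]]; have [_ _ ->] := OP _ Oq; exact: cmapK.
pose c' := Chart oD oI cc ci cK.
exists c'; split=> //; last 2 first.
- by move=> q [].
- by move=> q [_ [/OP[]]].
  apply: atlas_maximal => c'' a''.
  split=> s x [q [cq cq'] <-].
    have [cq0 [Oq Oq']] := cq; have [_ sq _] := OP _ Oq.
    have [sw _] := OP' _ Oq'.
    have S : sm (transition c' c'') (psi (cmap c q)).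
      rewrite /transition /=.
      have -> : cmap c'' \o (fun x => cinv c (g x)) = (fun x => transition c c'' (g x)) by [].
      apply: (sm_comp sw); have [_ _ ->] := OP _ Oq; exact: sm_transition.
    by have [E [oE Ex]] := S; apply.
  have [cq0 [Oq Oq']] := cq; have [_ sq _] := OP _ Oq.
  have S : sm (transition c'' c') (cmap c'' q).
    have -> : transition c'' c' = (fun x => psi (transition c'' c x)) by [].
    by apply: (sm_comp (sm_transition a'' ac cq' cq0)); rewrite transitionE.
  by have [E [oE Ex]] := S; apply.
Unshelve. all: by end_near. Qed.

Lemma components_of_map (c c' : chart R m M) (psi : V -> V) (q : M) (v : tangent q) :
  atlas M c -> atlas M c' -> cdom c q -> cdom c' q ->
  (forall q, cmap c' q = psi (cmap c q)) -> sm psi (cmap c q) ->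
  components c' v = dd psi (cmap c q) (components c v).
Proof.
move=> ac ac' cq cq' E sp; rewrite (components_change _ ac ac' cq cq').
have -> : transition c c' = (fun x => psi (transition c c x)).
  by apply/funext => x; rewrite /transition /= E.
have st : sm (transition c c) (cmap c q) by exact: sm_transition.
have dp : differentiable psi (transition c c (cmap c q)) by rewrite transitionE //; exact: sm_diff.
by rewrite (dd_comp _ (sm_diff st) dp) transitionE // dd_transition_id.
Qed.

End ChartFromMap.

(** * Operators with constant coefficients in a chart *)

Section Operators.
Variables (R : realType) (m : nat) (M : manifold R m).
Implicit Types (c : chart R m M) (q : M) (X Y : vfield M) (W : set M).

Lemma sm_in_chart_change c c' X q : atlas M c -> atlas M c' -> cdom c q -> cdom c' q ->
  sm (in_chart c X) (cmap c q) -> sm (in_chart c' X) (cmap c' q).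
Proof.
move=> a a' cq cq' sX.
have st : sm (transition c' c) (cmap c' q) by exact: sm_transition.
have st' : sm (transition c c') (cmap c q) by exact: sm_transition.
have N : \forall x \near cmap c' q, in_chart c' X x =
    dd (transition c c') (transition c' c x) (in_chart c X (transition c' c x)).
  have H := in_chart_change X a a' cq cq'.
  have H' : \forall x \near cmap c' q, in_chart c' X (transition c c' (transition c' c x)) =
      dd (transition c c') (transition c' c x) (in_chart c X (transition c' c x)).
    have H0 : \forall x \near transition c' c (cmap c' q), in_chart c' X (transition c c' x) =
        dd (transition c c') x (in_chart c X x) by rewrite transitionE.
    exact: (sm_cont st H0).
  have K := near_cinv cq'; have K' := near_chart cq' (near_cdom cq).
  near=> x.
  have [Ex _] : cmap c' (cinv c' x) = x /\ cdom c' (cinv c' x) by near: x; exact: K.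
  have dx : cdom c (cinv c' x) by near: x; exact: K'.
  have e : transition c c' (transition c' c x) = x by rewrite /transition /= cmapK.
  have : in_chart c' X (transition c c' (transition c' c x)) =
      dd (transition c c') (transition c' c x) (in_chart c X (transition c' c x)) by near: x; exact: H'.
  by rewrite e.
apply: (sm_eq (f := fun x => dd (transition c c') (transition c' c x) (in_chart c X (transition c' c x)))).
  by near=> x; apply: esym; near: x; exact: N.
apply: (sm_comp (g := fun y => dd (transition c c') y (in_chart c X y)) st).
by rewrite transitionE //; exact: sm_dd.
Unshelve. all: by end_near. Qed.

Variables (S : calg R m) (mu : 'rV[R]_m) (c : chart R m M).
Local Notation "a ** b" := (amul S a b) (at level 40, left associativity).

Definition mul_operator : fibre_map M := fun q w => tangent_of c q (components c w ** mu).

Lemma mul_operatorE q (w : tangent q) : atlas M c -> cdom c q ->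
  components c (mul_operator w) = components c w ** mu.
Proof. by move=> a cq; rewrite /mul_operator tangent_ofK. Qed.

Hypothesis ac : atlas M c.

Lemma in_chart_mul X q : cdom c q ->
  \forall x \near cmap c q, in_chart c X x ** mu = in_chart c (apply_field mul_operator X) x.
Proof.
move=> cq; apply: filterS (near_cinv cq) => x [_ dx].
by rewrite /in_chart /apply_field mul_operatorE.
Qed.

Lemma smooth_mul_operator W X : W `<=` cdom c -> open W -> smooth_vfield W X ->
  smooth_vfield W (apply_field mul_operator X).
Proof.
move=> Wc oW sX; apply: smooth_vfieldP => c' q a' cq' Wq; have cq := Wc _ Wq.
apply: (sm_in_chart_change ac a' cq cq').
apply: (sm_eq (in_chart_mul X cq)).
by apply: (sm_amul S); [exact: sm_in_chart sX _ _ _|exact: sm_cst].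
Qed.

Lemma dd_in_chart_mul W X q w : W `<=` cdom c -> open W -> smooth_vfield W X -> W q ->
  dd (in_chart c (apply_field mul_operator X)) (cmap c q) w = dd (in_chart c X) (cmap c q) w ** mu.
Proof.
move=> Wc oW sX Wq; have cq := Wc _ Wq.
have sA : sm (in_chart c X) (cmap c q) by exact: sm_in_chart sX _ _ _.
have E : \forall x \near cmap c q, in_chart c (apply_field mul_operator X) x = in_chart c X x ** mu.
  by apply: filterS (in_chart_mul X cq) => x ->.
rewrite -(dd_near w E); last first.
  exact: (sm_diff (sm_in_chart oW (smooth_mul_operator Wc oW sX) ac Wq cq)).
by rewrite (dd_amul S w (sm_diff sA) (differentiable_cst _ _)) dd_cst amul0r addr0.
Qed.

(** In the chart the coefficients are constant: the operator commutes with derivatives and the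
    torsion cancels term by term. *)
Lemma mul_operator_nijenhuis U : U `<=` cdom c -> nijenhuis_on U mul_operator.
Proof.
move=> Uc; split; first split.
- move=> q Uq a u v _ _; apply: (components_inj ac (Uc _ Uq)).
  by rewrite componentsP !mul_operatorE ?componentsP ?amulDl ?amulZl //; exact: Uc.
- by move=> W X oW WU [sX _]; apply: smooth_mul_operator => // q /WU/Uc.
move=> W X Y oW WU sX sY q Wq.
have Wc : W `<=` cdom c by move=> q' /WU/Uc.
have cq := Wc _ Wq; have sJX := smooth_mul_operator Wc oW sX; have sJY := smooth_mul_operator Wc oW sY.
apply: (components_inj ac cq).
have mE (w : tangent q) : components c (mul_operator w) = components c w ** mu := mul_operatorE w ac cq.
have fE Z : in_chart c (apply_field mul_operator Z) (cmap c q) = in_chart c Z (cmap c q) ** mu.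
  by rewrite !in_chart_cmap // -mE.
have dE Z w : smooth_vfield W Z -> dd (in_chart c (apply_field mul_operator Z)) (cmap c q) w =
  dd (in_chart c Z) (cmap c q) w ** mu by move=> sZ; exact: dd_in_chart_mul sZ Wq.
have main (l1 l2 l3 l4 : tangent q) b1 b2 b3 b4 :
  components c l1 = b1 -> components c l2 = b2 -> components c l3 = b3 -> components c l4 = b4 ->
  b1 - b2 ** mu - b3 ** mu + b4 ** mu ** mu = 0 ->
  components c (l1 - mul_operator l2 - mul_operator l3 + mul_operator (mul_operator l4)) = components c (0 : tangent q).
  move=> e1 e2 e3 e4 e5; rewrite componentsD !componentsB !mE e1 e2 e3 e4 e5.
  by rewrite componentsE dd0.
apply: (main _ _ _ _ _ _ _ _ (lie_bracket_chart oW sJX sJY ac cq Wq) (lie_bracket_chart oW sJX sY ac cq Wq)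
  (lie_bracket_chart oW sX sJY ac cq Wq) (lie_bracket_chart oW sX sY ac cq Wq)).
rewrite /bracket !fE !(dE _ _ sX) !(dE _ _ sY).
move: (dd _ _ _) (dd _ _ _) (dd _ _ _) (dd _ _ _) => p1 p2 p3 p4.
have Er (K : comPzRingType) (a b e f k : K) :
  a * k - b * k - (a - f * k) * k - (e * k - b) * k + (e - f) * k * k = 0 by ring.
exact: (Er (asort S)).
Qed.

End Operators.

(** * Distributions tangent to a foliation *)

Section Foliations.
Variables (R : realType) (m : nat) (M : manifold R m) (TF : tangent_distribution M).
Hypothesis fol : foliation TF.

Lemma foliation_lin q a (u v : tangent q) : TF u -> TF v -> TF (a *: u + v).
Proof.
have [k _ H] := fol; have [c [ac cq E]] := H q => /(E _ cq) Hu /(E _ cq) Hv.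
by apply/(E _ cq) => i ki; rewrite componentsP !mxE Hu // Hv // mulr0 addr0.
Qed.

Lemma foliation_sum q n (a : 'I_n -> R) (u : 'I_n -> tangent q) :
  (forall i, TF (u i)) -> TF (\sum_i a i *: u i).
Proof.
move=> H; elim/big_rec: _ => [|i x _ Hx]; last exact: foliation_lin.
have [k _ H'] := fol; have [c [ac cq E]] := H' q; apply/(E _ cq) => i ki.
by rewrite componentsE dd0 mxE.
Qed.

(** In an adapted chart the transverse components of both fields vanish identically, hence so do
    their derivatives. *)
Lemma foliation_involutive W X Y q : open W -> is_section W TF X -> is_section W TF Y -> W q ->
  TF (lie_bracket X Y q).
Proof.
move=> oW [sX TX] [sY TY] Wq; have [k _ H] := fol; have [c [ac cq E]] := H q.
apply/(E _ cq) => i ki; rewrite (lie_bracket_chart oW sX sY ac cq Wq) bracket_coord.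
have Z0 Z w : smooth_vfield W Z -> (forall q', W q' -> TF (Z q')) -> (dd (in_chart c Z) (cmap c q) w) 0 i = 0.
  move=> sZ TZ; have sA := sm_in_chart oW sZ ac Wq cq.
  have N : \forall x \near cmap c q, 0 = in_chart c Z x 0 i.
    have nW : \forall q' \near q, W q' by exact: open_nbhs_nbhs.
    have H1 := near_chart cq nW; have H2 := near_cinv cq.
    near=> x; apply: esym.
    have [_ dx] : cmap c (cinv c x) = x /\ cdom c (cinv c x) by near: x; exact: H2.
    have Wx : W (cinv c x) by near: x; exact: H1.
    by have /(E _ dx) := TZ _ Wx; exact.
  by rewrite dd_coord; [rewrite (dd_near w N (differentiable_cst _ _)) dd_cst|exact: sm_diff].
by rewrite big1 // => j _; rewrite !Z0 // !mulr0 subr0.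
Unshelve. all: by end_near. Qed.

End Foliations.

(** * Extension of the operator near a normalised point *)

Section LocalExtension.
Variables (R : realType) (M : manifold R 3) (TF : tangent_distribution M) (Jbar : fibre_map M).
Variables (S : calg R 3) (mu : 'rV[R]_3).
Local Notation "a ** b" := (amul S a b) (at level 40, left associativity).
Local Notation one := (aone S).
Local Notation V5 := 'rV[R]_(2 + 3).
Local Notation V3 := 'rV[R]_3.

Hypothesis pn : partial_nijenhuis TF Jbar.

Definition spans W (v : 'I_2 -> vfield M) :=
  forall q, W q -> forall u : tangent q, TF u -> exists a : 'I_2 -> R, u = \sum_i a i *: v i q.

Lemma Jbar_lin q a (u v : tangent q) : TF u -> TF v -> Jbar (a *: u + v) = a *: Jbar u + Jbar v.
Proof. by have [_ [H _] _] := pn; exact: H. Qed.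

Lemma Jbar_sum q n (a : 'I_n -> R) (u : 'I_n -> tangent q) : (forall i, TF (u i)) ->
  Jbar (\sum_i a i *: u i) = \sum_i a i *: Jbar (u i).
Proof.
have [fol _ _] := pn => H.
have T0 : TF (0 : tangent q).
  have := foliation_sum fol (fun=> 0) H; rewrite big1 // => i _; exact: scale0r.
have J0 : Jbar (0 : tangent q) = 0.
  by have := Jbar_lin 1 T0 T0; rewrite !scale1r addr0 => /eqP; rewrite -subr_eq0 opprD addNKr oppr_eq0 => /eqP.
have : TF (\sum_i a i *: u i) /\ Jbar (\sum_i a i *: u i) = \sum_i a i *: Jbar (u i).
  elim/big_rec2: _ => [|i x y _ [Ty <-]]; first by [].
  by split; [exact: foliation_lin|exact: Jbar_lin].
by case.
Qed.

Section Bracket.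
Variables (W : set M) (v : 'I_2 -> vfield M) (c : chart R 3 M).
Hypothesis oW : open W.
Hypothesis secv : forall i, is_section W TF (v i).
Hypothesis spanv : spans W v.
Hypothesis ac : atlas M c.
Local Notation u := (fun i => apply_field Jbar (v i)).

Lemma smooth_Jbar i : smooth_vfield W (u i).
Proof. by have [_ [_ H] _] := pn; apply: (H W (v i) oW). Qed.

(** [a] exists by involutivity and [b] because the deformed bracket is tangent to the foliation. The
    mixed relation is the definition of that bracket after J is applied to the first relation; the
    last one is the torsion condition. *)
Lemma frame_brackets q : W q -> cdom c q -> exists a b : 'I_2 -> R,
  [/\ bracket (in_chart c (v 0)) (in_chart c (v 1)) (cmap c q) = \sum_i a i *: in_chart c (v i) (cmap c q),
      bracket (in_chart c (u 0)) (in_chart c (v 1)) (cmap c q) + bracket (in_chart c (v 0)) (in_chart c (u 1)) (cmap c q)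
        = \sum_i (a i *: in_chart c (u i) (cmap c q) + b i *: in_chart c (v i) (cmap c q)) &
      bracket (in_chart c (u 0)) (in_chart c (u 1)) (cmap c q) = \sum_i b i *: in_chart c (u i) (cmap c q)].
Proof.
move=> Wq cq; have [fol _ nij] := pn.
have [[s0 T0] [s1 T1]] := (secv 0, secv 1).
have [a Ea] := spanv Wq (foliation_involutive fol oW (secv 0) (secv 1) Wq).
have [[_ Tb] nb] := nij W _ _ oW (secv 0) (secv 1).
have [b Eb] := spanv Wq (Tb _ Wq).
exists a, b.
have TFv i : TF (v i q) by case: (secv i) => _; apply.
have Ja : Jbar (lie_bracket (v 0) (v 1) q) = \sum_i a i *: Jbar (v i q) by rewrite Ea Jbar_sum.
have Jb : Jbar (deformed_bracket Jbar (v 0) (v 1) q) = \sum_i b i *: Jbar (v i q) by rewrite Eb Jbar_sum.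
have cs n (e : 'I_n -> R) (x : 'I_n -> tangent q) : components c (\sum_i e i *: x i) = \sum_i e i *: components c (x i).
  by rewrite components_sum; apply: eq_bigr => i _; exact: componentsZ.
have iE X : in_chart c X (cmap c q) = components c (X q) by exact: in_chart_cmap.
split.
- rewrite -(lie_bracket_chart oW s0 s1 ac cq Wq) Ea cs.
  by apply: eq_bigr => i _; rewrite iE.
- rewrite -(lie_bracket_chart oW (smooth_Jbar 0) s1 ac cq Wq) -(lie_bracket_chart oW s0 (smooth_Jbar 1) ac cq Wq).
  rewrite -componentsD.
  have -> : lie_bracket (u 0) (v 1) q + lie_bracket (v 0) (u 1) q =
      \sum_i a i *: Jbar (v i q) + \sum_i b i *: v i q.
    have K (t x : tangent q) : x = t + (x - t) by rewrite addrC subrK.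
    by rewrite -Eb -Ja; exact: K.
  rewrite componentsD !cs -big_split /=.
  by apply: eq_bigr => i _; rewrite !iE.
- rewrite -(lie_bracket_chart oW (smooth_Jbar 0) (smooth_Jbar 1) ac cq Wq).
  have := nb _ Wq => /eqP; rewrite subr_eq0 => /eqP ->; rewrite Jb cs.
  by apply: eq_bigr => i _; rewrite iE.
Qed.

End Bracket.

Section Extend.
Variables (p : M) (c : chart R 3 M) (W : set M) (v : 'I_2 -> vfield M).
Local Notation u := (fun i => apply_field Jbar (v i)).
Hypotheses (ac : atlas M c) (cp : cdom c p) (p0 : cmap c p = 0) (oW : open W) (Wp : W p).
Hypothesis secv : forall i, is_section W TF (v i).
Hypothesis spanv : spans W v.
Hypothesis v0 : components c (v 0 p) = delta_mx 0 1.
Hypothesis v1 : components c (v 1 p) = delta_mx 0 2%:R.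
Hypothesis u0 : components c (Jbar (v 0 p)) = delta_mx 0 0.
Hypothesis u1 : components c (Jbar (v 1 p)) = delta_mx 0 1.
Hypothesis mu_indep : forall w : V3,
  w 0 2%:R *: one + w 0 1 *: mu + w 0 0 *: (mu ** mu) = 0 -> w = 0.

Variables (V U : 'I_2 -> 'I_3 -> V5 -> V3) (C : (V5 -> V3) -> Prop).
Hypothesis exV : forall i k, \forall y \near (0 : V3), V i k (slice S y) = in_chart c (v i) y 0 k *: one.
Hypothesis exU : forall i k, \forall y \near (0 : V3), U i k (slice S y) = in_chart c (u i) y 0 k *: one.
Hypothesis C_CRsm : forall f, C f -> CRsm S f.
Hypothesis C_cst : forall a, C (fun=> a).
Hypothesis C_sub : forall f g, C f -> C g -> C (fun z => f z - g z).
Hypothesis C_amul : forall f g, C f -> C g -> C (fun z => f z ** g z).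
Hypothesis C_id : forall f, C f -> (\forall y \near (0 : V3), f (slice S y) = 0) ->
  \forall z \near (0 : V5), f z = 0.
Hypothesis CV : forall i k, C (V i k).
Hypothesis CU : forall i k, C (U i k).
Hypothesis CdV : forall i k j, C (fun z => dd (V i k) z (slicevec S j)).
Hypothesis CdU : forall i k j, C (fun z => dd (U i k) z (slicevec S j)).

Theorem local_extension : exists D c' (J : fibre_map M),
  [/\ open D, D p, atlas M c' & D `<=` cdom c'] /\
  [/\ nijenhuis_on D J,
      forall q, D q -> forall w : tangent q, components c' (J q w) = components c' w ** mu &
      forall q, D q -> forall w : tangent q, TF w -> J q w = Jbar w].
Proof.
have [f [sf fJ finj]] : exists f : V3 -> V3, [/\ sm f 0,
  \forall y \near (0 : V3), forall i, dd f y (in_chart c (u i) y) = dd f y (in_chart c (v i) y) ** mu &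
  forall w, dd f 0 w = 0 -> w = 0].
  apply: (@adapted_map _ S mu (fun i => in_chart c (v i)) (fun i => in_chart c (u i)) V U C) => //.
  - by move=> i; rewrite -p0; case: (secv i) => sX _; exact: sm_in_chart sX _ _ _.
  - by move=> i; rewrite -p0; exact: sm_in_chart (smooth_Jbar oW secv i) _ _ _.
  - by rewrite -p0 in_chart_cmap.
  - by rewrite -p0 in_chart_cmap.
  - by rewrite -p0 in_chart_cmap.
  - by rewrite -p0 in_chart_cmap.
  - have nW : \forall q \near p, W q by exact: open_nbhs_nbhs.
    have H1 := near_chart cp nW; have H2 := near_cinv cp; rewrite p0 in H1 H2.
    near=> y.
    have [Ey dy] : cmap c (cinv c y) = y /\ cdom c (cinv c y) by near: y; exact: H2.
    have Wy : W (cinv c y) by near: y; exact: H1.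
    by have := frame_brackets oW secv spanv ac Wy dy; rewrite Ey.
have sfp : sm f (cmap c p) by rewrite p0.
have [|c' [ac' cp' cc' E sc']] := chart_of_map ac cp sfp; first by rewrite p0.
pose G := [set q | [/\ cdom c' q, W q & forall i,
  dd f (cmap c q) (in_chart c (u i) (cmap c q)) = dd f (cmap c q) (in_chart c (v i) (cmap c q)) ** mu]].
have GD q : interior G q -> G q by exact: nbhs_singleton.
exists (interior G), c', (mul_operator S mu c'); split; split=> //.
- exact: open_interior.
- rewrite /interior /=.
  have H1 := near_cdom cp'; have H2 : \forall q \near p, W q by exact: open_nbhs_nbhs.
  have H3 : \forall q \near p, forall i, dd f (cmap c q) (in_chart c (u i) (cmap c q)) =
      dd f (cmap c q) (in_chart c (v i) (cmap c q)) ** mu.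
    by apply: (chart_near cp (P := fun y => forall i, dd f y (in_chart c (u i) y) = dd f y (in_chart c (v i) y) ** mu)); rewrite p0.
  near=> q; split; near: q; [exact: H1|exact: H2|exact: H3].
- by move=> q /GD[].
- by apply: mul_operator_nijenhuis => // q /GD[].
- by move=> q /GD[cq _ _] w; exact: mul_operatorE.
- move=> q /GD[cq' Wq H] w Tw; apply: (components_inj ac' cq').
  have cq := cc' _ cq'.
  have [a Ea] := spanv Wq Tw.
  have TFv i : TF (v i q) by case: (secv i) => _; apply.
  rewrite mul_operatorE // Ea Jbar_sum // !components_sum.
  have -> : (\sum_i components c' (a i *: v i q)) ** mu = \sum_i (components c' (a i *: v i q)) ** mu.
    by rewrite !sum2 amulDl.
  apply: eq_bigr => i _; rewrite !componentsZ amulZl; congr (_ *: _).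
  have sq := sc' _ cq'.
  rewrite !(components_of_map _ ac ac' cq cq' E sq).
  by have := H i; rewrite !in_chart_cmap.
Unshelve. all: by end_near. Qed.

End Extend.
End LocalExtension.

(** * Types A, B and C *)

Definition extendible (R : realType) (S : calg R 3) (f : 'rV[R]_3 -> R) :=
  exists G, @CRsm R 3 S 2 G /\ \forall y \near (0 : 'rV[R]_3), G (slice S y) = f y *: aone S.

Section NormalChart.
Variables (R : realType) (M : manifold R 3).
Local Notation V3 := 'rV[R]_3.

Lemma sm_affine m (x0 : 'rV[R]_m) (P : 'M[R]_m) x : sm (fun y => (y - x0) *m P) x.
Proof.
have sB : sm (fun y : 'rV[R]_m => y - x0) x by apply: smB; [exact: sm_id|exact: sm_cst].
exact: (sm_linrV (mulmxr P : {linear 'rV[R]_m -> 'rV[R]_m}) sB).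
Qed.

Lemma dd_affine m (x0 : 'rV[R]_m) (P : 'M[R]_m) x w : dd (fun y => (y - x0) *m P) x w = w *m P.
Proof.
have dB : differentiable (fun y : 'rV[R]_m => y - x0) x.
  by apply/sm_diff; apply: smB; [exact: sm_id|exact: sm_cst].
have dP : differentiable (mulmxr P : {linear 'rV[R]_m -> 'rV[R]_m}) (x - x0).
  exact/sm_diff/(sm_linrV (mulmxr P : {linear 'rV[R]_m -> 'rV[R]_m}) (sm_id _)).
rewrite -[LHS]/(dd (fun y => (mulmxr P : {linear 'rV[R]_m -> 'rV[R]_m}) (y - x0)) x w).
rewrite (dd_comp w dB dP) dd_linear /= dd_sub; last 2 first.
- exact/sm_diff/sm_id.
- exact: differentiable_cst.
by rewrite dd_cst subr0 (dd_linear (@idfun 'rV[R]_m)).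
Qed.

Lemma frame_unitmx (c : chart R 3 M) W (w : 'I_3 -> vfield M) p : atlas M c -> cdom c p -> W p ->
  frame W (full_tangent M) w -> (\matrix_i components c (w i p)) \in unitmx.
Proof.
move=> ac cp Wp [_ /(_ p Wp) H]; rewrite -row_full_unit -sub1mx; apply/row_subP => i.
have [a [E _]] := H (tangent_of c p (row i 1%:M)) I.
apply/submxP; exists a; rewrite -(tangent_ofK (row i 1%:M) ac cp) E componentsE dd_sum.
by rewrite mulmx_sum_row; apply: eq_bigr => j _; rewrite ddZ -componentsE rowK.
Qed.

(** The new chart is an affine function of the old one, which lets power series expansions in [c0]
    be transported to it. *)
Lemma normal_chart (c0 : chart R 3 M) p (w : 'I_3 -> tangent p) : atlas M c0 -> cdom c0 p ->
  (\matrix_i components c0 (w i)) \in unitmx ->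
  exists (c : chart R 3 M) (P : 'M[R]_3),
   [/\ atlas M c, cdom c p /\ cdom c `<=` cdom c0, P \in unitmx,
     forall q, cmap c q = (cmap c0 q - cmap c0 p) *m P &
     (forall q (u : tangent q), cdom c q -> components c u = components c0 u *m P) /\
     forall i, components c (w i) = delta_mx 0 i].
Proof.
move=> a0 c0p; set A := \matrix_i _ => uA; pose P := invmx A.
have uP : P \in unitmx by rewrite unitmx_inv.
pose psi (x : V3) := (x - cmap c0 p) *m P.
have [||c [ac cp sub E sc]] := @chart_of_map _ _ _ c0 p psi a0 c0p.
- exact: sm_affine.
- by move=> h; rewrite dd_affine => /(congr1 (mulmx^~ A)); rewrite mulmxKV // mul0mx.
have cE q (u : tangent q) : cdom c q -> components c u = components c0 u *m P.
  by move=> cq; rewrite (components_of_map u a0 ac (sub _ cq) cq E (sc _ cq)) dd_affine.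
exists c, P; split=> //; split=> // i.
have -> : components c (w i) = row i A *m P by rewrite cE // rowK.
by rewrite -row_mul mulmxV // row1.
Qed.

End NormalChart.

Section SmoothTypes.
Variables (R : realType) (M : manifold R 3) (TF : tangent_distribution M) (Jbar : fibre_map M).
Local Notation V5 := 'rV[R]_(2 + 3).
Local Notation V3 := 'rV[R]_3.
Hypothesis pn : partial_nijenhuis TF Jbar.
Hypothesis gen : generic_type TF Jbar.

Definition extends_as_at (S : calg R 3) (mu : V3) (p : M) := exists D c' (J : fibre_map M),
  [/\ open D, D p, atlas M c' & D `<=` cdom c'] /\
  [/\ nijenhuis_on D J,
      forall q, D q -> forall w : tangent q, components c' (J q w) = amul S (components c' w) mu &
      forall q, D q -> forall w : tangent q, TF w -> J q w = Jbar w].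

Definition extends_as (S : calg R 3) (mu : V3) := forall p : M, extends_as_at S mu p.

Section Extension.
Variables (S : calg R 3) (mu : V3).
Hypothesis indep : forall w : V3,
  w 0 2%:R *: aone S + w 0 1 *: mu + w 0 0 *: amul S mu mu = 0 -> w = 0.
Hypothesis uniq : forall f, CRsm S f -> (\forall y \near (0 : V3), f (slice S y) = 0) ->
  \forall z \near (0 : V5), f z = 0.

Lemma extendible_frame_extension p (c : chart R 3 M) W (v : 'I_2 -> vfield M) (w : 'I_3 -> tangent p) :
  atlas M c -> cdom c p -> cmap c p = 0 -> open W -> W p ->
  (forall i, is_section W TF (v i)) -> spans TF W v ->
  (forall i, components c (w i) = delta_mx 0 i) ->
  (forall i, Jbar (v i p) = w (widen_ord (leqnSn 2) i) /\ v i p = w (lift ord0 i)) ->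
  (forall i k, extendible S (fun y => in_chart c (v i) y 0 k)) ->
  (forall i k, extendible S (fun y => in_chart c (apply_field Jbar (v i)) y 0 k)) ->
  extends_as_at S mu p.
Proof.
move=> ac cp p0 oW Wp secv spanv cw vw exV exU.
have /choice[V HV] : forall ik : 'I_2 * 'I_3, exists G, CRsm S G /\
    \forall y \near (0 : V3), G (slice S y) = in_chart c (v ik.1) y 0 ik.2 *: aone S by move=> ik; exact: exV.
have /choice[U HU] : forall ik : 'I_2 * 'I_3, exists G, CRsm S G /\
    \forall y \near (0 : V3), G (slice S y) = in_chart c (apply_field Jbar (v ik.1)) y 0 ik.2 *: aone S.
  by move=> ik; exact: exU.
have l0 : lift ord0 0 = 1 :> 'I_3 by exact/val_inj.
have l1 : lift ord0 1 = 2%:R :> 'I_3 by exact/val_inj.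
have w0 : widen_ord (leqnSn 2) 0 = 0 :> 'I_3 by exact/val_inj.
have w1 : widen_ord (leqnSn 2) 1 = 1 :> 'I_3 by exact/val_inj.
have [e0 f0] := vw 0; have [e1 f1] := vw 1.
have X := (@local_extension _ M TF Jbar S mu pn p c W v ac cp p0 oW Wp secv spanv _ _ _ _ indep
  (fun i k => V (i, k)) (fun i k => U (i, k)) (@CRsm R 3 S 2)).
apply: X => //.
- by rewrite f0 l0.
- by rewrite f1 l1.
- by rewrite e0 w0.
- by rewrite e1 w1.
- by move=> i k; case: (HV (i, k)).
- by move=> i k; case: (HU (i, k)).
- exact: CRsm_cst.
- exact: CRsm_sub.
- exact: CRsm_amul.
- by move=> i k; case: (HV (i, k)).
- by move=> i k; case: (HU (i, k)).
- by move=> i k j; apply: CRsm_derive; case: (HV (i, k)).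
- by move=> i k j; apply: CRsm_derive; case: (HU (i, k)).
Qed.

Lemma smooth_extension :
  (forall (f : V3 -> V3) k, sm f 0 -> extendible S (fun y => f y 0 k)) -> extends_as S mu.
Proof.
move=> ext p.
have [W [v [w [oW Wp [secv fv] fw vw]]]] := gen p.
have [c0 [a0 c0p]] := atlas_cover p.
have [c [P [ac [cp _] _ E [_ cw]]]] := normal_chart a0 c0p (frame_unitmx a0 c0p Wp fw).
have p0 : cmap c p = 0 by rewrite E subrr mul0mx.
have spanv : spans TF W v.
  by move=> q Wq u Tu; have [a [Ea _]] := fv q Wq u Tu; exists (a 0).
apply: (extendible_frame_extension ac cp p0 oW Wp secv spanv cw) => [i|i k|i k]; first exact: vw.
- by apply: ext; rewrite -p0; case: (secv i) => sX _; exact: sm_in_chart sX _ _ _.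
- by apply: ext; rewrite -p0; exact: sm_in_chart (smooth_Jbar pn oW secv i) _ _ _.
Qed.

End Extension.

Lemma smooth1_cst (D : set R) (a : R) : smooth1_on D (fun=> a).
Proof.
move=> k t _; have E : derive1n k (fun=> a) = (fun=> if k == 0%N then a else 0).
  elim: k => [//|k IH]; rewrite derive1nS IH; apply/funext => x; rewrite derive1E; exact: derive_cst.
by rewrite E; exact: derivable_cst.
Qed.

Lemma locally_extends_of (S : calg R 3) (mu : V3) (T : set M -> fibre_map M -> Prop) :
  extends_as S mu ->
  (forall D c' (J : fibre_map M), atlas M c' -> D `<=` cdom c' ->
    (forall q, D q -> forall w : tangent q, components c' (J q w) = amul S (components c' w) mu) -> T D J) ->
  locally_extends TF Jbar T.
Proof.
move=> H HT p; have [D [c' [J [[oD Dp ac' sub] [nj mJ eJ]]]]] := H p.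
by exists D; split=> //; exists J; split=> //; exact: HT mJ.
Qed.

Lemma mx3_mul (a b c d e f g h i : R) (x : V3) : (mx3 [:: [:: a; b; c]; [:: d; e; f]; [:: g; h; i]] *m x^T)^T =
  vec3 (a * x 0 0 + b * x 0 1 + c * x 0 2%:R) (d * x 0 0 + e * x 0 1 + f * x 0 2%:R)
       (g * x 0 0 + h * x 0 1 + i * x 0 2%:R).
Proof. by apply: rowP3; rewrite vec3E !mxE sum3 !mxE. Qed.

Lemma has_matrixP (c : chart R 3 M) (J : fibre_map M) q A :
  (forall w : tangent q, components c (J q w) = (A *m (components c w)^T)^T) -> has_matrix c J q A.
Proof. by move=> H w; rewrite H trmxK. Qed.

(** mu = (1, 2, 3) has distinct components, so its powers are independent by the Vandermonde
    determinant. *)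
Lemma locally_extends_A : locally_extends TF Jbar (@typeA R M).
Proof.
have H : extends_as (algA R) (vec3 1 2 3).
  apply: smooth_extension.
  - move=> w H.
    have := congr1 (fun x : V3 => x 0 0) H; have := congr1 (fun x : V3 => x 0 1) H;
    have := congr1 (fun x : V3 => x 0 2%:R) H.
    rewrite !mxE /= ?mxE /= => E0 E1 E2.
    by apply: rowP3; rewrite mxE; lra.
  - exact: algA_unique.
  - by move=> f k; exact: extendA.
apply: (locally_extends_of H) => D c' J ac' sub mJ; exists c'; split=> //.
exists (fun=> 1), (fun=> 2), (fun=> 3); split; [exact: smooth1_cst|exact: smooth1_cst|exact: smooth1_cst|].
move=> q Dq; split.
- by apply/eqP => E; lra.
- by apply/eqP => E; lra.
- by apply/eqP => E; lra.
apply: has_matrixP => w; rewrite mJ // mx3_mul /= /mulA !vec3E.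
by apply: rowP3; rewrite !vec3E; ring.
Qed.

(** mu = (e, 1) in R[e]/e^2 x R: a nilpotent block with eigenvalue 0 and the eigenvalue 1. *)
Lemma locally_extends_B : locally_extends TF Jbar (@typeB R M).
Proof.
have H : extends_as (algB R) (vec3 1 0 1).
  apply: smooth_extension.
  - move=> w H.
    have := congr1 (fun x : V3 => x 0 0) H; have := congr1 (fun x : V3 => x 0 1) H;
    have := congr1 (fun x : V3 => x 0 2%:R) H.
    rewrite !mxE /= ?mxE /= => E0 E1 E2.
    by apply: rowP3; rewrite mxE; lra.
  - exact: algB_unique.
  - by move=> f k; exact: extendB.
apply: (locally_extends_of H) => D c' J ac' sub mJ; exists c'; split=> //.
exists (fun=> 0), (fun=> 1); split; [exact: smooth1_cst|exact: smooth1_cst|].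
move=> q Dq; split; first by apply/eqP => E; lra.
apply: has_matrixP => w; rewrite mJ // mx3_mul /= /mulB !vec3E.
by apply: rowP3; rewrite !vec3E; ring.
Qed.

(** mu = e in R[e]/e^3. The eigenvalue is the constant 0, so the exponential entry of the matrix is
    1. *)
Lemma locally_extends_C : locally_extends TF Jbar (@typeC R M).
Proof.
have H : extends_as (algC R) (vec3 0 1 0).
  apply: smooth_extension.
  - move=> w H.
    have := congr1 (fun x : V3 => x 0 0) H; have := congr1 (fun x : V3 => x 0 1) H;
    have := congr1 (fun x : V3 => x 0 2%:R) H.
    rewrite !mxE /= ?mxE /= => E0 E1 E2.
    by apply: rowP3; rewrite mxE; lra.
  - exact: algC_unique.
  - by move=> f k; exact: extendC.
apply: (locally_extends_of H) => D c' J ac' sub mJ; exists c'; split=> //.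
exists (fun=> 0); split; first exact: smooth1_cst.
move=> q Dq; apply: has_matrixP => w; rewrite mJ // mx3_mul /= /mulC !vec3E.
rewrite derive1E derive_cst [0 * coord2 c' q]mul0r expR0.
by apply: rowP3; rewrite !vec3E; ring.
Qed.

(** mu = (i, 0) in C x R: the holomorphic function is the constant i. *)
Lemma locally_extends_D : extends_as (algD R) (vec3 0 1 0) -> locally_extends TF Jbar (@typeD R M).
Proof.
move=> H; apply: (locally_extends_of H) => D c' J ac' sub mJ; exists c'; split=> //.
exists (fun=> (0 +i* 1)%C), (fun=> 0); split; first exact: smooth1_cst.
move=> q Dq /=; split; [exact: derivable_cst|exact: oner_neq0|].
apply: has_matrixP => w; rewrite mJ // mx3_mul /= /mulD !vec3E.
by apply: rowP3; rewrite !vec3E; ring.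
Qed.

End SmoothTypes.

(** * Unique continuation from the real slice for type D *)

Section SecondDerivative.
Variables (R : realType) (m : nat).
Implicit Types (f g : 'rV[R]_m -> R) (x v : 'rV[R]_m).

Lemma derive_smM f g v x : sm f x -> sm g x ->
  'D_v (fun y => f y * g y) x = 'D_v f x * g x + f x * 'D_v g x.
Proof.
move=> /sm_diff df /sm_diff dg.
rewrite deriveM; [|exact: diff_derivable|exact: diff_derivable].
by rewrite addrC mulrC.
Qed.

Lemma derive_smD f g v x : sm f x -> sm g x -> 'D_v (fun y => f y + g y) x = 'D_v f x + 'D_v g x.
Proof. by move=> /sm_diff df /sm_diff dg; rewrite deriveD //; exact: diff_derivable. Qed.

Lemma derive_smN f v x : sm f x -> 'D_v (fun y => - f y) x = - 'D_v f x.
Proof. by move=> /sm_diff df; rewrite deriveN //; exact: diff_derivable. Qed.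

Lemma second_derive_max f v x : sm f x -> (\forall t \near (0 : R), f (x + t *: v) <= f x) ->
  'D_v (fun y => 'D_v f y) x <= 0.
Proof.
move=> sf mx; rewrite leNgt; apply/negP; set L := 'D_v _ x => L0.
have sf1 : sm (fun y => 'D_v f y) x := smR_derive v sf.
have [K K0 HK] := sm_quadR sf1.
have [e e0 He] : exists2 e : R, 0 < e & forall y, ball x e y -> differentiable f y /\
    `|'D_v f y - 'D_v f x - 'd (fun y => 'D_v f y) x (y - x)| <= K * `|y - x| ^+ 2.
  near (0 : R)^'+ => d; exists d; first by near: d; exact: nbhs_right_gt.
  move=> y xy; split.
    move: y xy; near: d; apply: near_ball_right; apply: filterS (sm_near sf) => y /sm_diff; exact.
  have H : forall y z, ball x d y -> ball x d z -> `|'D_v f z - 'D_v f y - 'd (fun y => 'D_v f y) y (z - y)| <= K * `|z - y| ^+ 2.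
    by near: d.
  by apply: H => //; apply: ballxx; near: d; exact: nbhs_right_gt.
have Ld : 'd (fun y => 'D_v f y) x v = L by rewrite /L [RHS]deriveE //; exact: sm_diff.
have mx2 : \forall t \near (0 : R), f (x + (- t) *: v) <= f x.
  have co : {for (0 : R), continuous (fun t : R => - t)} by exact: opp_continuous.
  by apply: (co (fun t => f (x + t *: v) <= f x)); rewrite oppr0.
have c0 : 0 < 2 * K * `|v| ^+ 2 + 1 by apply: ltr_wpDl => //; rewrite mulr_ge0 ?exprn_ge0 // mulr_ge0.
near (0 : R)^'+ => t.
have t0 : 0 < t by near: t; exact: nbhs_right_gt.
have te : t * `|v| < e.
  have : t < e / (`|v| + 1) by near: t; apply: nbhs_right_lt; rewrite divr_gt0 // ltr_wpDl.
  rewrite ltr_pdivlMr ?ltr_wpDl //; apply: le_lt_trans.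
  by rewrite ler_pM2l // lerDl.
have m1 : f (x + t *: v) <= f x by near: t; apply: cvg_within; exact: mx.
have m2 : f (x + (- t) *: v) <= f x by near: t; apply: cvg_within; exact: mx2.
have tL : 2 * K * `|v| ^+ 2 * t <= L.
  have : t <= L / (2 * K * `|v| ^+ 2 + 1) by near: t; apply: nbhs_right_le; rewrite divr_gt0.
  rewrite ler_pdivlMr // mulrC; apply: le_trans.
  by apply: ler_wpM2r; [exact: ltW|rewrite lerDl].
have bs s : `|s| <= t -> ball x e (x + s *: v).
  move=> st; rewrite -ball_normE /= opprD addNKr normrN normrZ.
  by apply: le_lt_trans te; rewrite ler_wpM2r.
have df s : `|s| <= t -> is_derive s (1 : R) (fun s : R => f (x + s *: v)) ('D_v f (x + s *: v)).
  move=> st; have [dfs _] := He _ (bs _ st).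
  by rewrite (deriveE _ dfs); exact: (is_derive_curve (is_derive_line x v s) dfs).
have est s : `|s| <= t -> `|'D_v f (x + s *: v) - 'D_v f x - s * L| <= K * `|v| ^+ 2 * s ^+ 2.
  move=> st; have [_] := He _ (bs _ st).
  have -> : x + s *: v - x = s *: v by rewrite addrAC subrr add0r.
  rewrite linearZ /= Ld normrZ exprMn real_normK ?num_real //.
  by rewrite (mulrC (s ^+ 2)) mulrA.
pose psi s := f (x + s *: v) + f (x + (- s) *: v) - L / 2 * (s * s).
have dpsi s : 0 <= s <= t -> is_derive s (1 : R) psi ('D_v f (x + s *: v) - 'D_v f (x + (- s) *: v) - L * s).
  move=> /andP[s0 st]; have s1 : `|s| <= t by rewrite ger0_norm.
  have s2 : `|- s| <= t by rewrite normrN.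
  have d1 := df _ s1; have d2 := df _ s2.
  have dN : is_derive s (1 : R) (fun s : R => - s) (- 1).
    by have := is_deriveN (is_derive_id s (1 : R)).
  have d3 : is_derive s (1 : R) (fun s : R => f (x + (- s) *: v)) (- 'D_v f (x + (- s) *: v)).
    have := @is_derive1_comp R (fun s : R => f (x + s *: v)) (fun s : R => - s) s _ _ d2 dN.
    by rewrite mulrN1.
  have d4 : is_derive s (1 : R) (fun s : R => L / 2 * (s * s)) (L * s).
    have := is_deriveZ (L / 2) (is_deriveM (is_derive_id s (1 : R)) (is_derive_id s (1 : R))).
    by rewrite (_ : _ *: _ = L * s) // /GRing.scale /=; field.
  exact: is_deriveB (is_deriveD d1 d3) d4.
have [s s0t] := MVTR (ltW t0) dpsi; rewrite subr0 => E.
have /andP[s0 st] := s0t.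
have s1 : `|s| <= t by rewrite ger0_norm.
have s2 : `|- s| <= t by rewrite normrN.
have : 0 <= psi t - psi 0.
  rewrite E; apply: mulr_ge0; last exact: ltW.
  have := est _ s1; have := est _ s2; rewrite !ler_norml sqrrN => /andP[_ E2] /andP[E1 _].
  have sb : K * `|v| ^+ 2 * s ^+ 2 * 2 <= L * s.
    rewrite expr2 [X in X <= _](_ : _ = 2 * K * `|v| ^+ 2 * s * s); last by ring.
    apply: ler_wpM2r => //; apply: le_trans tL; apply: ler_wpM2l => //.
    by rewrite mulr_ge0 ?exprn_ge0 // mulr_ge0.
  by lra.
rewrite /psi oppr0 !scale0r !addr0 !mulr0 subr0.
have : 0 < L / 2 * (t * t) by rewrite mulr_gt0 ?divr_gt0 // mulr_gt0.
by lra.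
Unshelve. all: by end_near. Qed.

End SecondDerivative.

(** * Holomorphic functions on a half box *)

Section MaximumPrinciple.
Variable R : realType.
Local Notation V2 := 'rV[R]_2.
Local Notation a := (delta_mx 0 0 : V2).
Local Notation b := (delta_mx 0 1 : V2).
Implicit Types (p q u w : V2 -> R) (y : V2).

Lemma near_lt_affine (x y z : R) : x < y -> \forall t \near (0 : R), x < y + t * z.
Proof.
move=> xy; have z0 : 0 < `|z| + 1 by rewrite ltr_wpDl.
have d0 : 0 < (y - x) / (`|z| + 1) by rewrite divr_gt0 // subr_gt0.
apply: filterS (nbhsx_ballx (0 : R) _ d0) => t.
rewrite -ball_normE /= sub0r normrN ltr_pdivlMr // => H.
have : `|t * z| < y - x.
  by apply: le_lt_trans H; rewrite normrM ler_wpM2l // lerDl.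
by rewrite ltr_norml => /andP[H1 _]; lra.
Qed.

(* p + i q is smooth and holomorphic near y. *)
Record holo p q y : Prop := Holo {
  holoP : sm p y; holoQ : sm q y;
  holoE : \forall z \near y, 'D_a p z = 'D_b q z /\ 'D_a q z = - 'D_b p z }.

Lemma holo_mul p q u w y : holo p q y -> holo u w y ->
  holo (fun z => p z * u z - q z * w z) (fun z => p z * w z + q z * u z) y.
Proof.
move=> [sp sq E] [su sw E'].
have np := sm_near sp; have nq := sm_near sq; have nu := sm_near su; have nw := sm_near sw.
split; [by apply: smB; exact: smM|by apply: smD; exact: smM|near=> z].
have spz : sm p z by near: z.
have sqz : sm q z by near: z.
have suz : sm u z by near: z.
have swz : sm w z by near: z.
have [e1 e2] : 'D_a p z = 'D_b q z /\ 'D_a q z = - 'D_b p z by near: z.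
have [e3 e4] : 'D_a u z = 'D_b w z /\ 'D_a w z = - 'D_b u z by near: z.
have sM (f g : V2 -> R) : sm f z -> sm g z -> sm (fun z => f z * g z) z by exact: smM.
have DB (f g : V2 -> R) v : sm f z -> sm g z -> 'D_v (fun z => f z - g z) z = 'D_v f z - 'D_v g z.
  by move=> sf sg; rewrite (derive_smD v sf (smN sg)) derive_smN.
rewrite !(DB _ _ _ (sM _ _ spz suz) (sM _ _ sqz swz)).
rewrite !(derive_smD _ (sM _ _ spz swz) (sM _ _ sqz suz)).
rewrite !(derive_smM _ spz suz) !(derive_smM _ sqz swz) !(derive_smM _ spz swz) !(derive_smM _ sqz suz).
by rewrite e1 e2 e3 e4; split; ring.
Unshelve. all: by end_near. Qed.

Lemma laplaceE p q y : holo p q y ->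
  'D_a (fun z => 'D_a p z) y + 'D_b (fun z => 'D_b p z) y = 0 /\
  'D_a (fun z => 'D_a q z) y + 'D_b (fun z => 'D_b q z) y = 0.
Proof.
move=> [sp sq E].
have E1 : \forall z \near y, 'D_a p z = 'D_b q z by apply: filterS E => z [].
have E2 : \forall z \near y, 'D_a q z = - 'D_b p z by apply: filterS E => z [].
have E3 : \forall z \near y, 'D_b q z = 'D_a p z by apply: filterS E => z [].
have E4 : \forall z \near y, 'D_b p z = - 'D_a q z by apply: filterS E => z [_ ->]; rewrite opprK.
have sD (f : V2 -> R) v : sm f y -> sm (fun z => 'D_v f z) y by exact: smR_derive.
split.
- rewrite (near_eq_derive a E1) (schwarzR b a sq) (near_eq_derive b E2).
  by rewrite (derive_smN b (sD _ b sp)) addNr.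
- rewrite (near_eq_derive a E2) (derive_smN a (sD _ b sp)) (schwarzR b a sp).
  by rewrite (near_eq_derive b E1) addNr.
Qed.

Lemma derive2_sqr p v y : sm p y -> 'D_v (fun z => 'D_v (fun z => p z * p z) z) y =
  2 * ('D_v p y * 'D_v p y + p y * 'D_v (fun z => 'D_v p z) y).
Proof.
move=> sp; have E : \forall z \near y, 'D_v (fun z => p z * p z) z = 'D_v p z * p z + p z * 'D_v p z.
  by apply: filterS (sm_near sp) => z sz; rewrite derive_smM.
have sD := smR_derive v sp.
rewrite (near_eq_derive v E) (derive_smD v (smM sD sp) (smM sp sD)) (derive_smM v sD sp) (derive_smM v sp sD).
ring.
Qed.

Definition half_box : set V2 := [set y | -1 <= y 0 0 <= 1 /\ 0 <= y 0 1 <= 1].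

Lemma compact_half_box : compact half_box.
Proof.
have := @rV_compact R 2 (fun i => if i == 0 then `[-1, 1]%classic else `[0, 1]%classic).
rewrite (_ : [set v | _] = half_box); last first.
  apply/seteqP; split=> y /=.
    by move=> H; have := H 0; have := H 1; rewrite /= !in_itv /=.
  by move=> [H0 H1]; apply: ord2P; rewrite /= in_itv.
by apply=> i; case: ifP => _; exact: segment_compact.
Qed.

(** The inequalities are the second-derivative tests of |p + i q|^2 + e x_0^2 at a maximum, in the
    two directions. With p and q harmonic, their sum is 2 |grad p|^2 + 2 |grad q|^2 + 2 e <= 0. *)
Lemma laplace_absurd (pc qc pa pb qa qb paa pbb qaa qbb e : R) :
  paa + pbb = 0 -> qaa + qbb = 0 -> 0 < e ->
  2 * (pa * pa + pc * paa) + 2 * (qa * qa + qc * qaa) + e * (2 * (1 * 1)) <= 0 ->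
  2 * (pb * pb + pc * pbb) + 2 * (qb * qb + qc * qbb) + e * (2 * (0 * 0)) <= 0 -> False.
Proof.
move=> L1 L2 e0 T1 T2.
have E1 : pbb = - paa by lra.
have E2 : qbb = - qaa by lra.
have := sqr_ge0 pa; have := sqr_ge0 pb; have := sqr_ge0 qa; have := sqr_ge0 qb.
by rewrite E1 E2 in T2; lra.
Qed.

(** The term e x_0^2 makes the function strictly subharmonic and so excludes an interior maximum.
    Since x_0^2 <= 1 on the box and e is half of the excess over B, the maximum is not on the
    boundary either. *)
Lemma maximum_principle p q B : (forall y, half_box y -> holo p q y) ->
  (forall y, half_box y -> [\/ y 0 0 = 1, y 0 0 = -1, y 0 1 = 0 | y 0 1 = 1] -> p y * p y + q y * q y <= B) ->
  forall y, half_box y -> p y * p y + q y * q y <= B.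
Proof.
move=> H HB y0 Ky0; rewrite leNgt; apply/negP => lt0.
pose e := (p y0 * p y0 + q y0 * q y0 - B) / 2.
have e0 : 0 < e by rewrite divr_gt0 // subr_gt0.
pose x0 (y : V2) := y 0 0.
have sx y : sm x0 y by apply: sm_coord; exact: sm_id.
pose f y := p y * p y + q y * q y + e * (x0 y * x0 y).
have spp y : half_box y -> sm (fun y => p y * p y) y by move=> /H[sp _ _]; exact: smM.
have sqq y : half_box y -> sm (fun y => q y * q y) y by move=> /H[_ sq _]; exact: smM.
have sxx y : sm (fun y => x0 y * x0 y) y by exact: smM.
have sf y : half_box y -> sm f y.
  move=> Ky; apply: smD; first by apply: smD; [exact: spp|exact: sqq].
  by apply: smM; [exact: sm_cst|].
have [||c] := @EVT_max_rV _ _ f half_box _ compact_half_box.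
- by exists y0.
- by apply: continuous_in_subspaceT => y /set_mem /sf /sm_cont.
rewrite inE => Kc mx.
have fc : B + 2 * e <= f c.
  apply: le_trans (mx _ (mem_set Ky0)).
  have -> : B + 2 * e = p y0 * p y0 + q y0 * q y0 by rewrite /e; field.
  by rewrite /f lerDl; apply: mulr_ge0; [exact: ltW|rewrite -expr2 sqr_ge0].
have xc : x0 c * x0 c <= 1.
  by have [/andP[c1 c2] _] := Kc; rewrite /x0; nra.
have nbd : ~ [\/ c 0 0 = 1, c 0 0 = -1, c 0 1 = 0 | c 0 1 = 1].
  move=> /(HB _ Kc) HBc; have : f c <= B + e by rewrite /f lerD // ler_piMr // ltW.
  by move=> H1; have := le_trans fc H1; nra.
have [/andP[c1 c2] /andP[c3 c4]] := Kc.
have int v : \forall t \near (0 : R), half_box (c + t *: v).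
  have n1 : c 0 0 < 1 by rewrite lt_neqAle c2 andbT; apply/eqP => E; apply: nbd; constructor 1.
  have n2 : -1 < c 0 0 by rewrite lt_neqAle c1 andbT; apply/eqP => E; apply: nbd; constructor 2.
  have n3 : 0 < c 0 1 by rewrite lt_neqAle c3 andbT; apply/eqP => E; apply: nbd; constructor 3.
  have n4 : c 0 1 < 1 by rewrite lt_neqAle c4 andbT; apply/eqP => E; apply: nbd; constructor 4.
  rewrite -ltrN2 in n1; rewrite -ltrN2 in n4.
  have N1 := near_lt_affine (- v 0 0) n1; have N2 := near_lt_affine (v 0 0) n2.
  have N3 := near_lt_affine (v 0 1) n3; have N4 := near_lt_affine (- v 0 1) n4.
  near=> t; split; rewrite !mxE.
    have a1 : -1 < - c 0 0 + t * - v 0 0 by near: t; exact: N1.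
    have a2 : -1 < c 0 0 + t * v 0 0 by near: t; exact: N2.
    by apply/andP; split; lra.
  have a1 : -1 < - c 0 1 + t * - v 0 1 by near: t; exact: N4.
  have a2 : 0 < c 0 1 + t * v 0 1 by near: t; exact: N3.
  by apply/andP; split; lra.
have test v : 'D_v (fun y => 'D_v f y) c <= 0.
  apply: second_derive_max; first exact: sf.
  by apply: filterS (int v) => t Kt; apply: mx; exact: mem_set.
have Df v : 'D_v (fun y => 'D_v f y) c = 'D_v (fun z => 'D_v (fun z => p z * p z) z) c +
    'D_v (fun z => 'D_v (fun z => q z * q z) z) c + e * 'D_v (fun z => 'D_v (fun z => x0 z * x0 z) z) c.
  have sP := spp _ Kc; have sQ := sqq _ Kc; have sX := sxx c.
  have nP := sm_near sP; have nQ := sm_near sQ; have nX := sm_near sX.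
  have De (g : V2 -> R) z : sm g z -> 'D_v (fun z => e * g z) z = e * 'D_v g z.
    by move=> sg; rewrite (derive_smM v (sm_cst e z) sg) derive_cst mul0r add0r.
  have E : \forall z \near c, 'D_v f z = 'D_v (fun z => p z * p z) z + 'D_v (fun z => q z * q z) z
      + e * 'D_v (fun z => x0 z * x0 z) z.
    near=> z.
    have sPz : sm (fun z => p z * p z) z by near: z; exact: nP.
    have sQz : sm (fun z => q z * q z) z by near: z; exact: nQ.
    have sXz : sm (fun z => x0 z * x0 z) z by near: z; exact: nX.
    by rewrite (derive_smD v (smD sPz sQz) (smM (sm_cst e z) sXz)) (derive_smD v sPz sQz) De.
  have dP := smR_derive v sP; have dQ := smR_derive v sQ; have dX := smR_derive v sX.
  rewrite (near_eq_derive v E) (derive_smD v (smD dP dQ) (smM (sm_cst e c) dX)).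
  by rewrite (derive_smD v dP dQ) De.
have [sp sq _] := H _ Kc; have [L1 L2] := laplaceE (H _ Kc).
have Dx v y : 'D_v x0 y = v 0 0.
  by rewrite /x0 -(@derive_coord R V2 2 id y v 0) ?derive_id //; exact: derivable_id.
have Dxx v : 'D_v (fun y => 'D_v x0 y) c = 0.
  by rewrite (_ : (fun y => 'D_v x0 y) = (fun=> v 0 0)); [exact: derive_cst|apply/funext => y].
have T (v : V2) (k : R) : v 0 0 = k -> 2 * ('D_v p c * 'D_v p c + p c * 'D_v (fun z => 'D_v p z) c) +
    2 * ('D_v q c * 'D_v q c + q c * 'D_v (fun z => 'D_v q z) c) + e * (2 * (k * k)) <= 0.
  move=> vk; have := test v; rewrite (Df v) (derive2_sqr v sp) (derive2_sqr v sq) (derive2_sqr v (sx c)).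
  by rewrite (Dxx v) (Dx v c) vk mulr0 addr0.
have aE : a 0 0 = 1 by rewrite mxE.
have bE : b 0 0 = 0 by rewrite mxE.
exact: (laplace_absurd L1 L2 e0 (T _ _ aE) (T _ _ bE)).
Unshelve. all: by end_near. Qed.

Let x0 (y : V2) : R := y 0 0.
Let x1 (y : V2) : R := y 0 1.

(* The real and imaginary parts of 1 + (1/4 + i z - z^2/2)/32, whose modulus is
   at most 1 on the sides of the half box that do not lie on the real axis, and
   larger than 1 near 0. *)
Definition weight_re (y : V2) : R := 129 / 128 + (- 32^-1 * x1 y + (- 64^-1 * (x0 y * x0 y) + 64^-1 * (x1 y * x1 y))).
Definition weight_im (y : V2) : R := 32^-1 * x0 y + - 32^-1 * (x0 y * x1 y).

Lemma holo_weight y : holo weight_re weight_im y.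
Proof.
have s0 z : sm x0 z by apply: sm_coord; exact: sm_id.
have s1 z : sm x1 z by apply: sm_coord; exact: sm_id.
have D0 v z : 'D_v x0 z = v 0 0.
  by rewrite /x0 -(@derive_coord R V2 2 id z v 0) ?derive_id //; exact: derivable_id.
have D1 v z : 'D_v x1 z = v 0 1.
  by rewrite /x1 -(@derive_coord R V2 2 id z v 1) ?derive_id //; exact: derivable_id.
have sC c (g : V2 -> R) z : sm g z -> sm (fun y => c * g y) z.
  by move=> sg; apply: smM => //; exact: sm_cst.
have DC c (g : V2 -> R) v z : sm g z -> 'D_v (fun z => c * g z) z = c * 'D_v g z.
  by move=> sg; rewrite (derive_smM v (sm_cst c z) sg) derive_cst mul0r add0r.
have s00 z : sm (fun y => x0 y * x0 y) z by exact: smM.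
have s11 z : sm (fun y => x1 y * x1 y) z by exact: smM.
have s01 z : sm (fun y => x0 y * x1 y) z by exact: smM.
have sq z : sm (fun y => - 64^-1 * (x0 y * x0 y) + 64^-1 * (x1 y * x1 y)) z by apply: smD; exact: sC.
have sr z : sm (fun y => - 32^-1 * x1 y + (- 64^-1 * (x0 y * x0 y) + 64^-1 * (x1 y * x1 y))) z.
  by apply: smD => //; exact: sC.
have Du v z : 'D_v weight_re z = - 32^-1 * v 0 1 + (- 32^-1 * x0 z * v 0 0 + 32^-1 * x1 z * v 0 1).
  rewrite /weight_re (derive_smD v (sm_cst _ z) (sr z)) derive_cst add0r.
  rewrite (derive_smD v (sC _ _ _ (s1 z)) (sq z)) (DC _ _ _ _ (s1 z)) D1.
  rewrite (derive_smD v (sC _ _ _ (s00 z)) (sC _ _ _ (s11 z))) (DC _ _ _ _ (s00 z)) (DC _ _ _ _ (s11 z)).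
  by rewrite (derive_smM v (s0 z) (s0 z)) (derive_smM v (s1 z) (s1 z)) D0 D1; field.
have Dw v z : 'D_v weight_im z = 32^-1 * v 0 0 - 32^-1 * (v 0 0 * x1 z + x0 z * v 0 1).
  rewrite /weight_im (derive_smD v (sC _ _ _ (s0 z)) (sC _ _ _ (s01 z))).
  rewrite (DC _ _ _ _ (s0 z)) (DC _ _ _ _ (s01 z)) (derive_smM v (s0 z) (s1 z)) D0 D1.
  by field.
have su z : sm weight_re z by exact: (smD (sm_cst _ z) (sr z)).
have sw z : sm weight_im z by exact: (smD (sC _ _ _ (s0 z)) (sC _ _ _ (s01 z))).
apply: Holo => //.
by near=> z; rewrite !Du !Dw !mxE /=; split; field.
Unshelve. all: by end_near. Qed.

(** The squared modulus is 1 + rho / 16 + (rho^2 + sig^2) / 1024. On these three sides rho lies in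
    [-5/4, -1/4] and |sig| <= 1; the factor 1/32 is small enough for the linear term to win. *)
Lemma weight_le1 y : half_box y -> [\/ y 0 0 = 1, y 0 0 = -1 | y 0 1 = 1] ->
  weight_re y * weight_re y + weight_im y * weight_im y <= 1.
Proof.
rewrite /half_box /weight_re /weight_im /x0 /x1 /= => -[/andP[a1 a2] /andP[a3 a4]].
move: (y 0 0) (y 0 1) a1 a2 a3 a4 => s t a1 a2 a3 a4 H.
pose rho := 1 / 4 - t - (s * s - t * t) / 2; pose sig := s - s * t.
have -> : 129 / 128 + (- 32^-1 * t + (- 64^-1 * (s * s) + 64^-1 * (t * t))) = 1 + rho / 32.
  by rewrite /rho; field.
have -> : 32^-1 * s + - 32^-1 * (s * t) = sig / 32 by rewrite /sig; field.
have sig1 : sig * sig <= 1.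
  have -> : sig * sig = (s * s) * ((1 - t) * (1 - t)) by rewrite /sig; ring.
  have h1 : s * s <= 1 by nra.
  have h2 : (1 - t) * (1 - t) <= 1 by nra.
  by apply: mulr_ile1 => //; rewrite -expr2 sqr_ge0.
have rho1 : rho <= - 1 / 4.
  by rewrite /rho; case: H => E; rewrite E; nra.
have rho2 : -5 / 4 <= rho by rewrite /rho; nra.
nra.
Qed.

(** The real part is at least 1 + 1/128 - 1/256 - 1/4096 = 1 + 15/4096. *)
Lemma weight_gt1 y : `|y 0 0| <= 1 / 8 -> 0 <= y 0 1 <= 1 / 8 ->
  1 + 1 / 200 <= weight_re y * weight_re y + weight_im y * weight_im y.
Proof.
rewrite /weight_re /weight_im /x0 /x1 /= ler_norml => /andP[a1 a2] /andP[a3 a4].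
move: (y 0 0) (y 0 1) a1 a2 a3 a4 => s t a1 a2 a3 a4.
have h1 : s * s <= 1 / 64 by nra.
set u := 129 / 128 + _; set w := _ * s + _.
have : 1 + 15 / 4096 <= u by rewrite /u; nra.
have : 0 <= w * w by rewrite -expr2 sqr_ge0.
nra.
Qed.

(** The real and imaginary parts of p + i q times the N-th power of the weight. *)
Fixpoint weighted p q N : (V2 -> R) * (V2 -> R) :=
  if N is N'.+1 then let pq := weighted p q N' in
    (fun z => pq.1 z * weight_re z - pq.2 z * weight_im z, fun z => pq.1 z * weight_im z + pq.2 z * weight_re z)
  else (p, q).

Lemma weighted_holo p q N y : holo p q y -> holo (weighted p q N).1 (weighted p q N).2 y.
Proof. by move=> H; elim: N => //= N IH; exact: holo_mul IH (holo_weight y). Qed.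

Lemma weighted_norm p q N y : (weighted p q N).1 y * (weighted p q N).1 y + (weighted p q N).2 y * (weighted p q N).2 y =
  (p y * p y + q y * q y) * (weight_re y * weight_re y + weight_im y * weight_im y) ^+ N.
Proof.
elim: N => [|N IH] /=; first by rewrite expr0 mulr1.
rewrite exprSr mulrA -IH; ring.
Qed.

Lemma holo_unique p q : (forall y, half_box y -> holo p q y) ->
  (forall y, half_box y -> y 0 1 = 0 -> p y = 0 /\ q y = 0) ->
  forall y, `|y 0 0| <= 1 / 8 -> 0 <= y 0 1 <= 1 / 8 -> p y = 0 /\ q y = 0.
Proof.
move=> H Z y y0 y1.
have Ky : half_box y.
  by move: y0 y1; rewrite ler_norml => /andP[? ?] /andP[? ?]; split; apply/andP; split; lra.
have nn z : 0 <= p z * p z + q z * q z by rewrite addr_ge0 // -expr2 sqr_ge0.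
have [B HB] : exists B, forall z, half_box z -> p z * p z + q z * q z <= B.
  have [||c] := @EVT_max_rV _ _ (fun z => p z * p z + q z * q z) half_box _ compact_half_box.
  - by exists y.
  - apply: continuous_in_subspaceT => z /set_mem /H [sp sq _].
    by apply: sm_cont; apply: smD; exact: smM.
  by move=> _ Hc; exists (p c * p c + q c * q c) => z Kz; apply: Hc; exact: mem_set.
have B0 : 0 <= B by exact: le_trans (nn y) (HB _ Ky).
pose r := weight_re y * weight_re y + weight_im y * weight_im y.
have main N : (p y * p y + q y * q y) * r ^+ N <= B.
  rewrite -weighted_norm; apply: (maximum_principle _ _ Ky).
    by move=> z Kz; apply: weighted_holo; exact: H.
  move=> z Kz bz; rewrite weighted_norm.
  have [z1|z1] := eqVneq (z 0 1) 0.
    by have [-> ->] := Z _ Kz z1; rewrite !mulr0 addr0 mul0r.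
  apply: le_trans (HB _ Kz); rewrite ler_piMr // exprn_ile1 //.
    by rewrite addr_ge0 // -expr2 sqr_ge0.
  apply: weight_le1 => //; case: bz => E; [by constructor 1|by constructor 2| |by constructor 3].
  by rewrite E eqxx in z1.
have r1 : 1 + 1 / 200 <= r by exact: weight_gt1.
have bern N : 1 + N%:R / 200 <= r ^+ N.
  elim: N => [|N IH]; first by rewrite mul0r addr0 expr0.
  rewrite exprS -natr1; have N0 : 0 <= N%:R :> R by [].
  have : (1 + 1 / 200) * (1 + N%:R / 200) <= r * r ^+ N.
    by apply: ler_pM => //; nra.
  by nra.
have E0 : p y * p y + q y * q y = 0.
  apply/eqP; rewrite eq_le nn andbT leNgt; apply/negP => lt0.
  have c0 : 0 < (p y * p y + q y * q y) / 200 by rewrite divr_gt0.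
  have [N HN] : exists N : nat, B / ((p y * p y + q y * q y) / 200) < N%:R.
    by exists (Num.truncn (B / ((p y * p y + q y * q y) / 200))).+1; exact: truncnS_gt.
  rewrite ltr_pdivrMr // in HN.
  have := main N; have : (p y * p y + q y * q y) * (1 + N%:R / 200) <= (p y * p y + q y * q y) * r ^+ N.
    by rewrite ler_pM2l.
  by move: (p y * p y + q y * q y) lt0 HN => P; lra.
have p0 : 0 <= p y * p y by rewrite -expr2 sqr_ge0.
have q0 : 0 <= q y * q y by rewrite -expr2 sqr_ge0.
have /eqP : p y * p y = 0 by lra.
have /eqP : q y * q y = 0 by lra.
by rewrite !mulf_eq0 !orbb => /eqP -> /eqP ->.
Qed.

End MaximumPrinciple.

Section UniqueContinuation.
Variable R : realType.
Local Notation V5 := 'rV[R]_(2 + 3).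
Local Notation V3 := 'rV[R]_3.
Local Notation V2 := 'rV[R]_2.

(** When the imaginary part of zeta is 0, the vertical segment to the slice changes zeta_2 only, on
    which components 0 and 1 do not depend. *)
Lemma algD_axis f : CRsm (algD R) f -> (\forall y \near (0 : V3), f (slice (algD R) y) = 0) ->
  \forall z \near (0 : V5), rsubmx z 0 1 = 0 -> f z 0 0 = 0 /\ f z 0 1 = 0.
Proof.
move=> [sf cf] f0.
have f0l l : \forall y \near (0 : V3), f (slice (algD R) y) 0 l = 0 by apply: filterS f0 => y ->; rewrite mxE.
have o0 : aone (algD R) 0 0 = 1 by rewrite /= vec3E.
have main l : (l == 0) || (l == 1) -> \forall z \near (0 : V5), rsubmx z 0 1 = 0 -> f z 0 l = 0.
  move=> l01; have H : \forall z \near (0 : V5), forall h : V3, h 0 0 = 0 /\ h 0 1 = 0 -> (dd f z (row_mx 0 h)) 0 l = 0.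
    apply: filterS cf => z K h [h0 h1]; rewrite (CRE K) /= /mulD.
    by case/orP: l01 => /eqP ->; rewrite vec3E h0 h1 !mul0r ?subrr ?addr0.
  apply: filterS (slice_const_on sf o0 H (f0l l)) => z Hz z1; apply: Hz.
  by rewrite !mxE /= mulr1 subrr -[X in X - _]/(z 0 (rshift 2 1)); move: z1; rewrite !mxE => ->; rewrite mulr0 subrr.
have H0 := main 0 isT; have H1 := main 1 isT.
near=> z => z1; split.
  by move: z1; near: z; exact: H0.
by move: z1; near: z; exact: H1.
Unshelve. all: by end_near. Qed.

Lemma algD_unique f : CRsm (algD R) f -> (\forall y \near (0 : V3), f (slice (algD R) y) = 0) ->
  \forall z \near (0 : V5), f z = 0.
Proof.
move=> Cf f0; have [sf cf] := Cf; have ax := algD_axis Cf f0.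
have f0l l : \forall y \near (0 : V3), f (slice (algD R) y) 0 l = 0 by apply: filterS f0 => y ->; rewrite mxE.
have n2 : \forall z \near (0 : V5), f z 0 2%:R = 0.
  apply: (@slice_const _ (algD R) f 2%:R 2%:R) => //; first by rewrite /= vec3E.
  by apply: filterS cf => z K h hl; rewrite (CRE K) /= vec3E hl mul0r.
have /nbhs_ballP[e /= e0 He] : \forall z \near (0 : V5), [/\ sm f z, CR (algD R) f z &
    rsubmx z 0 1 = 0 -> f z 0 0 = 0 /\ f z 0 1 = 0].
  have nf := sm_near sf; near=> z; split; near: z; [exact: nf|exact: cf|exact: ax].
pose r := e / 2; have r0 : 0 < r by rewrite divr_gt0.
have n01 : \forall z \near (0 : V5), f z 0 0 = 0 /\ f z 0 1 = 0.
  have r8 : 0 < r / 8 by rewrite divr_gt0.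
  near=> z.
  have zr i : `|z 0 i| <= r / 8.
    have : ball (0 : V5) (r / 8) z by near: z; exact: nbhsx_ballx.
    by rewrite -ball_normE /= sub0r normrN => /ltW; apply: le_trans; exact: norm_coord.
  have zl i : `|lsubmx z 0 i| <= r / 8 by rewrite mxE.
  have zz i : `|rsubmx z 0 i| <= r / 8 by rewrite mxE.
  (* The sign sends the lower half plane to the upper one. The imaginary part of f is multiplied by
     [s] too, which keeps p + i q holomorphic. *)
  pose s : R := if 0 <= rsubmx z 0 1 then 1 else -1.
  have s1 : s * s = 1 by rewrite /s; case: ifP => _; rewrite ?mulr1 // mulrNN mulr1.
  pose L : {linear V2 -> V5} := lincomb (fun i : 'I_2 =>
    if i == 0 then row_mx 0 (r *: delta_mx 0 0) else row_mx 0 ((s * r) *: delta_mx 0 1)).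
  pose Z0 : V5 := row_mx (lsubmx z) (rsubmx z 0 2%:R *: delta_mx 0 2%:R).
  (* The half box, scaled by r, in the complex line through z. It stays in the ball of radius e, and
     z, whose coordinates are at most r / 8, corresponds to a point where [holo_unique] applies. *)
  pose Z y := Z0 + L y.
  have ZE y : Z y = row_mx (lsubmx z) (vec3 (r * y 0 0) (s * r * y 0 1) (rsubmx z 0 2%:R)).
    rewrite /Z /Z0 /L /= /lincomb sum2 /= !scale_row_mx !add_row_mx !scaler0 !addr0; congr row_mx.
    by apply: rowP3; rewrite vec3E !mxE /=; ring.
  have Zb y : half_box y -> ball (0 : V5) e (Z y).
    move=> [/andP[y1 y2] /andP[y3 y4]]; rewrite -ball_normE /= sub0r normrN ZE.
    have re : r < e by rewrite /r; lra.
    apply: le_lt_trans re; apply: norm_row_mx.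
      by apply: norm_rV_le => [|i]; [exact: ltW|apply: le_trans (zl i) _; lra].
    apply: norm_rV_le => [|]; first exact: ltW.
    have sn : `|s| = 1 by rewrite /s; case: ifP => _; rewrite ?normrN normr1.
    apply: ord3P; rewrite vec3E.
    - rewrite normrM (gtr0_norm r0); apply: ler_piMr; first exact: ltW.
      by rewrite ler_norml; apply/andP; split; lra.
    - rewrite normrM (normrM s) sn mul1r (gtr0_norm r0); apply: ler_piMr; first exact: ltW.
      by rewrite ger0_norm.
    - by apply: le_trans (zz _) _; lra.
  have sZ y : sm Z y by apply: smD; [exact: sm_cst|exact: (sm_linrV L (sm_id y))].
  have dZ y v : dd Z y v = L v.
    have dL : differentiable L y by exact: (sm_diff (sm_linrV L (sm_id y))).
    by rewrite (dd_add v (differentiable_cst Z0 y) dL) dd_cst add0r dd_linear.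
  pose p y := f (Z y) 0 0; pose q y := s * f (Z y) 0 1.
  have Hpq y : half_box y -> holo p q y.
    move=> Ky; have [sfz _ _] := He _ (Zb _ Ky).
    have sfZ : sm (fun y => f (Z y)) y by exact: (sm_comp (sZ y) sfz).
    split; [exact: sm_coord|by apply: smM; [exact: sm_cst|exact: sm_coord]|].
    have nb : \forall y' \near y, ball (0 : V5) e (Z y').
      apply: (sm_cont (sZ y)); apply: open_nbhs_nbhs; split; [exact: ball_open|exact: Zb].
    near=> y'.
    have by' : ball (0 : V5) e (Z y') by near: y'; exact: nb.
    have [sfy K _] := He _ by'.
    have dfZ : differentiable (fun y => f (Z y)) y' by exact: (sm_diff (sm_comp (sZ y') sfy)).
    have Dl l v : 'D_v (fun y => f (Z y) 0 l) y' = (dd f (Z y') (L v)) 0 l.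
      rewrite -(dZ y') -(dd_comp v (sm_diff (sZ y')) (sm_diff sfy)) dd_coord // ddDe //.
      by move/differentiable_rVP: dfZ.
    have Dq v : 'D_v q y' = s * (dd f (Z y') (L v)) 0 1.
      have s1' : sm (fun y => f (Z y) 0 1) y' by exact: (sm_coord _ (sm_comp (sZ y') sfy)).
      by rewrite /q (derive_smM v (sm_cst s y') s1') derive_cst mul0r add0r Dl.
    have La : L (delta_mx 0 0) = row_mx 0 (r *: delta_mx 0 0).
      by rewrite /L /= /lincomb sum2 !mxE /= scale1r scale0r addr0.
    have Lb : L (delta_mx 0 1) = row_mx 0 ((s * r) *: delta_mx 0 1).
      by rewrite /L /= /lincomb sum2 !mxE /= scale1r scale0r add0r.
    rewrite !Dq !Dl La Lb (CRE K (r *: _)) (CRE K ((s * r) *: _)) /= /mulD !vec3E !mxE /=.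
    move: (dd f (Z y') _ 0 0) (dd f (Z y') _ 0 1) => D0 D1.
    split; last by ring.
    have -> : s * (s * r * 0 * D1 + s * r * 1 * D0) = (s * s) * (r * D0) by ring.
    by rewrite s1; ring.
  have axis y : half_box y -> y 0 1 = 0 -> p y = 0 /\ q y = 0.
    move=> Ky y1; have [_ _ A] := He _ (Zb _ Ky).
    have [|A0 A1] := A; first by rewrite ZE row_mxKr vec3E y1 mulr0.
    by rewrite /p /q A0 A1 mulr0.
  pose ys : V2 := \row_i nth 0 [:: rsubmx z 0 0 / r; s * rsubmx z 0 1 / r] i.
  have ys0 : ys 0 0 = rsubmx z 0 0 / r by rewrite mxE.
  have ys1 : ys 0 1 = s * rsubmx z 0 1 / r by rewrite mxE.
  have rn0 : r != 0 by rewrite gt_eqF.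
  have Zys : Z ys = z.
    rewrite ZE ys0 ys1 -[RHS]hsubmxK; congr row_mx; apply: rowP3; rewrite vec3E //.
      by rewrite mulrC divfK.
    have -> : s * r * (s * rsubmx z 0 1 / r) = (s * s) * (rsubmx z 0 1 / r * r) by ring.
    by rewrite s1 mul1r divfK.
  have sz : s * rsubmx z 0 1 = `|rsubmx z 0 1|.
    rewrite /s; case: ifP => [h|/negbT]; first by rewrite mul1r ger0_norm.
    by rewrite -ltNge => h; rewrite mulN1r ltr0_norm.
  have [||z0 z1] := @holo_unique R p q Hpq axis ys.
  - by rewrite ys0 normrM normfV (gtr0_norm r0) ler_pdivrMr //; apply: le_trans (zz _) _; lra.
  - rewrite ys1 sz; apply/andP; split; first by apply: divr_ge0; [exact: normr_ge0|exact: ltW].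
    by rewrite ler_pdivrMr //; apply: le_trans (zz _) _; lra.
  move: z0 z1; rewrite /p /q Zys => -> z1; split=> //.
  have : s * (s * f z 0 1) = 0 by rewrite z1 mulr0.
  by rewrite mulrA s1 mul1r.
near=> z; have [z0 z1] : f z 0 0 = 0 /\ f z 0 1 = 0 by near: z; exact: n01.
apply: rowP3; rewrite [RHS]mxE //; near: z; exact: n2.
Unshelve. all: by end_near. Qed.

End UniqueContinuation.

(** * Extension of power series to the algebra *)

Lemma pdE (R : realType) m k (i : 'I_m) (f : 'rV[R]_m -> 'rV[R]_k) x : differentiable f x ->
  pd i f x = dd f x (delta_mx 0 i).
Proof. by move=> df; rewrite ddDe. Qed.

Section ExponentialType.
Variables (R : realType) (m k : nat) (D : set 'rV[R]_m).
Hypothesis oD : open D.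
Implicit Types (f g : 'rV[R]_m -> 'rV[R]_k) (K A : R).

(* The partial derivatives of order j <= n are bounded by K A^j on D. *)
Fixpoint etype n K A f : Prop :=
  (forall x, D x -> differentiable f x /\ `|f x| <= K) /\
  (if n is n'.+1 then forall i, etype n' (K * A) A (pd i f) else True).

Lemma etype0 n K A f : etype n K A f -> forall x, D x -> differentiable f x /\ `|f x| <= K.
Proof. by case: n => [|n] []. Qed.

Lemma etype_pred n K A f : etype n.+1 K A f -> etype n K A f.
Proof.
elim: n K f => [|n IH] K f [H0 H1]; split=> // i.
exact: (IH _ _ (H1 i)).
Qed.

Lemma etype_eq n K A f g : (forall x, D x -> f x = g x) -> etype n K A f -> etype n K A g.
Proof.
have nE (p q : 'rV[R]_m -> 'rV[R]_k) x : (forall y, D y -> p y = q y) -> D x -> \near x, p x = q x.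
  by move=> pq Dx; apply: filterS (open_nbhs_nbhs (conj oD Dx)).
elim: n K f g => [|n IH] K f g fg [H0 H1]; split=> //.
- move=> x Dx; have [df bf] := H0 x Dx; rewrite -fg //; split=> //.
  by have [] := near_eq_differentiable (nE _ _ _ fg Dx) df.
- move=> x Dx; have [df bf] := H0 x Dx; rewrite -fg //; split=> //.
  by have [] := near_eq_differentiable (nE _ _ _ fg Dx) df.
- move=> i; apply: IH (H1 i) => x Dx; exact: near_eq_derive (nE _ _ _ fg Dx).
Qed.

Lemma etype_le n K K' A f : 0 <= A -> K <= K' -> etype n K A f -> etype n K' A f.
Proof.
move=> A0; elim: n K K' f => [|n IH] K K' f KK [H0 H1]; split=> //.
- by move=> x /H0[df bf]; split=> //; exact: le_trans bf KK.
- by move=> x /H0[df bf]; split=> //; exact: le_trans bf KK.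
- by move=> i; apply: IH (H1 i); rewrite ler_wpM2r.
Qed.

Lemma etype_ge n K A A' f : 0 <= K -> 0 <= A -> A <= A' -> etype n K A f -> etype n K A' f.
Proof.
move=> K0 A0 AA; have A0' := le_trans A0 AA; elim: n K K0 f => [|n IH] K K0 f [H0 H1]; split=> // i.
apply: (etype_le A0' (K := K * A)); first by rewrite ler_wpM2l.
by apply: IH (H1 i); rewrite mulr_ge0.
Qed.

Lemma etype_pow n K A f : 0 <= K -> 1 <= A -> etype n K A f -> etype n (K * A ^+ n) 1 f.
Proof.
move=> K0 A1; have A0 : 0 <= A := le_trans ler01 A1.
elim: n K K0 f => [|n IH] K K0 f [H0 H1]; first by rewrite expr0 mulr1; split.
split=> [x /H0[df bf]|i].
  split=> //; apply: le_trans bf _; rewrite ler_peMr //; exact: exprn_ege1.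
by rewrite mulr1 exprS mulrA; apply: (IH _ _ _ (H1 i)); rewrite mulr_ge0.
Qed.

Lemma etype_cst n K A (a : 'rV[R]_k) : 0 <= A -> `|a| <= K -> etype n K A (fun=> a).
Proof.
move=> A0; elim: n K a => [|n IH] K a aK; split=> //; try by move=> x _; split=> //; exact: differentiable_cst.
move=> i; apply: (etype_eq (f := fun=> 0)); first by move=> x _; rewrite /pd derive_cst.
by apply: IH; rewrite normr0 mulr_ge0 // (le_trans _ aK).
Qed.

Lemma etype_lin n K A (B : 'M[R]_(m, k)) : 0 <= A -> (forall x, D x -> `|x *m B| <= K) ->
  (forall i, `|(delta_mx 0 i : 'rV[R]_m) *m B| <= K * A) -> etype n K A (fun x => x *m B).
Proof.
move=> A0 HK HA; pose L : {linear 'rV[R]_m -> 'rV[R]_k} := mulmxr B.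
have dL (x : 'rV[R]_m) : differentiable (fun x => x *m B) x.
  by have : sm (fun x => L x) x := sm_linrV L (sm_id x); move=> /sm_diff.
case: n => [|n]; split=> //; try by move=> x Dx; split; [exact: dL|exact: HK].
move=> i; apply: (etype_eq (f := fun=> delta_mx 0 i *m B)); last exact: etype_cst.
by move=> x _; rewrite pdE //; apply: esym; exact: (dd_linear L).
Qed.

Lemma etype_add n K K' A f g : etype n K A f -> etype n K' A g -> etype n (K + K') A (fun x => f x + g x).
Proof.
elim: n K K' f g => [|n IH] K K' f g [F0 F1] [G0 G1]; split=> //.
- move=> x Dx; have [df bf] := F0 x Dx; have [dg bg] := G0 x Dx.
  by split; [exact: differentiableD|exact: le_trans (ler_normD _ _) (lerD bf bg)].
- move=> x Dx; have [df bf] := F0 x Dx; have [dg bg] := G0 x Dx.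
  by split; [exact: differentiableD|exact: le_trans (ler_normD _ _) (lerD bf bg)].
- move=> i; rewrite mulrDl; apply: (etype_eq (f := fun x => pd i f x + pd i g x)); last exact: (IH _ _ _ _ (F1 i) (G1 i)).
  move=> x Dx; have [df _] := F0 x Dx; have [dg _] := G0 x Dx.
  by rewrite !pdE // ?dd_add //; exact: differentiableD.
Qed.

Lemma etype_scale n K A (a : R) f : etype n K A f -> etype n (`|a| * K) A (fun x => a *: f x).
Proof.
have dZ (h : 'rV[R]_m -> 'rV[R]_k) x : differentiable h x -> differentiable (fun x => a *: h x) x.
  by move=> dh; apply: differentiable_scale => //; exact: differentiable_cst.
elim: n K f => [|n IH] K f [F0 F1]; split=> //.
- by move=> x /F0[df bf]; split; [exact: dZ|rewrite normrZ ler_wpM2l].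
- by move=> x /F0[df bf]; split; [exact: dZ|rewrite normrZ ler_wpM2l].
- move=> i; rewrite -mulrA; apply: (etype_eq (f := fun x => a *: pd i f x)); last exact: (IH _ _ (F1 i)).
  move=> x /F0[df _]; rewrite !pdE //; last exact: dZ.
  by rewrite (dd_scale _ (differentiable_cst _ _) df) dd_cst scale0r add0r.
Qed.

Lemma etype_sum n A (I : Type) (r : seq I) (P : pred I) (K : I -> R) (F : I -> 'rV[R]_m -> 'rV[R]_k) : 0 <= A ->
  (forall i, P i -> etype n (K i) A (F i)) -> etype n (\sum_(i <- r | P i) K i) A (fun x => \sum_(i <- r | P i) F i x).
Proof.
move=> A0 H; elim: r => [|i r IH].
  rewrite big_nil; apply: (etype_eq (f := fun=> 0)); first by move=> x _; rewrite big_nil.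
  by apply: etype_cst; rewrite ?normr0.
rewrite big_cons; case: ifP => Pi; last by apply: etype_eq IH => x _; rewrite big_cons Pi.
apply: (etype_eq (f := fun x => F i x + \sum_(j <- r | P j) F j x)); first by move=> x _; rewrite big_cons Pi.
by apply: etype_add => //; exact: H.
Qed.

(** K A^j is the j-th derivative of K exp(A t) at 0, so by the Leibniz rule a product multiplies the
    constants and adds the rates. *)
Lemma etype_amul (S : calg R k) c n K K' A A' f g : 0 <= c -> (forall a b, `|amul S a b| <= c * `|a| * `|b|) ->
  0 <= K -> 0 <= K' -> 0 <= A -> 0 <= A' ->
  etype n K A f -> etype n K' A' g -> etype n (c * K * K') (A + A') (fun x => amul S (f x) (g x)).
Proof.
move=> c0 Hc K0 K0' A0 A0'.
have bd (K1 K2 : R) h1 h2 x : 0 <= K1 -> `|h1 x| <= K1 -> `|h2 x| <= K2 -> `|amul S (h1 x : 'rV[R]_k) (h2 x)| <= c * K1 * K2 :> R.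
  move=> K10 b1 b2; apply: le_trans (Hc _ _) _.
  by apply: ler_pM => //; [rewrite mulr_ge0|rewrite ler_wpM2l].
have dM h1 h2 (x : 'rV[R]_m) : differentiable h1 x -> differentiable h2 x -> differentiable (fun x => amul S (h1 x) (h2 x)) x.
  move=> d1 d2; have -> : (fun x => amul S (h1 x) (h2 x)) =
      (fun x => \sum_j h2 x 0 j *: \sum_i h1 x 0 i *: amul S (delta_mx 0 i) (delta_mx 0 j)).
    by apply/funext => y; rewrite amul_sum.
  have dc h : differentiable h x -> forall j : 'I_k, differentiable (fun x : 'rV[R]_m => (h x : 'rV[R]_k) 0 j) x.
    by move=> /differentiable_rVP.
  have dS j : differentiable (fun x => \sum_i h1 x 0 i *: amul S (delta_mx 0 i) (delta_mx 0 j)) x.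
    by have [] := diff_sum 0 (fun i => differentiable_scale (dc _ d1 i) (differentiable_cst (amul S (delta_mx 0 i) (delta_mx 0 j)) x)).
  by have [] := diff_sum 0 (fun j => differentiable_scale (dc _ d2 j) (dS j)).
elim: n K K' f g K0 K0' => [|n IH] K K' f g K0 K0' Ff Gg; have [F0 F1] := Ff; have [G0 G1] := Gg; split=> //.
- move=> x Dx; have [df bf] := F0 x Dx; have [dg bg] := G0 x Dx.
  by split; [exact: dM|exact: bd].
- move=> x Dx; have [df bf] := F0 x Dx; have [dg bg] := G0 x Dx.
  by split; [exact: dM|exact: bd].
- move=> i; apply: (etype_eq (f := fun x => amul S (pd i f x) (g x) + amul S (f x) (pd i g x))).
    move=> x Dx; have [df _] := F0 x Dx; have [dg _] := G0 x Dx.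
    by rewrite !pdE //; [rewrite dd_amul|exact: dM].
  rewrite (_ : c * K * K' * (A + A') = c * (K * A) * K' + c * K * (K' * A')); last by ring.
  apply: etype_add; first exact: (IH _ _ _ _ (mulr_ge0 K0 A0) K0' (F1 i) (etype_pred Gg)).
  exact: (IH _ _ _ _ K0 (mulr_ge0 K0' A0') (etype_pred Ff) (G1 i)).
Qed.

End ExponentialType.

(** * Limits of sequences that converge with their derivatives *)

Section SmoothLimit.
Variables (R : realType) (m k : nat) (D : set 'rV[R]_m).
Hypothesis oD : open D.
Local Notation W := 'rV[R]_k.

Lemma pd_lipschitz (u : 'rV[R]_m -> W) c x d : 0 <= c ->
  (forall y, ball x d y -> differentiable u y /\ forall i, `|pd i u y| <= c) ->
  forall y z, ball x d y -> ball x d z -> `|u z - u y| <= m%:R * c * `|z - y|.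
Proof.
move=> c0 H y z xy xz; apply: norm_rV_le => [|j]; first by rewrite mulr_ge0 // mulr_ge0.
have dj y' : ball x d y' -> differentiable (fun y => u y 0 j) y' by move=> /H[/differentiable_rVP].
have [t t01 E] := @segMVT _ m (fun y => u y 0 j) y z (fun t t01 => dj _ (ball_seg xy xz t01)).
rewrite !mxE E; have xc := ball_seg xy xz t01; rewrite diff_pd; last exact: dj.
rewrite (_ : m%:R * c * `|z - y| = \sum_(i < m) (`|z - y| * c)); last first.
  by rewrite sumr_const card_ord -[RHS]mulr_natl; ring.
apply: le_trans (ler_norm_sum _ _ _) _; apply: ler_sum => i _.
rewrite normrM ler_pM //.
  by apply: le_trans (norm_coord (z - y) i); rewrite mxE.
have [df /(_ i)] := H _ xc; apply: le_trans; rewrite /pd -derive_coord; last exact: diff_derivable.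
exact: norm_coord.
Qed.

(** On a ball F N - F N0 has the Lipschitz constant m (e N + e N0). Letting N tend to infinity, G -
    F N0 has the constant m e N0, so G is linearised at x like F N0 up to O(e N0). *)
Lemma limit_C1 (F : nat -> 'rV[R]_m -> W) (G : 'rV[R]_m -> W) (H : 'I_m -> 'rV[R]_m -> W) (e : R ^nat) :
  e @ \oo --> 0 -> (forall N, 0 <= e N) ->
  (forall N x, D x -> differentiable (F N) x) ->
  (forall N x, D x -> `|F N x - G x| <= e N) ->
  (forall N x i, D x -> `|pd i (F N) x - H i x| <= e N) ->
  forall x, D x -> differentiable G x /\ forall i, pd i G x = H i x.
Proof.
move=> e0 en dF FG FH x Dx.
have [d d0 Hd] : exists2 d : R, 0 < d & ball x d `<=` D.
  by have /nbhs_ballP[d] := open_nbhs_nbhs (conj oD Dx); exists d.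
have small (g : R) : 0 < g -> exists N, e N < g.
  by move=> g0; have [N _ HN] := cvgr_lt _ e0 _ g0; exists N; exact: HN (leqnn N).
have lim0 (a c t : R) : 0 <= c -> (forall N, t <= a + c * e N) -> t <= a.
  move=> c0 H1; rewrite leNgt; apply/negP => ta.
  have c1 : 0 < c + 1 by rewrite ltr_wpDl.
  have [N] : exists N, e N < (t - a) / (c + 1) by apply: small; rewrite divr_gt0 // subr_gt0.
  by rewrite ltr_pdivlMr // => HN; have := H1 N; have := en N; move: (e N) HN => u; nra.
have est N0 y : ball x d y -> `|(G y - F N0 y) - (G x - F N0 x)| <= m%:R * e N0 * `|y - x|.
  move=> xy; have xx : ball x d x by exact: ballxx.
  have Dy : D y by exact: Hd.
  apply: (lim0 _ (m%:R * `|y - x| + 2)) => [|N]; first by rewrite addr_ge0 // mulr_ge0.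
  pose u z := F N z - F N0 z.
  have du z : D z -> differentiable u z by move=> Dz; apply: differentiableB; exact: dF.
  have bu z : ball x d z -> differentiable u z /\ forall i, `|pd i u z| <= e N + e N0.
    move=> /Hd Dz; split=> [|i]; first exact: du.
    have -> : pd i u z = (pd i (F N) z - H i z) - (pd i (F N0) z - H i z).
      rewrite (pdE i (du z Dz)) (pdE i (dF N z Dz)) (pdE i (dF N0 z Dz)).
      by rewrite (dd_sub _ (dF N z Dz) (dF N0 z Dz)) opprB addrA subrK.
    by apply: le_trans (ler_normB _ _) (lerD (FH _ _ _ Dz) (FH _ _ _ Dz)).
  have := pd_lipschitz (addr_ge0 (en N) (en N0)) bu xx xy; rewrite /u => lip.
  have -> : G y - F N0 y - (G x - F N0 x) = (F N y - F N0 y - (F N x - F N0 x)) - (F N y - G y) + (F N x - G x).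
    by apply/rowP => j; rewrite !mxE; ring.
  apply: le_trans (ler_normD _ _) _.
  have h1 := ler_normB (F N y - F N0 y - (F N x - F N0 x)) (F N y - G y).
  have h2 := FG N y Dy; have h3 := FG N x Dx.
  apply: le_trans (lerD (le_trans h1 (lerD lip h2)) h3) _.
  by move: (`|y - x|) (m%:R) (e N) (e N0) => p q v w; lra.
pose L : {linear 'rV[R]_m -> W} := lincomb (fun i => H i x).
have [dG EG] : differentiable G x /\ 'd G x = L :> ('rV[R]_m -> W).
  apply: differentiable_eqo => [|g g0]; first exact: lincomb_continuous.
  have c1 : 0 < 2 * m%:R + 1 :> R by rewrite ltr_wpDl // mulr_ge0.
  pose g1 := g / (2 * m%:R + 1); have g10 : 0 < g1 by rewrite divr_gt0.
  have [N HN] := small _ g10.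
  have dFx := dF N x Dx; have /diff_locally/eqaddoP/(_ _ g10) loc := dFx.
  have nb : \forall h \near (0 : 'rV[R]_m), ball x d (h + x).
    apply: filterS (nbhsx_ballx (0 : 'rV[R]_m) d d0) => h.
    by rewrite -!ball_normE /= sub0r normrN opprD addrCA subrr addr0 normrN.
  near=> h.
  have hb : ball x d (h + x) by near: h; exact: nb.
  have h1 : `|F N (h + x) - F N x - 'd (F N) x h| <= g1 * `|h|.
    have : `|((F N \o shift x) - (cst (F N x) + 'd (F N) x)) h| <= g1 * `|h| by near: h; exact: loc.
    by rewrite !fctE /= opprD addrA.
  have h2 : `|'d (F N) x h - L h| <= m%:R * e N * `|h|.
    rewrite diff_pd // /L /= /lincomb -sumrB.
    rewrite (_ : m%:R * e N * `|h| = \sum_(i < m) (`|h| * e N)); last first.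
      by rewrite sumr_const card_ord -[RHS]mulr_natl; ring.
    apply: le_trans (ler_norm_sum _ _ _) _; apply: ler_sum => i _.
    by rewrite -scalerBr normrZ ler_pM //; [exact: norm_coord|exact: FH].
  have h3 := est N _ hb; rewrite addrK in h3.
  have -> : G (h + x) - G x - L h = (G (h + x) - F N (h + x) - (G x - F N x)) +
      (F N (h + x) - F N x - 'd (F N) x h) + ('d (F N) x h - L h).
    by apply/rowP => j; rewrite !mxE; ring.
  apply: le_trans (ler_normD _ _) _; apply: le_trans (lerD (ler_normD _ _) (lexx _)) _.
  have gE : g = g1 * (2 * m%:R + 1) by rewrite /g1 divfK // gt_eqF.
  have mN : m%:R * e N <= m%:R * g1 by rewrite ler_wpM2l // ltW.
  have mNh : m%:R * e N * `|h| <= m%:R * g1 * `|h| by rewrite ler_wpM2r.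
  rewrite gE.
  apply: le_trans (lerD (lerD h3 h1) h2) _.
  by move: (`|h|) (m%:R) (e N) mNh => p q v mNh; lra.
split=> // i; rewrite /pd deriveE // EG /L /= /lincomb (bigD1 i) //= big1 ?addr0; last first.
  by move=> j ji; rewrite mxE (negPf ji) andbF scale0r.
by rewrite mxE !eqxx scale1r.
Unshelve. all: by end_near. Qed.

(** Each coordinate of the limit is the supremum of the lower bounds u N - C (l - S N), which lie
    below all the upper bounds u N + C (l - S N). The rate comes with the limit. *)
Lemma cauchy_limit (u : nat -> W) (S : R ^nat) (l C : R) : 0 <= C -> (forall N, S N <= l) ->
  (forall N N', (N <= N')%N -> `|u N' - u N| <= C * (S N' - S N)) ->
  exists y, forall N, `|u N - y| <= C * (l - S N).
Proof.
move=> C0 Sl H.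
have Hj j N N' : (N <= N')%N -> `|u N' 0 j - u N 0 j| <= C * (S N' - S N).
  by move=> NN; apply: le_trans (H _ _ NN); have := norm_coord (u N' - u N) j; rewrite !mxE.
have lower j N N' : u N 0 j - C * (l - S N) <= u N' 0 j + C * (l - S N').
  have [NN|/ltnW NN] := leqP N N'; have := Hj j _ _ NN; rewrite ler_norml => /andP[h1 h2];
    have := mulr_ge0 C0 (_ : 0 <= l - S N); have := mulr_ge0 C0 (_ : 0 <= l - S N');
    rewrite !subr_ge0 !Sl => /(_ isT) h3 /(_ isT) h4; lra.
pose E j : set R := range (fun N => u N 0 j - C * (l - S N)).
have hE j : has_sup (E j).
  split; first by exists (u 0%N 0 j - C * (l - S 0%N)); exists 0%N.
  by exists (u 0%N 0 j + C * (l - S 0%N)) => _ [N _ <-]; exact: lower.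
exists (\row_j sup (E j)) => N; apply: norm_rV_le => [|j]; first by rewrite mulr_ge0 // subr_ge0.
rewrite !mxE distrC ler_distl; apply/andP; split.
  by apply: (ub_le_sup (hE j).2); exists N.
by apply: ge_sup; [exact: (hE j).1|move=> _ [N' _ <-]; exact: lower].
Qed.

Lemma limit_C1_cauchy (S : R ^nat) (l C : R) (F : nat -> 'rV[R]_m -> W) G : (forall N, S N <= l) ->
  (fun N => l - S N) @ \oo --> (0 : R) -> 0 <= C -> (forall N x, D x -> differentiable (F N) x) ->
  (forall N N' x i, (N <= N')%N -> D x -> `|pd i (F N') x - pd i (F N) x| <= C * (S N' - S N)) ->
  (forall N x, D x -> `|F N x - G x| <= C * (l - S N)) ->
  (forall x, D x -> differentiable G x) /\ forall N x i, D x -> `|pd i (F N) x - pd i G x| <= C * (l - S N).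
Proof.
move=> Sl lS C0 sF dF FG.
have /choice[H HH] : forall x, exists y : 'I_m -> W, D x -> forall i N, `|pd i (F N) x - y i| <= C * (l - S N).
  move=> x; have [Dx|nDx] := pselect (D x); last by exists (fun=> 0).
  have /choice[y Hy] : forall i, exists y, forall N, `|pd i (F N) x - y| <= C * (l - S N).
    by move=> i; apply: cauchy_limit => // N N' NN; exact: dF.
  by exists y.
have e0 : (fun N => C * (l - S N)) @ \oo --> (0 : R) by rewrite -(mulr0 C); apply: cvgM => //; exact: cvg_cst.
have lim x : D x -> differentiable G x /\ forall i, pd i G x = H x i.
  apply: (@limit_C1 F G (fun i x => H x i) (fun N => C * (l - S N)) e0) => // [N|N y i Dy].
    by rewrite mulr_ge0 // subr_ge0.
  exact: HH.
split; first by move=> x /lim[].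
by move=> N x i Dx; have [_ ->] := lim x Dx; exact: HH.
Qed.

(** Convergence at every order is measured by the increments of one real sequence S. The partial
    derivatives of F N then satisfy the same hypotheses at one order less, with the partial
    derivative of G as limit. *)
Theorem smooth_limit (S : R ^nat) (l : R) : (forall N, S N <= l) -> (fun N => l - S N) @ \oo --> (0 : R) ->
  forall n C (F : nat -> 'rV[R]_m -> W) G, 0 <= C -> (forall N, smn n.+1 D (F N)) ->
  (forall N N', (N <= N')%N -> etype D n.+1 (C * (S N' - S N)) 1 (fun x => F N' x - F N x)) ->
  (forall N x, D x -> `|F N x - G x| <= C * (l - S N)) ->
  smn n D G /\ forall N x i, D x -> `|pd i (F N) x - pd i G x| <= C * (l - S N).
Proof.
move=> Sl lS n C F G C0 sF dF FG.
have base n' (F' : nat -> 'rV[R]_m -> W) G' : (forall N, smn n'.+1 D (F' N)) ->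
  (forall N N', (N <= N')%N -> etype D n'.+1 (C * (S N' - S N)) 1 (fun x => F' N' x - F' N x)) ->
  (forall N x, D x -> `|F' N x - G' x| <= C * (l - S N)) ->
  (forall x, D x -> differentiable G' x) /\ forall N x i, D x -> `|pd i (F' N) x - pd i G' x| <= C * (l - S N).
  move=> sF' dF' FG'; apply: limit_C1_cauchy => // [N x|N N' x i NN Dx]; first exact: smn_diff.
  have d1 := smn_diff (sF' N) Dx; have d2 := smn_diff (sF' N') Dx.
  have [_ /(_ i) H1] := dF' _ _ NN.
  have [_] := @etype0 _ _ _ D n' _ 1 (pd i (fun x => F' N' x - F' N x)) H1 x Dx.
  by rewrite mulr1 (pdE i (differentiableB d2 d1)) (dd_sub _ d2 d1) -!pdE.
elim: n F G sF dF FG => [|n IH] F G sF dF FG.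
  by have [dG pG] := base _ _ _ sF dF FG; split=> //; apply/smn0.
have [dG pG] := base _ _ _ sF dF FG; split=> //; apply/smnS; split=> // i.
have [] := IH (fun N => pd i (F N)) (pd i G) _ _ (fun N x => pG N x i) => //.
- by move=> N; have /smnS[] := sF N.
- move=> N N' NN; apply: (etype_eq oD (f := pd i (fun x => F N' x - F N x))).
    move=> x Dx; have d1 := smn_diff (sF N) Dx; have d2 := smn_diff (sF N') Dx.
    by rewrite (pdE i (differentiableB d2 d1)) (dd_sub _ d2 d1) -!pdE.
  by have [_ /(_ i)] := dF _ _ NN; rewrite mulr1.
Qed.

End SmoothLimit.

Section CubeSums.
Variables (m : nat).

Definition exponent N (k : {ffun 'I_m -> 'I_N}) : {ffun 'I_m -> nat} := [ffun i => k i : nat].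

Lemma cube_widen (V : nmodType) (F : {ffun 'I_m -> nat} -> V) N N' : (N <= N')%N ->
  \sum_(k : {ffun 'I_m -> 'I_N}) F (exponent k) =
  \sum_(k : {ffun 'I_m -> 'I_N'} | [forall i, (k i < N)%N]) F (exponent k).
Proof.
move=> NN; pose h (k : {ffun 'I_m -> 'I_N}) : {ffun 'I_m -> 'I_N'} := [ffun i => widen_ord NN (k i)].
have hE k : exponent (h k) = exponent k by apply/ffunP => i; rewrite !ffunE.
have hinj : injective h.
  by move=> k k' /ffunP H; apply/ffunP => i; apply: val_inj; have /(congr1 val) := H i; rewrite !ffunE.
rewrite (eq_bigl [pred k in h @: [set: {ffun 'I_m -> 'I_N}]%SET]); last first.
  move=> k; rewrite inE; apply/forallP/imsetP => [H|[k' _ ->] i]; last by rewrite ffunE /=.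
  exists [ffun i => Ordinal (H i)]; first by rewrite finset.inE.
  by apply/ffunP => i; rewrite !ffunE; apply: val_inj.
rewrite big_imset /=; last by move=> ? ? _ _; exact: hinj.
by apply: eq_big => k; rewrite ?finset.inE // hE.
Qed.

Lemma cube_diff (V : zmodType) (F : {ffun 'I_m -> nat} -> V) N N' : (N <= N')%N ->
  \sum_(k : {ffun 'I_m -> 'I_N'}) F (exponent k) - \sum_(k : {ffun 'I_m -> 'I_N}) F (exponent k) =
  \sum_(k : {ffun 'I_m -> 'I_N'} | ~~ [forall i, (k i < N)%N]) F (exponent k).
Proof.
move=> NN; rewrite (cube_widen F NN) (bigID (fun k : {ffun 'I_m -> 'I_N'} => [forall i, (k i < N)%N])) /=.
by rewrite addrAC subrr add0r.
Qed.

End CubeSums.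

(** * Power series in linear forms with values in the algebra *)

Section PowerSeries.
Variable R : realType.

(** The left side is the cost of n derivatives of a monomial of degree j. *)
Lemma poly_le_exp n (A : R) : 0 <= A -> exists2 C, 0 <= C & forall j : nat, (1 + j%:R * A) ^+ n <= C * 2 ^+ j.
Proof.
move=> A0; have lin c : 1 < c -> exists2 C, 0 <= C & forall j : nat, 1 + j%:R * A <= C * c ^+ j.
  move=> c1; have c10 : 0 < c - 1 by rewrite subr_gt0.
  have bern j : 1 + j%:R * (c - 1) <= c ^+ j.
    elim: j => [|j IH]; first by rewrite mul0r addr0 expr0.
    rewrite exprS -natr1; have j0 : 0 <= j%:R :> R by [].
    have : c * (1 + j%:R * (c - 1)) <= c * c ^+ j by rewrite ler_pM2l // (lt_trans ltr01).
    have : 0 <= j%:R * ((c - 1) * (c - 1)) by rewrite !mulr_ge0 // ltW.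
    by lra.
  exists (1 + A / (c - 1)) => [|j]; first by rewrite addr_ge0 // divr_ge0 // ltW.
  apply: le_trans (_ : (1 + A / (c - 1)) * (1 + j%:R * (c - 1)) <= _); last first.
    by apply: ler_wpM2l (bern j); rewrite addr_ge0 // divr_ge0 // ltW.
  have -> : (1 + A / (c - 1)) * (1 + j%:R * (c - 1)) = 1 + j%:R * A + (A / (c - 1) + j%:R * (c - 1)).
    by field; rewrite gt_eqF.
  by rewrite lerDl; apply: addr_ge0; [rewrite divr_ge0 // ltW|rewrite mulr_ge0 // ltW].
have main c : 1 < c -> exists2 C, 0 <= C & forall j : nat, (1 + j%:R * A) ^+ n <= C * c ^+ j.
  elim: n c => [|n IH] c c1.
    by exists 1 => // j; rewrite expr0 mul1r exprn_ege1 // ltW.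
  (* The rate c is shared: one factor 1 + e pays for a linear term, the other for the remaining
     power. *)
  have [e [e0 ec]] : exists e, 0 < e /\ (1 + e) * (1 + e) <= c.
    have [c4|c4] := leP c 4.
      by exists ((c - 1) / 5); split; [rewrite divr_gt0 // subr_gt0|nra].
    by exists 1; split=> //; lra.
  have e1 : 1 < 1 + e by rewrite ltrDl.
  have [C C0 HC] := lin _ e1; have [C' C0' HC'] := IH _ e1.
  exists (C * C') => [|j]; first exact: mulr_ge0.
  have j0 : 0 <= 1 + j%:R * A by rewrite addr_ge0 // mulr_ge0.
  rewrite exprS; apply: le_trans (ler_pM j0 (exprn_ge0 _ j0) (HC j) (HC' j)) _.
  rewrite mulrACA -exprMn; apply: ler_wpM2l; first exact: mulr_ge0.
  by apply: lerXn2r => //; rewrite nnegrE ?mulr_ge0 // ltW // (lt_trans ltr01).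
by apply: main; rewrite ltr1n.
Qed.

Variables (k d m : nat) (S : calg R d) (B : 'I_m -> 'M[R]_(k + d, d)).
Local Notation "a ** b" := (amul S a b) (at level 40, left associativity).
Local Notation one := (aone S).
Local Notation T := 'rV[R]_(k + d).
Local Notation W := 'rV[R]_d.

Lemma amul_bound : exists2 c, 0 < c & forall a b, `|a ** b| <= c * `|a| * `|b|.
Proof.
exists (1 + \sum_j \sum_i `|delta_mx 0 i ** delta_mx 0 j|) => [|a b].
  by rewrite ltr_pwDl // sumr_ge0 // => j _; rewrite sumr_ge0.
rewrite amul_sum; apply: le_trans (ler_norm_sum _ _ _) _.
apply: le_trans (_ : \sum_j \sum_i `|a| * `|b| * `|delta_mx 0 i ** delta_mx 0 j| <= _).
  apply: ler_sum => j _; rewrite normrZ.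
  apply: le_trans (ler_wpM2l (normr_ge0 _) (ler_norm_sum _ _ _)) _.
  rewrite mulr_sumr; apply: ler_sum => i _; rewrite normrZ mulrA ler_wpM2r //.
  by rewrite mulrC ler_pM //; exact: norm_coord.
have -> : \sum_j \sum_i `|a| * `|b| * `|delta_mx 0 i ** delta_mx 0 j| =
    `|a| * `|b| * \sum_j \sum_i `|delta_mx 0 i ** delta_mx 0 j|.
  by rewrite mulr_sumr; apply: eq_bigr => j _; rewrite mulr_sumr.
rewrite -(mulrA (1 + _)) [leRHS]mulrC; apply: ler_wpM2l; first by rewrite mulr_ge0.
by rewrite lerDr.
Qed.

(** The product over i in r of the powers (z B_i)^(e i): the linear forms z B_i take the place of
    the variables of the series. *)
Definition monomial (r : seq 'I_m) (e : 'I_m -> nat) (z : T) : W :=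
  foldr (fun i acc => iter (e i) (fun w => z *m B i ** w) acc) one r.

Lemma CR_amul f g z : sm f z -> sm g z -> CR S f z -> CR S g z -> CR S (fun z : T => f z ** g z) z.
Proof.
move=> /sm_diff dfz /sm_diff dgz ef eg.
split=> h; rewrite !dd_amul // (CRE ef h) (CRE eg h) amulDr; congr (_ + _).
  by rewrite -amulA.
by rewrite !(amulA S) (amulC S (f z)).
Qed.

Lemma sm_mulmxr (A : 'M[R]_(k + d, d)) z : sm (fun z : T => z *m A) z.
Proof. by have : sm (fun z => (mulmxr A : {linear T -> W}) z) z := sm_linrV _ (sm_id z). Qed.

Hypothesis CRB : forall i (h : W), row_mx 0 h *m B i = h ** (row_mx 0 one *m B i).

Lemma CR_B i z : CR S (fun z : T => z *m B i) z.
Proof.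
have D w : dd (fun z : T => z *m B i) z w = w *m B i by exact: (dd_linear (mulmxr (B i) : {linear T -> W})).
by split=> h; rewrite !D CRB.
Qed.

Lemma monomial_smCR r e z : sm (monomial r e) z /\ CR S (monomial r e) z.
Proof.
elim: r => [|i r [IH1 IH2]] /=.
  by split; [exact: sm_cst|split=> h; rewrite !dd_cst amul0r].
rewrite /monomial /= -/(monomial r e _); elim: (e i) => [|n [IHn1 IHn2]] //=.
split; first by apply: (sm_amul S) => //; exact: sm_mulmxr.
exact: (CR_amul (sm_mulmxr (B i) z) IHn1 (CR_B i z) IHn2).
Qed.

Lemma monomial_real r e z (t : 'I_m -> R) : (forall i, z *m B i = t i *: one) ->
  monomial r e z = (\prod_(i <- r) t i ^+ e i) *: one.
Proof.
move=> H; elim: r => [|i r IH]; first by rewrite big_nil scale1r.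
rewrite /monomial /= -/(monomial r e z) IH big_cons; elim: (e i) => [|n IHn] /=.
  by rewrite expr0 mul1r.
by rewrite IHn H amulZl amul1 scalerA exprS mulrA.
Qed.

Lemma monomial_etype (D : set T) c q A n r e : open D -> 0 <= c -> (forall a b, `|a ** b| <= c * `|a| * `|b|) ->
  0 <= q -> 0 <= A -> (forall i, etype D n q A (fun z => z *m B i)) ->
  etype D n (`|one| * (c * q) ^+ (\sum_(i <- r) e i)) ((\sum_(i <- r) e i)%:R * A) (monomial r e).
Proof.
move=> oD c0 Hc q0 A0 HB; elim: r => [|i r IH].
  by rewrite big_nil expr0 mulr1 mul0r; apply: etype_cst.
rewrite big_cons /monomial /= -/(monomial r e _); elim: (e i) => [|j IHj] //=.
set s := \sum_(j0 <- r) e j0 in IHj *.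
have -> : (j.+1 + s)%:R * A = A + (j + s)%:R * A by rewrite addSn -natr1; ring.
have -> : `|one| * (c * q) ^+ (j.+1 + s) = c * q * (`|one| * (c * q) ^+ (j + s)) by rewrite addSn exprS; ring.
have K0 : 0 <= `|one| * (c * q) ^+ (j + s) by rewrite mulr_ge0 // exprn_ge0 // mulr_ge0.
by apply: (etype_amul oD c0 Hc q0 K0 A0 _ (HB i) IHj); rewrite mulr_ge0.
Qed.

Lemma cvg_norm_le (u : nat -> W) y C (e : R ^nat) : (forall N, `|u N - y| <= C * e N) ->
  e @ \oo --> (0 : R) -> u @ \oo --> y.
Proof.
move=> H e0; have Ce : (fun N => C * e N) @ \oo --> (0 : R).
  by rewrite -(mulr0 C); apply: cvgM => //; exact: cvg_cst.
apply/cvgrPdist_le => eps eps0; move/cvgrPdist_le: Ce => /(_ _ eps0); apply: filterS => N.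
by rewrite sub0r normrN distrC => h; apply: le_trans (H N) (le_trans (ler_norm _) h).
Qed.

Lemma CR_limit (F : nat -> T -> W) G z C (e : R ^nat) : (forall N, CR S (F N) z) ->
  (forall N, differentiable (F N) z) -> differentiable G z ->
  (forall N i, `|pd i (F N) z - pd i G z| <= C * e N) -> e @ \oo --> (0 : R) -> CR S G z.
Proof.
move=> cF dF dG FG e0.
have L w : (fun N => dd (F N) z w) @ \oo --> dd G z w.
  apply: (@cvg_norm_le _ _ (\sum_i `|w 0 i| * C) e) => // N.
  rewrite {1 2}(row_sum_delta w) !dd_sum -sumrB; apply: le_trans (ler_norm_sum _ _ _) _.
  rewrite mulr_suml; apply: ler_sum => i _.
  by rewrite !ddZ -scalerBr normrZ -mulrA ler_wpM2l // -!pdE.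
split=> h; apply: (cvg_unique _ (L (row_mx 0 h))); first exact: norm_hausdorff.
rewrite (_ : (fun N => _) = fun N => h ** dd (F N) z (row_mx 0 one)); last first.
  by apply/funext => N; exact: CRE.
have cc := sm_cont (sm_amul S (sm_cst h _) (sm_id (dd G z (row_mx 0 one)))).
exact: continuous_cvg (L _).
Qed.

Lemma power_series_const (a : {ffun 'I_m -> nat} -> R) (rho : R) N :
  power_series a (const_mx rho) N =
  \sum_(e : {ffun 'I_m -> 'I_N}) a (exponent e) * rho ^+ (\sum_i exponent e i).
Proof.
apply: eq_bigr => e _; rewrite expr_sum; congr (_ * _).
by apply: eq_bigr => i _; rewrite mxE ffunE.
Qed.

Definition partial_sum (a : {ffun 'I_m -> nat} -> R) N (z : T) : W :=
  \sum_(e : {ffun 'I_m -> 'I_N}) a (exponent e) *: monomial (index_enum 'I_m) (exponent e) z.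

Lemma partial_sum_smCR a N z : sm (partial_sum a N) z /\ CR S (partial_sum a N) z.
Proof.
rewrite /partial_sum; elim: (index_enum _) => [|e r [IH1 IH2]].
  rewrite (_ : (fun z : T => _) = fun=> 0); last by apply/funext => y; rewrite big_nil.
  by split; [exact: sm_cst|split=> h; rewrite !dd_cst amul0r].
have [m1 m2] := monomial_smCR (index_enum 'I_m) (exponent e) z.
rewrite (_ : (fun z : T => _) = fun z : T => (a (exponent e) *: one) ** monomial (index_enum 'I_m) (exponent e) z +
    \sum_(e <- r) a (exponent e) *: monomial (index_enum 'I_m) (exponent e) z); last first.
  by apply/funext => y; rewrite big_cons amulZl amul1.
have m3 := sm_amul S (sm_cst (a (exponent e) *: one) z) m1.
split; first exact: smD.
have c3 : CR S (fun z : T => (a (exponent e) *: one) ** monomial (index_enum 'I_m) (exponent e) z) z.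
  by apply: CR_amul m2 => //; [exact: sm_cst|split=> h; rewrite !dd_cst amul0r].
by split=> h; rewrite !dd_add ?(CRE c3 h) ?(CRE IH2 h) ?amulDr //; exact: sm_diff.
Qed.

Lemma partial_sum_real a N z (t : 'rV[R]_m) : (forall i, z *m B i = t 0 i *: one) ->
  partial_sum a N z = power_series a t N *: one.
Proof.
move=> H; rewrite /partial_sum /power_series scaler_suml; apply: eq_bigr => e _.
rewrite (monomial_real _ _ H) scalerA; congr (_ * _ *: _).
by apply: eq_bigr => i _; rewrite ffunE.
Qed.

(* On the ball chosen below a monomial of degree s is O((rho/2)^s); the spare factor
   2^-s absorbs the polynomial in s produced by n derivatives. *)
Lemma monomial_majorant (rho : R) : 0 < rho -> exists D : set T, [/\ open D, D 0 &
  forall n, exists2 C, 0 <= C & forall e : {ffun 'I_m -> nat},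
    etype D n (C * rho ^+ (\sum_i e i)) 1 (monomial (index_enum 'I_m) e)].
Proof.
move=> rho0; have [c c0 Hc] := amul_bound.
pose q := rho / (2 * c); have q0 : 0 < q by rewrite divr_gt0 // mulr_gt0.
pose Mb := 1 + \sum_i \sum_j `|(delta_mx 0 j : T) *m B i|.
have Mb0 : 0 < Mb by rewrite ltr_pwDl // sumr_ge0 // => i _; rewrite sumr_ge0.
have rowMb i : \sum_j `|(delta_mx 0 j : T) *m B i| <= Mb.
  rewrite /Mb (bigD1 i) //= addrCA lerDl addr_ge0 // sumr_ge0 // => i' _; exact: sumr_ge0.
pose A := Mb / q; have A0 : 0 <= A by rewrite divr_ge0 // ltW.
pose D := ball (0 : T) (q / Mb).
have oD : open D by exact: ball_open.
exists D; split=> //; first by apply: ballxx; rewrite divr_gt0.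
have HB n i : etype D n q A (fun z => z *m B i).
  apply: etype_lin => // [z|j].
    rewrite /D -ball_normE /= sub0r normrN => zD.
    rewrite {1}(row_sum_delta z) mulmx_suml; apply: le_trans (ler_norm_sum _ _ _) _.
    apply: le_trans (_ : \sum_j `|z| * `|(delta_mx 0 j : T) *m B i| <= _).
      by apply: ler_sum => j _; rewrite -scalemxAl normrZ ler_wpM2r // norm_coord.
    rewrite -mulr_sumr; apply: le_trans (ler_wpM2l (normr_ge0 z) (rowMb i)) _.
    by rewrite -ler_pdivlMr // ltW.
  apply: le_trans (_ : \sum_j `|(delta_mx 0 j : T) *m B i| <= _).
    by rewrite (bigD1 j) //= lerDl sumr_ge0.
  by apply: le_trans (rowMb i) _; rewrite /A mulrC divfK // gt_eqF.
move=> n; have [C C0 HC] := poly_le_exp n A0.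
exists (`|one| * C) => [|e]; first exact: mulr_ge0.
set s := \sum_i e i.
have cq0 : 0 <= c * q by rewrite mulr_ge0 // ltW.
have K0 : 0 <= `|one| * (c * q) ^+ s by rewrite mulr_ge0 // exprn_ge0.
have sA0 : 0 <= s%:R * A by rewrite mulr_ge0.
have := monomial_etype (index_enum 'I_m) e oD (ltW c0) Hc (ltW q0) A0 (HB n).
move=> /(etype_ge K0 sA0 (A' := 1 + s%:R * A)).
have sA1 : s%:R * A <= 1 + s%:R * A by rewrite lerDr.
have s1 : 1 <= 1 + s%:R * A by rewrite lerDl.
move=> /(_ sA1) /(etype_pow K0 s1); apply: etype_le => //.
rewrite -!mulrA; apply: ler_wpM2l => //.
apply: le_trans (ler_wpM2l (exprn_ge0 _ cq0) (HC s)) _.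
have -> : rho = c * q * 2 by rewrite /q; field; rewrite gt_eqF.
by rewrite [leRHS]mulrC [X in _ <= X * _]exprMn -mulrA ler_wpM2l ?exprn_ge0 // mulrC.
Qed.

(** The partial sums s of the series of absolute values at (rho, ..., rho) measure the convergence.
    By [monomial_majorant], the derivatives up to order n of a difference of partial sums are
    bounded by C (s N' - s N), so [smooth_limit] applies at every order. *)
Theorem power_series_germ (a : {ffun 'I_m -> nat} -> R) (rho : R) : 0 < rho ->
  cvgn (power_series (fun e => `|a e|) (const_mx rho)) ->
  exists (D : set T) (G : T -> W), [/\ open D, D 0, forall z, D z -> sm G z, forall z, D z -> CR S G z &
    forall z (t : 'rV[R]_m) (g : R), D z -> (forall i, z *m B i = t 0 i *: one) ->
      power_series a t @ \oo --> g -> G z = g *: one].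
Proof.
move=> rho0; set s := power_series _ _ => cs; pose l := limn s.
have [D [oD D0 maj]] := monomial_majorant rho0.
have sdiff N N' : (N <= N')%N -> s N' - s N =
    \sum_(e : {ffun 'I_m -> 'I_N'} | ~~ [forall i, (e i < N)%N])
      `|a (exponent e)| * rho ^+ (\sum_i exponent e i).
  by move=> NN; rewrite /s !power_series_const (cube_diff (fun e => `|a e| * rho ^+ (\sum_i e i)) NN).
have snd : nondecreasing_seq s.
  move=> N N' NN; rewrite -subr_ge0 sdiff // sumr_ge0 // => e _.
  by rewrite mulr_ge0 // exprn_ge0 // ltW.
have sl N : s N <= l by exact: nondecreasing_cvgn_le.
have ls : (fun N => l - s N) @ \oo --> (0 : R).
  by rewrite -(subrr l); apply: cvgB => //; exact: cvg_cst.
have term n : exists2 C, 0 <= C & forall e : {ffun 'I_m -> nat},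
    etype D n (C * (`|a e| * rho ^+ (\sum_i e i))) 1 (fun z => a e *: monomial (index_enum 'I_m) e z).
  have [C C0 HC] := maj n; exists C => // e.
  by rewrite mulrCA; apply: etype_scale.
have dF n : exists2 C, 0 <= C & forall N N', (N <= N')%N ->
    etype D n (C * (s N' - s N)) 1 (fun z => partial_sum a N' z - partial_sum a N z).
  have [C C0 HC] := term n; exists C => // N N' NN.
  rewrite (_ : (fun z => _) = fun z => \sum_(e : {ffun 'I_m -> 'I_N'} | ~~ [forall i, (e i < N)%N])
      a (exponent e) *: monomial (index_enum 'I_m) (exponent e) z); last first.
    apply/funext => z; exact: (cube_diff (fun e => a e *: monomial (index_enum 'I_m) e z) NN).
  by rewrite sdiff // mulr_sumr; apply: etype_sum.
have [C0 C00 HC0] := dF 0%N.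
(* On [D] this condition determines the value, as l - s N tends to 0; where no such limit exists the
   value is 0. *)
pose G z := xget 0 [set y | forall N, `|partial_sum a N z - y| <= C0 * (l - s N)].
have FG N z : D z -> `|partial_sum a N z - G z| <= C0 * (l - s N).
  move=> Dz; have ex : exists y, forall N, `|partial_sum a N z - y| <= C0 * (l - s N).
    apply: cauchy_limit => // N1 N2 NN.
    by have [_] := etype0 (HC0 _ _ NN) Dz.
  exact: (xgetPex 0 ex N).
have lim n : smn n D G /\ exists C, forall N z i, D z -> `|pd i (partial_sum a N) z - pd i G z| <= C * (l - s N).
  have [C C1 HC] := dF n.+1.
  have CC0 : 0 <= C + C0 by rewrite addr_ge0.
  have sF N : smn n.+1 D (partial_sum a N).
    have sD : smooth_on D (partial_sum a N) by apply/(smooth_onP _ oD) => z Dz; have [] := partial_sum_smCR a N z.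
    by move/smooth_onE: sD.
  have dF' N N' : (N <= N')%N ->
      etype D n.+1 ((C + C0) * (s N' - s N)) 1 (fun z => partial_sum a N' z - partial_sum a N z).
    move=> NN; apply: etype_le (HC _ _ NN) => //; apply: ler_wpM2r; last by rewrite lerDl.
    by rewrite subr_ge0 snd.
  have FG' N z : D z -> `|partial_sum a N z - G z| <= (C + C0) * (l - s N).
    by move=> /FG-/(_ N) h; apply: le_trans h _; apply: ler_wpM2r; rewrite ?subr_ge0 // lerDr.
  by have [H1 H2] := smooth_limit oD sl ls CC0 sF dF' FG'; split=> //; exists (C + C0).
have sG : smooth_on D G by apply/smooth_onE => n; have [] := lim n.
have smG z : D z -> sm G z by move=> Dz; exists D.
exists D, G; split=> // [z Dz|z t g Dz Ht tg].
  have [_ [C HC]] := lim 0%N.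
  apply: (@CR_limit (partial_sum a) G z C (fun N => l - s N)) => // [N|N||N i].
  - by have [] := partial_sum_smCR a N z.
  - by have [/sm_diff] := partial_sum_smCR a N z.
  - exact/sm_diff/smG.
  - exact: HC.
apply: (cvg_unique _ (cvg_norm_le (fun N => FG N z Dz) ls)); first exact: norm_hausdorff.
rewrite (_ : (fun N => _) = fun N => power_series a t N *: one); last first.
  by apply/funext => N; exact: partial_sum_real.
by apply: cvgZr_tmp.
Qed.

End PowerSeries.

Section Extendible.
Variables (R : realType) (S : calg R 3).
Local Notation one := (aone S).

Lemma extendible_eq f g : (\forall y \near (0 : 'rV[R]_3), f y = g y) -> extendible S f -> extendible S g.
Proof. by move=> fg [G [CG HG]]; exists G; split=> //; apply: filterS2 HG fg => y -> ->. Qed.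

Lemma extendible_sum n (c : 'I_n -> R) (f : 'I_n -> 'rV[R]_3 -> R) : (forall i, extendible S (f i)) ->
  extendible S (fun y => \sum_i c i * f i y).
Proof.
move=> ef; elim: (index_enum _) => [|i r [G [CG HG]]].
  by exists (fun=> 0); split; [exact: CRsm_cst|near=> y; rewrite big_nil scale0r].
have [H [CH HH]] := ef i.
exists (fun z => amul S (c i *: one) (H z) + G z); split.
  by apply: CRsm_add => //; apply: CRsm_amul => //; exact: CRsm_cst.
near=> y; rewrite (near HG) // (near HH) // amulZl amul1 big_cons scalerA scalerDl.
by [].
Unshelve. all: by end_near. Qed.

(** [B i] is the form that is linear over [S] on the fibres and restricts on the slice to the i-th
    coordinate of y Q times the unit. Absolute convergence at the constant vector r / 2, inside the
    ball, is what [power_series_germ] requires. *)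
Theorem extendible_analytic (Q : 'M[R]_3) (a : {ffun 'I_3 -> nat} -> R) r (g : 'rV[R]_3 -> R) : 0 < r ->
  (forall h : 'rV[R]_3, `|h| < r ->
    cvgn (power_series (fun e => `|a e|) (\row_i `|h 0 i|)) /\ power_series a h @ \oo --> g h) ->
  extendible S (fun y => g (y *m Q)).
Proof.
move=> r0 H; pose B i : 'M[R]_(2 + 3, 3) :=
  col_mx (\matrix_(j < 2, l < 3) (Q (lift ord_max j) i * one 0 l)) (Q 2%:R i *: 1%:M).
have rowB (u : 'rV[R]_2) h i : row_mx u h *m B i = (\sum_(j < 2) u 0 j * Q (lift ord_max j) i) *: one + Q 2%:R i *: h.
  rewrite mul_row_col -scalemxAr mulmx1; congr (_ + _); apply/rowP => l.
  by rewrite !mxE mulr_suml; apply: eq_bigr => j _; rewrite mxE mulrA.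
have CRB i (h : 'rV[R]_3) : row_mx 0 h *m B i = amul S h (row_mx 0 one *m B i).
  by rewrite !rowB big1 ?scale0r ?add0r ?amulZr ?amul1r // => j _; rewrite mxE mul0r.
have sB i y : slice S y *m B i = (y *m Q) 0 i *: one.
  rewrite sliceE rowB scalerA -scalerDl; congr (_ *: _).
  rewrite sum2 !mxE sum3 /= [_ * y 0 _]mulrC; congr (_ * Q _ _ + _ * Q _ _ + _); exact: val_inj.
have rho0 : 0 < r / 2 by rewrite divr_gt0.
have crho : cvgn (power_series (fun e => `|a e|) (const_mx (r / 2) : 'rV[R]_3)).
  have h0 : `|const_mx (r / 2) : 'rV[R]_3| < r.
    apply: le_lt_trans (_ : r / 2 < r); last by rewrite ltr_pdivrMr // ltr_pMr // ltr1n.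
    by apply: norm_rV_le => [|j]; rewrite ?mxE ?ger0_norm // ltW.
  have [+ _] := H _ h0; rewrite (_ : \row_i _ = const_mx (r / 2)) //.
  by apply/rowP => i; rewrite !mxE ger0_norm // ltW.
have [D [G [oD D0 sG cG HG]]] := power_series_germ CRB rho0 crho.
exists G; split.
  split; first exact: sG.
  near=> z; apply: cG; near: z; exact: open_nbhs_nbhs.
have ns : \forall y \near (0 : 'rV[R]_3), D (slice S y) by apply: slice_near; exact: open_nbhs_nbhs.
have nQ : \forall y \near (0 : 'rV[R]_3), `|y *m Q| < r.
  have c0 : {for 0, continuous (fun y : 'rV[R]_3 => y *m Q)} := sm_cont (sm_linrV (mulmxr Q) (sm_id 0)).
  have : \forall t \near (0 *m Q : 'rV[R]_3), `|t| < r.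
    by rewrite mul0mx; apply: filterS (nbhsx_ballx 0 r r0) => t; rewrite -ball_normE /= sub0r normrN.
  exact: c0.
near=> y; have yQ : `|y *m Q| < r by near: y.
have yD : D (slice S y) by near: y.
by have [_ t] := H _ yQ; exact: (HG _ _ _ yD (sB^~ y) t).
Unshelve. all: by end_near. Qed.

End Extendible.

(** * Type D *)

Section AnalyticExtension.
Variables (R : realType) (M : manifold R 3) (TF : tangent_distribution M) (Jbar : fibre_map M).
Local Notation V3 := 'rV[R]_3.
Hypothesis pn : partial_nijenhuis TF Jbar.
Hypothesis gen : generic_type TF Jbar.

(** As [c] is affine in [c0], a component of X in [c] is a constant combination of its components in
    [c0] evaluated at c0(p) + y P^-1: the series at the point is composed with a linear map. *)
Lemma extendible_in_chart (S : calg R 3) (c0 c : chart R 3 M) (P : 'M[R]_3) W X p :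
  atlas M c -> cdom c p -> cdom c `<=` cdom c0 -> W p -> P \in unitmx ->
  (forall q, cmap c q = (cmap c0 q - cmap c0 p) *m P) ->
  (forall q (u : tangent q), cdom c q -> components c u = components c0 u *m P) ->
  analytic_on (cmap c0 @` (cdom c0 `&` W)) (in_chart c0 X) ->
  forall k, extendible S (fun y => in_chart c X y 0 k).
Proof.
move=> ac cp sub Wp uP E cE anX k.
have p0 : cmap c p = 0 by rewrite E subrr mul0mx.
have e j : extendible S (fun y => in_chart c0 X (cmap c0 p + y *m invmx P) 0 j).
  have [|a [r [r0 H]]] := anX (cmap c0 p) j.
    by exists p => //; split=> //; exact: sub.
  exact: (extendible_analytic S (invmx P) (g := fun h => in_chart c0 X (cmap c0 p + h) 0 j) r0 H).
apply: extendible_eq (extendible_sum (fun j => P j k) e).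
have := near_cinv cp; rewrite p0; apply: filterS => y [Ey dy].
rewrite -{2}Ey in_chart_cmap // cE // mxE; apply: eq_bigr => j _; rewrite mulrC; congr (_ 0 j * _).
rewrite -in_chart_cmap; last exact: sub.
congr (in_chart _ _ _).
by rewrite -{1}Ey E mulmxK // addrC subrK.
Qed.

(** The frame of the generic type is only smooth. Constant combinations of the analytic frame that
    agree with it at p stay analytic. The number k is not known in advance: the matrices P and Q of
    the two changes of frame at p satisfy Q P = 1 by uniqueness of coordinates, so v' is a constant
    combination of v'' on all of W. *)
Lemma analytic_frame p (W : set M) k (v' : 'I_k -> vfield M) (W0 : set M) (v : 'I_2 -> vfield M) :
  open W -> W p -> frame W TF v' -> W0 p -> frame W0 TF v ->
  exists P : 'M[R]_(2, k), let v'' i q := \sum_l P i l *: v' l q in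
    [/\ forall i, v i p = v'' i p, forall i, is_section W TF (v'' i) & spans TF W v''].
Proof.
have [fol _ _] := pn.
move=> oW Wp [sv' fv'] W0p [sv fv].
have Tv i : TF (v i p) by case: (sv i) => _; apply.
have Tv' l q : W q -> TF (v' l q) by case: (sv' l) => _; apply.
have /choice[P HP] : forall i, exists a : 'rV[R]_k, v i p = \sum_l a 0 l *: v' l p.
  by move=> i; have [a [Ea _]] := fv' p Wp _ (Tv i); exists a.
have /choice[Q HQ] : forall l, exists a : 'rV[R]_2, v' l p = \sum_i a 0 i *: v i p.
  by move=> l; have [a [Ea _]] := fv p W0p _ (Tv' l p Wp); exists a.
pose PM : 'M[R]_(2, k) := \matrix_i P i; pose QM : 'M[R]_(k, 2) := \matrix_l Q l.
have QP : QM *m PM = 1%:M.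
  apply/row_matrixP => l; rewrite row1.
  have [a [_ Ua]] := fv' p Wp _ (Tv' l p Wp).
  rewrite -(Ua (delta_mx 0 l)); last first.
    by rewrite (bigD1 l) //= mxE !eqxx scale1r big1 ?addr0 // => j jl; rewrite mxE eqxx (negPf jl) scale0r.
  apply/esym/Ua; rewrite {1}HQ.
  have E (x : 'rV[R]_2) : \sum_i x 0 i *: v i p = \sum_l (x *m PM) 0 l *: v' l p.
    rewrite (eq_bigr (fun i => \sum_l (x 0 i * P i 0 l) *: v' l p)) => [|i _]; last first.
      by rewrite HP scaler_sumr; apply: eq_bigr => j _; rewrite scalerA.
    rewrite exchange_big; apply: eq_bigr => j _; rewrite -scaler_suml mxE; congr (_ *: _).
    by apply: eq_bigr => i _; rewrite mxE.
  by rewrite E row_mul rowK.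
exists PM => v''; split=> [i|i|q Wq u /(fv' q Wq)[b [-> _]]].
- by rewrite HP; apply: eq_bigr => l _; rewrite mxE.
- split=> [|q Wq]; last by apply: foliation_sum => // l; exact: Tv'.
  apply: smooth_vfieldP => c q ac cq Wq.
  have s l : sm (in_chart c (v' l)) (cmap c q) by case: (sv' l) => sX _; exact: sm_in_chart sX _ _ _.
  rewrite (_ : in_chart c (v'' i) = fun y => \sum_l PM i l *: in_chart c (v' l) y).
    by apply: sm_sum => l _; exact: smZ.
  apply/funext => y; rewrite /in_chart components_sum; apply: eq_bigr => l _; exact: componentsZ.
- exists ((b *m QM) 0); rewrite -[b in LHS]mulmx1 -QP mulmxA; move: (b *m QM) => x.
  rewrite (eq_bigr (fun i => \sum_l (x 0 i * PM i l) *: v' l q)) => [|i _]; last first.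
    by rewrite scaler_sumr; apply: eq_bigr => j _; rewrite scalerA.
  by rewrite exchange_big; apply: eq_bigr => j _; rewrite -scaler_suml mxE.
Qed.

Theorem analytic_extension : real_analytic TF Jbar -> extends_as TF Jbar (algD R) (vec3 0 1 0).
Proof.
move=> [At [[sub cov _] fr]] p.
have [W0 [v [w [oW0 W0p fv fw vw]]]] := gen p.
have [W [k [v' [oW Wp fv' an]]]] := fr p.
have [c0 [A0 c0p]] := cov p; have a0 := sub _ A0.
have [c [P [ac [cp cs] uP E [cE cw]]]] := normal_chart a0 c0p (frame_unitmx a0 c0p W0p fw).
have p0 : cmap c p = 0 by rewrite E subrr mul0mx.
have [Q [vp secv spanv]] := analytic_frame oW Wp fv' W0p fv.
have Tv' l q : W q -> TF (v' l q) by case: fv' => /(_ l)[_ T] _; exact: T.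
(* Used for v'' and for its image by [Jbar], which is the same constant combination of the analytic
   fields Jbar v'. *)
have lin (X : vfield M) (Y : 'I_k -> vfield M) i : (forall l, analytic_vfield At W (Y l)) ->
    (forall q, W q -> X q = \sum_l Q i l *: Y l q) ->
    forall j, extendible (algD R) (fun y => in_chart c X y 0 j).
  move=> anY XY j.
  have e l : extendible (algD R) (fun y => in_chart c (Y l) y 0 j).
    exact: (extendible_in_chart _ ac cp cs Wp uP E cE (anY l _ A0)).
  apply: extendible_eq (extendible_sum (fun l => Q i l) e).
  have nW : \forall q \near p, W q by exact: open_nbhs_nbhs.
  have := near_chart cp nW; rewrite p0; apply: filterS => y Wy.
  rewrite /in_chart XY // components_sum summxE; apply: eq_bigr => l _.
  by rewrite componentsZ mxE.
apply: (extendible_frame_extension pn _ _ ac cp p0 oW Wp secv spanv cw).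
- move=> u H.
  have := congr1 (fun x : V3 => x 0 0) H; have := congr1 (fun x : V3 => x 0 1) H;
  have := congr1 (fun x : V3 => x 0 2%:R) H.
  rewrite !mxE /= ?mxE /= => E0 E1 E2.
  by apply: rowP3; rewrite mxE; lra.
- exact: algD_unique.
- by move=> i; rewrite -vp; exact: vw.
- by move=> i; apply: (lin _ v' i) => // l; case: (an l).
- move=> i; apply: (lin _ (fun l => apply_field Jbar (v' l)) i) => [l|q Wq]; first by case: (an l).
  by rewrite /apply_field (Jbar_sum pn) // => l; exact: Tv'.
Qed.

End AnalyticExtension.

Theorem mainTheorem2 (R : realType) (M : manifold R 3)
    (TF : tangent_distribution M) (Jbar : fibre_map M) :
  partial_nijenhuis TF Jbar -> generic_type TF Jbar ->
  locally_extends TF Jbar (@typeA R M) /\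
  locally_extends TF Jbar (@typeB R M) /\
  locally_extends TF Jbar (@typeC R M) /\
  (real_analytic TF Jbar -> locally_extends TF Jbar (@typeD R M)).
Proof.
move=> pn gen; split; first exact: locally_extends_A.
split; first exact: locally_extends_B.
split; first exact: locally_extends_C.
move=> ra; apply: locally_extends_D; exact: analytic_extension.
Qed.
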